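(* Let $l_1\ge L=L(\sqrt{A^TA},W_{\rm cell},l_2,\dots,l_d)$ and let $a_\varepsilon>0$ satisfy $a_\varepsilon/\sqrt{\varepsilon}\to a\in[0,\infty]$ as $\varepsilon\to0$. Then the limiting minimal energy exists and is given by $$\mathcal E_{\rm lim}(a):=\lim_{\varepsilon\to0}\ \inf\{\mathcal E_\varepsilon(y): y\in\mathcal A(a_\varepsilon)\}=\frac{\prod_{j=2}^d l_j}{\det A}\,\min\Big\{\tfrac12\, l_1\,\alpha_A\,a^2,\ \beta_A\Big\}$$ (where for $a=\infty$ the minimum is $\beta_A$).
   Context: Lattice and cells. Let $d\ge2$, $\Omega=(0,l_1)\times\dots\times(0,l_d)$ with $l_j>0$. Let $v_1,\dots,v_d\in\mathbb R^d$ be linearly independent, $A=(v_1,\dots,v_d)$ with $\det A>0$, $\mathcal L=A\mathbb Z^d$, $\mathcal L_\varepsilon=\varepsilon\mathcal L$ for $\varepsilon>0$. Let $\mathcal L'_\varepsilon=\varepsilon A((\frac12,\dots,\frac12)^T+\mathbb Z^d)$ be the set of cell midpoints and, for $\bar x\in\mathcal L'_\varepsilon$, $Q_\varepsilon(\bar x)=\bar x+\varepsilon A[-\frac12,\frac12)^d$. Let $(\mathcal L'_\varepsilon(\Omega))^\circ=\{\bar x\in\mathcal L'_\varepsilon:\overline{Q_\varepsilon(\bar x)}\subset\Omega\}$. Let $z_1,\dots,z_{2^d}$ be an enumeration of $A\{-\frac12,\frac12\}^d$, $\mathcal Z=\{z_1,\dots,z_{2^d}\}$, $Z=(z_1,\dots,z_{2^d})\in\mathbb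 R^{d\times2^d}$, $\bar{SO}(d)=\{RZ:R\in SO(d)\}$. Deformations and energy. For $y:\mathcal L_\varepsilon\cap\Omega\to\mathbb R^d$ and $\bar x\in(\mathcal L'_\varepsilon(\Omega))^\circ$ put $y_i=y(\bar x+\varepsilon z_i)$, $\bar y=2^{-d}\sum_i y_i$, and define the discrete gradient $\bar\nabla y(\bar x)=\varepsilon^{-1}(y_1-\bar y,\dots,y_{2^d}-\bar y)\in\mathbb R^{d\times2^d}$. The rescaled energy is $$\mathcal E_\varepsilon(y)=\varepsilon^{d-1}\sum_{\bar x\in(\mathcal L'_\varepsilon(\Omega))^\circ}W_{\rm cell}(\bar\nabla y(\bar x)).$$ Assumptions on $W_{\rm cell}:\mathbb R^{d\times2^d}\to[0,\infty]$. For $G=(g_1,\dots,g_{2^d})$, $\tilde{\mathcal Z}\subset\mathcal Z$ let $G[\tilde{\mathcal Z}]=(g_j)_{z_j\in\tilde{\mathcal Z}}$, and $d(G;\mathcal Z_1,\mathcal Z_2)=\min\{|g_i-g_j|:z_i\in\mathcal Z_1,z_j\in\mathcal Z_2\}$. (i) $W_{\rm cell}(RG+(c,\dots,c))=W_{\rm cell}(G)$ for all $R\in SO(d)$, $c\in\mathbb R^d$. (ii) $W_{\rm cell}(G)=0$ iff $G=RZ+(c,\dots,c)$ for some $R\in SO(d)$, $c\in\mathbb R^d$. (iii) $W_{\rm cell}$ is continuous, and $C^2$ in a neighborhood of $\bar{SO}(d)$; the Hessian $Q_{\rm cell}=D^2W_{\rm cell}(Z)$ (viewed as a quadratic form) is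 positive definite on the complement of the subspace spanned by the translations $(c,\dots,c)$ and the infinitesimal rotations $HZ$, $H+H^T=0$. (iv) There are functions $W^{\tilde{\mathcal Z}}:\mathbb R^{d\times\#\tilde{\mathcal Z}}\to[0,\infty)$ and numbers $\beta(z_s,z_t)=\beta(z_t,z_s)\ge0$ ($z_s\ne z_t$ in $\mathcal Z$) such that for every partition $\mathcal Z=\mathcal Z_1\dot\cup\dots\dot\cup\mathcal Z_n$ $$W_{\rm cell}(G)=\sum_{i=1}^nW^{\mathcal Z_i}(G[\mathcal Z_i])+\frac12\sum_{i\ne j}\sum_{z_s\in\mathcal Z_i}\sum_{z_t\in\mathcal Z_j}\beta(z_s,z_t)+o(1)\quad\text{as }\min_{i<j}d(G;\mathcal Z_i,\mathcal Z_j)\to\infty,$$ where the triple sum is strictly positive unless $n=1$; moreover $W^{\mathcal Z_i}(H[\mathcal Z_i])\le C\,W_{\rm cell}(H)$ for $H$ in a neighborhood of $\bar{SO}(d)$. Normalization: let $\mathcal V=A\{-1,0,1\}^d\setminus\{0\}$ and $\mathcal V_k=\{At:t\in\{-1,0,1\}^d\text{ with exactly }k\text{ nonzero entries}\}$. It is assumed (redistributing the energy of bonds shared by several cells) that for each $1\le k\le d$ and $\nu\in\mathcal V_k$ there is $\beta(\nu)\ge0$ with $\frac12\beta(z_s,z_t)=2^{k-d}\beta(\nu)$ for all $z_s,z_t\in\mathcal Z$ with $z_s-z_t=\nu$. Boundary conditions. Let $l_A=\sum_{j=1}^d|v_j\cdot\mathbf e_1|$, $B_1^\varepsilon=\{x\in\overline\Omega:x_1\le2l_A\varepsilon\}$,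 $B_2^\varepsilon=\{x\in\overline\Omega:x_1\ge l_1-2l_A\varepsilon\}$. $\mathcal A(a_\varepsilon)$ is the set of $y=(y^1,\dots,y^d)^T:\mathcal L_\varepsilon\cap\Omega\to\mathbb R^d$ satisfying the boundary condition, i.e. either $y^1(x)=(1+a_\varepsilon)x_1$ for $x\in B_1^\varepsilon\cup B_2^\varepsilon$, or [$y^1(x)=x_1$ for $x\in B_1^\varepsilon$ and $y^1(x)=x_1+a_\varepsilon l_1$ for $x\in B_2^\varepsilon$] (for $x$ in the domain of $y$). Constants. $\beta_A=\min_{\xi\in\mathbb R^d\setminus\{0\}}\dfrac{\sum_{\nu\in\mathcal V}\beta(\nu)|\nu\cdot\xi|}{|\mathbf e_1\cdot\xi|}$ (the quotient being $+\infty$ if $\mathbf e_1\cdot\xi=0$). $\alpha_A>0$ is the number such that $\min\{Q_{\rm cell}(\frac12(G+G^T)Z):G\in\mathbb R^{d\times d},g_{11}=r\}=\alpha_Ar^2$ for all $r\in\mathbb R$. With $M_1=\min_{\xi\in S^{d-1}}\sum_{\nu\in\mathcal V}\beta(\nu)|\nu\cdot\xi|$ and $M_2=\max_{\xi\in S^{d-1}}\sum_{\nu\in\mathcal V}\beta(\nu)|\nu\cdot\xi|$, set $L=C_*\max\{l_2,\dots,l_d\}\,M_2/M_1$, where $C_*>0$ is a sufficiently large constant independent of $M_1,M_2,l_2,\dots,l_d$. *)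

(* Defs.v *)
From mathcomp Require Import all_boot all_order all_algebra.
From mathcomp Require Import all_classical all_reals all_analysis.

Set Implicit Arguments.
Unset Strict Implicit.
Unset Printing Implicit Defensive.

Import Order.TTheory GRing.Theory Num.Theory numFieldNormedType.Exports.
Local Open Scope classical_set_scope.
Local Open Scope ring_scope.

Definition is_min {disp : Order.disp_t} {T : porderType disp}
  (S : set T) (m : T) : Prop := S m /\ lbound S m.

Definition is_max {disp : Order.disp_t} {T : porderType disp}
  (S : set T) (m : T) : Prop := S m /\ ubound S m.

Section Definitions.
Context {R : realType} {n : nat}.

(* The space dimension is d = n.+2, so that d >= 2 and the first coordinate
   is the index ord0; a cell has N = 2 ^ d corners. *)
Local Notation d := n.+2.
Local Notation N := (2 ^ n.+2)%N.

(* The norm of the library on matrices is the sup norm; the Euclidean norm is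
   needed here. *)
Definition dot (u v : 'cV[R]_d) : R := \sum_i u i 0 * v i 0.
Definition enorm (u : 'cV[R]_d) : R := Num.sqrt (dot u u).
Definition e1 : 'cV[R]_d := delta_mx ord0 ord0.

Definition SO : set 'M[R]_d := [set Q | Q^T *m Q = 1%:M /\ \det Q = 1].

(* The d x N matrix (c, ..., c). *)
Definition translation (c : 'cV[R]_d) : 'M[R]_(d, N) :=
  \matrix_(i, j) c i 0.

Definition mxdot (G H : 'M[R]_(d, N)) : R := \tr (G^T *m H).

Section Lattice.
Variables (A : 'M[R]_d) (l : 'I_d -> R).

Definition Omega : set 'cV[R]_d := [set x | forall j, 0 < x j 0 < l j].

Definition lattice (eps : R) : set 'cV[R]_d :=
  [set eps *: (A *m map_mx intr k) | k in [set: 'cV[int]_d]].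

Definition midpoints (eps : R) : set 'cV[R]_d :=
  [set eps *: (A *m (const_mx 2^-1 + map_mx intr k)) | k in [set: 'cV[int]_d]].

Definition cell (eps : R) (x : 'cV[R]_d) : set 'cV[R]_d :=
  [set x + eps *: (A *m u) | u in
    [set u : 'cV[R]_d | forall i, - 2^-1 <= u i 0 < 2^-1]].

Definition inner_midpoints (eps : R) : set 'cV[R]_d :=
  [set x | midpoints eps x /\ closure (cell eps x) `<=` Omega].

(* The columns z_1, ..., z_N of Z enumerate A {-1/2, 1/2}^d without
   repetition. *)
Definition corner_enumeration (Z : 'M[R]_(d, N)) : Prop :=
  injective (fun j => col j Z) /\
  range (fun j => col j Z) =
    [set A *m u | u in
      [set u : 'cV[R]_d | forall i, u i 0 = - 2^-1 \/ u i 0 = 2^-1]].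

Definition dgrad (Z : 'M[R]_(d, N)) (eps : R) (y : 'cV[R]_d -> 'cV[R]_d)
    (x : 'cV[R]_d) : 'M[R]_(d, N) :=
  let yc j := y (x + eps *: col j Z) in
  let ybar := (2 ^+ d)^-1 *: \sum_j yc j in
  \matrix_(i, j) (eps^-1 *: (yc j - ybar)) i 0.

(* Deformations are total functions, but only their values on
   [lattice eps `&` Omega] enter [energy] and [admissible]: the corners of the
   inner cells belong to that set. *)
Definition energy (W : 'M[R]_(d, N) -> \bar R) (Z : 'M[R]_(d, N)) (eps : R)
    (y : 'cV[R]_d -> 'cV[R]_d) : \bar R :=
  ((eps ^+ d.-1)%:E *
   \sum_(x \in inner_midpoints eps) W (dgrad Z eps y x))%E.

Definition lA : R := \sum_j `|dot (col j A) e1|.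

Definition B1 (eps : R) : set 'cV[R]_d :=
  [set x | closure Omega x /\ x ord0 0 <= 2 * lA * eps].

Definition B2 (eps : R) : set 'cV[R]_d :=
  [set x | closure Omega x /\ l ord0 - 2 * lA * eps <= x ord0 0].

Definition admissible (eps a : R) : set ('cV[R]_d -> 'cV[R]_d) :=
  [set y |
    (forall x, (lattice eps `&` Omega) x -> (B1 eps `|` B2 eps) x ->
       y x ord0 0 = (1 + a) * x ord0 0) \/
    ((forall x, (lattice eps `&` Omega) x -> B1 eps x ->
       y x ord0 0 = x ord0 0) /\
     (forall x, (lattice eps `&` Omega) x -> B2 eps x ->
       y x ord0 0 = x ord0 0 + a * l ord0))].

Definition bonds (k : nat) : set 'cV[R]_d :=
  [set A *m t | t in
    [set t : 'cV[R]_d | (forall i, t i 0 \in [:: -1; 0; 1]) /\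
                        #|[pred i | t i 0 != 0]| = k]].

Definition all_bonds : set 'cV[R]_d :=
  [set A *m t | t in [set t : 'cV[R]_d | forall i, t i 0 \in [:: -1; 0; 1]]]
  `\ 0.

Variable beta : 'cV[R]_d -> R.

(* [all_bonds] is finite, so this is a genuine finite sum. *)
Definition crack_density (xi : 'cV[R]_d) : R :=
  \sum_(nu \in all_bonds) beta nu * `|dot nu xi|.

Definition crack_quotient (xi : 'cV[R]_d) : \bar R :=
  if dot e1 xi == 0 then +oo%E
  else (crack_density xi / `|dot e1 xi|)%:E.

Definition betaA : \bar R :=
  xget 0%E (is_min [set crack_quotient xi | xi in [set xi | xi != 0]]).

Definition M1 : R :=
  xget 0 (is_min [set crack_density xi | xi in [set xi | enorm xi = 1]]).

Definition M2 : R :=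
  xget 0 (is_max [set crack_density xi | xi in [set xi | enorm xi = 1]]).

Definition Lmin (Cs : R) : R :=
  Cs * \big[Num.max/0]_(j | j != ord0) l j * (M2 / M1).

End Lattice.

Section CellEnergy.
Variables (A : 'M[R]_d) (Z : 'M[R]_(d, N)) (W : 'M[R]_(d, N) -> \bar R).

Definition SObar : set 'M[R]_(d, N) := [set Q *m Z | Q in SO].

Definition C2_on (U : set 'M[R]_(d, N)) (w : 'M[R]_(d, N) -> R) : Prop :=
  forall G, U G -> forall H K : 'M[R]_(d, N),
    [/\ derivable w G H, derivable ('D_H w) G K &
        {for G, continuous ('D_K ('D_H w))}].

(* D^2 W (Z) as a quadratic form. *)
Definition Qcell (H : 'M[R]_(d, N)) : R := 'D_H ('D_H (fine \o W)) Z.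

Definition frame_indifferent : Prop :=
  forall Q, SO Q -> forall (c : 'cV[R]_d) (G : 'M[R]_(d, N)),
    W (Q *m G + translation c) = W G.

Definition zero_set_rigid : Prop :=
  forall G, W G = 0%E <->
    exists Q (c : 'cV[R]_d), SO Q /\ G = Q *m Z + translation c.

Definition regular_near_wells : Prop :=
  exists U, [/\ open U, SObar `<=` U, forall G, U G -> W G \is a fin_num &
                C2_on U (fine \o W)].

(* Positive definiteness on the orthogonal complement of the translations and
   the infinitesimal rotations. *)
Definition Hessian_nondegenerate : Prop :=
  forall H : 'M[R]_(d, N), H != 0 ->
    (forall (c : 'cV[R]_d) (S : 'M[R]_d), S + S^T = 0 ->
       mxdot (translation c + S *m Z) H = 0) ->
    0 < Qcell H.

(* A subset of the set of corners is given by its set I of indices. *)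
Definition restrict (G : 'M[R]_(d, N)) (I : {set 'I_N}) : 'M[R]_(d, #|I|) :=
  colsub (fun k : 'I_#|I| => enum_val k) G.

Definition is_corner_partition (P : {set {set 'I_N}}) : Prop :=
  finset.partition P [set: 'I_N]%SET.

Definition broken_energy (bp : 'I_N -> 'I_N -> R) (P : {set {set 'I_N}}) : R :=
  2^-1 * \sum_(I in P) \sum_(J in P | I != J)
           \sum_(s in I) \sum_(t in J) bp s t.

(* The minimal distance of the blocks of P in the configuration G is >= M. *)
Definition separated (P : {set {set 'I_N}}) (M : R) (G : 'M[R]_(d, N)) : Prop :=
  forall I J, I \in P -> J \in P -> I != J ->
    forall s t, s \in I -> t \in J -> M <= enorm (col s G - col t G).

(* The asymptotic expansion concerns partitions into at least two blocks: for
   a single block there is no distance to send to infinity (and the convention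
   min set0 = +oo would force W to be real-valued). *)
Definition fracture_asymptotics
    (WI : forall I : {set 'I_N}, 'M[R]_(d, #|I|) -> R)
    (bp : 'I_N -> 'I_N -> R) : Prop :=
  forall P, is_corner_partition P -> (1 < #|P|)%N ->
    0 < broken_energy bp P /\
    forall eta : R, 0 < eta -> exists M : R, forall G, separated P M G ->
      (`|W G - (\sum_(I in P) WI I (restrict G I) + broken_energy bp P)%:E|
         <= eta%:E)%E.

Definition block_energy_bound
    (WI : forall I : {set 'I_N}, 'M[R]_(d, #|I|) -> R) : Prop :=
  exists (C : R) (U : set 'M[R]_(d, N)), [/\ open U, SObar `<=` U &
    forall P I, is_corner_partition P -> I \in P ->
      forall H, U H -> ((WI I (restrict H I))%:E <= C%:E * W H)%E].

Definition bond_normalization (bp : 'I_N -> 'I_N -> R)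
    (beta : 'cV[R]_d -> R) : Prop :=
  forall k, (1 <= k <= d)%N -> forall nu, bonds A k nu ->
    0 <= beta nu /\
    forall s t, col s Z - col t Z = nu ->
      2^-1 * bp s t = 2 ^+ k / 2 ^+ d * beta nu.

Record cell_energy_assumptions (beta : 'cV[R]_d -> R) : Prop := {
  cell_energy_ge0 : forall G, (0 <= W G)%E ;
  cell_energy_frame : frame_indifferent ;
  cell_energy_zero : zero_set_rigid ;
  cell_energy_continuous : continuous W ;
  cell_energy_regular : regular_near_wells ;
  cell_energy_Hessian : Hessian_nondegenerate ;
  cell_energy_fracture :
    exists (WI : forall I : {set 'I_N}, 'M[R]_(d, #|I|) -> R)
           (bp : 'I_N -> 'I_N -> R),
      [/\ forall I G, 0 <= WI I G,
          forall s t, s != t -> 0 <= bp s t /\ bp s t = bp t s,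
          fracture_asymptotics WI bp,
          block_energy_bound WI &
          bond_normalization bp beta] }.

Definition alphaA : R :=
  xget 0 [set al | 0 < al /\ forall r : R,
    is_min [set Qcell ((2^-1 *: (G + G^T)) *m Z) | G in
              [set G : 'M[R]_d | G ord0 ord0 = r]]
           (al * r ^+ 2)].

End CellEnergy.

End Definitions.

(* Main.v *)
(** Lower bound.  By duality, the minimality of [betaA] gives bond weights
    [|Lam s t| <= b s t] with [\sum Lam s t (z_s - z_t) = betaA e_1].  Running
    through the bonds with these frequencies yields a periodic lattice path in
    direction [e_1]; its translates starting in a cube of side [m] fill a tube of
    width [m].  If every path in a tube contains a very long bond, then, since a
    bond of type [(s, t)] in a given cell lies on about [b s t * m / betaA] paths
    at most, the tube carries the fracture energy of its cross section.
    Otherwise one path joins the two boundary layers without a break.  On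
    stretches of the tube where the cells have small energy, the deformation is
    close to a single rotation, and the stress functional of the optimal strain,
    which telescopes along the path, bounds the elongation by the elastic energy:
    [r al (elongation) - r^2 al / 2 (length)] is at most the energy per path for
    every [r > 0].  The remaining times are few, because each of them costs a
    fixed amount of energy, and the unbroken path gains only a bounded elongation
    there.  The choice [r = a sqrt eps] gives the elastic energy of the tube.
    Disjoint tubes fill the domain up to a small fraction as [eps -> 0] and then
    [m -> infinity].

    Upper bound.  The elastic value is attained by an affine deformation whose
    linearised strain is optimal, and the crack energy by the separation along a
    plane orthogonal to a minimiser of the crack quotient; averaging over parallel
    planes selects one which does not cut too many bonds.  The lower bound on
    [l_1] keeps the plane away from the boundary layers. *)

Require Import Defs.
From mathcomp Require Import all_boot all_order all_algebra.
From mathcomp Require Import finmap fingroup perm.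
From mathcomp Require Import all_classical all_reals all_analysis.
From mathcomp Require Import ring lra zify.
Set Implicit Arguments.
Unset Strict Implicit.
Unset Printing Implicit Defensive.
Import Order.TTheory GRing.Theory Num.Theory numFieldNormedType.Exports.
Local Open Scope classical_set_scope.
Local Open Scope ring_scope.

(** * Preliminaries on matrices *)

(** The path argument replaces a rigidity estimate for the whole body, which a cracked body does not
    satisfy. Rigidity is used only on windows of fixed side m, and the rotation may change from one
    window to the next. The windows fit together through [yhat], the position extrapolated from the
    lattice path to the straight line that it follows: its increments telescope, and as a rotation
    does not lengthen e_1 ([rotation_stretch]), each of them exceeds the step tau by at most the
    linear strain and a quadratic term. Within a window, the stress differs from the telescoping
    quantity by sums of strain differences; these reduce to boundary sums over m^(d-1) cells,
    against m^d in the volume, and Young's inequality absorbs them. This dictates the order of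
    choices: eta, then m, then the energy threshold, then eps. As W may be infinite, the lower bound
    works with a finite truncation of it. The constant C_* is 2d: a minimiser with first entry 1 has
    length at most M2 / M1, which limits how far the crack plane leans over the cross section. *)

Section MatrixNorm.
Context {R : realType}.

Lemma mx_entry_le m n (M : 'M[R]_(m, n)) i j : `|M i j| <= `|M|.
Proof.
rewrite [leRHS]/Num.norm /= mx_normrE.
by apply/bigmax_geP; right; exists (i, j).
Qed.

Lemma mx_norm_le m n (M : 'M[R]_(m, n)) (c : R) :
  0 <= c -> (forall i j, `|M i j| <= c) -> `|M| <= c.
Proof.
move=> c0 Mc; rewrite [leLHS]/Num.norm /= mx_normrE.
by apply/bigmax_leP; split=> // -[i j] _; exact: Mc.
Qed.

Lemma mx_norm_mul m n p (A : 'M[R]_(m, n)) (B : 'M[R]_(n, p)) :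
  `|A *m B| <= n%:R * `|A| * `|B|.
Proof.
apply: mx_norm_le => [|i j]; first by rewrite !mulr_ge0.
rewrite mxE (le_trans (ler_norm_sum _ _ _))//.
rewrite -mulrA -[X in X%:R](card_ord n) mulr_natl -sumr_const ler_sum// => k _.
by rewrite normrM ler_pM// mx_entry_le.
Qed.

Lemma mx_norm_tr m n (A : 'M[R]_(m, n)) : `|A^T| <= `|A|.
Proof. by apply: mx_norm_le => // i j; rewrite mxE mx_entry_le. Qed.

Lemma continuous_sum (T : topologicalType) (I : Type) (r : seq I) (P : pred I)
    (F : I -> T -> R) :
  (forall i, P i -> continuous (F i)) ->
  continuous (fun x => \sum_(i <- r | P i) F i x).
Proof. by move=> Fc; apply: continuous_big => //; exact: add_continuous. Qed.

Lemma continuous_mul (T : topologicalType) (f g : T -> R) :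
  continuous f -> continuous g -> continuous (fun x => f x * g x).
Proof. by move=> fc gc x; apply: continuousM; [exact: fc|exact: gc]. Qed.

Lemma continuous_add (T : topologicalType) (f g : T -> R) :
  continuous f -> continuous g -> continuous (fun x => f x + g x).
Proof. by move=> fc gc x; apply: continuousD; [exact: fc|exact: gc]. Qed.

Lemma continuous_scale (T : topologicalType) (a : R) (f : T -> R) :
  continuous f -> continuous (fun x => a * f x).
Proof. by apply: continuous_mul => x; exact: cst_continuous. Qed.

Lemma mx_continuous_atP m n (V : normedModType R) (f : 'M[R]_(m, n) -> V) x :
  {for x, continuous f} <->
  forall e : R, 0 < e -> exists2 d : R, 0 < d &
    forall y, `|x - y| < d -> `|f x - f y| <= e.
Proof.
split=> [/(@cvgrPdist_le _ _ _ _ (nbhs_filter x)) fx e /fx|fx].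
  move=> /nbhs_ballP[d /= d0 xd]; exists d => // y xy.
  by apply: xd; rewrite mx_norm_ball.
apply/(@cvgrPdist_le _ _ _ _ (nbhs_filter x)) => e /fx[d d0 xd].
apply: (filterS _ (nbhsx_ballx x _ d0)) => y.
by rewrite mx_norm_ball; exact: xd.
Qed.

Lemma lipschitz_continuous m n (V : normedModType R) (f : 'M[R]_(m, n) -> V) (c : R) :
  (forall x y, `|f x - f y| <= c * `|x - y|) -> continuous f.
Proof.
move=> fc x; apply/mx_continuous_atP => e e0.
have d0 : 0 < e / (`|c| + 1) by rewrite divr_gt0// ltr_pwDr.
exists (e / (`|c| + 1)) => // y /ltW xy; apply: (le_trans (fc _ _)).
move: xy; rewrite ler_pdivlMr ?ltr_pwDr// mulrC => /(le_trans _); apply.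
by rewrite ler_wpM2r// (le_trans (ler_norm _))// lerDl.
Qed.

Lemma mulmxr_continuous m n p (B : 'M[R]_(n, p)) :
  continuous (fun A : 'M[R]_(m, n) => A *m B).
Proof.
apply: (@lipschitz_continuous _ _ _ _ (n%:R * `|B|)) => x y.
by rewrite -mulmxBl (le_trans (mx_norm_mul _ _))// mulrAC.
Qed.

(** Heine-Borel for row vectors, transported by [vec_mx], which does not increase the sup norm. *)
Lemma mx_bounded_closed_compact m n (A : set 'M[R]_(m, n)) (c : R) :
  (forall x, A x -> `|x| <= c) -> closed A -> compact A.
Proof.
move=> Ac Acl.
pose g (v : 'rV[R]_(m * n)) : 'M[R]_(m, n) := vec_mx v.
have gc : continuous g.
  apply: (@lipschitz_continuous _ _ _ _ 1) => x y; rewrite mul1r -linearB/=.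
  by apply: mx_norm_le => // i j; rewrite mxE mx_entry_le.
have -> : A = g @` (g @^-1` A).
  apply/seteqP; split=> [x Ax|_ [v Av <-]//].
  by exists (mxvec x); rewrite /preimage/= /g mxvecK.
apply: continuous_compact; first exact: continuous_subspaceT.
apply: bounded_closed_compact.
  exists c; split; first exact: num_real.
  move=> e ce v /= /Ac gvc; apply: le_trans (ltW ce).
  apply: mx_norm_le => [|i j]; first exact: le_trans gvc.
  rewrite ord1 -[v]vec_mxK; case/mxvec_indexP: j => k l.
  by rewrite mxvecE (le_trans (mx_entry_le _ _ _)).
by apply: preimage_closed => // x _; exact: gc.
Qed.

Lemma mx_EVT_min m n (A : set 'M[R]_(m, n)) (c : R) (f : 'M[R]_(m, n) -> R) :
  A !=set0 -> (forall x, A x -> `|x| <= c) -> closed A -> continuous f ->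
  exists2 x, A x & forall y, A y -> f x <= f y.
Proof.
move=> A0 Ac Acl fc.
have [x /set_mem Ax xmin] := compact_EVT_min A0
  (mx_bounded_closed_compact Ac Acl) (continuous_subspaceT fc).
by exists x => // y Ay; apply: xmin; rewrite inE.
Qed.

Lemma closed_levelset (T : topologicalType) (f : T -> R) (a : R) :
  continuous f -> closed [set x | f x = a].
Proof.
move=> fc; have := @preimage_closed _ _ f [set x | x = a].
by apply; [move=> x _; exact: fc|exact: closed_eq].
Qed.

Lemma closed_sublevel (T : topologicalType) (f : T -> R) (a : R) :
  continuous f -> closed [set x | f x <= a].
Proof.
move=> fc; have := @preimage_closed _ _ f [set x | x <= a].
by apply; [move=> x _; exact: fc|exact: closed_le].
Qed.

Lemma closed_superlevel (T : topologicalType) (f : T -> R) (a : R) :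
  continuous f -> closed [set x | a <= f x].
Proof.
move=> fc; have := @preimage_closed _ _ f [set x | a <= x].
by apply; [move=> x _; exact: fc|exact: closed_ge].
Qed.

Lemma closed_forall (T : topologicalType) (I : Type) (P : I -> set T) :
  (forall i, closed (P i)) -> closed [set x | forall i, P i x].
Proof.
move=> Pcl; have -> : [set x | forall i, P i x] = \bigcap_(i in setT) P i.
  by apply/seteqP; split=> x Px i; [move=> _|]; exact: Px.
by apply: closed_bigI => i _.
Qed.

End MatrixNorm.

Lemma fin_uniform_gt0 (R : realType) (I : finType) (P : I -> R -> Prop) :
  (forall i, exists2 d : R, 0 < d & P i d) ->
  (forall i d d', 0 < d' -> d' <= d -> P i d -> P i d') ->
  exists2 d : R, 0 < d & forall i, P i d.
Proof.
move=> Pd Pmono.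
pose g i := s2val (cid2 (Pd i)).
have g0 i : 0 < g i by rewrite /g; case: cid2.
exists (\big[Num.min/1]_i g i); first by apply/lt_bigmin.
move=> i; apply: (Pmono i (g i)); first by apply/lt_bigmin.
  exact: bigmin_le_cond.
by rewrite /g; case: cid2.
Qed.

(** * Second-order calculus from directional derivatives *)

Section DirectionalDerivatives.
Context {R : realType} {p q : nat}.
Local Notation V := 'M[R]_(p, q).
Implicit Types (f : V -> R) (G H K : V).

Lemma directional_derivativeP f G H (l : R) :
  (derivable f G H /\ 'D_H f G = l) <->
  forall e : R, 0 < e -> exists2 d : R, 0 < d & forall t : R, t != 0 -> `|t| < d ->
    `|t^-1 * (f (t *: H + G) - f G) - l| <= e.
Proof.
pose g (t : R) : R := t^-1 *: (f (t *: H + G) - f G).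
have gP : (g t @[t --> 0^'] --> l) <->
  forall e, 0 < e -> exists2 d : R, 0 < d & forall t : R, t != 0 -> `|t| < d ->
    `|g t - l| <= e.
  split=> [/(@cvgrPdist_le _ _ _ (0 : R)^') gl e /gl|gl].
    move=> /nbhs_ballP[d /= d0 xd]; exists d => // t t0 td.
    by rewrite distrC; apply: xd => //; rewrite /ball/= sub0r normrN.
  apply/(@cvgrPdist_le _ _ _ (0 : R)^') => e /gl[d d0 xd].
  apply/nbhs_ballP; exists d => // t; rewrite /ball/= sub0r normrN => td t0.
  by rewrite distrC; exact: xd.
rewrite -gP; split=> [[dH <-]|gl]; first exact: dH.
by split; [apply/cvg_ex; exists l|apply: cvg_lim].
Qed.

Lemma directional_derivative_lim f G H (e : R) : derivable f G H -> 0 < e ->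
  exists2 d : R, 0 < d & forall t : R, t != 0 -> `|t| < d ->
    `|t^-1 * (f (t *: H + G) - f G) - 'D_H f G| <= e.
Proof. by move=> df; exact: (proj1 (directional_derivativeP _ _ _ _) (conj df erefl)). Qed.

Lemma directional_derivative_eq f f' G H (l d : R) : 0 < d ->
  (forall t : R, `|t| < d -> f' (t *: H + G) = f (t *: H + G)) ->
  derivable f G H /\ 'D_H f G = l -> derivable f' G H /\ 'D_H f' G = l.
Proof.
move=> d0 ff' /directional_derivativeP fl.
apply/directional_derivativeP => e /fl[d1 d10 fe].
exists (Num.min d d1) => [|t t0]; first by rewrite lt_min d0.
rewrite lt_min => /andP[td td1].
have := fe t t0 td1; rewrite ff'// .
by have := ff' 0; rewrite normr0 scale0r add0r => ->.
Qed.

Lemma directional_derivativeZ f G H (a : R) :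
  derivable f G H -> 'D_(a *: H) f G = a * 'D_H f G.
Proof.
move=> df; have fl e := directional_derivative_lim (e := e) df.
suff /directional_derivativeP[_ ->//] : forall e : R, 0 < e -> exists2 d : R, 0 < d &
  forall t : R, t != 0 -> `|t| < d ->
    `|t^-1 * (f (t *: (a *: H) + G) - f G) - a * 'D_H f G| <= e.
have [->|a0] := eqVneq a 0 => e e0.
  exists 1 => // t t0 _.
  by rewrite scale0r scaler0 add0r subrr mulr0 mul0r subrr normr0 ltW.
have a_gt0 : 0 < `|a| by rewrite normr_gt0.
have [d d0 fd] := fl (e / `|a|) (divr_gt0 e0 a_gt0).
exists (d / `|a|) => [|t t0 td]; first by rewrite divr_gt0.
have ta0 : t * a != 0 by rewrite mulf_neq0.
have := fd (t * a) ta0; rewrite normrM -ltr_pdivlMr// => /(_ td).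
rewrite ler_pdivlMr// mulrC -normrM scalerA mulrBr mulrA invfM.
by rewrite mulrCA mulfV// mulr1.
Qed.

Lemma directional_MVT f G H (s : R) : 0 < s ->
  (forall t, 0 <= t <= s -> derivable f (t *: H + G) H) ->
  exists2 t, 0 < t < s & f (s *: H + G) - f G = s * 'D_H f (t *: H + G).
Proof.
move=> s0 df; pose g (t : R) := f (t *: H + G).
have dg (t : R) : 0 <= t <= s -> is_derive t 1 g ('D_H f (t *: H + G)).
  move=> ts; have := df t ts; rewrite /derivable /derive.
  have -> : (fun h : R => h^-1 *: (f (h *: H + (t *: H + G)) - f (t *: H + G)))
     = (fun h : R => h^-1 *: (g (h *: 1 + t) - g t)).
    by apply/funext => h; rewrite /g scalerDl addrA [h *: 1]mulr1.
  by move=> dgt; split.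
have [t ts] : exists2 c, c \in `]0, s[%R & g s - g 0 = 'D_H f (c *: H + G) * (s - 0).
  apply: MVT => // [x|].
    by rewrite in_itv => /andP[x0 xs]; apply: dg; rewrite !ltW.
  apply: derivable_within_continuous => x; rewrite in_itv => xs.
  by have [] := dg x xs.
rewrite /g scale0r add0r subr0 mulrC => gs; by exists t.
Qed.

Variable U : set V.
Hypothesis openU : open U.

Lemma open_ball G : U G -> exists2 d : R, 0 < d & forall X, `|X - G| < d -> U X.
Proof.
move=> UG; have /nbhs_ballP[d d0 Ud] : nbhs G U by exact: open_nbhs_nbhs.
by exists d => // X XG; apply: Ud; rewrite mx_norm_ball /ball_ /= distrC.
Qed.

(** Only directional derivatives are available, so additivity in the direction is not automatic. The
    increment along H + K is split at the point reached along H; by the mean value theorem the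
    second part is a derivative in direction K at a nearby point, and continuity of that one
    derivative at G suffices. *)
Lemma directional_derivativeD f G H K :
  (forall X, U X -> forall H, derivable f X H) -> U G ->
  {for G, continuous ('D_K f)} ->
  'D_(H + K) f G = 'D_H f G + 'D_K f G.
Proof.
move=> df UG cK; have [d d0 Ud] := open_ball UG.
apply/eqP; rewrite -subr_eq0 -normr_le0; apply/ler_addgt0Pl => e e0.
rewrite addr0; have e3 : 0 < e / 3 by rewrite divr_gt0.
have [d1 d10 f1] := directional_derivative_lim (df _ UG (H + K)) e3.
have [d2 d20 f2] := directional_derivative_lim (df _ UG H) e3.
have [d3 d30 f3] := proj1 (mx_continuous_atP _ _) cK _ e3.
pose m := Num.min (Num.min d1 d2) (Num.min d d3).
pose M := `|H| + `|K| + 1.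
have M0 : 0 < M by rewrite ltr_pwDr// addr_ge0.
have M1 : 1 <= M by rewrite lerDr addr_ge0.
have m0 : 0 < m by rewrite !lt_min d0 d10 d20 d30.
have [s s0 sM] : exists2 s : R, 0 < s & s * M < m.
  exists (m / (2 * M)); first by rewrite divr_gt0// mulr_gt0.
  have -> : m / (2 * M) * M = m / 2 by field; rewrite gt_eqF.
  by rewrite ltr_pdivrMr// ltr_pMr// ltr1n.
have sm : s < m by apply: le_lt_trans sM; rewrite ler_peMr// ltW.
have near (t : R) : 0 <= t <= s -> `|t *: K + (s *: H + G) - G| < m.
  move=> /andP[t0 ts]; rewrite addrA addrK (le_lt_trans (ler_normD _ _))//.
  apply: le_lt_trans sM; rewrite !normrZ (ger0_norm t0) (gtr0_norm s0).
  by have := ler_wpM2r (normr_ge0 K) ts; rewrite /M; lra.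
have Un (t : R) : 0 <= t <= s -> U (t *: K + (s *: H + G)).
  move=> ts; apply: Ud; apply: lt_le_trans (near _ ts) _.
  by rewrite /m !ge_min lexx orbT.
have [t ts fst_] := directional_MVT s0 (fun t ts => df _ (Un t ts) K).
have s_n0 : s != 0 by rewrite gt_eqF.
have := f1 s s_n0; have := f2 s s_n0; rewrite gtr0_norm//.
have -> : s < d2 by apply: lt_le_trans sm _; rewrite /m !ge_min lexx ?orbT.
have -> : s < d1 by apply: lt_le_trans sm _; rewrite /m !ge_min lexx ?orbT.
move=> /(_ erefl) A2 /(_ erefl) A1.
have : `|'D_K f G - 'D_K f (t *: K + (s *: H + G))| <= e / 3.
  apply: f3; rewrite distrC; apply: lt_le_trans (near _ _) _.
    by case/andP: ts => *; rewrite !ltW.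
  by rewrite /m !ge_min lexx ?orbT.
move: A1 A2; rewrite scalerDr (addrC (s *: H)) -addrA.
rewrite -(subrK (f (s *: H + G)) (f (s *: K + _))) fst_.
set a := 'D_(H + K) f G; set b := 'D_H f G; set c := 'D_K f G.
set c' := 'D_K f _; set x := f (s *: H + G) - f G.
rewrite -addrA -/x mulrDr mulKf// => A1 A2 A3.
have -> : a - (b + c) = - (c' + s^-1 * x - a) + (s^-1 * x - b) - (c - c').
  by ring.
rewrite (le_trans (ler_normD _ _))// normrN.
have -> : e = e / 3 + e / 3 + e / 3 by field.
by rewrite lerD// (le_trans (ler_normD _ _))// normrN lerD.
Qed.

End DirectionalDerivatives.

Section SecondOrder.
Context {R : realType} {p q : nat}.
Local Notation V := 'M[R]_(p, q).
Variables (U : set V) (w : V -> R).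
Hypothesis openU : open U.
Hypothesis C2w : forall G, U G -> forall H K : V,
  [/\ derivable w G H, derivable ('D_H w) G K & {for G, continuous ('D_K ('D_H w))}].

Lemma linear_expansion (g : V -> R) :
  (forall H K, g (H + K) = g H + g K) -> (forall a H, g (a *: H) = a * g H) ->
  forall H, g H = \sum_i \sum_j H i j * g (delta_mx i j).
Proof.
move=> gD gZ H; have g0 : g 0 = 0 by rewrite -(scale0r (0 : V)) gZ mul0r.
rewrite {1}(matrix_sum_delta H).
rewrite (big_morph g gD g0); apply: eq_bigr => i _.
by rewrite (big_morph g gD g0); apply: eq_bigr => j _; rewrite gZ.
Qed.

Lemma second_derivativeDr G H K K' : U G ->
  'D_(K + K') ('D_H w) G = 'D_K ('D_H w) G + 'D_K' ('D_H w) G.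
Proof.
move=> UG; apply: (directional_derivativeD openU) => //.
  by move=> X UX K1; have [] := C2w UX H K1.
by have [] := C2w UG H K'.
Qed.

Lemma second_derivativeZr G H K a : U G ->
  'D_(a *: K) ('D_H w) G = a * 'D_K ('D_H w) G.
Proof. by move=> UG; apply: directional_derivativeZ; have [] := C2w UG H K. Qed.

(** Continuity is assumed of the second derivatives only. In the finitely many directions
    [delta_mx i j] they are bounded near G, and by linearity in the direction and the mean value
    theorem ['D_H w] changes by at most a constant times the displacement. *)
Lemma first_derivative_continuous G H : U G -> {for G, continuous ('D_H w)}.
Proof.
move=> UG; apply/mx_continuous_atP => e e0.
have [d d0 Ud] := open_ball openU UG.
pose c i j := 'D_(delta_mx i j) ('D_H w) G.
have [d1 d10 cd1] : exists2 d1, 0 < d1 & forall ij : 'I_p * 'I_q, forall X,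
    `|G - X| < d1 -> `|'D_(delta_mx ij.1 ij.2) ('D_H w) X| <= `|c ij.1 ij.2| + 1.
  apply: (@fin_uniform_gt0 _ _ (fun ij d1 => forall X, `|G - X| < d1 ->
    `|'D_(delta_mx ij.1 ij.2) ('D_H w) X| <= `|c ij.1 ij.2| + 1)).
    move=> [i j] /=; have [_ _ /mx_continuous_atP] := C2w UG H (delta_mx i j).
    move=> /(_ 1 ltr01)[d1 d10 cd]; exists d1 => // X /cd.
    rewrite distrC => cX; rewrite -(subrK (c i j) ('D_(delta_mx i j) _ _)).
    by rewrite (le_trans (ler_normD _ _))// addrC lerD2l.
  by move=> ij d1 d2 _ d21 Pd X /lt_le_trans/(_ d21)/Pd.
pose C := \sum_i \sum_j (`|c i j| + 1).
have C0 : 0 <= C by do 2!apply: sumr_ge0 => ? _; rewrite addr_ge0.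
pose m := Num.min (Num.min d d1) (e / (C + 1)).
exists m; first by rewrite !lt_min d0 d10 divr_gt0// ltr_pwDr.
move=> Y GY; pose X := Y - G.
have Xm : `|X| < m by rewrite /X distrC.
have near (t : R) : 0 <= t <= 1 -> `|t *: X + G - G| < m.
  move=> /andP[t0 t1]; rewrite addrK normrZ ger0_norm//.
  by apply: le_lt_trans Xm; rewrite ler_piMl.
have nearU (t : R) : 0 <= t <= 1 -> U (t *: X + G).
  by move=> /near Xt; apply: Ud; apply: lt_le_trans Xt _; rewrite !ge_min lexx.
have [t /andP[t0 t1]] := directional_MVT ltr01
  (fun t ts => let: And3 _ dd _ := C2w (nearU t ts) H X in dd).
have ts : 0 <= t <= 1 by rewrite !ltW.
rewrite scale1r mul1r {1}/X subrK distrC => ->.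
rewrite (linear_expansion (fun K K' => second_derivativeDr H K K' (nearU t ts))
   (fun a K => second_derivativeZr H K a (nearU t ts)) X).
apply: (@le_trans _ _ (`|X| * C)).
  rewrite (le_trans (ler_norm_sum _ _ _))// /C mulr_sumr ler_sum// => i _.
  rewrite (le_trans (ler_norm_sum _ _ _))// mulr_sumr ler_sum// => j _.
  rewrite normrM ler_pM ?mx_entry_le//.
  apply: (cd1 (i, j)); rewrite distrC; apply: lt_le_trans (near t ts) _.
  by rewrite /m !ge_min lexx orbT.
have : `|X| <= e / (C + 1).
  by apply: ltW; apply: lt_le_trans Xm _; rewrite /m !ge_min lexx orbT.
rewrite ler_pdivlMr ?ltr_pwDr// => /(le_trans _); apply.
by rewrite ler_wpM2l// lerDl.
Qed.

Lemma first_derivativeD G H K : U G ->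
  'D_(H + K) w G = 'D_H w G + 'D_K w G.
Proof.
move=> UG; apply: (directional_derivativeD openU) => //.
  by move=> X UX K1; have [] := C2w UX K1 K1.
exact: first_derivative_continuous.
Qed.

Lemma second_derivativeDl G H H' K : U G ->
  'D_K ('D_(H + H') w) G = 'D_K ('D_H w) G + 'D_K ('D_H' w) G.
Proof.
move=> UG; have [d d0 Ud] := open_ball openU UG.
have Kd : 0 < d / (`|K| + 1) by rewrite divr_gt0// ltr_pwDr.
have [_ dH _] := C2w UG H K; have [_ dH' _] := C2w UG H' K.
have : derivable (fun X => 'D_H w X + 'D_H' w X) G K /\
    'D_K (fun X => 'D_H w X + 'D_H' w X) G = 'D_K ('D_H w) G + 'D_K ('D_H' w) G.
  by split; [exact: derivableD|exact: deriveD].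
case/(directional_derivative_eq Kd (f' := 'D_(H + H') w)) => // t tK.
apply: first_derivativeD; apply: Ud; rewrite addrK normrZ.
move: tK; rewrite ltr_pdivlMr ?ltr_pwDr//; apply: le_lt_trans.
by rewrite ler_wpM2l// lerDl.
Qed.

Lemma second_derivativeZl G H K a : U G ->
  'D_K ('D_(a *: H) w) G = a * 'D_K ('D_H w) G.
Proof.
move=> UG; have [d d0 Ud] := open_ball openU UG.
have Kd : 0 < d / (`|K| + 1) by rewrite divr_gt0// ltr_pwDr.
have [_ dH _] := C2w UG H K.
have : derivable (a \*: 'D_H w) G K /\
    'D_K (a \*: 'D_H w) G = a * 'D_K ('D_H w) G.
  by split; [exact: derivableZ|exact: deriveZ].
case/(directional_derivative_eq Kd (f' := 'D_(a *: H) w)) => // t tK.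
apply: directional_derivativeZ.
suff UX : U (t *: K + G) by have [] := C2w UX H H.
apply: Ud; rewrite addrK normrZ.
move: tK; rewrite ltr_pdivlMr ?ltr_pwDr//; apply: le_lt_trans.
by rewrite ler_wpM2l// lerDl.
Qed.

Lemma second_derivative_expansion G H : U G ->
  'D_H ('D_H w) G = \sum_i \sum_j \sum_k \sum_l
     H i j * (H k l * 'D_(delta_mx k l) ('D_(delta_mx i j) w) G).
Proof.
move=> UG; rewrite (linear_expansion (g := fun X => 'D_H ('D_X w) G)
  (fun K K' => second_derivativeDl K K' H UG)
  (fun a K => second_derivativeZl K H a UG) H).
apply: eq_bigr => i _; apply: eq_bigr => j _.
rewrite (linear_expansion (g := fun X => 'D_X ('D_(delta_mx i j) w) G)
  (fun K K' => second_derivativeDr (delta_mx i j) K K' UG)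
  (fun a K => second_derivativeZr (delta_mx i j) K a UG) H).
rewrite mulr_sumr; apply: eq_bigr => k _.
by rewrite mulr_sumr.
Qed.

(** The second derivative is a quadratic form with finitely many coefficients, each continuous at G;
    this makes the estimate uniform in H. *)
Lemma second_derivative_near G (e : R) : U G -> 0 < e ->
  exists2 d : R, 0 < d & forall X H, `|X - G| < d ->
    U X /\ `|'D_H ('D_H w) X - 'D_H ('D_H w) G| <= e * `|H| ^+ 2.
Proof.
move=> UG e0; have [d d0 Ud] := open_ball openU UG.
pose I := ('I_p * 'I_q * ('I_p * 'I_q))%type.
pose N : R := #|{: I}|%:R + 1.
have N0 : 0 < N by rewrite ltr_pwDr.
pose D X (i : I) := 'D_(delta_mx i.2.1 i.2.2) ('D_(delta_mx i.1.1 i.1.2) w) X.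
have [d1 d10 Dd1] : exists2 d1, 0 < d1 & forall i : I, forall X,
    `|G - X| < d1 -> `|D G i - D X i| <= e / N.
  apply: (@fin_uniform_gt0 _ _ (fun i d1 => forall X, `|G - X| < d1 ->
    `|D G i - D X i| <= e / N)).
    move=> [[i j] [k l]] /=.
    have [_ _ /mx_continuous_atP] := C2w UG (delta_mx i j) (delta_mx k l).
    by apply; rewrite divr_gt0.
  by move=> ij d1 d2 _ d21 Pd X /lt_le_trans/(_ d21)/Pd.
exists (Num.min d d1); first by rewrite lt_min d0.
move=> X H; rewrite lt_min => /andP[Xd Xd1]; have UX := Ud _ Xd; split=> //.
have E Y : U Y -> 'D_H ('D_H w) Y =
    \sum_(i : I) H i.1.1 i.1.2 * (H i.2.1 i.2.2 * D Y i).
  move=> UY; rewrite second_derivative_expansion//.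
  rewrite pair_bigA -(pair_bigA _ (fun ij kl => H ij.1 ij.2 * (H kl.1 kl.2 * D Y (ij, kl))))/=.
  by apply: eq_bigr => ij _; rewrite pair_bigA.
rewrite !E// -sumrB (le_trans (ler_norm_sum _ _ _))//.
apply: (@le_trans _ _ (\sum_(i : I) `|H| ^+ 2 * (e / N))).
  apply: ler_sum => i _; rewrite -!mulrBr !normrM mulrA.
  rewrite ler_pM ?mulr_ge0 ?expr2 ?ler_pM ?mx_entry_le// distrC.
  by apply: Dd1; rewrite distrC.
rewrite sumr_const -mulr_natr -mulrA mulrC ler_wpM2r ?sqr_ge0//.
rewrite mulrAC ler_pdivrMr//; apply: ler_wpM2l; first exact: ltW.
by rewrite /N lerDl.
Qed.

Lemma taylor2 G (e : R) : U G -> 0 < e ->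
  exists2 d : R, 0 < d & forall H, `|H| < d ->
    U (H + G) /\
    `|w (H + G) - w G - 'D_H w G - 2^-1 * 'D_H ('D_H w) G| <= e * `|H| ^+ 2.
Proof.
move=> UG e0; have [d d0 near] := second_derivative_near UG e0.
exists d => // H Hd.
have Hn (t : R) : 0 <= t <= 1 -> `|t *: H + G - G| < d.
  move=> /andP[t0 t1]; rewrite addrK normrZ ger0_norm//.
  by apply: le_lt_trans Hd; rewrite ler_piMl.
have Un (t : R) : 0 <= t <= 1 -> U (t *: H + G) by move=> /Hn /(near _ 0)[].
have UH : U (H + G) by have := Un 1; rewrite scale1r; apply; rewrite ler01 lexx.
split=> //; pose c := w (H + G) - w G - 'D_H w G.
(* The multiple of t^2 is such that [g 1 = g 0]. The mean value theorem then expresses [c] by a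
   difference of first derivatives at an intermediate time, and a second application turns it into
   half of a second derivative. *)
pose g (t : R) := w (t *: H + G) - t * 'D_H w G - t ^+ 2 * c.
have dg (t : R) : 0 <= t <= 1 ->
    is_derive t 1 g ('D_H w (t *: H + G) - 'D_H w G - 2 * t * c).
  move=> ts; have [dw _ _] := C2w (Un t ts) H H.
  have dw1 : is_derive t (1:R) (fun t : R => w (t *: H + G)) ('D_H w (t *: H + G)).
    move: dw; rewrite /derivable /derive.
    have -> : (fun h : R => h^-1 *: (w (h *: H + (t *: H + G)) - w (t *: H + G)))
     = (fun h : R => h^-1 *: ((fun t : R => w (t *: H + G)) (h *: 1 + t) - w (t *: H + G))).
      by apply/funext => h; rewrite scalerDl addrA [h *: 1]mulr1.
    by move=> dgt; split.
  apply: is_derive_eq.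
  by rewrite /GRing.scale/=; ring.
have [t] : exists2 t, t \in `]0, 1[%R & g 1 - g 0 =
    ('D_H w (t *: H + G) - 'D_H w G - 2 * t * c) * (1 - 0).
  apply: MVT => // [x|].
    by rewrite in_itv => /andP[x0 xs]; apply: dg; rewrite !ltW.
  apply: derivable_within_continuous => x; rewrite in_itv => xs.
  by have [] := dg x xs.
rewrite in_itv/= => /andP[t0 t1].
rewrite /g !scale1r scale0r add0r !mul1r !mul0r expr0n/= mul0r expr1n mul1r.
rewrite !subr0 mulr1 {1}/c => gE.
have [s /andP[s0 st]] := directional_MVT t0 (fun s (ss : 0 <= s <= t) =>
  let: And3 _ dd _ := C2w (Un s (introT andP (conj (proj1 (andP ss))
    (le_trans (proj2 (andP ss)) (ltW t1))))) H H in dd).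
move=> DE.
have s1 : 0 <= s <= 1 by rewrite ltW//= ltW// (lt_trans st).
have cE : c = 2^-1 * 'D_H ('D_H w) (s *: H + G).
  have : 2 * t * c = t * 'D_H ('D_H w) (s *: H + G).
    by rewrite -DE; move: gE; rewrite /c; lra.
  move/(congr1 (fun x => x / (2 * t))); rewrite mulrC mulKf ?mulf_neq0 ?gt_eqF//.
  by move=> ->; field; rewrite gt_eqF.
rewrite -/c cE -mulrBr normrM gtr0_norm ?invr_gt0//.
have [_] := near _ H (Hn s s1).
apply: le_trans; rewrite ler_piMl// invf_le1 ?ler1n//.
Qed.

End SecondOrder.

(** * Rotations and the Cayley transform *)

Section Rotations.
Context {R : realType} {n : nat}.
Local Notation d := n.+2.
Implicit Types (Q S : 'M[R]_d).

Lemma SO1 : SO (1%:M : 'M[R]_d).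
Proof. by rewrite /SO/= trmx1 mul1mx det1. Qed.

Lemma SOP Q : SO Q -> Q *m Q^T = 1%:M.
Proof. by case=> /mulmx1C. Qed.

Lemma SO_tr Q : SO Q -> SO Q^T.
Proof. by move=> SOQ; split; [rewrite trmxK SOP|rewrite det_tr; case: SOQ]. Qed.

Lemma SO_mul Q Q' : SO Q -> SO Q' -> SO (Q *m Q').
Proof.
move=> [Q1 Q2] [Q1' Q2']; split; last by rewrite det_mulmx Q2 Q2' mulr1.
by rewrite trmx_mul -mulmxA (mulmxA Q^T) Q1 mul1mx.
Qed.

Lemma SO_entry_sum Q j : SO Q -> \sum_i Q i j ^+ 2 = 1.
Proof.
case=> /matrixP/(_ j j); rewrite !mxE eqxx => QQ _.
by apply: etrans QQ; apply: eq_bigr => i _; rewrite mxE expr2.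
Qed.

Lemma SO_norm Q : SO Q -> `|Q| <= 1.
Proof.
move=> SOQ; apply: mx_norm_le => // i j.
rewrite -(@ler_pXn2r _ 2)// ?nnegrE// expr1n -normrX -(SO_entry_sum j SOQ).
rewrite ger0_norm ?sqr_ge0// (bigD1 i)//= lerDl sumr_ge0// => k _.
exact: sqr_ge0.
Qed.

Lemma SO_mul_norm m Q (X : 'M[R]_(d, m)) : SO Q -> `|Q *m X| <= d%:R * `|X|.
Proof.
move=> SOQ; rewrite (le_trans (mx_norm_mul _ _))// ler_wpM2r//.
by rewrite ler_piMr// SO_norm.
Qed.

Lemma det_continuous : continuous (fun X : 'M[R]_d => \det X).
Proof.
rewrite /determinant; apply: continuous_sum => s _; apply: continuous_scale.
apply: continuous_big => [|i _]; first exact: mul_continuous.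
exact: coord_continuous.
Qed.

Lemma SO_closed : closed (SO : set 'M[R]_d).
Proof.
have -> : (SO : set 'M[R]_d) =
  [set X | forall ij : 'I_d * 'I_d, (X^T *m X) ij.1 ij.2 = (1%:M : 'M[R]_d) ij.1 ij.2]
  `&` [set X | \det X = 1].
  apply/seteqP; split=> X /= [XX dX]; split=> //; first by move=> ij; rewrite XX.
  by apply/matrixP => i j; have := XX (i, j).
apply: closedI; last exact: closed_levelset det_continuous.
apply: closed_forall => -[i j] /=; apply: closed_levelset.
have -> : (fun X : 'M[R]_d => (X^T *m X) i j) = (fun X => \sum_k X k i * X k j).
  by apply/funext => X; rewrite mxE; apply: eq_bigr => k _; rewrite mxE.
apply: continuous_sum => k _.
by apply: continuous_mul; exact: coord_continuous.
Qed.

(* The Cayley transform [(1 - t S / 2)^-1 (1 + t S / 2)] of a skew matrix. *)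
Lemma Cayley S (t : R) : S + S^T = 0 -> 0 <= t ->
  exists Q X : 'M[R]_d, [/\ SO Q, Q = 1%:M + t *: S + t ^+ 2 *: X &
    `|X| <= d%:R * `|S *m S|].
Proof.
move=> skewS t0; have ST : S^T = - S by apply/eqP; rewrite -addr_eq0 addrC skewS.
pose P := (t / 2) *: S; have PT : P^T = - P by rewrite /P linearZ/= ST scalerN.
pose M := 1%:M - P; pose N := 1%:M + P.
have MT : M^T = N by rewrite /M linearB/= trmx1 PT opprK.
have NT : N^T = M by rewrite -MT trmxK.
have unitM : M \in unitmx.
  rewrite -row_free_unit; apply: inj_row_free => v.
  rewrite /M mulmxBr mulmx1 => /eqP; rewrite subr_eq0 => /eqP vP.
  have vPv : v *m P *m v^T = 0.
    have /matrixP/(_ 0 0) E : (v *m P *m v^T)^T = v *m P *m v^T.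
      by apply/matrixP => i j; rewrite !ord1 mxE.
    apply/matrixP => i j; rewrite !ord1 [RHS]mxE.
    move: E; rewrite !trmx_mul trmxK PT mulmxA mulmxN mulNmx mxE.
    by lra.
  rewrite -vP in vPv; apply/rowP => k; rewrite [RHS]mxE.
  have /matrixP/(_ 0 0) := vPv; rewrite !mxE => /psumr_eq0P vv.
  apply/eqP; rewrite -sqrf_eq0 expr2; apply/eqP.
  have := vv _ k isT; rewrite mxE; apply.
  by move=> i _; rewrite mxE -expr2 sqr_ge0.
have MN : M *m N = N *m M.
  rewrite {1}/M {2}/N mulmxBl mulmxDl !mul1mx /N mulmxDr /M mulmxBr !mulmx1.
  by rewrite opprD addrA addrK addrA subrK.
have unitN : N \in unitmx by rewrite -MT unitmx_tr.
pose Q := invmx M *m N.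
have SOQ : SO Q.
  split; last first.
    rewrite det_mulmx det_inv -MT det_tr mulVr//.
  have MVN : M *m invmx N = invmx N *m M.
    by rewrite -{1}(mulKmx unitN M) -MN !mulmxA mulmxK.
  by rewrite /Q trmx_mul trmx_inv NT MT mulmxA MVN -(mulmxA _ M) mulmxV// mulmx1 mulVmx.
(* The inverse is the mean of the identity and a rotation, so the remainder is bounded independently
   of t. *)
have QM : invmx M = 2^-1 *: (1%:M + Q).
  have -> : 1%:M + Q = invmx M *m (M + N) by rewrite mulmxDr mulVmx.
  have -> : M + N = 2 *: 1%:M by rewrite /M /N addrACA addNr addr0 scaler_nat mulr2n.
  by rewrite -scalemxAr mulmx1 scalerA mulVf// scale1r.
exists Q, (2^-1 *: (invmx M *m (S *m S))); split=> //.
  have Q1 : Q = 1%:M + invmx M *m (t *: S).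
    have -> : t *: S = N - M by rewrite /N /M opprB addrC addrA subrK /P -scalerDl; congr (_ *: _); field.
    by rewrite mulmxBr mulVmx// addrC subrK.
  have M1 : invmx M = 1%:M + invmx M *m P.
    have -> : P = 1%:M - M by rewrite /M opprB addrC subrK.
    by rewrite mulmxBr mulVmx// mulmx1 addrC subrK.
  rewrite {1}Q1 {1}M1 mulmxDl mul1mx addrA; congr (_ + _).
  by rewrite /P -!mulmxA -!scalemxAr -!scalemxAl -!scalemxAr !scalerA; congr (_ *: _); field.
rewrite normrZ gtr0_norm ?invr_gt0// QM -scalemxAl normrZ gtr0_norm ?invr_gt0//.
rewrite mulmxDl mul1mx.
have h1 := ler_normD (S *m S) (Q *m (S *m S)).
have h2 := SO_mul_norm (S *m S) SOQ.
have h3 : `|S *m S| <= d%:R * `|S *m S| by rewrite ler_peMl// ler1n.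
set a := `|S *m S + _| in h1 *; set b := d%:R * _ in h2 h3 *.
by have : 0 <= b := le_trans (normr_ge0 _) h3; lra.
Qed.

End Rotations.

(** * The Frobenius product and orthogonal projections *)

Section FrobeniusProduct.
Context {R : realType} {n : nat}.
Local Notation d := n.+2.
Local Notation N := (2 ^ n.+2)%N.
Implicit Types (G H K : 'M[R]_(d, N)).

Lemma mxdotE G H : mxdot G H = \sum_i \sum_j G i j * H i j.
Proof.
rewrite /mxdot /mxtrace exchange_big/=; apply: eq_bigr => j _.
by rewrite mxE; apply: eq_bigr => i _; rewrite mxE.
Qed.

Lemma mxdotC G H : mxdot G H = mxdot H G.
Proof. by rewrite !mxdotE; do 2!(apply: eq_bigr => ? _); rewrite mulrC. Qed.

Lemma mxdotDl G H K : mxdot (G + H) K = mxdot G K + mxdot H K.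
Proof. by rewrite /mxdot linearD/= mulmxDl mxtraceD. Qed.

Lemma mxdotZl a G H : mxdot (a *: G) H = a * mxdot G H.
Proof. by rewrite /mxdot linearZ/= -scalemxAl mxtraceZ. Qed.

Lemma mxdot0l H : mxdot 0 H = 0.
Proof. by rewrite /mxdot trmx0 mul0mx mxtrace0. Qed.

Lemma mxdotDr G H K : mxdot K (G + H) = mxdot K G + mxdot K H.
Proof. by rewrite mxdotC mxdotDl !(mxdotC K). Qed.

Lemma mxdotZr a G H : mxdot G (a *: H) = a * mxdot G H.
Proof. by rewrite mxdotC mxdotZl mxdotC. Qed.

Lemma mxdotNr G H : mxdot G (- H) = - mxdot G H.
Proof. by rewrite -scaleN1r mxdotZr mulN1r. Qed.

Lemma mxdot_ge0 G : 0 <= mxdot G G.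
Proof. by rewrite mxdotE; do 2!apply: sumr_ge0 => ? _; rewrite -expr2 sqr_ge0. Qed.

Lemma mxdot_norm G : `|G| ^+ 2 <= mxdot G G.
Proof.
have [->|] := eqVneq `|G| 0; first by rewrite expr0n mxdot_ge0.
case/mx_norm_neq0 => -[i j] /= GE; rewrite {1}/Num.norm/= GE.
rewrite -normrX ger0_norm ?sqr_ge0// mxdotE (bigD1 i)//= (bigD1 j)//= expr2 -addrA.
rewrite lerDl addr_ge0//; first by apply: sumr_ge0 => k _; rewrite -expr2 sqr_ge0.
by do 2!apply: sumr_ge0 => ? _; rewrite -expr2 sqr_ge0.
Qed.

Lemma mxdot_eq0 G : (mxdot G G == 0) = (G == 0).
Proof.
apply/eqP/eqP => [G0|->]; last first.
  by rewrite mxdotE; do 2!(rewrite big1// => ? _); rewrite mxE mul0r.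
have := mxdot_norm G; rewrite G0 => h.
apply/eqP; rewrite -normr_eq0 -sqrf_eq0 eq_le h sqr_ge0//.
Qed.

Lemma mxdot_rotation (Q : 'M[R]_d) G H : SO Q -> mxdot (Q *m G) (Q *m H) = mxdot G H.
Proof. by case=> QQ _; rewrite /mxdot trmx_mul mulmxA -(mulmxA G^T) QQ mulmx1. Qed.

Lemma mxdot_continuous K : continuous (mxdot K).
Proof.
have -> : mxdot K = (fun G => \sum_i \sum_j K i j * G i j).
  by apply/funext => G; rewrite mxdotE.
apply: continuous_sum => i _; apply: continuous_sum => j _.
by apply: continuous_scale; exact: coord_continuous.
Qed.

(* The middle clause says that [Y] lies in the span of [s]. *)
Lemma orthogonal_projection (P : 'M[R]_(d, N) -> Prop) (s : seq 'M[R]_(d, N)) :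
  P 0 -> (forall a G H, P G -> P H -> P (a *: G + H)) ->
  {in s, forall G, P G} ->
  forall H, exists Y, [/\ P Y,
    forall K, {in s, forall G, mxdot G K = 0} -> mxdot Y K = 0 &
    {in s, forall G, mxdot G (H - Y) = 0}].
Proof.
move=> P0 Plin; elim: s => [_ H|x s IH Ps H].
  by exists 0; split=> // K _; rewrite mxdot0l.
have {}IH := IH (fun G Gs => Ps G (mem_behead (s := x :: s) Gs)).
have [X [PX Xs xX]] := IH x; have [Y [PY Ys HY]] := IH H.
pose x' := x - X.
have Px' : P x'.
  by rewrite /x' -scaleN1r addrC; apply: Plin => //; apply: Ps; rewrite mem_head.
have [x0|x'0] := eqVneq x' 0.
  exists Y; split=> // [K sK|G]; first by apply: Ys => G Gs; rewrite sK// mem_behead.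
  rewrite in_cons => /predU1P[->|/HY//].
  by have /eqP := x0; rewrite subr_eq0 => /eqP ->; exact: Xs.
have xx0 : mxdot x' x' != 0 by rewrite mxdot_eq0.
pose a := mxdot x' H / mxdot x' x'.
have HE : H - (a *: x' + Y) = (H - Y) - a *: x' by rewrite opprD addrA addrAC.
have sY : {in s, forall G, mxdot G (H - (a *: x' + Y)) = 0}.
  by move=> G Gs; rewrite HE mxdotDr mxdotNr mxdotZr HY// xX// mulr0 subrr.
exists (a *: x' + Y); split=> [|K sK|G].
- exact: Plin.
- have sK' : {in s, forall G, mxdot G K = 0} by move=> G Gs; rewrite sK// mem_behead.
  rewrite mxdotDl mxdotZl Ys// addr0 /x' mxdotDl mxdotC -[X in mxdot K X]scale1r.
  rewrite scale1r -scaleN1r mxdotZl Xs// mulr0 addr0 mxdotC sK ?mulr0//.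
  exact: mem_head.
- rewrite in_cons => /predU1P[->|/sY//].
  rewrite -(subrK X x) -/x' mxdotDl (Xs _ sY) addr0 HE mxdotDr mxdotNr mxdotZr.
  rewrite /a mulfVK// mxdotDr mxdotNr mxdotC -[mxdot x' Y]mxdotC Ys//; last first.
  by rewrite oppr0 addr0 mxdotC subrr.
Qed.

End FrobeniusProduct.

(** * The cell energy near its wells *)

Section CellQuadraticForm.
Context {R : realType} {n : nat}.
Local Notation d := n.+2.
Local Notation N := (2 ^ n.+2)%N.
Variables (Z : 'M[R]_(d, N)) (W : 'M[R]_(d, N) -> \bar R).
Hypothesis W_ge0 : forall G, (0 <= W G)%E.
Hypothesis W_frame : frame_indifferent W.
Hypothesis W_zero : zero_set_rigid Z W.
Hypothesis W_regular : regular_near_wells Z W.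
Hypothesis W_Hessian : Hessian_nondegenerate Z W.
Implicit Types (G H K : 'M[R]_(d, N)) (S F : 'M[R]_d) (c : 'cV[R]_d).

Local Notation w := (fine \o W).

Lemma translationD c c' : translation (n := n) (c + c') = translation c + translation c'.
Proof. by apply/matrixP => i j; rewrite !mxE. Qed.

Lemma translationZ a c : translation (n := n) (a *: c) = a *: translation c.
Proof. by apply/matrixP => i j; rewrite !mxE. Qed.

Lemma translation0 : translation (n := n) (0 : 'cV[R]_d) = 0.
Proof. by apply/matrixP => i j; rewrite !mxE. Qed.

Lemma mul_translation F c : F *m translation c = translation (n := n) (F *m c).
Proof. by apply/matrixP => i j; rewrite !mxE; apply: eq_bigr => k _; rewrite mxE. Qed.

Lemma W_translation c G : W (G + translation c) = W G.
Proof. by rewrite -{1}(mul1mx G) (W_frame SO1). Qed.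

Lemma W_rotation (P : 'M[R]_d) G : SO P -> W (P *m G) = W G.
Proof. by move=> SOP_; rewrite -(W_frame SOP_ 0 G) translation0 addr0. Qed.

Lemma W_Z : W Z = 0%E.
Proof.
by apply/W_zero; exists 1%:M, 0; rewrite mul1mx translation0 addr0; split; [exact: SO1|].
Qed.

Lemma w_ge0 G : 0 <= w G. Proof. by rewrite /= fine_ge0. Qed.

Lemma SObar_Z : SObar Z Z.
Proof. by exists 1%:M; [exact: SO1|rewrite mul1mx]. Qed.

(** Only the diagonal values [D H H] matter for the quadratic form; symmetrising takes the place of
    Schwarz's theorem on mixed derivatives. *)
Lemma symmetrized_bilinear (D : 'M[R]_(d, N) -> 'M[R]_(d, N) -> R) :
  (forall H H' K, D (H + H') K = D H K + D H' K) ->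
  (forall H K K', D H (K + K') = D H K + D H K') ->
  (forall a H K, D (a *: H) K = a * D H K) ->
  (forall a H K, D H (a *: K) = a * D H K) ->
  exists B : 'M[R]_(d, N) -> 'M[R]_(d, N) -> R,
  [/\ forall H K, B H K = B K H, forall H, B H H = D H H,
     forall H H' K, B (H + H') K = B H K + B H' K &
     forall a H K, B (a *: H) K = a * B H K].
Proof.
move=> Dl Dr Zl Zr; exists (fun H K => 2^-1 * (D H K + D K H)); split.
- by move=> H K; rewrite addrC.
- by move=> H; field.
- by move=> H H' K; rewrite Dl Dr; ring.
- by move=> a H K; rewrite Zl Zr; ring.
Qed.

Lemma Bcell_exists : exists B : 'M[R]_(d, N) -> 'M[R]_(d, N) -> R,
  [/\ forall H K, B H K = B K H, forall H, B H H = Qcell Z W H,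
     forall H H' K, B (H + H') K = B H K + B H' K &
     forall a H K, B (a *: H) K = a * B H K].
Proof.
have [U [openU SU _ C2]] := W_regular; have UZ := SU _ SObar_Z.
apply: (@symmetrized_bilinear (fun H K => 'D_K ('D_H w) Z)).
- by move=> H H' K; exact: (second_derivativeDl openU C2 _ _ _ UZ).
- by move=> H K K'; exact: (second_derivativeDr openU C2 _ _ _ UZ).
- by move=> a H K; exact: (second_derivativeZl openU C2 _ _ _ UZ).
- by move=> a H K; exact: (second_derivativeZr C2 _ _ _ UZ).
Qed.

Definition Bcell : 'M[R]_(d, N) -> 'M[R]_(d, N) -> R := sval (cid Bcell_exists).

Lemma BcellC H K : Bcell H K = Bcell K H.
Proof. by rewrite /Bcell; case: cid => B []. Qed.

Lemma Bcell_diag H : Bcell H H = Qcell Z W H.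
Proof. by rewrite /Bcell; case: cid => B []. Qed.

Lemma BcellDl H H' K : Bcell (H + H') K = Bcell H K + Bcell H' K.
Proof. by rewrite /Bcell; case: cid => B []. Qed.

Lemma BcellZl a H K : Bcell (a *: H) K = a * Bcell H K.
Proof. by rewrite /Bcell; case: cid => B []. Qed.

Lemma BcellDr H K K' : Bcell H (K + K') = Bcell H K + Bcell H K'.
Proof. by rewrite BcellC BcellDl !(BcellC H). Qed.

Lemma BcellZr a H K : Bcell H (a *: K) = a * Bcell H K.
Proof. by rewrite BcellC BcellZl BcellC. Qed.

Lemma QcellD H K :
  Qcell Z W (H + K) = Qcell Z W H + 2 * Bcell H K + Qcell Z W K.
Proof. by rewrite -!Bcell_diag BcellDl !BcellDr (BcellC K H); ring. Qed.

Lemma QcellZ a H : Qcell Z W (a *: H) = a ^+ 2 * Qcell Z W H.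
Proof. by rewrite -!Bcell_diag BcellZl BcellZr mulrA. Qed.

Lemma Bcell_expansion H K : Bcell H K =
  \sum_i \sum_j H i j * \sum_k \sum_l K k l * Bcell (delta_mx i j) (delta_mx k l).
Proof.
rewrite (linear_expansion (g := Bcell^~ K) (fun X Y => BcellDl X Y K)
  (fun a X => BcellZl a X K) H).
apply: eq_bigr => i _; apply: eq_bigr => j _; congr (_ * _).
exact: (linear_expansion (g := Bcell (delta_mx i j)) (BcellDr _) (fun a X => BcellZr a _ X)).
Qed.

Lemma Bcell_bound : exists2 C : R, 0 <= C & forall H K, `|Bcell H K| <= C * `|H| * `|K|.
Proof.
exists (\sum_(i < d) \sum_(j < N) \sum_(k < d) \sum_(l < N)
   `|Bcell (delta_mx i j) (delta_mx k l)|) => [|H K].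
  by do 4!apply: sumr_ge0 => ? _.
rewrite Bcell_expansion (le_trans (ler_norm_sum _ _ _))// -mulrA mulr_suml.
apply: ler_sum => i _.
rewrite (le_trans (ler_norm_sum _ _ _))// mulr_suml ler_sum// => j _.
rewrite normrM mulrCA ler_pM ?mx_entry_le// mulr_suml.
rewrite (le_trans (ler_norm_sum _ _ _))// ler_sum// => k _.
rewrite (le_trans (ler_norm_sum _ _ _))// mulr_suml ler_sum// => l _.
by rewrite normrM mulrC ler_wpM2l// mx_entry_le.
Qed.

(** Z minimises W, whose value there is 0: the difference quotients at t and -t are close to the
    derivative and have opposite signs. *)
Lemma first_derivative_Z H : 'D_H w Z = 0.
Proof.
have [U [openU SU _ C2]] := W_regular; have UZ := SU _ SObar_Z.
have [dH _ _] := C2 _ UZ H H.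
have sgn (e : R) : 0 < e -> exists2 t : R, 0 < t &
    `|t^-1 * w (t *: H + Z) - 'D_H w Z| <= e /\
    `|t^-1 * w (- t *: H + Z) + 'D_H w Z| <= e.
  move=> e0; have [t t0 P] := directional_derivative_lim dH e0.
  have t2 : 0 < t / 2 by rewrite divr_gt0.
  have t2t : t / 2 < t by rewrite ltr_pdivrMr// ltr_pMr// ltr1n.
  exists (t / 2) => //.
  have := P (t / 2) (lt0r_neq0 t2); have := P (- (t / 2)).
  rewrite oppr_eq0 normrN (gtr0_norm t2) (lt0r_neq0 t2) t2t /= W_Z /= !subr0.
  move=> /(_ isT erefl) A1 /(_ erefl) A2; split; [exact: A2|].
  by move: A1; rewrite invrN mulNr -opprD normrN.
apply/eqP; rewrite -normr_le0; apply/ler_addgt0Pl => e e0; rewrite addr0.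
have [t t0 [A1 A2]] := sgn e e0.
have w1 : 0 <= t^-1 * w (t *: H + Z) by rewrite mulr_ge0 ?w_ge0// invr_ge0 ltW.
have w2 : 0 <= t^-1 * w (- t *: H + Z) by rewrite mulr_ge0 ?w_ge0// invr_ge0 ltW.
move: A1 A2; rewrite !ler_norml; lra.
Qed.

Lemma W_taylor (e : R) : 0 < e -> exists2 t : R, 0 < t & forall H, `|H| < t ->
  W (Z + H) \is a fin_num /\
  `|fine (W (Z + H)) - 2^-1 * Qcell Z W H| <= e * `|H| ^+ 2.
Proof.
move=> e0; have [U [openU SU Wfin C2]] := W_regular; have UZ := SU _ SObar_Z.
have [t t0 P] := taylor2 openU C2 UZ e0; exists t => // H /P[UH].
by rewrite first_derivative_Z /= W_Z /= !subr0 (addrC H) => QH; split=> //; apply: Wfin; rewrite addrC.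
Qed.

(** Second-order condition at the minimum Z: the expansion is applied to a small multiple of H and
    divided by the square of the factor. *)
Lemma Qcell_ge0 H : 0 <= Qcell Z W H.
Proof.
rewrite -oppr_le0; apply/ler_addgt0Pr => e e0; rewrite add0r.
pose M := `|H| + 1.
have M0 : 0 < M by rewrite ltr_pwDr.
have e1 : 0 < e / (2 * M ^+ 2) by rewrite divr_gt0// mulr_gt0// exprn_gt0.
have [t t0 P] := W_taylor e1.
have small : e / (2 * M ^+ 2) * `|H| ^+ 2 <= e / 2.
  have -> : e / (2 * M ^+ 2) * `|H| ^+ 2 = e / 2 * (`|H| ^+ 2 / M ^+ 2).
    by field; rewrite gt_eqF.
  apply: ler_piMr; first by rewrite divr_ge0// ltW.
  rewrite ler_pdivrMr ?exprn_gt0// mul1r lerXn2r ?nnegrE ?(ltW M0)//.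
  by rewrite /M lerDl.
move: (e / (2 * M ^+ 2)) e1 P small => c c0 P small.
pose s := t / (2 * M); have s0 : 0 < s by rewrite divr_gt0// mulr_gt0.
have sH : `|s *: H| < t.
  rewrite normrZ gtr0_norm//; apply: (@le_lt_trans _ _ (s * M)).
    by rewrite (ler_wpM2l (ltW s0))// lerDl.
  have -> : s * M = t / 2 by rewrite /s; field; rewrite gt_eqF.
  by rewrite ltr_pdivrMr// ltr_pMr// ltr1n.
clearbody s.
have [_] := P _ sH; rewrite QcellZ normrZ exprMn (gtr0_norm s0) ler_norml => /andP[_].
have := w_ge0 (Z + s *: H) => /= w0 le1.
have : 0 <= s ^+ 2 * (2^-1 * Qcell Z W H + c * `|H| ^+ 2) by lra.
by rewrite pmulr_rge0 ?exprn_gt0//; lra.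
Qed.

(* [K] is tangent to the zero set of [W] at [Z]. *)
Lemma Qcell_tangent_eq0 K (C : R) : (forall t : R, 0 < t <= 1 -> exists2 X,
    `|X| <= C & W (Z + t *: K + t ^+ 2 *: X) = 0%E) -> Qcell Z W K = 0.
Proof.
move=> tangent; apply/eqP; rewrite eq_le Qcell_ge0 andbT.
have [Cb Cb0 bB] := Bcell_bound.
have C0 : 0 <= C.
  by have [|X XC _] := tangent 1; [rewrite ltr01 lexx|exact: le_trans XC].
pose M := `|K| + C; have M0 : 0 <= M by rewrite addr_ge0.
apply/ler_addgt0Pr => e e0; rewrite add0r.
have e1 : 0 < e / (4 * (M ^+ 2 + 1)) by rewrite divr_gt0// mulr_gt0// ltr_pwDr// sqr_ge0.
have [t t0 P] := W_taylor e1.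
pose D := 4 * (Cb * `|K| * C + 1).
have D0 : 0 < D by rewrite mulr_gt0// ltr_pwDr// !mulr_ge0.
pose s := Num.min (Num.min 1 (t / (2 * (M + 1)))) (e / D).
have s0 : 0 < s by rewrite !lt_min ltr01 !divr_gt0// mulr_gt0// ltr_pwDr.
have s1 : s <= 1 by rewrite /s !ge_min lexx.
have sM : s * M < t.
  have : s <= t / (2 * (M + 1)) by rewrite /s !ge_min lexx !orbT.
  rewrite ler_pdivlMr; last by rewrite mulr_gt0// ltr_pwDr.
  have : 0 <= s * M by rewrite mulr_ge0// ltW.
  by move: t0 s0; lra.
have sD : s * D <= e.
  by rewrite -ler_pdivlMr// /s ge_min lexx orbT.
clearbody s.
have [|X XC W0] := tangent s; first by rewrite s0.
have XE : Z + s *: K + s ^+ 2 *: X = Z + s *: (K + s *: X).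
  by rewrite scalerDr scalerA addrA.
have KX : `|K + s *: X| <= M.
  rewrite (le_trans (ler_normD _ _))// lerD2l normrZ gtr0_norm//.
  by apply: le_trans XC; rewrite ler_piMl.
have sKX : `|s *: (K + s *: X)| < t.
  rewrite normrZ gtr0_norm//; apply: le_lt_trans sM.
  by rewrite ler_wpM2l// ltW.
have nE : `|s *: (K + s *: X)| = s * `|K + s *: X| by rewrite normrZ gtr0_norm.
have [_] := P _ sKX; rewrite nE -XE W0 /= sub0r normrN QcellZ.
rewrite exprMn ler_norml => /andP[_].
rewrite mulrCA [X in _ <= X]mulrCA ler_pM2l ?exprn_gt0// => h1.
have h2 : e / (4 * (M ^+ 2 + 1)) * `|K + s *: X| ^+ 2 <= e / 4.
  have M1 : 0 < M ^+ 2 + 1 by rewrite ltr_wpDl// sqr_ge0.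
  have -> : e / (4 * (M ^+ 2 + 1)) * `|K + s *: X| ^+ 2 =
     e / 4 * (`|K + s *: X| ^+ 2 / (M ^+ 2 + 1)) by field; rewrite gt_eqF.
  apply: ler_piMr; first by rewrite divr_ge0// ltW.
  rewrite ler_pdivrMr// mul1r (@le_trans _ _ (M ^+ 2))//; last by rewrite lerDl.
  by rewrite lerXn2r ?nnegrE.
have h3 : `|Bcell K X| <= Cb * `|K| * C.
  by rewrite (le_trans (bB _ _))// ler_wpM2l// mulr_ge0.
have h4 := Qcell_ge0 (s *: X).
move/le_trans/(_ h2): h1; rewrite QcellD BcellZr => {}h1.
move: h3; rewrite ler_norml => /andP[h3 _].
have h5 : - (s * (Cb * `|K| * C)) <= s * Bcell K X.
  by rewrite -mulrN ler_pM2l.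
move: sD h5 h4 h1; rewrite /D mulrCA mulrDr mulr1.
move: (s * (Cb * _ * _)) (s * Bcell K X) (Qcell Z W K) (Qcell Z W (s *: X)) => x y z u.
clear -s0; lra.
Qed.

Lemma Qcell_translation c : Qcell Z W (translation c) = 0.
Proof.
apply: (@Qcell_tangent_eq0 _ 0) => t _; exists 0; first by rewrite normr0.
by rewrite scaler0 addr0 -translationZ W_translation W_Z.
Qed.

(** The Cayley rotations form a curve through Z in the zero set of W with tangent [S *m Z] and a
    quadratic remainder that is bounded uniformly in t. *)
Lemma Qcell_skew S : S + S^T = 0 -> Qcell Z W (S *m Z) = 0.
Proof.
move=> skewS.
apply: (@Qcell_tangent_eq0 _ (d%:R * (d%:R * `|S *m S|) * `|Z|)) => t /andP[t0 _].
have [P [X [SOP_ PE XS]]] := Cayley skewS (ltW t0).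
exists (X *m Z).
  rewrite (le_trans (mx_norm_mul _ _))// ler_wpM2r// ler_wpM2l//.
have -> : Z + t *: (S *m Z) + t ^+ 2 *: (X *m Z) = P *m Z.
  by rewrite PE !mulmxDl mul1mx -!scalemxAl.
by rewrite W_rotation// W_Z.
Qed.

Lemma quadratic_linear_part (b q : R) : (forall t : R, 0 <= 2 * t * b + t ^+ 2 * q) ->
  b = 0.
Proof.
move=> tbq; have q0 : 0 <= q.
  by have := tbq 1; have := tbq (-1); rewrite sqrrN expr1n !mul1r; lra.
apply/eqP; apply: contraT => b0.
have b2 : 0 < b ^+ 2 by rewrite exprn_even_gt0.
have q1 : 0 < q + 1 by rewrite ltr_wpDl.
have := tbq (- b / (q + 1)).
have -> : 2 * (- b / (q + 1)) * b + (- b / (q + 1)) ^+ 2 * q =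
   - (b ^+ 2 * ((q + 2) / (q + 1) ^+ 2)) by field; rewrite gt_eqF.
rewrite oppr_ge0 leNgt mulr_gt0// divr_gt0 ?exprn_gt0// ltr_wpDl//.
Qed.

(** An isotropic vector of a nonnegative form lies in its radical: otherwise the multiple of K
    chosen here, added to H, would bring the form to the value -1. *)
Lemma Bcell_kernel K H : Qcell Z W K = 0 -> Bcell K H = 0.
Proof.
move=> QK; apply/eqP; apply: contraT => b0.
have := Qcell_ge0 (H + (- (Qcell Z W H + 1) / (2 * Bcell K H)) *: K).
rewrite QcellD QcellZ QK mulr0 addr0 BcellZr (BcellC H).
have -> : Qcell Z W H + 2 * (- (Qcell Z W H + 1) / (2 * Bcell K H) * Bcell K H) = -1.
  by field.
by rewrite oppr_ge0 ler10.
Qed.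

Lemma Qcell_rigidD H c S : S + S^T = 0 ->
  Qcell Z W (H + (translation c + S *m Z)) = Qcell Z W H.
Proof.
move=> skewS; have Q0 : Qcell Z W (translation c + S *m Z) = 0.
  by rewrite QcellD Qcell_translation Qcell_skew// (Bcell_kernel _ (Qcell_translation c)) mulr0 !addr0.
by rewrite QcellD Q0 BcellC (Bcell_kernel _ Q0) mulr0 !addr0.
Qed.

Lemma Qcell_continuous : continuous (Qcell Z W).
Proof.
have -> : Qcell Z W = fun H => \sum_i \sum_j H i j *
    \sum_k \sum_l H k l * Bcell (delta_mx i j) (delta_mx k l).
  by apply/funext => H; rewrite -Bcell_diag Bcell_expansion.
apply: continuous_sum => i _; apply: continuous_sum => j _.
apply: continuous_mul; first exact: coord_continuous.
apply: continuous_sum => k _; apply: continuous_sum => l _.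
by apply: continuous_mul => H; [exact: coord_continuous|exact: cst_continuous].
Qed.

Definition rigid_orthogonal H := forall c S, S + S^T = 0 ->
  mxdot (translation c + S *m Z) H = 0.

(** Positive definiteness becomes a uniform bound by minimising over the unit sphere of the
    complement, which is compact. If this sphere is empty, 0 is the only element of the
    complement. *)
Lemma Qcell_coercive : exists2 C : R, 0 < C &
  forall H, rigid_orthogonal H -> C * mxdot H H <= Qcell Z W H.
Proof.
pose D := [set H | mxdot H H = 1 /\ rigid_orthogonal H].
have [[H0 DH0]|D0] := pselect (D !=set0); last first.
  exists 1 => // H oH; have [->|H0] := eqVneq H 0.
    by rewrite mxdot0l mulr0 Qcell_ge0.
  exfalso; apply: D0.
  have HH : 0 < mxdot H H by rewrite lt_def mxdot_eq0 H0 mxdot_ge0.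
  exists ((Num.sqrt (mxdot H H))^-1 *: H); split.
    rewrite mxdotZl mxdotZr mulrA -expr2 exprVn sqr_sqrtr ?mxdot_ge0//.
    by rewrite mulVf// gt_eqF.
  by move=> c S skewS; rewrite mxdotZr oH// mulr0.
have Dcl : closed D.
  have -> : D = [set H | mxdot H H = 1] `&`
      [set H | forall cS : 'cV[R]_d * 'M[R]_d, cS.2 + cS.2^T = 0 ->
         mxdot (translation cS.1 + cS.2 *m Z) H = 0].
    apply/seteqP; split=> H [H1 oH]; split=> //; first by move=> [c S] /= /oH.
    by move=> c S skewS; exact: (oH (c, S)).
  apply: closedI.
    apply: closed_levelset.
    have -> : (fun H => mxdot H H) = (fun G => \sum_i \sum_j G i j * G i j).
      by apply/funext => G; rewrite mxdotE.
    apply: continuous_sum => i _; apply: continuous_sum => j _.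
    by apply: continuous_mul; exact: coord_continuous.
  apply: closed_forall => -[c S] /=.
  have [skewS|nskew] := pselect (S + S^T = 0); last first.
    set B := (X in closed X); have -> : B = setT by apply/seteqP; split=> // H _ /= /nskew.
    exact: closedT.
  set B := (X in closed X).
  have -> : B = [set H | mxdot (translation c + S *m Z) H = 0].
    by apply/seteqP; split=> H /= h; [exact: h|move=> _].
  exact: (closed_levelset (@mxdot_continuous _ _ (translation c + S *m Z))).
have Dbound H : D H -> `|H| <= 1.
  case=> H1 _; rewrite -(@expr_le1 _ 2)//.
  by rewrite -H1 mxdot_norm.
have [H1 [H1n oH1] H1min] := mx_EVT_min (ex_intro _ H0 DH0) Dbound Dcl Qcell_continuous.
have H1n0 : H1 != 0 by rewrite -mxdot_eq0 H1n oner_eq0.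
exists (Qcell Z W H1) => [|H oH]; first exact: W_Hessian.
have [->|Hn0] := eqVneq H 0.
  by rewrite mxdot0l mulr0 Qcell_ge0.
have HH : 0 < mxdot H H by rewrite lt_def mxdot_eq0 Hn0 mxdot_ge0.
have := H1min ((Num.sqrt (mxdot H H))^-1 *: H).
rewrite QcellZ exprVn sqr_sqrtr ?mxdot_ge0// ler_pdivlMl// mulrC; apply; split.
  rewrite mxdotZl mxdotZr mulrA -expr2 exprVn sqr_sqrtr ?mxdot_ge0//.
  by rewrite mulVf// gt_eqF.
by move=> c S skewS; rewrite mxdotZr oH// mulr0.
Qed.

Lemma rigid_decomposition H : exists c S, S + S^T = 0 /\
  rigid_orthogonal (H - (translation c + S *m Z)).
Proof.
pose P K := exists c S, S + S^T = 0 /\ K = translation c + S *m Z.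
pose sk (ij : 'I_d * 'I_d) : 'M[R]_d := delta_mx ij.1 ij.2 - delta_mx ij.2 ij.1.
pose s := [seq translation (delta_mx i 0) | i : 'I_d] ++
  [seq sk ij *m Z | ij : ('I_d * 'I_d)%type].
have skT ij : sk ij + (sk ij)^T = 0.
  by rewrite /sk linearB/= !trmx_delta addrA subrK subrr.
have [||K|Y [[c [S [skewS ->]]] _ oY]] := @orthogonal_projection _ _ P s _ _ _ H.
- by exists 0, 0; rewrite trmx0 addr0 mul0mx translation0 addr0.
- move=> a G K [c [S [skS ->]]] [c' [S' [skS' ->]]].
  exists (a *: c + c'), (a *: S + S'); split.
    by rewrite linearD linearZ/= addrACA -scalerDr skS scaler0 add0r.
  by rewrite translationD translationZ mulmxDl -scalemxAl scalerDr addrACA.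
- rewrite mem_cat => /orP[/mapP[i _ ->]|/mapP[ij _ ->]].
    by exists (delta_mx i 0), 0; rewrite trmx0 addr0 mul0mx addr0.
  by exists 0, (sk ij); rewrite skT translation0 add0r.
have s1 i : translation (delta_mx i 0) \in s.
  by rewrite /s mem_cat; apply/orP; left; apply/mapP; exists i; rewrite ?mem_enum.
have s2 i j : sk (i, j) *m Z \in s.
  by rewrite /s mem_cat; apply/orP; right; apply/mapP; exists (i, j); rewrite ?mem_enum.
exists c, S; split=> // c' S' skS'; set K := H - _ in oY *.
rewrite mxdotDl; have -> : translation c' = \sum_i c' i 0 *: translation (delta_mx i 0).
  apply/matrixP => i j; rewrite !mxE summxE (bigD1 i)//= big1 ?addr0 => [|k ki].
    by rewrite !mxE !eqxx mulr1.
  by rewrite !mxE eq_sym (negbTE ki) mulr0.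
(* The factor 1/2 is due to the double occurrence of each generator, as [sk (i, j)] and as
   [- sk (j, i)]. *)
have -> : S' = \sum_i \sum_j (2^-1 * S' i j) *: sk (i, j).
  apply/matrixP => i j; rewrite summxE.
  transitivity (\sum_k \sum_l 2^-1 * S' k l * ((delta_mx k l) i j - (delta_mx l k) i j : R)); last first.
    by apply: eq_bigr => k _; rewrite summxE; apply: eq_bigr => l _; rewrite !mxE.
  have E k l : 2^-1 * S' k l * ((delta_mx k l) i j - (delta_mx l k) i j : R) =
      2^-1 * S' k l * ((i == k) && (j == l))%:R - 2^-1 * S' k l * ((i == l) && (j == k))%:R.
    by rewrite !mxE mulrBr.
  under eq_bigr do under eq_bigr do rewrite E.
  under eq_bigr do rewrite sumrB.
  rewrite sumrB (bigD1 i)//= (bigD1 j)//= !eqxx mulr1 big1 ?addr0; last first.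
    by move=> l lj; rewrite (eq_sym j) (negbTE lj) andbF mulr0.
  rewrite big1 ?addr0 => [|k ki]; last first.
    by apply: big1 => l _; rewrite (eq_sym i) (negbTE ki) mulr0.
  rewrite (bigD1 j)//= (bigD1 i)//= !eqxx mulr1 big1 ?addr0; last first.
    by move=> l lj; rewrite (eq_sym i) (negbTE lj) mulr0.
  rewrite big1 ?addr0 => [|k ki]; last first.
    by apply: big1 => l _; rewrite (eq_sym j) (negbTE ki) andbF mulr0.
  have /matrixP/(_ i j) := skS'; rewrite !mxE => e.
  lra.
rewrite mulmx_suml.
have -> : mxdot (\sum_i c' i 0 *: translation (delta_mx i 0)) K = 0.
  elim/big_rec: _ => [|i x _ IH]; first exact: mxdot0l.
  by rewrite mxdotDl IH mxdotZl oY ?mulr0 ?addr0.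
rewrite add0r; elim/big_rec: _ => [|i x _ IH]; first exact: mxdot0l.
rewrite mxdotDl IH addr0 mulmx_suml.
elim/big_rec: _ => [|j y _ IHy]; first exact: mxdot0l.
by rewrite mxdotDl IHy addr0 -scalemxAl mxdotZl oY ?mulr0.
Qed.

Variables (A : 'M[R]_d) (j0 : 'I_N) (ji : 'I_d -> 'I_N).
Hypothesis unitA : A \in unitmx.
Hypothesis Z_edges : forall i, col (ji i) Z - col j0 Z = col i A.

Definition edge_differences H : 'M[R]_d := \matrix_(k, i) (H k (ji i) - H k j0).

Lemma edge_differencesD G H :
  edge_differences (G + H) = edge_differences G + edge_differences H.
Proof. by apply/matrixP => i j; rewrite !mxE; ring. Qed.

Lemma edge_differences_affine c F :
  edge_differences (translation c + F *m Z) = F *m A.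
Proof.
apply/matrixP => k i; rewrite !mxE opprD addrACA subrr add0r -sumrB.
apply: eq_bigr => l _; rewrite -mulrBr; congr (_ * _).
by have /matrixP/(_ l 0) := Z_edges i; rewrite !mxE.
Qed.

Lemma edge_differences_norm H : `|edge_differences H| <= 2 * `|H|.
Proof.
apply: mx_norm_le => [|i j]; first by rewrite mulr_ge0.
rewrite mxE (le_trans (ler_normB _ _))// mulrDl mul1r.
by rewrite lerD// mx_entry_le.
Qed.

(* The linearised strain of a cell displacement, in the basis given by [A]. *)
Definition cell_strain H : 'M[R]_d :=
  2^-1 *: (A^T *m edge_differences H + (edge_differences H)^T *m A).

Lemma cell_strainD G H : cell_strain (G + H) = cell_strain G + cell_strain H.
Proof.
rewrite /cell_strain edge_differencesD mulmxDr [(_ + _)^T]linearD/= mulmxDl -scalerDr.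
by rewrite addrACA.
Qed.

Lemma cell_strain_affine c F :
  cell_strain (translation c + F *m Z) = A^T *m (2^-1 *: (F + F^T)) *m A.
Proof.
rewrite /cell_strain edge_differences_affine trmx_mul mulmxA.
by rewrite -[in RHS]scalemxAr -[in RHS]scalemxAl mulmxDr mulmxDl.
Qed.

(** Neither the strain nor [Qcell] sees translations and infinitesimal rotations, so H may be
    replaced by its component orthogonal to them, where [Qcell] is coercive. *)
Lemma cell_strain_bound : exists2 C : R, 0 < C &
  forall H, `|cell_strain H| ^+ 2 <= C * Qcell Z W H.
Proof.
have [Cq Cq0 coer] := Qcell_coercive.
pose B : R := 2 * d%:R * `|A|.
have B0 : 0 <= B by rewrite !mulr_ge0.
have strain_le H : `|cell_strain H| <= B * `|H|.
  rewrite normrZ gtr0_norm ?invr_gt0//.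
  have e1 := edge_differences_norm H.
  have h1 : `|A^T *m edge_differences H| <= d%:R * `|A| * (2 * `|H|).
    rewrite (le_trans (mx_norm_mul _ _))// ler_pM ?mulr_ge0//.
    by rewrite ler_wpM2l// mx_norm_tr.
  have h2 : `|(edge_differences H)^T *m A| <= d%:R * `|A| * (2 * `|H|).
    rewrite (le_trans (mx_norm_mul _ _))// mulrAC ler_wpM2l ?mulr_ge0//.
    exact: le_trans (mx_norm_tr _) e1.
  by have := ler_normD (A^T *m edge_differences H) ((edge_differences H)^T *m A);
    rewrite /B; lra.
exists ((B ^+ 2 + 1) / Cq) => [|H]; first by rewrite divr_gt0// ltr_wpDl// sqr_ge0.
have [c [S [skewS oK]]] := rigid_decomposition H.
set K := H - _ in oK; have HE : H = K + (translation c + S *m Z) by rewrite subrK.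
rewrite HE cell_strainD cell_strain_affine skewS scaler0 mulmx0 mul0mx addr0.
rewrite Qcell_rigidD//; apply: (@le_trans _ _ ((B ^+ 2 + 1) * mxdot K K)).
  apply: (@le_trans _ _ (B ^+ 2 * mxdot K K)).
    rewrite (le_trans (lerXn2r 2 _ _ (strain_le K))) ?nnegrE ?mulr_ge0//.
    by rewrite exprMn ler_wpM2l ?sqr_ge0// mxdot_norm.
  by rewrite ler_wpM2r ?mxdot_ge0// lerDl.
rewrite -mulrA ler_wpM2l ?addr_ge0 ?sqr_ge0// ler_pdivlMl//.
exact: coer.
Qed.

Lemma scale_half_double (E : 'M[R]_d) : 2^-1 *: (E + E) = E.
Proof.
rewrite scalerDr -scalerDl; have -> : 2^-1 + 2^-1 = 1 :> R by field.
exact: scale1r.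
Qed.

(** The strain of the affine displacement [E *m Z] is [A^T *m E *m A], from which E is recovered
    since A is invertible. *)
Lemma Qcell_symmetric_coercive : exists2 C : R, 0 < C &
  forall E : 'M[R]_d, E^T = E -> C * `|E| ^+ 2 <= Qcell Z W (E *m Z).
Proof.
have [C C0 strainQ] := cell_strain_bound.
pose B : R := d%:R * `|invmx A| * (d%:R * `|invmx A|) + 1.
have B0 : 0 < B by rewrite ltr_wpDl// !mulr_ge0.
exists (B ^+ 2 * C)^-1 => [|E ET]; first by rewrite invr_gt0 mulr_gt0// exprn_gt0.
rewrite ler_pdivrMl ?mulr_gt0 ?exprn_gt0// -mulrA.
apply: (@le_trans _ _ (B ^+ 2 * `|cell_strain (E *m Z)| ^+ 2)); last first.
  by rewrite ler_wpM2l ?sqr_ge0.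
have -> : cell_strain (E *m Z) = A^T *m E *m A.
  rewrite -[E *m Z]add0r -translation0 cell_strain_affine ET.
  by rewrite scale_half_double.
rewrite -exprMn lerXn2r ?nnegrE ?mulr_ge0// ?(ltW B0)//.
set X := A^T *m E *m A.
have -> : E = (invmx A)^T *m X *m invmx A.
  by rewrite /X !mulmxA -trmx_mul mulmxV// trmx1 mul1mx mulmxK.
rewrite (le_trans (mx_norm_mul _ _))//.
apply: (@le_trans _ _ (d%:R * (d%:R * `|invmx A| * `|X|) * `|invmx A|)).
  rewrite ler_wpM2r// ler_wpM2l// (le_trans (mx_norm_mul _ _))//.
  by rewrite ler_wpM2r// ler_wpM2l// mx_norm_tr.
have := normr_ge0 X; rewrite /B; set x := `|invmx A|; set y := `|X|.
by move=> y0; rewrite [leRHS]mulrDl mul1r; lra.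
Qed.

Lemma trmx_scale (a : R) (E : 'M[R]_d) : (a *: E)^T = a *: E^T.
Proof. exact: linearZ. Qed.

Lemma trmx_add (E F : 'M[R]_d) : (E + F)^T = E^T + F^T.
Proof. exact: linearD. Qed.

Lemma alphaA_spec : exists E : 'M[R]_d,
  [/\ 0 < alphaA Z W, E^T = E, E ord0 ord0 = 1,
     Qcell Z W (E *m Z) = alphaA Z W &
     forall G : 'M[R]_d, G^T = G -> alphaA Z W * G ord0 ord0 ^+ 2 <= Qcell Z W (G *m Z)].
Proof.
have [C C0 coer] := Qcell_symmetric_coercive.
pose E0 : 'M[R]_d := delta_mx ord0 ord0.
(* Outside the ball of this radius coercivity already gives a value above that of the competitor
   [E0], so the minimum over the compact set [D] is a global one. *)
pose rho := Qcell Z W (E0 *m Z) / C + 1.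
have rho1 : 1 <= rho by rewrite lerDr divr_ge0 ?Qcell_ge0// ltW.
pose D := [set E : 'M[R]_d | [/\ forall ij : 'I_d * 'I_d, E ij.2 ij.1 = E ij.1 ij.2,
  E ord0 ord0 = 1 & `|E| <= rho]].
have DT E : D E -> E^T = E.
  by move=> [ET _ _]; apply/matrixP => i j; rewrite mxE (ET (i, j)).
have D0 : D E0.
  split=> [[i j]||]; rewrite /= ?mxE ?eqxx//; first by rewrite andbC.
  by apply: mx_norm_le => [|i j]; rewrite ?mxE ?(le_trans ler01)//; case: (_ && _); rewrite ?normr1 ?normr0// (le_trans ler01).
have Dcl : closed D.
  have -> : D = [set E : 'M[R]_d | forall ij : 'I_d * 'I_d, E ij.2 ij.1 - E ij.1 ij.2 = 0]
     `&` ([set E : 'M[R]_d | E ord0 ord0 = 1] `&` [set E : 'M[R]_d | `|E| <= rho]).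
    apply/seteqP; split=> E /=; first by case=> ET E1 Er; split=> // ij; rewrite ET subrr.
    by case=> ET [E1 Er]; split=> // ij; apply/eqP; rewrite -subr_eq0 ET.
  apply: closedI; [|apply: closedI].
  - apply: closed_forall => -[i j]; apply: closed_levelset => E.
    by apply: continuousB; exact: coord_continuous.
  - by apply: closed_levelset; exact: coord_continuous.
  - by apply: closed_sublevel => E; exact: norm_continuous.
have Qc : continuous (fun E : 'M[R]_d => Qcell Z W (E *m Z)).
  by move=> E; apply: (continuous_comp (@mulmxr_continuous _ _ _ _ Z E)); exact: Qcell_continuous.
have [E DE Emin] := mx_EVT_min (ex_intro _ E0 D0) (fun E DE => let: And3 _ _ h := DE in h) Dcl Qc.
have [_ E1 _] := DE; have ET := DT _ DE.
have En0 : E != 0 by apply/negP => /eqP E00; move: E1; rewrite E00 mxE => /eqP; rewrite eq_sym oner_eq0.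
have [al alQ] : exists al, al = Qcell Z W (E *m Z) by eexists.
have al0 : 0 < al.
  by rewrite alQ; apply: lt_le_trans (coer _ ET); rewrite mulr_gt0// exprn_gt0// normr_gt0.
have min1 (G : 'M[R]_d) : G^T = G -> G ord0 ord0 = 1 -> al <= Qcell Z W (G *m Z).
  move=> GT G1; rewrite alQ; have [Gr|Gr] := leP `|G| rho.
    by apply: Emin; split=> // ij; rewrite -{1}GT mxE.
  apply: le_trans (Emin _ D0) _; apply: le_trans (coer _ GT).
  rewrite -ler_pdivrMl// mulrC; apply: (@le_trans _ _ rho); first by rewrite lerDl.
  apply: le_trans (ltW Gr) _; rewrite expr2 ler_peMl//.
  by rewrite ltW// (le_lt_trans rho1).
have minr (G : 'M[R]_d) : G^T = G -> al * G ord0 ord0 ^+ 2 <= Qcell Z W (G *m Z).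
  move=> GT; have [->|G0] := eqVneq (G ord0 ord0) 0.
    by rewrite expr0n mulr0 Qcell_ge0.
  pose a := (G ord0 ord0)^-1.
  have GT1 : (a *: G)^T = a *: G by rewrite trmx_scale GT.
  have G1 : (a *: G) ord0 ord0 = 1 by rewrite mxE mulVf.
  have := min1 _ GT1 G1; rewrite -scalemxAl QcellZ exprVn.
  by rewrite ler_pdivlMl ?exprn_even_gt0// mulrC.
have symT (G : 'M[R]_d) : (2^-1 *: (G + G^T))^T = 2^-1 *: (G + G^T).
  by rewrite trmx_scale trmx_add trmxK addrC.
have sym1 (G : 'M[R]_d) : (2^-1 *: (G + G^T)) ord0 ord0 = G ord0 ord0.
  by rewrite !mxE; field.
have symE (G : 'M[R]_d) : G^T = G -> 2^-1 *: (G + G^T) = G.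
  by move=> GT; rewrite GT scale_half_double.
have alP : [set al | 0 < al /\ forall r : R,
    is_min [set Qcell Z W ((2^-1 *: (G + G^T)) *m Z) | G in
              [set G : 'M[R]_d | G ord0 ord0 = r]] (al * r ^+ 2)] al.
  split=> // r; split.
    exists (r *: E); first by rewrite /= mxE E1 mulr1.
    rewrite symE; last by rewrite trmx_scale ET.
    by rewrite -scalemxAl QcellZ -alQ; exact: mulrC.
  by move=> _ [G /= Gr <-]; have := minr _ (symT G); rewrite sym1 Gr; exact.
(* [alphaA] is a chosen element of a set; the case r = 1 determines this element uniquely. *)
have alE : alphaA Z W = al.
  apply: xget_unique => // al' [_ /(_ 1)]; rewrite expr1n mulr1 => -[[G /= G1 QG] lb].
  apply/eqP; rewrite eq_le; apply/andP; split.
    apply: (lb al); exists E; first exact: E1.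
    by rewrite (symE _ ET); exact: (esym alQ).
  have := minr _ (symT G); rewrite sym1 G1 expr1n mulr1 QG; exact.
by exists E; rewrite alE; split.
Qed.

(* Linearising [Qcell] at the optimal strain gives the "stress" [T], a linear
   functional on cell displacements that sees only the (1,1) entry of an
   affine displacement. *)
Lemma stress_functional : exists T : 'M[R]_(d, N) -> R,
  [/\ (forall G H, T (G + H) = T G + T H) /\ (forall a H, T (a *: H) = a * T H),
     forall c, T (translation c) = 0,
     forall F : 'M[R]_d, T (F *m Z) = alphaA Z W * F ord0 ord0 &
     forall H r, 2 * r * T H - alphaA Z W * r ^+ 2 <= Qcell Z W H].
Proof.
have [E [al0 ET E1 QE min]] := alphaA_spec.
exists (Bcell (E *m Z)); split.
- by split=> [G H|a H]; [rewrite BcellDr|rewrite BcellZr].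
- by move=> c; rewrite BcellC (Bcell_kernel _ (Qcell_translation c)).
- move=> F; pose S := 2^-1 *: (F - F^T).
  pose G := 2^-1 *: (F + F^T) - F ord0 ord0 *: E.
  have skewS : S + S^T = 0.
    by apply/matrixP => i j; rewrite !mxE; ring.
  have GT : G^T = G.
    by apply/matrixP => i j; rewrite !mxE -{2}ET mxE; ring.
  have G0 : G ord0 ord0 = 0 by rewrite !mxE E1; field.
  have FE : F = F ord0 ord0 *: E + G + S.
    by apply/matrixP => i j; rewrite !mxE; field.
  have FZ : F *m Z = F ord0 ord0 *: (E *m Z) + G *m Z + S *m Z.
    by rewrite {1}FE !mulmxDl -scalemxAl.
  have SZ0 : Bcell (E *m Z) (S *m Z) = 0.
    by rewrite BcellC (Bcell_kernel _ (Qcell_skew skewS)).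
  rewrite FZ !BcellDr SZ0 addr0 BcellZr Bcell_diag QE.
  suff -> : Bcell (E *m Z) (G *m Z) = 0 by rewrite addr0 mulrC.
  apply: (@quadratic_linear_part _ (Qcell Z W (G *m Z))).
  move=> t; have := min (E + t *: G); rewrite trmx_add trmx_scale ET GT => /(_ erefl).
  rewrite mxE E1 mxE G0 mulr0 addr0 expr1n mulr1 mulmxDl -scalemxAl.
  rewrite QcellD QcellZ QE BcellZr.
  by move: (alphaA Z W) (Bcell _ _) (Qcell Z W _) => x y z; lra.
- move=> H r; have := Qcell_ge0 (H - r *: (E *m Z)).
  rewrite -scaleNr QcellD QcellZ QE BcellZr BcellC sqrrN.
  by move: (alphaA Z W) (Bcell _ _) (Qcell Z W _) => x y z; lra.
Qed.

End CellQuadraticForm.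

Lemma fin_uniform_large (R : realType) (I : finType) (P : I -> R -> Prop) :
  (forall i, exists M, P i M) -> (forall i M M', M <= M' -> P i M -> P i M') ->
  exists2 M, 0 < M & forall i, P i M.
Proof.
move=> PM Pmono; pose g i := sval (cid (PM i)).
exists (1 + \sum_i `|g i|); first by rewrite ltr_pwDl// sumr_ge0.
move=> i; apply: (Pmono i (g i)); last by rewrite /g; case: cid.
rewrite (le_trans (ler_norm _))// (bigD1 i)//= addrCA lerDl addr_ge0//.
exact: sumr_ge0.
Qed.

(* Moving the two blocks of a separated configuration jointly does not change
   [k]; hence [f] would decrease linearly along a half line if [h] varied. *)
Lemma separated_sum_constant (R : realType) (f h k : R -> R) (t : R) :
  (forall x, 0 <= f x) ->
  (forall eta : R, 0 < eta -> exists M : R, forall a b, M <= `|b - a| ->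
     `|k (b - a) - (f a + h b)| <= eta) -> h t = h 0.
Proof.
move=> f0 fhk; apply/eqP; rewrite -subr_eq0; apply: contraT => phi0.
set phi := h t - h 0 in phi0.
have eta0 : 0 < `|phi| / 4 by rewrite divr_gt0// normr_gt0.
have t0 : t != 0 by apply: contra_neq phi0; rewrite /phi => ->; rewrite subrr.
have [M MP] := fhk _ eta0.
have step a : M <= `|t - a| -> `|f (a - t) - f a - phi| <= `|phi| / 2.
  move=> Ma; have := MP _ _ Ma.
  have := MP (a - t) 0; rewrite sub0r opprB => /(_ Ma).
  rewrite !ler_norml /phi; set q := `|_| / 4; have -> : `|h t - h 0| / 2 = q + q.
    by rewrite /q; field.
  lra.
clearbody phi; have [m Mm] : exists m : nat, M <= m%:R * `|t|.
  exists (Num.bound `|M / `|t| |).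
  rewrite -ler_pdivrMr ?normr_gt0// ltW// (le_lt_trans (ler_norm _))//.
  exact: archi_boundP.
have [phip|phin|phi00] := ltrgt0P phi; last by rewrite phi00 eqxx in phi0.
- pose a j := (m + j)%:R * t + t.
  have dec j : f (a j) <= f (a 0%N) - j%:R * (phi / 2).
    elim: j => [|j IH]; first by rewrite mul0r subr0.
    have : M <= `|t - a j.+1|.
      rewrite /a opprD addrCA subrr addr0 normrN normrM normr_nat.
      by rewrite (le_trans Mm)// ler_wpM2r// ler_nat addnS leqW// leq_addr.
    move/step; have -> : a j.+1 - t = a j.
      by rewrite /a addnS -[(m + j).+1%:R]natr1; ring.
    by rewrite (gtr0_norm phip) ler_norml -[j.+1%:R]natr1 => /andP[h1 h2]; lra.
  have [j fj] : exists j : nat, f (a 0%N) < j%:R * (phi / 2).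
    exists (Num.bound (f (a 0%N) / (phi / 2))).
    by rewrite -ltr_pdivrMr ?divr_gt0// archi_boundP// divr_ge0// divr_ge0// ltW.
  by have := dec j; have := f0 (a j); lra.
- pose a j := - (m + j)%:R * t.
  have dec j : f (a j) <= f (a 0%N) + j%:R * (phi / 2).
    elim: j => [|j IH]; first by rewrite mul0r addr0.
    have : M <= `|t - a j|.
      rewrite /a mulNr opprK -{1}(mul1r t) -mulrDl normrM nat1r normr_nat.
      by rewrite (le_trans Mm)// ler_wpM2r// ler_nat leqW// leq_addr.
    move/step; have -> : a j - t = a j.+1.
      by rewrite /a addnS -[(m + j).+1%:R]natr1; ring.
    by rewrite (ltr0_norm phin) ler_norml -[j.+1%:R]natr1 => /andP[h1 h2]; lra.
  have [j fj] : exists j : nat, f (a 0%N) < j%:R * (- phi / 2).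
    exists (Num.bound (f (a 0%N) / (- phi / 2))).
    rewrite -ltr_pdivrMr ?divr_gt0 ?oppr_gt0//.
    by rewrite archi_boundP// divr_ge0// divr_ge0// oppr_ge0 ltW.
  by have := dec j; have := f0 (a j); lra.
Qed.

(** * The fracture regime of the cell energy *)

Section Fracture.
Context {R : realType} {n : nat}.
Local Notation d := n.+2.
Local Notation N := (2 ^ n.+2)%N.
Variables (Z : 'M[R]_(d, N)) (W : 'M[R]_(d, N) -> \bar R).
Hypothesis W_ge0 : forall G, (0 <= W G)%E.
Hypothesis W_frame : frame_indifferent W.
Hypothesis W_zero : zero_set_rigid Z W.
Variables (WI : forall I : {set 'I_N}, 'M[R]_(d, #|I|) -> R) (bp : 'I_N -> 'I_N -> R).
Hypothesis WI_ge0 : forall I G, 0 <= WI (I := I) G.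
Hypothesis bp_sym : forall s t, s != t -> 0 <= bp s t /\ bp s t = bp t s.
Hypothesis W_fracture : fracture_asymptotics W WI bp.
Hypothesis W_block : block_energy_bound Z W WI.
Implicit Types (G : 'M[R]_(d, N)) (P : {set {set 'I_N}}).

Lemma enorm_ge (u : 'cV[R]_d) : `|u| <= enorm u.
Proof.
apply: mx_norm_le => [|i j]; first exact: sqrtr_ge0.
rewrite ord1 /enorm -sqrtr_sqr ler_sqrt; last first.
  by rewrite /dot sumr_ge0// => k _; rewrite -expr2 sqr_ge0.
rewrite /dot (bigD1 i)//= expr2 lerDl sumr_ge0// => k _.
by rewrite -expr2 sqr_ge0.
Qed.

Lemma enormB (u v : 'cV[R]_d) : enorm (u - v) = enorm (v - u).
Proof.
by rewrite /enorm /dot; congr (Num.sqrt _); apply: eq_bigr => k _; rewrite !mxE; ring.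
Qed.

Lemma broken_energyE P : is_corner_partition P ->
  broken_energy bp P =
    \sum_s \sum_(t | t \notin finset.pblock P s) 2^-1 * bp s t.
Proof.
move=> partP; have /and3P[/eqP coverP trivP _] := partP.
have inP s : finset.pblock P s \in P by apply: pblock_mem; rewrite coverP inE.
have bigP (f : 'I_N -> R) : \sum_(s in [set: 'I_N]%SET) f s =
    \sum_(I in P) \sum_(s in I) f s.
  by rewrite -coverP; exact: finset.big_trivIset.
rewrite /broken_energy mulr_sumr.
transitivity (\sum_(I in P) \sum_(s in I)
    \sum_(t | t \notin finset.pblock P s) 2^-1 * bp s t); last first.
  by rewrite -bigP; apply: eq_bigl => s; rewrite inE.
apply: eq_bigr => I IP; rewrite exchange_big mulr_sumr/=.
apply: eq_bigr => s sI; rewrite (def_pblock trivP IP sI) -mulr_sumr; congr (_ * _).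
apply: (addIr (\sum_(t in I) bp s t)).
transitivity (\sum_(J in P) \sum_(t in J) bp s t).
  rewrite [RHS](bigD1 I)//= [LHS]addrC; congr (_ + _).
  by apply: eq_bigl => J; rewrite eq_sym.
rewrite -bigP (bigID (mem I)) /= [LHS]addrC.
by congr (_ + _); apply: eq_bigl => t; rewrite inE.
Qed.

(** The diagonal is set to 0 because the sign of [bp] is known for distinct corners only; the weight
    is thus nonnegative on all pairs. *)
Definition half_bond s t : R := if s == t then 0 else 2^-1 * bp s t.

Lemma half_bond_ge0 s t : 0 <= half_bond s t.
Proof.
rewrite /half_bond; case: eqVneq => // st.
by rewrite mulr_ge0//; have [] := bp_sym st.
Qed.

Lemma broken_energy_half P : is_corner_partition P ->
  broken_energy bp P = \sum_s \sum_(t | t \notin finset.pblock P s) half_bond s t.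
Proof.
move=> partP; rewrite broken_energyE//; apply: eq_bigr => s _.
apply: eq_bigr => t tP; rewrite /half_bond; case: eqVneq => // st.
have /and3P[/eqP coverP _ _] := partP.
by move: tP; rewrite -st mem_pblock coverP inE.
Qed.

(** There are finitely many partitions. The common lower bound turns the additive error of the
    asymptotic expansion into a relative one. *)
Lemma broken_energy_min : exists2 m : R, 0 < m &
  forall P, is_corner_partition P -> (1 < #|P|)%N -> m <= broken_energy bp P.
Proof.
apply: (@fin_uniform_gt0 _ _ (fun P m => is_corner_partition P -> (1 < #|P|)%N -> m <= broken_energy bp P)).
  move=> P; have [PP|nP] := pselect (is_corner_partition P /\ (1 < #|P|)%N).
    by exists (broken_energy bp P) => //; have [] := W_fracture PP.1 PP.2.
  by exists 1 => // P1 P2; exfalso; apply: nP.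
by move=> P m m' _ mm' Pm P1 P2; apply: le_trans mm' (Pm P1 P2).
Qed.

Lemma separated_mono P (M M' : R) G : M <= M' -> Defs.separated P M' G -> Defs.separated P M G.
Proof.
move=> MM' sep I J IP JP IJ s t sI tJ.
exact: le_trans MM' (sep I J IP JP IJ s t sI tJ).
Qed.

Lemma fracture_uniform (eta : R) : 0 < eta -> exists2 M : R, 0 < M &
  forall P, is_corner_partition P -> (1 < #|P|)%N -> forall G, Defs.separated P M G ->
  (`|W G - (\sum_(I in P) WI (Defs.restrict G I) + broken_energy bp P)%:E| <= eta%:E)%E.
Proof.
move=> eta0.
apply: (@fin_uniform_large _ _ (fun P M => is_corner_partition P -> (1 < #|P|)%N ->
  forall G, Defs.separated P M G ->
  (`|W G - (\sum_(I in P) WI (Defs.restrict G I) + broken_energy bp P)%:E| <= eta%:E)%E)).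
  move=> P; have [PP|nP] := pselect (is_corner_partition P /\ (1 < #|P|)%N).
    have [_ /(_ _ eta0)[M MP]] := W_fracture PP.1 PP.2.
    by exists M.
  by exists 1 => // P1 P2; exfalso; apply: nP.
by move=> P M M' MM' PM P1 P2 G /(separated_mono MM')/(PM P1 P2).
Qed.

Lemma abse_sub_le (x : \bar R) (a e : R) : (`|x - a%:E| <= e%:E)%E ->
  ((a - e)%:E <= x /\ x <= (a + e)%:E)%E.
Proof.
case: x => [x| |]; rewrite /= ?leey// -?EFinB ?lee_fin.
by rewrite ler_norml => /andP[h1 h2]; split; rewrite ?lee_fin; lra.
Qed.

(* The blocks are the connected components of the graph joining corners at
   distance less than [M]. *)
Lemma fracture_dichotomy (eta : R) : 0 < eta -> exists2 M : R, 0 < M & forall G,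
  exists c : rel 'I_N, [/\ equivalence_rel c,
    forall s t, c s t -> `|col s G - col t G| <= M &
    (forall s t, c s t) \/
    exists P, [/\ is_corner_partition P, (1 < #|P|)%N,
      forall s t, (t \notin finset.pblock P s) = ~~ c s t &
      ((broken_energy bp P - eta)%:E <= W G)%E]].
Proof.
move=> eta0; have [M M0 MP] := fracture_uniform eta0.
(* Within a component two corners are joined by a path without repetition, hence with at most [N]
   steps, each shorter than [M]. *)
exists (N%:R * M) => [|G]; first by rewrite mulr_gt0// ltr0n expn_gt0.
pose e : rel 'I_N := fun s t => enorm (col s G - col t G) < M.
have esym : connect_sym e.
  by apply: sym_connect_sym => s t; rewrite /e enormB.
have eqv : equivalence_rel (connect e).
  move=> s t u; split=> [|st]; first exact: connect0.
  exact: same_connect.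
exists (connect e); split=> //.
- move=> s t /connectP[p]; case/shortenP => p' pth uniq_p _ ->{t p}.
  have : (size p' <= N)%N.
    have := card_uniqP uniq_p; rewrite /= => E.
    by rewrite -ltnS -E (leq_trans (max_card _))// card_ord.
  move=> sz; apply: (@le_trans _ _ ((size p')%:R * M)); last first.
    by rewrite (ler_wpM2r (ltW M0))// ler_nat.
  elim: p' s pth {uniq_p sz} => [|u p IH] s /=.
    by rewrite subrr normr0 mul0r.
  move=> /andP[su /IH h]; rewrite -(subrKA (col u G)) (le_trans (ler_normD _ _))//.
  rewrite -natr1 mulrDl mul1r addrC lerD//.
  by rewrite (le_trans (enorm_ge _))// ltW.
- have [all_c|] := pselect (forall s t, connect e s t); first by left.
  move=> /existsNP[s0] /existsNP[t0] nst; right.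
  pose P := equivalence_partition (connect e) [set: 'I_N]%SET.
  have eqvT : {in [set: 'I_N]%SET & &, equivalence_rel (connect e)}.
    by move=> s t u _ _ _; exact: eqv.
  have partP : is_corner_partition P by exact: equivalence_partitionP.
  have pb s t : (t \in finset.pblock P s) = connect e s t.
    by rewrite pblock_equivalence_partition ?inE.
  have /and3P[/eqP coverP trivP _] := partP.
  have inP s : finset.pblock P s \in P by apply: pblock_mem; rewrite coverP inE.
  have P2 : (1 < #|P|)%N.
    apply/card_gt1P; exists (finset.pblock P s0), (finset.pblock P t0); split=> //.
    by apply/eqP => E; apply: nst; rewrite -pb E mem_pblock coverP inE.
  exists P. split=> //; first by move=> s t; rewrite pb.
  have sep : Defs.separated P M G.
    move=> I J IP JP IJ s t sI tJ; rewrite leNgt; apply/negP => est.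
    have : connect e s t by exact: connect1.
    rewrite -pb (def_pblock trivP IP sI) => tI.
    by move: IJ; rewrite -(def_pblock trivP IP tI) (def_pblock trivP JP tJ) eqxx.
  have [+ _] := abse_sub_le (MP P partP P2 G sep).
  apply: le_trans; rewrite lee_fin lerB// lerDr.
  by apply: sumr_ge0 => I _; exact: WI_ge0.
Qed.

(** A bond longer than the threshold joins different blocks, so the long bonds weigh at most as much
    as the broken energy. The error was taken to be eta times the smallest broken energy and is
    therefore relative; for eta at least 1 the left side is nonpositive. *)
Lemma fracture_lower_bound (eta : R) : 0 < eta -> exists2 M : R, 0 < M & forall G,
  (((1 - eta) * \sum_s \sum_(t | M < `|col s G - col t G|) half_bond s t)%:E <= W G)%E.
Proof.
move=> eta0; have [m m0 mP] := broken_energy_min.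
have [M M0 MP] := fracture_dichotomy (mulr_gt0 eta0 m0).
exists M => // G; have [c [_ cM]] := MP G.
have [eta1|eta1] := leP 1 eta.
  move=> _; apply: (@le_trans _ _ 0%E); last exact: W_ge0.
  rewrite lee_fin mulr_le0_ge0 ?subr_le0// sumr_ge0// => s _.
  by rewrite sumr_ge0// => t _; rewrite half_bond_ge0.
case=> [all_c|[P [partP P2 Pc]]].
  rewrite big1 ?mulr0 => [|s _]; first exact: W_ge0.
  by rewrite big_pred0// => t; apply/negbTE; rewrite -leNgt cM.
apply: le_trans; rewrite lee_fin.
apply: (@le_trans _ _ ((1 - eta) * broken_energy bp P)); last first.
  by have := mP _ partP P2; rewrite -(ler_pM2l eta0); lra.
rewrite ler_wpM2l ?subr_ge0 ?(ltW eta1)// broken_energy_half// ler_sum// => s _.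
rewrite [leLHS]big_mkcond [leRHS]big_mkcond ler_sum// => t _.
rewrite Pc; have [st|] := ltP M; last by case: ifP => // _ _; exact: half_bond_ge0.
by have [/cM|] := boolP (c s t); [rewrite leNgt st|].
Qed.

(** A configuration with several blocks has energy at least m - m/2, which exceeds the threshold
    m/3; hence all corners belong to one component of bounded diameter. *)
Lemma small_energy_bounded : exists2 th : R, 0 < th & exists D : R,
  forall G, (W G <= th%:E)%E -> forall s t, `|col s G - col t G| <= D.
Proof.
have [m m0 mP] := broken_energy_min.
have m2 : 0 < m / 2 by rewrite divr_gt0.
have m3 : 0 < m / 3 by rewrite divr_gt0.
have [M M0 MP] := fracture_dichotomy m2.
exists (m / 3) => //; exists M => G Gm s t; have [c [_ cM]] := MP G.
case=> [all_c|[P [partP P2 Pc /le_trans/(_ Gm)]]]; first exact: cM.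
by rewrite lee_fin; have := mP _ partP P2; lra.
Qed.

Definition crack_shift (J : {set 'I_N}) (t : R) : 'M[R]_(d, N) :=
  \matrix_(i, j) (Z i j + t *+ ((j \in J) && (i == ord0))).

Lemma block_energy_Z P I : is_corner_partition P -> I \in P -> WI (Defs.restrict Z I) = 0.
Proof.
move=> partP IP; have [C [U [_ SU bound]]] := W_block.
apply/eqP; rewrite eq_le WI_ge0 andbT.
have := bound P I partP IP Z (SU _ (SObar_Z Z)).
by rewrite (W_Z W_zero) mule0 lee_fin.
Qed.

Lemma two_block_partition (J : {set 'I_N}) : J != finset.set0 -> ~: J != finset.set0 ->
  is_corner_partition [set J; ~: J]%SET /\ #|[set J; ~: J]%SET| = 2.
Proof.
move=> J0 J1; have JJ : J != ~: J.
  apply/eqP => /setP E; have /set0Pn[j jJ] := J0.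
  by have := E j; rewrite inE jJ.
split; last by rewrite cards2 JJ.
apply/and3P; split.
- apply/eqP/setP => x; rewrite inE; apply/finset.bigcupP.
  have [xJ|xJ] := boolP (x \in J); first by exists J; rewrite ?inE ?eqxx.
  by exists (~: J); rewrite !inE ?eqxx ?orbT.
- apply/finset.trivIsetP => A B; rewrite !inE => /orP[]/eqP -> /orP[]/eqP ->; rewrite ?eqxx// => _.
    by rewrite -finset.setI_eq0 finset.setICr.
  by rewrite -finset.setI_eq0 finset.setIC finset.setICr.
- by rewrite !inE negb_or !(eq_sym finset.set0) J0.
Qed.

(** The block energies vanish at Z, but they are not assumed to be invariant under translations, so
    the block that has been moved needs an argument. Moving both blocks jointly does not change W,
    and [separated_sum_constant] then shows that the energy of the block J is constant along e_1. *)
Lemma fracture_upper_bound (eta : R) : 0 < eta -> exists2 M : R, 0 < M &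
  forall (J : {set 'I_N}) t, J != finset.set0 -> ~: J != finset.set0 -> M <= t ->
  (W (crack_shift J t) <=
    ((1 + eta) * \sum_s \sum_(t | (s \in J) != (t \in J)) half_bond s t)%:E)%E.
Proof.
move=> eta0; have [m m0 mP] := broken_energy_min.
have [M M0 MP] := fracture_uniform (mulr_gt0 eta0 m0).
pose diam := \sum_s \sum_t `|col s Z - col t Z|.
have diam_ge s t : `|col s Z - col t Z| <= diam.
  rewrite /diam (bigD1 s)//= (bigD1 t)//= -addrA lerDl addr_ge0// ?sumr_ge0// => u _.
  by rewrite sumr_ge0.
have diam0 : 0 <= diam := le_trans (normr_ge0 _) (diam_ge (Ordinal (expn_gt0 2 d)) (Ordinal (expn_gt0 2 d))).
have sepJ (J : {set 'I_N}) (M' a : R) : M' + diam <= `|a| ->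
    Defs.separated [set J; ~: J]%SET M' (crack_shift J a).
  move=> Ma; have key s t : s \in J -> t \notin J ->
      M' <= enorm (col s (crack_shift J a) - col t (crack_shift J a)).
    move=> sJ tJ.
    rewrite (le_trans _ (enorm_ge _))// (le_trans _ (mx_entry_le _ ord0 0))//.
    rewrite !mxE sJ (negbTE tJ) eqxx mulr1n mulr0n addr0.
    have := mx_entry_le (col s Z - col t Z) ord0 0; rewrite !mxE.
    move/le_trans/(_ (diam_ge s t)) => h1.
    have := ler_normB (Z ord0 s + a - Z ord0 t) (Z ord0 s - Z ord0 t).
    have -> : Z ord0 s + a - Z ord0 t - (Z ord0 s - Z ord0 t) = a by ring.
    by move=> h2; lra.
  move=> I K; rewrite !inE => /orP[]/eqP -> /orP[]/eqP ->; rewrite ?eqxx// => _ s t.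
    by move=> sJ; rewrite inE; exact: key.
  by rewrite inE => sJ tJ; rewrite enormB; exact: key.
exists (M + diam) => [|J t J0 J1 Mt]; first by rewrite ltr_wpDr.
have [partP P2] := two_block_partition J0 J1.
have P2' : (1 < #|[set J; ~: J]%SET|)%N by rewrite P2.
have JP : J \in [set J; ~: J]%SET by rewrite !inE eqxx.
have JCP : ~: J \in [set J; ~: J]%SET by rewrite !inE eqxx orbT.
have JJ : J != ~: J by apply/eqP => E; move: P2; rewrite -E finset.setUid cards1.
have t0 : 0 < t by apply: lt_le_trans Mt; rewrite ltr_wpDr.
have WIsum G : \sum_(I in [set J; ~: J]%SET) WI (Defs.restrict G I) =
    WI (Defs.restrict G J) + WI (Defs.restrict G (~: J)).
  by rewrite big_setU1/= ?big_set1// inE.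
have shiftE (a b : R) : Z + translation (a *: e1) + (crack_shift J (b - a) - Z) =
    \matrix_(i, j) (Z i j + (if j \in J then b else a) *+ (i == ord0)).
  apply/matrixP => i j; rewrite !mxE; case: (j \in J) => /=.
    by case: eqP => _ /=; rewrite ?mulr1n ?mulr0n; ring.
  by case: eqP => _ /=; rewrite ?mulr1n ?mulr0n; ring.
(* [h] and [f] are the energies of the two blocks translated separately; at large separation their
   sum is a function of the relative shift alone, up to an arbitrarily small error. *)
have WIJ : WI (Defs.restrict (crack_shift J t) J) = 0.
  pose h b := WI (Defs.restrict (crack_shift J b) J).
  pose f a := WI (Defs.restrict (Z + translation (a *: e1)) (~: J)).
  have h0 : h 0 = 0.
    apply: etrans (block_energy_Z partP JP); congr (WI (Defs.restrict _ _)).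
    by apply/matrixP => i j; rewrite !mxE mul0rn addr0.
  rewrite -h0; apply: (@separated_sum_constant _ f h
    (fun c => fine (W (crack_shift J c)) - broken_energy bp [set J; ~: J]%SET)) => [x|eta' eta'0].
    exact: WI_ge0.
  have [M' M'0 M'P] := fracture_uniform eta'0.
  exists (M' + diam) => a b ab.
  pose G := crack_shift J (b - a) + translation (a *: e1).
  have GI : Defs.restrict G J = Defs.restrict (crack_shift J b) J.
    apply/matrixP => i j; rewrite !mxE.
    have := enum_valP j; set k := enum_val j => kJ; rewrite kJ /=.
    by case: eqP => _ /=; rewrite ?mulr1n ?mulr0n; ring.
  have GC : Defs.restrict G (~: J) = Defs.restrict (Z + translation (a *: e1)) (~: J).
    apply/matrixP => i j; rewrite !mxE.
    have := enum_valP j; set k := enum_val j; rewrite inE => kJ; rewrite (negbTE kJ) /=.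
    by rewrite mulr0n addr0.
  have sepG : Defs.separated [set J; ~: J]%SET M' G.
    have := sepJ J M' _ ab => + I K IP KP IK s u sI uK.
    move=> /(_ I K IP KP IK s u sI uK); congr (_ <= enorm _).
    by apply/matrixP => i j; rewrite !mxE; ring.
  have := M'P _ partP P2' G sepG.
  rewrite WIsum GI GC /G (W_translation W_frame) -/(h b) -/(f a).
  have := W_ge0 (crack_shift J (b - a)).
  case: (W _) => [x| |] //= _; rewrite -?EFinB ?lee_fin//.
  apply: le_trans; rewrite le_eqVlt; apply/orP; left; apply/eqP.
  by congr (`|_|); ring.
have WIC : WI (Defs.restrict (crack_shift J t) (~: J)) = 0.
  apply: etrans (block_energy_Z partP JCP); congr (WI _).
  apply/matrixP => i j; rewrite !mxE.
  have := enum_valP j; set k := enum_val j; rewrite inE => kJ; rewrite (negbTE kJ) /=.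
  by rewrite mulr0n addr0.
have tM : M + diam <= `|t| by rewrite gtr0_norm.
have := MP _ partP P2' _ (sepJ J M t tM).
rewrite WIsum WIJ WIC addr0 add0r => /abse_sub_le[_ /le_trans]; apply.
have bE : broken_energy bp [set J; ~: J]%SET =
    \sum_s \sum_(t | (s \in J) != (t \in J)) half_bond s t.
  rewrite broken_energy_half//; apply: eq_bigr => s _; apply: eq_bigl => u.
  have /and3P[_ trivP _] := partP.
  have [sJ|sJ] := boolP (s \in J).
    by rewrite (def_pblock trivP JP sJ); case: (u \in J).
  have sC : s \in ~: J by rewrite inE.
  by rewrite (def_pblock trivP JCP sC) inE negbK; case: (u \in J).
rewrite lee_fin mulrDl mul1r -bE lerD2l ler_wpM2l ?(ltW eta0)//.
exact: mP.
Qed.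

End Fracture.

(** * Nearest rotations and quadratic control near the wells *)

Section NearWells.
Context {R : realType} {n : nat}.
Local Notation d := n.+2.
Local Notation N := (2 ^ n.+2)%N.
Variables (Z : 'M[R]_(d, N)) (W : 'M[R]_(d, N) -> \bar R).
Implicit Types (G H K : 'M[R]_(d, N)) (S F P : 'M[R]_d) (c : 'cV[R]_d).

Lemma mxdot_bound G H : `|mxdot G H| <= (d * N)%:R * `|G| * `|H|.
Proof.
rewrite mxdotE (le_trans (ler_norm_sum _ _ _))//.
apply: (@le_trans _ _ (\sum_(i < d) \sum_(j < N) `|G| * `|H|)).
  apply: ler_sum => i _; rewrite (le_trans (ler_norm_sum _ _ _))//.
  by apply: ler_sum => j _; rewrite normrM ler_pM// mx_entry_le.
by rewrite !sumr_const !card_ord -mulrnA -[X in X <= _]mulr_natr mulnC [X in X <= _]mulrC mulrA.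
Qed.

Lemma mxdot_sqrB G H (t : R) : mxdot (G - t *: H) (G - t *: H) =
  mxdot G G - 2 * t * mxdot G H + t ^+ 2 * mxdot H H.
Proof.
by rewrite -scaleNr !(mxdotDl, mxdotDr, mxdotZl, mxdotZr) (mxdotC H G); ring.
Qed.

Lemma NR_gt0 : 0 < N%:R :> R. Proof. by rewrite ltr0n expn_gt0. Qed.

Lemma sum_corners_const (a : R) : \sum_(j < N) a = N%:R * a.
Proof. by rewrite sumr_const card_ord mulr_natl. Qed.

Definition barycenter G : 'cV[R]_d := \col_i (N%:R^-1 * \sum_j G i j).

Definition centered G : 'M[R]_(d, N) := G - translation (barycenter G).

Lemma centeredE G i j : centered G i j = G i j - N%:R^-1 * \sum_k G i k.
Proof. by rewrite !mxE. Qed.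

Lemma centered_norm G : `|centered G| <= 2 * `|G|.
Proof.
apply: mx_norm_le => [|i j]; first by rewrite mulr_ge0.
rewrite centeredE (le_trans (ler_normB _ _))// mulrDl mul1r lerD ?mx_entry_le//.
rewrite normrM gtr0_norm ?invr_gt0 ?NR_gt0// ler_pdivrMl ?NR_gt0//.
rewrite (le_trans (ler_norm_sum _ _ _))//.
rewrite -[X in _ <= X%:R * _](card_ord N) mulr_natl -sumr_const ler_sum// => k _.
exact: mx_entry_le.
Qed.

Lemma centered_sum G i : \sum_j centered G i j = 0.
Proof.
under eq_bigr do rewrite centeredE.
by rewrite sumrB sum_corners_const mulVKf ?gt_eqF ?NR_gt0// subrr.
Qed.

Lemma centered_mul P G : centered (P *m G) = P *m centered G.
Proof.
apply/matrixP => i j; rewrite centeredE !mxE.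
under [in RHS]eq_bigr do rewrite centeredE mulrBr.
rewrite sumrB; congr (_ - _).
under eq_bigr do rewrite mxE.
rewrite exchange_big mulr_sumr; apply: eq_bigr => k _.
by rewrite mulrCA -mulr_sumr.
Qed.

Lemma centeredB G H : centered (G - H) = centered G - centered H.
Proof.
apply/matrixP => i j; rewrite !(mxE, centeredE).
under eq_bigr do rewrite !mxE.
by rewrite sumrB mulrBr; ring.
Qed.

Lemma centered_translation c : centered (translation c) = 0.
Proof.
apply/matrixP => i j; rewrite centeredE !mxE; under eq_bigr do rewrite mxE.
by rewrite sum_corners_const mulKf ?gt_eqF ?NR_gt0// subrr.
Qed.

Lemma mxdot_centered c G : mxdot (translation c) (centered G) = 0.
Proof.
rewrite mxdotE big1// => i _.
by under eq_bigr do rewrite [translation c i _]mxE; rewrite -mulr_sumr centered_sum mulr0.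
Qed.

Lemma nearest_rotation G : exists P, SO P /\
  (forall P', SO P' -> mxdot (P^T *m centered G - centered Z) (P^T *m centered G - centered Z)
     <= mxdot (P'^T *m centered G - centered Z) (P'^T *m centered G - centered Z)).
Proof.
pose f P := mxdot (P^T *m centered G - centered Z) (P^T *m centered G - centered Z).
have fc : continuous f.
  have -> : f = (fun P => \sum_i \sum_j (P^T *m centered G - centered Z) i j *
      (P^T *m centered G - centered Z) i j).
    by apply/funext => P; rewrite /f mxdotE.
  have ec i j : continuous (fun P => (P^T *m centered G - centered Z) i j).
    have -> : (fun P => (P^T *m centered G - centered Z) i j) =
       (fun P => \sum_k P k i * centered G k j + - centered Z i j).
      apply/funext => P; rewrite mxE [X in _ + X]mxE; congr (_ + _).
      by rewrite mxE; apply: eq_bigr => k _; rewrite mxE.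
    apply: continuous_add; last by move=> ?; exact: cst_continuous.
    apply: continuous_sum => k _; apply: continuous_mul; first exact: coord_continuous.
    by move=> ?; exact: cst_continuous.
  by apply: continuous_sum => i _; apply: continuous_sum => j _; exact: continuous_mul.
have [P SOP_ Pmin] := mx_EVT_min (ex_intro _ _ SO1) (@SO_norm _ _) (@SO_closed _ _) fc.
by exists P.
Qed.

(* First order optimality of the nearest rotation. *)
Lemma nearest_rotation_orthogonal G P : SO P ->
  (forall P', SO P' -> mxdot (P^T *m centered G - centered Z) (P^T *m centered G - centered Z)
     <= mxdot (P'^T *m centered G - centered Z) (P'^T *m centered G - centered Z)) ->
  rigid_orthogonal Z (P^T *m centered G - centered Z).
Proof.
move=> SOP_ Pmin; set H := P^T *m centered G - centered Z in Pmin *.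
have HC : H = centered (P^T *m G - Z) by rewrite centeredB centered_mul.
have half S : S + S^T = 0 -> mxdot H (S *m centered Z) <= 0.
  move=> skewS; pose K := S *m centered Z.
  pose B := (d * N)%:R * `|H| * (d%:R * (d%:R * `|S *m S|) * `|centered Z|).
  pose C := d%:R * (d%:R * `|S *m S|) * `|centered Z| : R.
  have C0 : 0 <= C by rewrite !mulr_ge0.
  pose D := 2 * ((d * N)%:R * `|H| * C) + (d * N)%:R * (`|K| + C) * (`|K| + C).
  have D0 : 0 <= D.
    by rewrite addr_ge0 ?mulr_ge0// addr_ge0.
  apply/ler_addgt0Pr => e e0; rewrite add0r.
  pose t := Num.min 1 (e / (D + 1)).
  have t0 : 0 < t by rewrite lt_min ltr01 divr_gt0// ltr_wpDl.
  have t1 : t <= 1 by rewrite /t ge_min lexx.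
  have tD : t * (D + 1) <= e by rewrite -ler_pdivlMr ?ltr_wpDl// /t ge_min lexx orbT.
  clearbody t.
  have [Q [X [SOQ QE XS]]] := Cayley skewS (ltW t0).
  have := Pmin _ (SO_mul SOP_ SOQ).
  rewrite trmx_mul -mulmxA.
  have -> : Q^T *m (P^T *m centered G) - centered Z =
      Q^T *m (H - t *: (K + t *: (X *m centered Z))).
    have -> : P^T *m centered G = H + centered Z by rewrite subrK.
    have {2}-> : centered Z = Q^T *m (Q *m centered Z) by case: SOQ => QQ _; rewrite mulmxA QQ mul1mx.
    rewrite -mulmxBr QE !mulmxDl mul1mx -!scalemxAl scalerDr scalerA -expr2.
    by congr (_ *m _); rewrite -[X in _ - X]addrA opprD addrA addrK.
  rewrite mxdot_rotation; last exact: SO_tr.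
  set Y := X *m centered Z.
  have YC : `|Y| <= C by rewrite (le_trans (mx_norm_mul _ _))// ler_wpM2r// ler_wpM2l.
  have KY : `|K + t *: Y| <= `|K| + C.
    rewrite (le_trans (ler_normD _ _))// lerD2l normrZ gtr0_norm//.
    by rewrite (le_trans _ YC)// ler_piMl.
  have -> : mxdot (H - t *: (K + t *: Y)) (H - t *: (K + t *: Y)) =
      mxdot H H - 2 * t * (mxdot H K + t * mxdot H Y) + t ^+ 2 * mxdot (K + t *: Y) (K + t *: Y).
    by rewrite -mxdotZr -mxdotDr mxdot_sqrB.
  have h1 : `|mxdot H Y| <= (d * N)%:R * `|H| * C.
    by rewrite (le_trans (mxdot_bound _ _))// ler_wpM2l// mulr_ge0.
  have h2 : mxdot (K + t *: Y) (K + t *: Y) <= (d * N)%:R * (`|K| + C) * (`|K| + C).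
    rewrite (le_trans (ler_norm _))// (le_trans (mxdot_bound _ _))//.
    by rewrite ler_pM ?mulr_ge0// ler_wpM2l.
  set x := mxdot H K; set y := mxdot H Y in h1 *; set z := mxdot (K + t *: Y) _ in h2 *.
  move=> h3.
  have h4 : 0 <= t * (- 2 * x - 2 * t * y + t * z) by lra.
  rewrite pmulr_rge0// in h4.
  move: h1; rewrite ler_norml => /andP[h1 _].
  have h5 : t * (- 2 * y + z) <= t * D by rewrite ler_pM2l// /D; lra.
  have h6 : t * D <= e by apply: le_trans tD; rewrite ler_pM2l// lerDl.
  by clearbody x; lra.
move=> c S skewS.
have tr0 c' : mxdot (translation c') H = 0 by rewrite HC mxdot_centered.
rewrite mxdotDl tr0 add0r.
have -> : S *m Z = S *m centered Z + translation (S *m barycenter Z).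
  by rewrite -mul_translation -mulmxDr /centered subrK.
rewrite mxdotDl tr0 addr0 mxdotC; apply/eqP; rewrite eq_le half//=.
have := half (- S); rewrite linearN/= -opprD skewS oppr0 => /(_ erefl).
by rewrite mulNmx mxdotNr oppr_le0.
Qed.

Hypothesis W_ge0 : forall G, (0 <= W G)%E.
Hypothesis W_frame : frame_indifferent W.
Hypothesis W_zero : zero_set_rigid Z W.
Hypothesis W_continuous : continuous W.
Hypothesis W_regular : regular_near_wells Z W.
Hypothesis W_Hessian : Hessian_nondegenerate Z W.
Hypothesis W_bounded : exists2 th : R, 0 < th & exists D : R,
  forall G, (W G <= th%:E)%E -> forall s t, `|col s G - col t G| <= D.

(** By compactness. At small energy the corner distances are bounded, and fixing one corner at the
    origin removes the translations. On the compact set of such configurations at distance at least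
    e from all wells, W is positive; as its values are extended reals, the uniform lower bound is
    obtained from a covering argument. *)
Lemma near_wells (e : R) : 0 < e -> exists2 th : R, 0 < th &
  forall G, (W G <= th%:E)%E -> exists P c, SO P /\ `|G - (P *m Z + translation c)| <= e.
Proof.
move=> e0; have [th1 th10 [D WD]] := W_bounded.
pose j0 : 'I_N := Ordinal (expn_gt0 2 d).
pose K := [set G : 'M[R]_(d, N) | [/\ `|G| <= D, forall i, G i j0 = 0 &
   forall Pc : 'M[R]_d * 'cV[R]_d, SO Pc.1 -> e <= `|G - (Pc.1 *m Z + translation Pc.2)|]].
have Kcl : closed K.
  have -> : K = [set G : 'M[R]_(d, N) | `|G| <= D] `&` ([set G : 'M[R]_(d, N) | forall i, G i j0 = 0] `&`
     [set G : 'M[R]_(d, N) | forall Pc : 'M[R]_d * 'cV[R]_d, SO Pc.1 -> e <= `|G - (Pc.1 *m Z + translation Pc.2)|]).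
    by apply/seteqP; split=> G /=; [case|case=> ? []].
  apply: closedI; [|apply: closedI].
  - by apply: closed_sublevel => G; exact: norm_continuous.
  - by apply: closed_forall => i; apply: closed_levelset; exact: coord_continuous.
  - apply: closed_forall => -[P c] /=; have [SOP_|nSO] := pselect (SO P).
      set B := (X in closed X).
      have -> : B = [set G : 'M[R]_(d, N) | e <= `|G - (P *m Z + translation c)|].
        by apply/seteqP; split=> G /= h; [exact: h|move=> _].
      apply: closed_superlevel; apply: (@lipschitz_continuous _ _ _ _ _ 1) => G G'.
      rewrite mul1r (le_trans (ler_dist_dist _ _))//.
      by rewrite opprB addrA subrK.
    set B := (X in closed X); have -> : B = setT by apply/seteqP; split=> // G _ /= /nSO.
    exact: closedT.
have Kbd G : K G -> `|G| <= D by case.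
have Kco : compact K := mx_bounded_closed_compact Kbd Kcl.
have : \forall i \near \oo, K `<=` [set G | ((i.+1%:R^-1 : R)%:E < W G)%E].
  move/compact_near_coveringP: Kco => Kco.
  apply: (Kco nat eventually (fun i G => ((i.+1%:R^-1 : R)%:E < W G)%E)) => G [_ _ GK].
  have WG : (0 < W G)%E.
    rewrite lt_def W_ge0 andbT; apply/negP => /eqP /W_zero[P [c [SOP_ GE]]].
    by have := GK (P, c) SOP_; rewrite /= GE subrr normr0 leNgt e0.
  have [c c0 cW] : exists2 c : R, 0 < c & (c%:E < W G)%E.
    move: WG; case: (W G) => [x| |]//=; rewrite ?lte_fin => x0; last by exists 1; rewrite ?ltry.
    by exists (x / 2); rewrite ?divr_gt0// lte_fin ltr_pdivrMr// ltr_pMr// ltr1n.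
  have nG : nbhs G [set G' | (c%:E < W G')%E].
    apply: open_nbhs_nbhs; split=> //.
    exact: (@open_comp _ _ W [set y | (c%:E < y)%E] (fun x _ => @W_continuous x) (@open_ereal_gt_ereal _ c%:E)).
  exists ([set G' | (c%:E < W G')%E], [set i : nat | i.+1%:R^-1 < c]).
    split=> //=; exact: (near_infty_natSinv_lt (PosNum c0)).
  by move=> [G' i] /= [h1 h2]; apply: lt_trans h1; rewrite lte_fin.
move=> [i _ /(_ i (leqnn i)) Ki].
exists (Num.min th1 i.+1%:R^-1); first by rewrite lt_min th10 invr_gt0 ltr0n.
move=> G; rewrite EFin_min le_min => /andP[G1 G2].
have D0 : 0 <= D by apply: le_trans (WD _ G1 j0 j0).
apply: contrapT => nG.
pose G' := G + translation (- col j0 G).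
have WG' : W G' = W G by rewrite /G' (W_translation W_frame).
suff KG : K G' by have := Ki G' KG; rewrite /= WG' ltNge G2.
split.
- apply: mx_norm_le => // i1 j; rewrite !mxE.
  have := WD _ G1 j j0; apply: le_trans; apply: le_trans (mx_entry_le _ i1 0).
  by rewrite !mxE.
- by move=> i1; rewrite !mxE subrr.
- move=> [P c] /= SOP_; rewrite leNgt; apply/negP => /ltW Ge; apply: nG.
  exists P, (c + col j0 G); split=> //; apply: le_trans Ge.
  rewrite le_eqVlt; apply/orP; left; apply/eqP; congr (`|_|).
  by apply/matrixP => i1 j; rewrite !mxE; ring.
Qed.

(** Subtracting the nearest well makes H orthogonal to the infinitesimal rigid motions, so that
    [Qcell] is coercive at H. The Taylor error with coefficient C/4 leaves C/4 of the coefficient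
    C/2. *)
Lemma well_decomposition : exists c0 th : R, [/\ 0 < c0, 0 < th &
  forall G, (W G <= th%:E)%E -> exists P c H,
    [/\ SO P, G = P *m (Z + H) + translation c & c0 * `|H| ^+ 2 <= fine (W G)]].
Proof.
have [C C0 coer] := Qcell_coercive W_ge0 W_zero W_regular W_Hessian.
have C4 : 0 < C / 4 by rewrite divr_gt0.
have [t t0 taylor] := W_taylor W_ge0 W_zero W_regular C4.
pose k : R := (d * N)%:R * (2 * d%:R) * (2 * d%:R) + 1.
have k0 : 0 < k by rewrite ltr_wpDl// !mulr_ge0.
pose e := t / (2 * k).
have e0 : 0 < e by rewrite divr_gt0// mulr_gt0.
have [th th0 near] := near_wells e0.
exists (C / 4), th; split=> // G Gth.
have [P0 [c [SOP0 GPc]]] := near _ Gth.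
have [P [SOP_ Pmin]] := nearest_rotation G.
have oH := nearest_rotation_orthogonal SOP_ Pmin.
(* The nearest rotation beats the rotation [P0] given by [near_wells], so H is small in the
   Frobenius norm; [k] pays for passing between this norm and the sup norm. *)
set H := P^T *m centered G - centered Z in Pmin oH.
have Ht : `|H| < t.
  have h1 := le_trans (mxdot_norm H) (Pmin _ SOP0).
  set H0 := P0^T *m centered G - centered Z in h1.
  have H0E : H0 = centered (P0^T *m (G - (P0 *m Z + translation c))).
    rewrite mulmxBr mulmxDr mul_translation mulmxA; case: (SOP0) => -> _.
    by rewrite mul1mx opprD addrA !centeredB centered_mul centered_translation subr0.
  have h2 : `|H0| <= 2 * (d%:R * e).
    rewrite H0E (le_trans (centered_norm _))// ler_wpM2l//.
    rewrite (le_trans (SO_mul_norm _ (SO_tr SOP0)))// ler_wpM2l//.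
  have h3 : `|H| ^+ 2 < t ^+ 2.
    apply: le_lt_trans h1 _; apply: le_lt_trans (ler_norm _) _.
    apply: le_lt_trans (mxdot_bound _ _) _.
    apply: (@le_lt_trans _ _ (k * e ^+ 2)).
      apply: (@le_trans _ _ ((d * N)%:R * (2 * (d%:R * e)) * (2 * (d%:R * e)))).
        by rewrite ler_pM ?mulr_ge0// ler_wpM2l.
      rewrite /k; have := sqr_ge0 e; move: (d * N)%:R (d%:R : R) => x y.
      by rewrite expr2; nra.
    have -> : k * e ^+ 2 = t ^+ 2 / (4 * k) by rewrite /e; field; rewrite gt_eqF.
    have k1 : 1 <= k by rewrite lerDr !mulr_ge0.
    rewrite ltr_pdivrMr ?mulr_gt0// ltr_pMr ?exprn_gt0//.
    by lra.
  by rewrite -(@ltr_pXn2r _ 2)// ?nnegrE// ltW.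
have GE : G = P *m (Z + H) + translation (barycenter G - P *m barycenter Z).
  have PG : P *m (P^T *m centered G) = centered G by rewrite mulmxA SOP// mul1mx.
  have tB (c1 c2 : 'cV[R]_d) : translation (n := n) (c1 - c2) = translation c1 - translation c2.
    by apply/matrixP => i j; rewrite !mxE.
  rewrite /H mulmxDr mulmxBr PG tB -mul_translation {2}/centered mulmxBr {1}/centered.
  move: (P *m Z) (translation (barycenter G)) (P *m translation _) => a x y.
  by apply/matrixP => i j; rewrite !mxE; ring.
exists P, (barycenter G - P *m barycenter Z), H; split=> //.
have WE : W G = W (Z + H).
  by rewrite {1}GE (W_translation W_frame) (W_rotation W_frame _ SOP_).
rewrite WE; have [_] := taylor _ Ht.
have := coer _ oH; have := mxdot_norm H; have := ler_wpM2l (ltW C0) (mxdot_norm H).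
move: (Qcell Z W H) (fine _) => q w h1 _ h2; rewrite ler_norml => /andP[h3 _].
by lra.
Qed.

End NearWells.

(** * Corner labels and the reduced cell energy *)

Section Corners.
Context {R : realType} {n : nat}.
Local Notation d := n.+2.
Local Notation N := (2 ^ n.+2)%N.
Implicit Types (A : 'M[R]_d) (Z : 'M[R]_(d, N)).

Definition emb (m : nat) (k : 'cV[int]_m) : 'cV[R]_m := map_mx intr k.

Lemma embD m (k k' : 'cV[int]_m) : emb (k + k') = emb k + emb k'.
Proof. exact: map_mxD. Qed.

Lemma embB m (k k' : 'cV[int]_m) : emb (k - k') = emb k - emb k'.
Proof. exact: map_mxB. Qed.

Lemma embE m (k : 'cV[int]_m) i j : emb k i j = (k i j)%:~R.
Proof. by rewrite mxE. Qed.

Lemma emb_inj m : injective (@emb m).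
Proof.
move=> k k' /matrixP E; apply/matrixP => i j; have := E i j.
by rewrite !embE => /eqP; rewrite eqr_int => /eqP.
Qed.

(* Corner j of the cell k (with midpoint A (k + 1/2)) is the lattice point
   A (k + sg j). *)
Definition corner_labels A Z (sg : 'I_N -> 'cV[int]_d) : Prop :=
  [/\ forall j, col j Z = A *m (emb (sg j) - const_mx 2^-1),
      forall j i, sg j i 0 = 0 \/ sg j i 0 = 1,
      forall b : 'I_d -> bool, exists j, forall i, sg j i 0 = (b i)%:Z &
      injective sg].

Lemma corner_labels_exist A Z : A \in unitmx -> corner_enumeration A Z ->
  exists sg, corner_labels A Z sg.
Proof.
move=> unitA [injZ rangeZ].
have uP j : exists u : 'cV[R]_d, A *m u = col j Z /\
    forall i, u i 0 = - 2^-1 \/ u i 0 = 2^-1.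
  have : range (fun j => col j Z) (col j Z) by exists j.
  by rewrite rangeZ => -[u uP uE]; exists u.
have [u uPj] := choice uP.
pose sg j : 'cV[int]_d := \col_i (u j i 0 == 2^-1)%:Z.
have h0 : - 2^-1 == 2^-1 :> R = false by apply/negbTE; rewrite lt_eqF// gtrN// invr_gt0.
have sgu j : u j = emb (sg j) - const_mx 2^-1.
  apply/matrixP => i k; rewrite ord1 !mxE.
  have [_ /(_ i)[]->] := uPj j; rewrite ?h0 ?eqxx /= ?mulr0z ?mulr1z; lra.
exists sg; split.
- by move=> j; rewrite -sgu; have [] := uPj j.
- by move=> j i; rewrite !mxE; case: (_ == _); [right|left].
- move=> b; pose v : 'cV[R]_d := \col_i (if b i then 2^-1 else - 2^-1).
  have : range (fun j => col j Z) (A *m v).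
    by rewrite rangeZ; exists v => // i; rewrite mxE; case: (b i); [right|left].
  case=> j _ ZE; exists j => i; rewrite !mxE.
  have -> : u j = v.
    by have [uE _] := uPj j; rewrite -(mulKmx unitA v) -ZE -uE mulKmx.
  by rewrite mxE; case: (b i); rewrite ?h0 ?eqxx.
- move=> j j' sgE; apply: injZ; have [<- _] := uPj j; have [<- _] := uPj j'.
  by rewrite !sgu sgE.
Qed.

End Corners.

Section ReducedCell.
Context {R : realType} {n : nat}.
Local Notation d := n.+2.
Local Notation N := (2 ^ n.+2)%N.

(* What the lower bound needs to know about a finite function [om] below the
   cell energy: the fracture bound with the bond weights [b], closeness to the
   wells at small energy, and a quadratic lower bound [Q] at [Z] with its
   stress functional [T]. *)
Record reduced_cell (A : 'M[R]_d) (Z : 'M[R]_(d, N)) (j0 : 'I_N) (ji : 'I_d -> 'I_N)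
    (al : R) (b : 'I_N -> 'I_N -> R) (om Q T : 'M[R]_(d, N) -> R) : Prop := {
  rc_al : 0 < al ;
  rc_b : forall s t, 0 <= b s t ;
  rc_ge0 : forall G, 0 <= om G ;
  rc_rotation : forall P G, SO P -> om (P *m G) = om G ;
  rc_translation : forall c G, om (G + translation c) = om G ;
  rc_fracture : forall eta : R, 0 < eta -> exists2 M : R, 0 < M & forall G,
    (1 - eta) * \sum_s \sum_(t | M < `|col s G - col t G|) b s t <= om G ;
  rc_wells : exists c0 th : R, [/\ 0 < c0, 0 < th &
    forall G, om G <= th -> exists P c H,
    [/\ SO P, G = P *m (Z + H) + translation c & c0 * `|H| ^+ 2 <= om G]] ;
  rc_taylor : forall e : R, 0 < e -> exists2 t : R, 0 < t &
    forall H, `|H| < t -> 2^-1 * Q H - e * `|H| ^+ 2 <= om (Z + H) ;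
  rc_TD : forall G H, T (G + H) = T G + T H ;
  rc_TZ : forall a H, T (a *: H) = a * T H ;
  rc_T_translation : forall c, T (translation c) = 0 ;
  rc_T_affine : forall F : 'M[R]_d, T (F *m Z) = al * F ord0 ord0 ;
  rc_QT : forall H r, 2 * r * T H - al * r ^+ 2 <= Q H ;
  rc_strain : exists2 C : R, 0 < C & forall H, `|cell_strain A j0 ji H| ^+ 2 <= C * Q H }.

(** W may be infinite, so [om] is W cut off at a level V. Since V is above every lower bound that is
    required, the cut-off destroys none of them. *)
Lemma reduced_cell_exists (A : 'M[R]_d) (Z : 'M[R]_(d, N)) W beta
    (j0 : 'I_N) (ji : 'I_d -> 'I_N)
    (WI : forall I : {set 'I_N}, 'M[R]_(d, #|I|) -> R) (bp : 'I_N -> 'I_N -> R) :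
  A \in unitmx -> (forall i, col (ji i) Z - col j0 Z = col i A) ->
  cell_energy_assumptions A Z W beta ->
  (forall I G, 0 <= WI I G) ->
  (forall s t, s != t -> 0 <= bp s t /\ bp s t = bp t s) ->
  fracture_asymptotics W WI bp ->
  exists om Q T, reduced_cell A Z j0 ji (alphaA Z W) (half_bond bp) om Q T /\
    forall G, ((om G)%:E <= W G)%E.
Proof.
move=> unitA edges [W0 Wf Wz Wc Wr WH _] WI0 bps Wfr.
have Wb := small_energy_bounded WI0 Wfr.
have [c0 [th [c00 th0 wells]]] := well_decomposition W0 Wf Wz Wc Wr WH Wb.
have [Cb Cb0 bB] := Bcell_bound Wr.
have [T [[TD TZ] Ttr Taff QT]] := stress_functional W0 Wf Wz Wr WH unitA edges.
have [_ [al0 _ _ _ _]] := alphaA_spec W0 Wf Wz Wr WH unitA edges.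
have strain := cell_strain_bound W0 Wf Wz Wr WH edges.
pose b := half_bond bp; have b0 s t : 0 <= b s t by exact: half_bond_ge0.
pose Sb := \sum_s \sum_t b s t.
have Sb0 : 0 <= Sb by do 2!apply: sumr_ge0 => ? _.
(* [Sb] bounds the weight of all bonds, [th] is the threshold of the well decomposition, and [Cb]
   bounds the quadratic form for displacements of norm at most 1. *)
pose V := Sb + th + Cb + 1.
have V1 : th < V /\ Sb <= V /\ Cb <= V by rewrite /V; split; [|split]; lra.
have V0 : 0 < V by apply: lt_trans V1.1.
pose om G := fine (mine (W G) V%:E).
have omE G : (om G)%:E = mine (W G) V%:E.
  rewrite /om fineK//; have := W0 G; case: (W G) => [x| |]//= x0.
    by rewrite -EFin_min.
have om_le G : ((om G)%:E <= W G)%E by rewrite omE ge_min lexx.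
have om_ge x G : x <= V -> (x%:E <= W G)%E -> x <= om G.
  by move=> xV xW; rewrite -lee_fin omE le_min xW lee_fin.
have om_small G x : x < V -> om G <= x -> W G = (om G)%:E.
  move=> xV; rewrite -lee_fin omE ge_min lee_fin [V <= x]leNgt xV orbF => Wx.
  by rewrite min_l// (le_trans Wx)// lee_fin ltW.
exists om, (Qcell Z W), T; split=> //; split=> //.
- by move=> G; apply: om_ge; [exact: ltW|exact: W0].
- by move=> P G SOP_; rewrite /om (W_rotation Wf _ SOP_).
- by move=> c G; rewrite /om (W_translation Wf).
- move=> eta eta0; have [M M0 MW] := fracture_lower_bound W0 WI0 bps Wfr eta0.
  exists M => // G; apply: om_ge; last exact: MW.
  apply: (@le_trans _ _ (1 * \sum_s \sum_(t | M < `|col s G - col t G|) b s t)).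
    rewrite ler_wpM2r ?gerBl ?(ltW eta0)//.
    by do 2!apply: sumr_ge0 => ? _.
  rewrite mul1r (le_trans _ V1.2.1)// ler_sum// => s _.
  by rewrite [leLHS]big_mkcond ler_sum// => t _; case: ifP.
- exists c0, th; split=> // G Gth.
  have WG := om_small _ _ V1.1 Gth.
  have [|P [c [H [SOP_ GE cH]]]] := wells G; first by rewrite WG lee_fin.
  by exists P, c, H; split=> //; move: cH; rewrite WG.
- move=> e e0; have [t t0 tW] := W_taylor W0 Wz Wr e0.
  exists (Num.min 1 t) => [|H]; first by rewrite lt_min ltr01.
  rewrite lt_min => /andP[H1 /tW[Wfin]].
  have := bB H H; rewrite Bcell_diag; move: (Qcell Z W H) => q qB.
  rewrite ler_norml => /andP[h _]; apply: om_ge.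
    have : `|H| ^+ 2 <= 1 by rewrite expr_le1// ltW.
    have := sqr_ge0 `|H|; move: qB; rewrite ler_norml -mulrA -expr2 => /andP[_ h1] h2 h3.
    have h4 : Cb * `|H| ^+ 2 <= Cb by rewrite ler_piMr.
    have h5 : 0 <= e * `|H| ^+ 2 by rewrite mulr_ge0// ltW.
    by apply: le_trans V1.2.2; lra.
  by rewrite -(fineK Wfin) lee_fin; lra.
Qed.

End ReducedCell.

(** * The crack density *)

Section CrackDensity.
Context {R : realType} {n : nat}.
Local Notation d := n.+2.
Local Notation N := (2 ^ n.+2)%N.
Variables (A : 'M[R]_d) (Z : 'M[R]_(d, N)) (sg : 'I_N -> 'cV[int]_d).
Variables (beta : 'cV[R]_d -> R) (bp : 'I_N -> 'I_N -> R).
Hypothesis unitA : A \in unitmx.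
Hypothesis labels : corner_labels A Z sg.
Hypothesis bp_sym : forall s t, s != t -> 0 <= bp s t /\ bp s t = bp t s.
Hypothesis bp_norm : bond_normalization A Z bp beta.
Hypothesis bp_broken : forall P : {set {set 'I_N}}, is_corner_partition P ->
  (1 < #|P|)%N -> 0 < broken_energy bp P.
Implicit Types (xi nu : 'cV[R]_d) (s t : 'I_N).

Local Notation b := (half_bond bp).

Lemma dotDl (u v x : 'cV[R]_d) : dot (u + v) x = dot u x + dot v x.
Proof. by rewrite /dot -big_split; apply: eq_bigr => i _; rewrite mxE mulrDl. Qed.

Lemma dotC (u v : 'cV[R]_d) : dot u v = dot v u.
Proof. by apply: eq_bigr => i _; rewrite mulrC. Qed.

Lemma dotZl (a : R) (u v : 'cV[R]_d) : dot (a *: u) v = a * dot u v.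
Proof. by rewrite /dot mulr_sumr; apply: eq_bigr => i _; rewrite mxE mulrA. Qed.

Lemma dotZr (a : R) (u v : 'cV[R]_d) : dot u (a *: v) = a * dot u v.
Proof. by rewrite dotC dotZl dotC. Qed.

Lemma dotNl (u v : 'cV[R]_d) : dot (- u) v = - dot u v.
Proof. by rewrite -scaleN1r dotZl mulN1r. Qed.

Lemma dotBl (u v x : 'cV[R]_d) : dot (u - v) x = dot u x - dot v x.
Proof. by rewrite dotDl dotNl. Qed.

Lemma dot_sqrB (h : R) (u w : 'cV[R]_d) :
  dot (u - h *: w) (u - h *: w) = dot u u - 2 * h * dot w u + h ^+ 2 * dot w w.
Proof.
rewrite dotBl dotZl (dotC u) (dotC w) !dotBl !dotZl (dotC u w); ring.
Qed.

Lemma dotDr (u v x : 'cV[R]_d) : dot x (u + v) = dot x u + dot x v.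
Proof. by rewrite dotC dotDl !(dotC x). Qed.

Lemma dot_ge0 (u : 'cV[R]_d) : 0 <= dot u u.
Proof. by apply: sumr_ge0 => i _; rewrite -expr2 sqr_ge0. Qed.

Lemma dot_norm (u : 'cV[R]_d) : `|u| ^+ 2 <= dot u u.
Proof.
have := enorm_ge u; rewrite /enorm => h.
rewrite -(sqr_sqrtr (dot_ge0 u)) lerXn2r ?nnegrE ?sqrtr_ge0//.
Qed.

Lemma dot_eq0 (u : 'cV[R]_d) : dot u u = 0 -> u = 0.
Proof.
move=> u0; have := dot_norm u; rewrite u0 => h.
by apply/eqP; rewrite -normr_eq0 -sqrf_eq0 eq_le h sqr_ge0.
Qed.

Lemma dot_e1 xi : dot e1 xi = xi ord0 0.
Proof.
rewrite /dot (bigD1 ord0)//= big1 ?addr0 => [|i i0]; first by rewrite mxE !eqxx mul1r.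
by rewrite mxE (negbTE i0) mul0r.
Qed.

Lemma dot_continuous (u : 'cV[R]_d) : continuous (fun v : 'cV[R]_d => dot u v).
Proof.
by apply: continuous_sum => i _; apply: continuous_scale; exact: coord_continuous.
Qed.

(** The crack density written over ordered pairs of corners of one cell; [crack_densityE] identifies
    the two. In this form it can be compared with cell energies. *)
Definition pair_density xi : R :=
  \sum_s \sum_t b s t * `|dot (col s Z - col t Z) xi|.

Lemma b_ge0 s t : 0 <= b s t. Proof. exact: half_bond_ge0. Qed.

Lemma pair_density_ge0 xi : 0 <= pair_density xi.
Proof. by do 2!apply: sumr_ge0 => ? _; rewrite mulr_ge0// b_ge0. Qed.

Lemma pair_densityZ (a : R) xi : pair_density (a *: xi) = `|a| * pair_density xi.
Proof.
rewrite /pair_density mulr_sumr; apply: eq_bigr => s _.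
by rewrite mulr_sumr; apply: eq_bigr => t _; rewrite dotZr normrM mulrCA.
Qed.

Lemma pair_density_continuous : continuous pair_density.
Proof.
apply: continuous_sum => s _; apply: continuous_sum => t _; apply: continuous_scale.
move=> xi; apply: (continuous_comp (@dot_continuous _ xi)); exact: norm_continuous.
Qed.

Lemma edge_labels : exists (j0 : 'I_N) (ji : 'I_d -> 'I_N),
  [/\ forall i, col (ji i) Z - col j0 Z = col i A,
     sg j0 = 0 & forall i, sg (ji i) = delta_mx i 0].
Proof.
have [ZE _ sgS _] := labels.
have [j0 j0P] := sgS (fun=> false).
have [ji jiP] := choice (fun i => sgS (pred1 i)).
have sg0 : sg j0 = 0 by apply/matrixP => k l; rewrite ord1 j0P mxE.
have sgi i : sg (ji i) = delta_mx i 0.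
  by apply/matrixP => k l; rewrite ord1 jiP !mxE eqxx andbT /=; case: (k == i).
exists j0, ji; split=> // i; rewrite !ZE -mulmxBr sg0 sgi.
have -> : emb (delta_mx i 0) - const_mx 2^-1 - (emb 0 - const_mx 2^-1) = delta_mx i 0 :> 'cV[R]_d.
  by apply/matrixP => k l; rewrite !mxE ord1; case: (_ && _); rewrite /= ?mulr1z ?mulr0z; ring.
by rewrite -colE.
Qed.

(** If the density vanished, no bond of positive weight would join corners of different height along
    xi. The partition into level sets would then have zero broken energy; it has at least two blocks
    because the edges of the cell span the space. *)
Lemma pair_density_gt0 xi : xi != 0 -> 0 < pair_density xi.
Proof.
move=> xi0; rewrite lt_def pair_density_ge0 andbT; apply/negP => /eqP pd0.
have b0 s t : dot (col s Z) xi != dot (col t Z) xi -> b s t = 0.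
  move=> st; have s0 u : 0 <= \sum_t b u t * `|dot (col u Z - col t Z) xi|.
    by apply: sumr_ge0 => v _; rewrite mulr_ge0// b_ge0.
  have /eqP := psumr_eq0P (fun u _ => s0 u) pd0 (i := s) isT.
  rewrite psumr_eq0 => [/allP/(_ t)|v _]; last by rewrite mulr_ge0// b_ge0.
  rewrite mem_index_enum => /(_ isT)/=; rewrite mulf_eq0 normr_eq0 dotBl subr_eq0.
  by rewrite (negbTE st) orbF => /eqP.
pose f s := dot (col s Z) xi.
have partP := preim_partitionP f [set: 'I_N]%SET.
set P := preim_partition f _ in partP.
have /and3P[/eqP coverP trivP _] := partP.
have pb s t : (t \in finset.pblock P s) = (f s == f t).
  rewrite /P /preim_partition pblock_equivalence_partition ?inE// => x y z _ _ _.
  by split=> [|/eqP ->].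
have inP s : finset.pblock P s \in P by apply: pblock_mem; rewrite coverP inE.
have [j0 [ji [edges _ _]]] := edge_labels.
have [i fi] : exists i, f (ji i) != f j0.
  apply: contrapT => nf.
  have fE i : f (ji i) = f j0 by apply/eqP; apply: contrapT => h; apply: nf; exists i; apply/negP.
  have : A^T *m xi = 0.
    apply/matrixP => i k; rewrite !mxE ord1.
    transitivity (dot (col i A) xi); last first.
      by rewrite -edges dotBl; apply/eqP; rewrite subr_eq0; apply/eqP; exact: fE.
    by apply: eq_bigr => l _; rewrite !mxE.
  move/(congr1 (mulmx (invmx A)^T)); rewrite mulmxA -trmx_mul mulmxV// trmx1 mul1mx mulmx0.
  by move/eqP; rewrite (negbTE xi0).
have P2 : (1 < #|P|)%N.
  apply/card_gt1P; exists (finset.pblock P (ji i)), (finset.pblock P j0); split=> //.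
  apply: contra fi => /eqP E; rewrite -pb E pb eqxx//.
have := bp_broken partP P2; rewrite broken_energy_half// big1 ?ltxx// => s _.
by apply: big1 => t; rewrite pb => /b0.
Qed.

Lemma sphere_compact (f : 'cV[R]_d -> R) : continuous f ->
  (exists m, is_min [set f xi | xi in [set xi | enorm xi = 1]] m) /\
  (exists m, is_max [set f xi | xi in [set xi | enorm xi = 1]] m).
Proof.
move=> fc; pose S := [set xi : 'cV[R]_d | dot xi xi = 1].
have SE xi : enorm xi = 1 <-> dot xi xi = 1.
  rewrite /enorm; split=> [/(congr1 (fun x => x ^+ 2))|->]; last exact: sqrtr1.
  by rewrite sqr_sqrtr ?dot_ge0// expr1n.
have S1 xi : S xi -> `|xi| <= 1.
  by move=> Sxi; rewrite -(@expr_le1 _ 2)//; have := dot_norm xi; rewrite Sxi.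
have S0 : S !=set0 by exists e1; rewrite /S/= dot_e1 mxE !eqxx.
have Scl : closed S.
  apply: closed_levelset; apply: continuous_sum => i _.
  by apply: continuous_mul; exact: coord_continuous.
have Nfc : continuous (fun x => - 1 * f x) by exact: continuous_scale.
split.
  have [x Sx xmin] := mx_EVT_min S0 S1 Scl fc.
  exists (f x); split; first by exists x => //; apply/SE.
  by move=> _ [y /SE Sy <-]; exact: xmin.
have [x Sx xmin] := mx_EVT_min S0 S1 Scl Nfc.
exists (f x); split; first by exists x => //; apply/SE.
by move=> _ [y /SE Sy <-]; have := xmin y Sy; rewrite !mulN1r lerN2.
Qed.

Lemma is_min_unique (disp : Order.disp_t) (T : porderType disp) (S : set T) (x y : T) :
  is_min S x -> is_min S y -> x = y.
Proof.
by move=> [Sx lx] [Sy ly]; apply/eqP; rewrite eq_le lx//= ly.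
Qed.

Lemma all_bonds_finite : finite_set (all_bonds A).
Proof.
pose g (f : {ffun 'I_d -> 'I_3}) : 'cV[R]_d := A *m \col_i ((f i)%:R - 1).
apply: (@sub_finite_set _ _ (g @` setT)); last by apply: finite_image; exact: finite_finset.
move=> _ [[t tP <-] _]; pose h i : 'I_3 :=
  if t i 0 == -1 then ord0 else if t i 0 == 0 then lift ord0 ord0 else ord_max.
exists [ffun i => h i] => //; rewrite /g; congr (_ *m _).
apply/matrixP => i k; rewrite ord1 !mxE ffunE /h.
have := tP i; rewrite !inE => /or3P[]/eqP ->; rewrite ?eqxx.
- by rewrite sub0r.
- by rewrite eq_sym oppr_eq0 oner_eq0 /= subrr.
- rewrite -subr_eq0 opprK -(natrD _ 1 1) pnatr_eq0 /= oner_eq0.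
  by rewrite (natrD _ 1 1) addrK.
Qed.

(** Two labels in {0, 1} are determined by their difference unless it is 0, in which case they agree
    and their common value is free. *)
Lemma sign_difference (x y : int) (u : R) : x = 0 \/ x = 1 -> y = 0 \/ y = 1 ->
  u \in [:: -1; 0; 1] -> x%:~R - y%:~R = u ->
  x = (u == 1) || (u == 0) && (x == 1) /\ y = (u == -1) || (u == 0) && (x == 1).
Proof.
have h0 : (1 == 0 :> R) = false by rewrite oner_eq0.
have h1 : (-1 == 0 :> R) = false by rewrite oppr_eq0 oner_eq0.
have h2 : (1 == -1 :> R) = false by rewrite -subr_eq0 opprK -(natrD _ 1 1) pnatr_eq0.
have h3 : (0 == 1 :> R) = false by rewrite eq_sym.
have h4 : (0 == -1 :> R) = false by rewrite eq_sym.
have h5 : (-1 == 1 :> R) = false by rewrite eq_sym.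
by move=> [->|->] [->|->] _ <-; rewrite ?mulr0z ?mulr1z ?subrr ?sub0r ?subr0;
  rewrite ?eqxx ?h0 ?h1 ?h2 ?h3 ?h4 ?h5.
Qed.

(** A bond with k nonzero entries is realised by 2^(d-k) pairs of corners, and this number cancels
    the factor 2^(k-d) of the normalisation. *)
Lemma half_bond_sum nu : all_bonds A nu ->
  \sum_s \sum_(t | col s Z - col t Z == nu) b s t = beta nu.
Proof.
move=> [[u uP nuE] nu0]; have [ZE sg01 sgS sgI] := labels.
have u0 : u != 0 by apply: contra_not_neq nu0 => u0; rewrite -nuE u0 mulmx0.
pose Z0 : {set 'I_d} := [set i | u i 0 == 0]%SET.
pose k := #|[pred i | u i 0 != 0]|.
have kZ0 : (k + #|Z0| = d)%N.
  have E := cardsC Z0; rewrite card_ord addnC in E; rewrite -[RHS]E; congr (_ + _)%N.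
  by apply: eq_card => i; rewrite !inE.
have k1 : (1 <= k <= d)%N.
  apply/andP; split; last by apply: leq_trans (leq_addr _ _) (eq_leq kZ0).
  apply/card_gt0P.
  have [i ui] : exists i, u i 0 != 0.
    apply: contrapT => nu'; move: u0; apply/negP; rewrite negbK; apply/eqP.
    apply/matrixP => i l; rewrite ord1 mxE; apply/eqP.
    by apply: contrapT => h; apply: nu'; exists i; apply/negP.
  by exists i; rewrite inE.
have bnu : bonds A k nu by exists u.
have [beta0 bpE] := bp_norm k1 bnu.
have nuN0 : nu != 0 by apply/eqP => h; apply: nu0; rewrite h.
have diffE s t : (col s Z - col t Z == nu) =
    [forall i, (sg s i 0)%:~R - (sg t i 0)%:~R == u i 0].
  rewrite !ZE -nuE -mulmxBr; apply/eqP/forallP => [/(congr1 (mulmx (invmx A)))|E].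
    rewrite !mulKmx// => E i; have /matrixP/(_ i 0) := E; rewrite !mxE => <-.
    by apply/eqP; ring.
  congr (_ *m _); apply/matrixP => i l; rewrite ord1 !mxE -(eqP (E i)); ring.
pose lab (f : 'I_d -> bool) := sval (cid (sgS f)).
have labP f i : sg (lab f) i 0 = (f i)%:Z by rewrite /lab; case: cid.
(* The pairs realising [nu] correspond to the sets [B] of zero coordinates of [u] at which both
   corners have label 1; the labels at the other coordinates are forced. *)
pose phi (B : {set 'I_d}) := (lab (fun i => (u i 0 == 1) || (i \in B)),
  lab (fun i => (u i 0 == -1) || (i \in B))).
have one_neq : (1 == 0 :> R) = false /\ (-1 == 0 :> R) = false /\
   (1 == -1 :> R) = false /\ (-1 == 1 :> R) = false.
  rewrite oppr_eq0 oner_eq0 -subr_eq0 opprK (eq_sym (-1)) -(subr_eq0 1) opprK.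
  by rewrite -(natrD _ 1 1) pnatr_eq0.
have [e1_ [e2 [e3 e4]]] := one_neq.
have e5 : (0 == 1 :> R) = false by rewrite eq_sym.
have e6 : (0 == -1 :> R) = false by rewrite eq_sym.
have phi_inj : {in powerset Z0 &, injective phi}.
  move=> B B'; rewrite !powersetE => /fintype.subsetP BZ /fintype.subsetP BZ' [E _].
  have {}E i : (u i 0 == 1) || (i \in B) = ((u i 0 == 1) || (i \in B')).
    by have := congr1 (fun j => sg j i 0) E; rewrite !labP; do 2!case: (_ || _).
  apply/setP => i; have [ui|ui] := eqVneq (u i 0) 0.
    by have := E i; rewrite ui eq_sym e1_.
  apply/idP/idP => [/BZ|/BZ']; by rewrite inE (negbTE ui).
have imE : [set st : 'I_N * 'I_N | col st.1 Z - col st.2 Z == nu]%SET =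
    (phi @: powerset Z0)%SET.
  apply/setP => -[s t]; rewrite inE /= diffE; apply/forallP/imsetP.
    move=> E; exists [set i | (u i 0 == 0) && (sg s i 0 == 1)]%SET.
      by rewrite powersetE; apply/fintype.subsetP => i; rewrite !inE => /andP[].
    congr (_, _); apply: sgI; apply/matrixP => i l; rewrite ord1 labP inE.
      by have [] := sign_difference (sg01 s i) (sg01 t i) (uP i) (eqP (E i)).
    by have [] := sign_difference (sg01 s i) (sg01 t i) (uP i) (eqP (E i)).
  case=> B; rewrite powersetE => /fintype.subsetP BZ [-> ->] i.
  rewrite !labP; have := uP i; rewrite !inE => /or3P[]/eqP ui; rewrite ui ?eqxx ?e1_ ?e2 ?e3 ?e4 /=.
  - have -> : (i \in B) = false.
      by apply/negP => /BZ; rewrite inE ui e2.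
    by rewrite mulr0z sub0r.
  - by rewrite !(eq_sym 0) e1_ e2 /= subrr.
  - have -> : (i \in B) = false.
      by apply/negP => /BZ; rewrite inE ui e1_.
    by rewrite mulr0z subr0.
rewrite pair_big_dep/=.
transitivity (\sum_(st in [set st : 'I_N * 'I_N | col st.1 Z - col st.2 Z == nu]%SET)
    (2 ^+ k / 2 ^+ d * beta nu)).
  apply: eq_big => [st|st /eqP E]; first by rewrite inE.
  rewrite -(bpE st.1 st.2 E) /half_bond; case: eqVneq => // st12.
  by move: nuN0; rewrite -E st12 subrr eqxx.
rewrite sumr_const imE card_in_imset// card_powerset -[_ *+ (2 ^ _)%N]mulr_natr natrX.
have -> : 2 ^+ d = 2 ^+ k * 2 ^+ #|Z0| :> R by rewrite -exprD; congr (_ ^+ _).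
by field; rewrite !expf_neq0.
Qed.

Lemma crack_densityE xi : crack_density A beta xi = pair_density xi.
Proof.
rewrite /crack_density fsbig_finite/=; last exact: all_bonds_finite.
set r := finmap.enum_fset _.
have rP nu : nu \in r -> all_bonds A nu.
  by rewrite /r in_fset_set ?inE//; exact: all_bonds_finite.
transitivity (\sum_(nu <- r) \sum_s \sum_t
    (if col s Z - col t Z == nu then b s t * `|dot nu xi| else 0)).
  rewrite big_seq [RHS]big_seq; apply: eq_bigr => nu /rP nuB.
  rewrite -(half_bond_sum nuB) mulr_suml; apply: eq_bigr => s _.
  by rewrite mulr_suml -big_mkcond.
rewrite exchange_big; apply: eq_bigr => s _; rewrite exchange_big.
apply: eq_bigr => t _ /=; have [->|st] := eqVneq s t.
  by rewrite /half_bond eqxx mul0r big1// => nu _; rewrite mul0r if_same.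
pose nu := col s Z - col t Z.
have nur : nu \in r.
  rewrite /r in_fset_set ?inE; last exact: all_bonds_finite.
  have [ZE sg01 sgS sgI] := labels; split.
    exists (\col_i ((sg s i 0)%:~R - (sg t i 0)%:~R)) => [i|].
      rewrite mxE !inE; have [->|->] := sg01 s i; have [->|->] := sg01 t i.
      - by rewrite subrr eqxx orbT.
      - by rewrite mulr0z sub0r eqxx.
      - by rewrite mulr0z subr0 eqxx !orbT.
      - by rewrite subrr eqxx orbT.
    rewrite /nu !ZE -mulmxBr; congr (_ *m _); apply/matrixP => i k.
    by rewrite ord1 !mxE; ring.
  rewrite /= /nu !ZE -mulmxBr => /(congr1 (mulmx (invmx A))); rewrite mulKmx// mulmx0.
  move=> E; move: st; apply/negP; rewrite negbK; apply/eqP; apply: sgI; apply: (@emb_inj R).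
  by apply/eqP; rewrite -subr_eq0 -E; apply/eqP/matrixP => i k; rewrite !mxE; ring.
rewrite (bigD1_seq nu)//= ?eqxx ?finmap.fset_uniq// big1 ?addr0// => nu' nn'.
by rewrite eq_sym (negbTE nn').
Qed.

Lemma crack_density_pair : crack_density A beta = pair_density.
Proof. by apply/funext => xi; exact: crack_densityE. Qed.

Lemma surface_constants : [/\ 0 < M1 A beta,
  forall xi, M1 A beta * enorm xi <= pair_density xi &
  pair_density e1 <= M2 A beta].
Proof.
have [exm exM] := sphere_compact pair_density_continuous.
have := xgetPex 0 exm; have := xgetPex 0 exM.
rewrite -/(M1 A beta) -crack_density_pair -/(M2 A beta) -/(M1 A beta) crack_density_pair.
move: (M1 A beta) (M2 A beta) => m M [[xM _ _] MU] [[xm xm1 mE] mL].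
have m0 : 0 < m.
  rewrite -mE; apply: pair_density_gt0; apply: contra_eq_neq xm1 => ->.
  by rewrite /enorm -[X in dot X _](scale0r 0) dotZl mul0r sqrtr0 eq_sym oner_eq0.
split=> //.
  move=> xi; have [->|xi0] := eqVneq xi 0.
    by rewrite /enorm -[X in dot X _](scale0r 0) dotZl mul0r sqrtr0 mulr0 pair_density_ge0.
  have e0 : 0 < enorm xi by apply: lt_le_trans (enorm_ge xi); rewrite normr_gt0.
  have : m <= pair_density ((enorm xi)^-1 *: xi).
    apply: mL; exists ((enorm xi)^-1 *: xi) => //=.
    rewrite /enorm dotZl dotZr mulrA -expr2 exprVn sqr_sqrtr ?dot_ge0// mulVf ?sqrtr1//.
    by apply/eqP => /dot_eq0/eqP; rewrite (negbTE xi0).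
  by rewrite pair_densityZ ger0_norm ?invr_ge0 ?(ltW e0)// mulrC ler_pdivlMr.
by apply: MU; exists e1 => //=; rewrite /enorm dot_e1 mxE !eqxx sqrtr1.
Qed.

(** By homogeneity it suffices to minimise over vectors with first entry 1. Outside a ball slightly
    larger than M2 / M1 the density exceeds its value at e_1, so a minimiser exists. The same
    comparison bounds its length by M2 / M1; this controls the inclination of the crack plane. *)
Lemma surface_energy_direction : exists B xi0,
  [/\ 0 < B, betaA A beta = B%:E, xi0 ord0 0 = 1, pair_density xi0 = B &
      enorm xi0 <= M2 A beta / M1 A beta] /\
  forall xi, B * `|xi ord0 0| <= pair_density xi.
Proof.
have [m0 mP MP] := surface_constants.
have e10 : (e1 : 'cV[R]_d) ord0 0 = 1 by rewrite mxE !eqxx.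
pose rho := M2 A beta / M1 A beta + 1.
have e1rho : `|e1 : 'cV[R]_d| <= rho.
  rewrite (le_trans (enorm_ge _))// /rho (@le_trans _ _ (M2 A beta / M1 A beta)) ?lerDl//.
  by rewrite ler_pdivlMr// mulrC (le_trans (mP _)).
pose K := [set xi : 'cV[R]_d | xi ord0 0 = 1 /\ `|xi| <= rho].
have Kcl : closed K.
  apply: (@closedI _ [set xi : 'cV[R]_d | xi ord0 0 = 1] [set xi | `|xi| <= rho]).
    by apply: closed_levelset; exact: coord_continuous.
  by apply: closed_sublevel; exact: norm_continuous.
have [xi0 [xi01 xi0r] ximin] := mx_EVT_min (ex_intro K e1 (conj e10 e1rho))
  (fun x (Kx : K x) => Kx.2) Kcl pair_density_continuous.
pose B := pair_density xi0.
have xi0n0 : xi0 != 0.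
  by apply: contra_eq_neq xi01 => ->; rewrite mxE eq_sym oner_eq0.
have B0 : 0 < B by exact: pair_density_gt0.
have Be1 : B <= M2 A beta by apply: le_trans MP; apply: ximin; split.
have B1 xi : xi ord0 0 = 1 -> B <= pair_density xi.
  move=> xi1; have [le|lt] := leP `|xi| rho; first exact: ximin.
  rewrite (le_trans Be1)// (le_trans _ (mP xi))// mulrC -ler_pdivrMr//.
  rewrite (le_trans _ (enorm_ge xi))// (le_trans _ (ltW lt))// /rho.
  by rewrite lerDl.
have Bxi xi : B * `|xi ord0 0| <= pair_density xi.
  have [->|x0] := eqVneq (xi ord0 0) 0; first by rewrite normr0 mulr0 pair_density_ge0.
  have := B1 ((xi ord0 0)^-1 *: xi); rewrite mxE mulVf// => /(_ erefl).
  by rewrite pair_densityZ normfV mulrC ler_pdivlMr ?normr_gt0.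
exists B, xi0; split=> //; split=> //; last first.
  rewrite ler_pdivlMr// mulrC (le_trans (mP _))//.
have minB : is_min [set crack_quotient A beta xi | xi in [set xi | xi != 0]] B%:E.
  split.
    exists xi0 => //; rewrite /crack_quotient dot_e1 xi01 oner_eq0 crack_densityE.
    by rewrite normr1 divr1.
  move=> _ [xi xi0' <-]; rewrite /crack_quotient dot_e1 crack_densityE.
  case: eqVneq => [//|x0]; first by rewrite leey.
  by rewrite lee_fin ler_pdivlMr ?normr_gt0.
exact: (is_min_unique (xgetPex 0%E (ex_intro _ _ minB))).
Qed.

(* The first variation of |B e1 - q|^2 over the zonotope of the vectors q shows
   that a nearest point q has B e1 - q = 0, since B |x_0| <= pair_density x. *)
Lemma calibration (B : R) : 0 <= B -> (forall xi, B * `|xi ord0 0| <= pair_density xi) ->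
  exists Lam : 'I_N -> 'I_N -> R, (forall s t, `|Lam s t| <= b s t) /\
    \sum_s \sum_t Lam s t *: (col s Z - col t Z) = B *: e1.
Proof.
move=> B0 Bxi.
pose q (L : 'M[R]_N) := \sum_s \sum_t L s t *: (col s Z - col t Z).
pose v (L : 'M[R]_N) := B *: e1 - q L.
pose K := [set L : 'M[R]_N | forall s t, `|L s t| <= b s t].
pose Sb := \sum_s \sum_t b s t.
have Sb0 : 0 <= Sb by do 2!apply: sumr_ge0 => ? _; exact: b_ge0.
have Kb L : K L -> `|L| <= Sb.
  move=> KL; apply: mx_norm_le => // s t; rewrite (le_trans (KL s t))// /Sb (bigD1 s)//=.
  rewrite (bigD1 t)//= -addrA lerDl addr_ge0//; first by apply: sumr_ge0 => ? _; exact: b_ge0.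
  by do 2!apply: sumr_ge0 => ? _; exact: b_ge0.
have Kcl : closed K.
  apply: closed_forall => s; apply: closed_forall => t; apply: closed_sublevel => L.
  by apply: (continuous_comp (@coord_continuous _ _ _ s t L)); exact: norm_continuous.
have K0 : K !=set0.
  by exists 0 => s t; rewrite mxE normr0 b_ge0.
have qC i : continuous (fun L => v L i 0).
  have -> : (fun L => v L i 0) = (fun L => B * e1 i 0 + - 1 * \sum_s \sum_t (col s Z - col t Z) i 0 * L s t).
    apply/funext => L; rewrite !mxE mulN1r; congr (_ - _).
    rewrite summxE; apply: eq_bigr => s _; rewrite summxE; apply: eq_bigr => t _.
    by rewrite [LHS]mxE mulrC.
  apply: continuous_add; first by move=> x; exact: cst_continuous.
  apply: continuous_scale; apply: continuous_sum => s _; apply: continuous_sum => t _.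
  by apply: continuous_scale; exact: coord_continuous.
have fC : continuous (fun L => dot (v L) (v L)).
  by apply: continuous_sum => i _; exact: continuous_mul.
have [L KL Lmin] := mx_EVT_min K0 Kb Kcl fC.
(* These signs maximise the product with [v L] over the zonotope, and the maximum is the pair
   density of [v L]. *)
pose L' : 'M[R]_N := \matrix_(s, t) (b s t * Num.sg (dot (col s Z - col t Z) (v L))).
have L'pd : dot (q L') (v L) = pair_density (v L).
  transitivity (\sum_s \sum_t L' s t * dot (col s Z - col t Z) (v L)).
    rewrite /q (big_morph (fun x => dot x (v L)) (fun x y => dotDl x y _) (_ : _ = 0)); last first.
      by rewrite -(scale0r 0) dotZl mul0r.
    apply: eq_bigr => s _.
    rewrite (big_morph (fun x => dot x (v L)) (fun x y => dotDl x y _) (_ : _ = 0)); last first.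
      by rewrite -(scale0r 0) dotZl mul0r.
    by apply: eq_bigr => t _; rewrite dotZl.
  apply: eq_bigr => s _; apply: eq_bigr => t _; rewrite mxE -mulrA; congr (_ * _).
  by rewrite normrEsg.
have key (h : R) : 0 < h <= 1 -> 2 * dot (q L' - q L) (v L) <= h * dot (q L' - q L) (q L' - q L).
  move=> /andP[h0 h1]; pose Lh := L + h *: (L' - L).
  have KLh : K Lh.
    move=> s t; rewrite !mxE.
    have -> : L s t + h * (b s t * Num.sg (dot (col s Z - col t Z) (v L)) - L s t) =
      (1 - h) * L s t + h * (b s t * Num.sg (dot (col s Z - col t Z) (v L))) by ring.
    rewrite (le_trans (ler_normD _ _))// !normrM ger0_norm ?subr_ge0// (ger0_norm (ltW h0)).
    rewrite (ger0_norm (b_ge0 s t)).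
    have : (1 - h) * `|L s t| <= (1 - h) * b s t by rewrite ler_wpM2l ?subr_ge0.
    have : h * (b s t * `|Num.sg (dot (col s Z - col t Z) (v L))|) <= h * b s t.
      rewrite ler_wpM2l ?(ltW h0)// ler_piMr ?b_ge0// normr_sg.
      by case: (_ != _).
    by move=> u1 u2; lra.
  have vE : v Lh = v L - h *: (q L' - q L).
    rewrite /v -addrA -opprD; congr (_ - _).
    rewrite /q -sumrB scaler_sumr -big_split; apply: eq_bigr => s _.
    rewrite -sumrB scaler_sumr -big_split; apply: eq_bigr => t _ /=.
    by rewrite -scalerBl scalerA -scalerDl !mxE.
  have := Lmin _ KLh; rewrite vE dot_sqrB.
  move: (dot (q L' - q L) (v L)) (dot (q L' - q L) (q L' - q L)) (dot (v L) (v L)).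
  by move=> x y z H; rewrite -(ler_pM2l h0); nra.
have le0 : dot (q L' - q L) (v L) <= 0.
  set x := dot _ _ in key *; set y := dot _ _ in key.
  have y0 : 0 <= y by exact: dot_ge0.
  rewrite leNgt; apply/negP => x0.
  have y1 : 0 < y + x by lra.
  have := key (x / (y + x)); rewrite divr_gt0// ler_pdivrMr// mul1r lerDr y0 => /(_ isT).
  rewrite mulrAC ler_pdivlMr// => h.
  have : 0 < x * (y + 2 * x) by rewrite mulr_gt0//; lra.
  by nra.
have v0 : v L = 0.
  apply: dot_eq0; apply/eqP; rewrite eq_le dot_ge0 andbT.
  have := Bxi (v L); move: le0; rewrite dotBl L'pd.
  have -> : dot (q L) (v L) = B * v L ord0 0 - dot (v L) (v L).
    by rewrite -dot_e1 -dotZl -dotBl {2}/v opprB addrC subrK.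
  have := ler_norm (v L ord0 0); move: (v L ord0 0) (pair_density _) (dot _ _) => x y z.
  move=> h1 h2 h3; have : B * x <= B * `|x| by rewrite ler_wpM2l.
  by lra.
exists (fun s t => L s t); split=> //.
by apply/eqP; rewrite eq_sym -subr_eq0; apply/eqP.
Qed.
End CrackDensity.

(** * Counting lattice points *)

Section FiniteSums.
Context {R : realType} {T : choiceType}.
Implicit Types (S : set T) (f g : T -> R).

(** Meant for finite sets, as [fset_set] of an infinite set is empty; this explains the finiteness
    assumptions below. *)
Definition fsum S f : R := \sum_(k <- fset_set S) f k.
Definition cnt S : R := fsum S (fun=> 1).

Lemma fsum_eq S f g : finite_set S -> (forall k, S k -> f k = g k) -> fsum S f = fsum S g.
Proof.
move=> fS fg; rewrite /fsum big_seq [RHS]big_seq; apply: eq_bigr => k.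
by rewrite in_fset_set// inE => /fg.
Qed.

Lemma ler_fsum S f g : finite_set S -> (forall k, S k -> f k <= g k) -> fsum S f <= fsum S g.
Proof.
move=> fS fg; rewrite /fsum big_seq [leRHS]big_seq; apply: ler_sum => k.
by rewrite in_fset_set// inE => /fg.
Qed.

Lemma fsum_ge0 S f : finite_set S -> (forall k, S k -> 0 <= f k) -> 0 <= fsum S f.
Proof.
move=> fS f0; rewrite /fsum big_seq; apply: sumr_ge0 => k.
by rewrite in_fset_set// inE => /f0.
Qed.

Lemma fsumD S f g : fsum S (fun k => f k + g k) = fsum S f + fsum S g.
Proof. exact: big_split. Qed.

Lemma fsumB S f g : fsum S (fun k => f k - g k) = fsum S f - fsum S g.
Proof. exact: sumrB. Qed.

Lemma fsumZ S (a : R) f : fsum S (fun k => a * f k) = a * fsum S f.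
Proof. by rewrite /fsum mulr_sumr. Qed.

Lemma fsum_const S (a : R) : fsum S (fun=> a) = a * cnt S.
Proof. by rewrite /cnt -fsumZ; apply: eq_bigr => k _; rewrite mulr1. Qed.

Lemma cntE S : cnt S = (#|` fset_set S|)%:R.
Proof. by rewrite card_fset_sum1 natr_sum. Qed.

Lemma cnt_ge0 S : 0 <= cnt S. Proof. by rewrite cntE ler0n. Qed.

Lemma fsum_cond S (P : set T) f : finite_set S ->
  fsum (S `&` P) f = fsum S (fun k => if `[< P k >] then f k else 0).
Proof.
move=> fS; rewrite /fsum -big_mkcond [RHS]big_fset_condE; congr (\sum_(k <- enum_fset _) _).
apply/fsetP => k; rewrite !inE in_fset_set; last exact: finite_setIl.
by rewrite in_fset_set// in_setI; congr (_ && _); apply/idP/asboolP; rewrite inE.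
Qed.

Lemma fsum_le_set S S' f : finite_set S' -> S `<=` S' -> (forall k, S' k -> 0 <= f k) ->
  fsum S f <= fsum S' f.
Proof.
move=> fS SS' f0; have -> : S = S' `&` S by rewrite setIC; apply/esym/setIidPl.
rewrite fsum_cond//; apply: ler_fsum => // k Sk; case: ifP => // _; exact: f0.
Qed.

Lemma cnt_le S S' : finite_set S' -> S `<=` S' -> cnt S <= cnt S'.
Proof. by move=> fS SS'; apply: fsum_le_set. Qed.

Lemma fsum_setU S S' f : finite_set S -> finite_set S' -> S `&` S' = set0 ->
  fsum (S `|` S') f = fsum S f + fsum S' f.
Proof.
move=> fS fS' dis; rewrite /fsum -big_cat; apply: perm_big; apply: uniq_perm.
- exact: fset_uniq.
- rewrite cat_uniq !fset_uniq andbT /=; apply/hasPn => k.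
  rewrite in_fset_set// inE => S'k; rewrite /= in_fset_set//; apply/negP; rewrite inE => Sk.
  by have : (S `&` S') k by []; rewrite dis.
- move=> k; rewrite mem_cat !in_fset_set ?finite_setU//.
  by apply/idP/orP; rewrite !inE.
Qed.

Lemma fsum_fiber (I : finType) (h : T -> I) S f : finite_set S ->
  fsum S f = \sum_(i : I) fsum (S `&` [set k | h k = i]) f.
Proof.
move=> fS; under [RHS]eq_bigr do rewrite fsum_cond//.
rewrite /fsum exchange_big; apply: eq_bigr => k _ /=.
rewrite (bigD1 (h k))//= asboolT// big1 ?addr0// => i ik.
by rewrite asboolF// => E; rewrite E eqxx in ik.
Qed.

Lemma exchange_fsum (I : Type) (r : seq I) (P : pred I) S (F : I -> T -> R) :
  \sum_(i <- r | P i) fsum S (F i) = fsum S (fun k => \sum_(i <- r | P i) F i k).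
Proof. exact: exchange_big. Qed.

Lemma fsum_norm S f : `|fsum S f| <= fsum S (fun k => `|f k|).
Proof. exact: ler_norm_sum. Qed.

Lemma fsum1 x f : fsum [set x] f = f x.
Proof. by rewrite /fsum fset_set1 big_seq_fset1. Qed.

End FiniteSums.

Lemma fsum_image {R : realType} (T T' : choiceType) (g : T -> T') (S : set T) (f : T' -> R) :
  injective g -> finite_set S -> fsum (g @` S) f = fsum S (f \o g).
Proof.
move=> gi fS; rewrite /fsum fset_set_image//.
by rewrite big_imfset//= => x y _ _; exact: gi.
Qed.

Lemma exchange_fsum2 {R : realType} (T T' : choiceType) (S : set T) (S' : set T') (f : T -> T' -> R) :
  fsum S (fun x => fsum S' (f x)) = fsum S' (fun y => fsum S (fun x => f x y)).
Proof. exact: exchange_big. Qed.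

Section IntCounting.
Context {R : realType}.
Implicit Types (T : set int).

Lemma seq_int_min (r : seq int) : r != [::] -> exists2 a, a \in r & {in r, forall t, a <= t}.
Proof.
elim: r => // x r IH _; have [->|/IH[a ar amin]] := eqVneq r [::].
  by exists x; rewrite ?inE// => t; rewrite inE => /eqP ->.
have [ax|xa] := leP a x.
  by exists a; rewrite ?inE ?ar ?orbT// => t; rewrite inE => /orP[/eqP ->//|/amin].
exists x; rewrite ?inE ?eqxx// => t; rewrite inE => /orP[/eqP ->//|/amin].
exact/le_trans/ltW.
Qed.

Lemma int_cnt_le T : finite_set T -> T !=set0 -> exists a b, [/\ T a, T b, a <= b &
  cnt T <= (b - a)%:~R + 1 :> R].
Proof.
move=> fT [t0 Tt0]; have inT t : (t \in fset_set T : bool) = (t \in T) by rewrite in_fset_set.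
set F : seq int := fset_set T.
have F0 : F != [::].
  apply/eqP => F0; have : t0 \in (fset_set T : seq int) by rewrite inT inE.
  by rewrite -/F F0.
have [a aF amin] := seq_int_min F0.
have mF : [seq - t | t <- F] != [::] by move: F0; rewrite -!size_eq0 size_map.
have [b' /mapP[b bF ->] bmax] := seq_int_min mF.
have ab : a <= b by exact: amin.
exists a, b; split=> //; first by move: aF; rewrite /F inT inE.
  by move: bF; rewrite /F inT inE.
rewrite cntE.
have -> : (b - a)%:~R + 1 = (`|b - a|%N + 1)%:R :> R.
  by rewrite natrD natr_absz ger0_norm// subr_ge0.
rewrite ler_nat.
have sub : {subset F <= [seq a + i%:Z | i <- iota 0 (`|b - a|%N + 1)]}.
  move=> t tF; apply/mapP; exists `|t - a|%N; rewrite ?mem_iota/=.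
    have h1 := amin t tF; have : - b <= - t by apply: bmax; apply: map_f.
    by lia.
  by have h1 := amin t tF; lia.
have := uniq_leq_size (fset_uniq _) sub; rewrite size_map size_iota.
by rewrite /F cardfE.
Qed.

Lemma int_cnt_ge T (x y : R) : finite_set T -> (forall t : int, x <= t%:~R <= y -> T t) ->
  y - x - 1 <= cnt T.
Proof.
move=> fT Txy; set a := Num.ceil x; set b := Num.floor y.
have ha : a%:~R < x + 1 by have := ceil_gt_int x; have := @ceil_itv R x; rewrite -/a => /andP[h _] _; rewrite rmorphB /= in h; lra.
have hax : x <= a%:~R by exact: ceil_ge.
have hb : y < b%:~R + 1 by have := @floor_itv R y; rewrite -/b => /andP[_ h]; rewrite rmorphD /= in h.
have hby : b%:~R <= y by exact: floor_le.
have [ab|ba] := leP a b; last first.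
  have : b%:~R + 1 <= a%:~R :> R by rewrite -(rmorphD _ b 1) ler_int; lia.
  by move=> h; rewrite (le_trans _ (cnt_ge0 _))//; lra.
pose m := (`|b - a|%N + 1)%N.
have mE : m%:R = b%:~R - a%:~R + 1 :> R.
  by rewrite natrD natr_absz ger0_norm ?subr_ge0// rmorphB.
apply: (@le_trans _ _ m%:R); first by rewrite mE; lra.
rewrite cntE ler_nat.
have sub : {subset [seq a + i%:Z | i <- iota 0 m] <= fset_set T}.
  move=> t /mapP[i]; rewrite mem_iota /= add0n => im ->.
  rewrite in_fset_set// inE; apply: Txy; rewrite rmorphD /=.
  have : (i%:R : R) <= m%:R - 1 by rewrite lerBrDr natr1 ler_nat.
  by rewrite mE => h; have := ler0n R i; rewrite -!pmulrn => h0; apply/andP; split; lra.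
have := uniq_leq_size _ sub; rewrite size_map size_iota cardfE; apply.
by rewrite map_inj_uniq ?iota_uniq// => i j /addrI [].
Qed.

End IntCounting.

Lemma int_bounded_finite {R : realType} (T : set int) (r : R) :
  (forall t, T t -> `|t%:~R| <= r) -> finite_set T.
Proof.
move=> Tr; pose m := Num.truncn r.
apply: (@sub_finite_set _ _ ((fun i : 'I_(2 * m + 1) => i%:Z - m%:Z) @` setT)); last first.
  by apply: finite_image; exact: finite_finset.
move=> t Tt; have := Tr t Tt => tr.
have r0 : 0 <= r by apply: le_trans tr.
have tm : (`|t| <= m)%N.
  rewrite /m truncn_ge_nat// (le_trans _ tr)// -intr_norm.
  by rewrite -[(`|t|%N)%:R]/((`|t|%N%:Z)%:~R) abszE.
have lt : (`|(t + m%:Z)%R|%N < 2 * m + 1)%N by lia.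
by exists (Ordinal lt) => //=; lia.
Qed.

Section IntervalCount.
Context {R : realType}.

(** Both counts are compared with the extreme points of the other one: the part of I between them
    contributes its length up to a rounding error. Thus the length of I itself is never
    mentioned. *)
Lemma interval_cnt (I : set R) (s c r : R) : s != 0 ->
  (forall x y z, I x -> I y -> x <= z <= y -> I z) -> (forall x, I x -> `|x| <= r) ->
  `| `|s| * cnt [set t : int | I (s * t%:~R + c)] - cnt [set t : int | I t%:~R]|
    <= `|s| + 1.
Proof.
move=> s0 Iconv Ir; set S2 := [set t : int | I (s * t%:~R + c)].
set S1 := [set t : int | I t%:~R].
have as0 : 0 < `|s| by rewrite normr_gt0.
have fS1 : finite_set S1 by apply: (@int_bounded_finite R _ r) => t /Ir.
have fS2 : finite_set S2.
  apply: (@int_bounded_finite R _ ((r + `|c|) / `|s|)) => t /Ir h.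
  rewrite ler_pdivlMr// mulrC -normrM.
  by have := ler_normB (s * t%:~R + c) c; rewrite addrK; move: h; lra.
have Ilin (x y t : R) : I x -> I y -> Num.min x y <= t <= Num.max x y -> I t.
  move=> Ix Iy; have [xy|/ltW yx] := leP x y => h; first exact: (Iconv x y).
  exact: (Iconv y x).
have mm (x y : R) : Num.max x y - Num.min x y = `|x - y|.
  have [xy|yx] := leP x y; first by rewrite distrC ger0_norm ?subr_ge0.
  by rewrite ger0_norm ?subr_ge0// ltW.
have H1 : `|s| * cnt S2 <= cnt S1 + (`|s| + 1).
  have [->|/set0P S20] := eqVneq S2 set0.
    rewrite /cnt /fsum fset_set0 big_seq_fset0 mulr0.
    by rewrite addr_ge0 ?cnt_ge0// addr_ge0.
  have [a [b [Sa Sb ab cab]]] := @int_cnt_le R _ fS2 S20.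
  have abn : `|a - b| = b - a by rewrite distrC ger0_norm ?subr_ge0.
  have : Num.max (s * a%:~R + c) (s * b%:~R + c) - Num.min (s * a%:~R + c) (s * b%:~R + c) - 1
      <= cnt S1 by apply: int_cnt_ge => // t; exact: Ilin.
  rewrite mm; have -> : s * a%:~R + c - (s * b%:~R + c) = s * (a - b)%:~R by rewrite rmorphB/=; ring.
  rewrite normrM -intr_norm abn.
  have h : `|s| * cnt S2 <= `|s| * ((b - a)%:~R + 1) by rewrite ler_pM2l.
  by move: h => *; lra.
have H2 : cnt S1 <= `|s| * cnt S2 + (`|s| + 1).
  have [->|/set0P S10] := eqVneq S1 set0.
    rewrite {1}/cnt /fsum fset_set0 big_seq_fset0.
    by rewrite addr_ge0 ?mulr_ge0 ?cnt_ge0// addr_ge0.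
  have [a [b [Sa Sb ab cab]]] := @int_cnt_le R _ fS1 S10.
  have abn : `|a - b| = b - a by rewrite distrC ger0_norm ?subr_ge0.
  have : Num.max ((a%:~R - c) / s) ((b%:~R - c) / s) -
      Num.min ((a%:~R - c) / s) ((b%:~R - c) / s) - 1 <= cnt S2.
    apply: int_cnt_ge => // t ht; apply: (Iconv a%:~R b%:~R) => //; move: ht.
    have [sp|sn] := ltP 0 s.
      rewrite min_l ?max_r ?ler_pM2r ?invr_gt0 ?lerB ?ler_int//.
      by rewrite ler_pdivrMr// ler_pdivlMr// mulrC => /andP[h1 h2]; apply/andP; split; lra.
    have sn' : s < 0 by rewrite lt_neqAle s0.
    rewrite min_r ?max_l ?ler_nM2r ?invr_lt0 ?lerB ?ler_int//.
    by rewrite ler_ndivrMr// ler_ndivlMr// mulrC => /andP[h1 h2]; apply/andP; split; lra.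
  rewrite mm; have -> : (a%:~R - c) / s - (b%:~R - c) / s = (a - b)%:~R / s by rewrite rmorphB/= -mulrBl; congr (_ / _); ring.
  rewrite normrM normfV -intr_norm abn => h.
  have : `|s| * ((b - a)%:~R / `|s| - 1) <= `|s| * cnt S2 by rewrite ler_pM2l.
  by rewrite mulrBr mulrCA divff ?gt_eqF//; lra.
by rewrite ler_norml; apply/andP; split; lra.
Qed.

End IntervalCount.

Section LineCounting.
Context {R : realType} {p : nat}.
Local Notation d := p.+1.
Implicit Types (S : set 'cV[int]_d) (i : 'I_d) (k L : 'cV[int]_d).

Definition lateral i k : 'cV[int]_d := \col_j (if j == i then 0 else k j 0).
Definition basis i : 'cV[int]_d := delta_mx i 0.

Lemma bounded_points_finite S (r : R) : (forall k, S k -> forall j, `|(k j 0)%:~R| <= r) ->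
  finite_set S.
Proof.
move=> Sr; pose m := Num.truncn r.
apply: (@sub_finite_set _ _ ((fun f : {ffun 'I_d -> 'I_(2 * m + 1)} =>
   \col_j ((f j)%:Z - m%:Z)) @` setT)); last first.
  by apply: finite_image; exact: finite_finset.
move=> k Sk.
have lt j : (`|(k j 0 + m%:Z)%R|%N < 2 * m + 1)%N /\ (`|k j 0%R| <= m)%N.
  have kr := Sr k Sk j; have r0 : 0 <= r by apply: le_trans kr.
  suff : (`|k j 0%R| <= m)%N by lia.
  rewrite /m truncn_ge_nat// (le_trans _ kr)// -intr_norm.
  by rewrite natr_absz.
exists [ffun j => Ordinal (lt j).1] => //.
apply/matrixP => j q; rewrite mxE ffunE /=; have -> : q = 0 by exact: ord1.
have := (lt j).2; move: (k j 0) => x; lia.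
Qed.

(** The labels of the lines in direction i are fixed before the set and the summand, so that two
    different sets can be compared line by line. *)
Lemma lateral_fiber (m : nat) i S (f : 'cV[int]_d -> R) : finite_set S ->
  (forall k, S k -> forall j, j != i -> (`|k j 0%R| <= m)%N) ->
  exists base : {ffun 'I_p -> 'I_(2 * m).+1} -> 'cV[int]_d, forall S' (f' : 'cV[int]_d -> R),
  finite_set S' ->
  (forall k, S' k -> forall j, j != i -> (`|k j 0%R| <= m)%N) ->
  fsum S' f' = \sum_g fsum (S' `&` [set k | lateral i k = base g]) f'.
Proof.
move=> _ _; pose base (g : {ffun 'I_p -> 'I_(2 * m).+1}) : 'cV[int]_d :=
  \col_j (if unlift i j is Some j' then (g j')%:Z - m%:Z else 0).
exists base => S' f' fS' S'm.
pose h k : {ffun 'I_p -> 'I_(2 * m).+1} := [ffun j => inord `|(k (lift i j) 0 + m%:Z)%R|%N].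
rewrite (fsum_fiber h)//; apply: eq_bigr => g _; congr (fsum _ _).
apply/seteqP; split=> k [S'k hk]; split=> //=.
  apply/matrixP => j q; rewrite ord1 !mxE; case: unliftP => [j' ->|->]; last by rewrite eqxx.
  rewrite -hk ffunE /= eq_sym (negbTE (neq_lift _ _)) inordK.
    by have := S'm k S'k (lift i j'); rewrite eq_sym (neq_lift i) => /(_ isT); lia.
  by have := S'm k S'k (lift i j'); rewrite eq_sym (neq_lift i) => /(_ isT); lia.
apply/ffunP => j; rewrite ffunE; apply: val_inj; rewrite /= inordK.
  have /matrixP/(_ (lift i j) 0) := hk; rewrite !mxE liftK eq_sym (negbTE (neq_lift _ _)).
  by move=> ->; lia.
by have := S'm k S'k (lift i j); rewrite eq_sym (neq_lift i) => /(_ isT); lia.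
Qed.

Lemma lines_le (m : nat) i S S' (x y c : R) : finite_set S -> finite_set S' ->
  (forall k, (S `|` S') k -> forall j, j != i -> (`|k j 0%R| <= m)%N) ->
  (forall L, `|x * cnt (S `&` [set k | lateral i k = L]) -
               y * cnt (S' `&` [set k | lateral i k = L])| <= c) ->
  `|x * cnt S - y * cnt S'| <= c * (2 * m).+1%:R ^+ p.
Proof.
move=> fS fS' Sm H.
have S1 : forall k, S k -> forall j, j != i -> (`|k j 0%R| <= m)%N.
  by move=> k Sk; apply: Sm; left.
have S2 : forall k, S' k -> forall j, j != i -> (`|k j 0%R| <= m)%N.
  by move=> k Sk; apply: Sm; right.
have [base baseP] := @lateral_fiber m i S (fun=> 1) fS S1.
rewrite /cnt (baseP S)// (baseP S')// !mulr_sumr -sumrB.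
rewrite (le_trans (ler_norm_sum _ _ _))//.
apply: (@le_trans _ _ (\sum_(g : {ffun 'I_p -> 'I_(2 * m).+1}) c)); first by apply: ler_sum => g _; exact: H.
by rewrite sumr_const card_ffun !card_ord -natrX mulr_natr.
Qed.

Lemma cnt_line i L (P : set int) : L i 0 = 0 -> finite_set P ->
  cnt [set k | lateral i k = L /\ P (k i 0)] = cnt P :> R.
Proof.
move=> L0 fP; rewrite -[RHS](fsum_image (fun=> 1 : R) (_ : injective (fun t : int => L + t *: basis i)))//.
  congr (fsum _ _); apply/seteqP; split=> k /=.
    move=> [kL Pk]; exists (k i 0) => //; apply/matrixP => j q; rewrite ord1 -kL !mxE.
    by rewrite eqxx andbT; have [->|] := eqVneq j i; rewrite ?mulr1 ?mulr0 ?add0r ?addr0.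
  case=> t Pt <-; split.
    apply/matrixP => j q; rewrite ord1 !mxE eqxx andbT; have [->//|ji] := eqVneq j i.
    by rewrite mulr0 addr0.
  by rewrite !mxE !eqxx L0 mulr1 add0r.
move=> t t' /matrixP/(_ i 0); rewrite !mxE !eqxx !mulr1 => /addrI //.
Qed.

Lemma lateral_line0 i L S : L i 0 != 0 -> S `&` [set k | lateral i k = L] = set0.
Proof.
move=> L0; apply/seteqP; split=> // k [_ /= kL].
by move: L0; rewrite -kL mxE eqxx eqxx.
Qed.

Lemma emb_bound k (c : R) : `|emb k : 'cV[R]_d| <= c -> forall j, `|(k j 0)%:~R| <= c :> R.
Proof.
move=> kc j; apply: le_trans kc; rewrite -(embE (R := R)); exact: mx_entry_le.
Qed.

End LineCounting.

Lemma prod_diff {R : realType} (m : nat) (x y : 'I_m.+1 -> R) (X e : R) : 0 <= X -> 0 <= e ->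
  (forall j, `|x j| <= X) -> (forall j, `|y j| <= X) -> (forall j, `|x j - y j| <= e) ->
  `|\prod_j x j - \prod_j y j| <= m.+1%:R * e * X ^+ m.
Proof.
move=> X0 e0; elim: m x y => [|m IH] x y xX yX xy.
  by rewrite !big_ord_recl !big_ord0 !mulr1 mul1r.
rewrite big_ord_recl [X in _ - X]big_ord_recl.
set px := \prod_(i < _) _; set py := \prod_(i < _) _.
have pxX : `|px| <= X ^+ m.+1.
  have := @ler_prod _ _ (index_enum _) xpredT (fun i : 'I_m.+1 => `|x (lift ord0 i)|) (fun=> X).
  by rewrite -normr_prod prodr_const card_ord; apply => i _; rewrite normr_ge0 xX.
have pxy : `|px - py| <= m.+1%:R * e * X ^+ m by apply: IH => j.
have -> : x ord0 * px - y ord0 * py = (x ord0 - y ord0) * px + y ord0 * (px - py) by ring.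
rewrite (le_trans (ler_normD _ _))// !normrM.
have h1 : `|x ord0 - y ord0| * `|px| <= e * X ^+ m.+1 by apply: ler_pM.
have h2 : `|y ord0| * `|px - py| <= X * (m.+1%:R * e * X ^+ m) by apply: ler_pM.
apply: le_trans (lerD h1 h2) _; rewrite -[m.+2%:R]natr1 !exprS.
by rewrite le_eqVlt; apply/orP; left; apply/eqP; ring.
Qed.

Lemma pairwise_rev (T : Type) (r : rel T) (s : seq T) :
  pairwise r (rev s) = pairwise (fun x y => r y x) s.
Proof. by elim: s => //= x s IH; rewrite rev_cons pairwise_rcons all_rev IH. Qed.

(** * Lattice points in convex sets *)

Section Density.
Context {R : realType} {p : nat}.
Local Notation d := p.+1.
Implicit Types (A E : 'M[R]_d) (K : set 'cV[R]_d) (i : 'I_d).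

Definition convex_set K := forall x y t, K x -> K y -> 0 <= t <= 1 -> K (x + t *: (y - x)).
Definition pts A K : set 'cV[int]_d := [set k | K (A *m emb k)].
(** The reference is the number of integer points of the same convex set, not its volume. In this
    form the property passes along a factorisation of the matrix, and no measure theory is
    involved. *)
Definition uniform_density A := exists2 c : R, 0 <= c &
  forall (M : R) K, 1 <= M -> convex_set K -> (forall x, K x -> `|x| <= M) ->
  `| `|\det A| * cnt (pts A K) - cnt (pts 1%:M K)| <= c * M ^+ p.

Lemma pts_bound A K (M : R) : A \in unitmx -> (forall x, K x -> `|x| <= M) ->
  forall x, K (A *m x) -> `|x| <= d%:R * `|invmx A| * M.
Proof.
move=> uA KM x /KM h; rewrite -[x in leLHS](mulKmx uA).
by rewrite (le_trans (mx_norm_mul _ _))// ler_wpM2l.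
Qed.

Lemma pts_finite A K (M : R) : A \in unitmx -> (forall x, K x -> `|x| <= M) ->
  finite_set (pts A K).
Proof.
move=> uA KM; apply: (@bounded_points_finite R _ _ (d%:R * `|invmx A| * M)) => k Kk.
by apply: emb_bound; exact: pts_bound Kk.
Qed.

Lemma nat_bound (c M : R) : 0 <= c -> 1 <= M -> exists m : nat,
  (forall x : int, `|x%:~R| <= c * M -> (`|x| <= m)%N) /\
  ((2 * m).+1%:R <= (2 * c + 1) * M).
Proof.
move=> c0 M1; have cM0 : 0 <= c * M by rewrite mulr_ge0// (le_trans _ M1).
exists (Num.truncn (c * M)); split=> [x xc|].
  by rewrite truncn_ge_nat// natr_absz intr_norm.
rewrite -[(2 * _).+1%:R]natr1 natrM [leRHS]mulrDl mul1r lerD// -mulrA ler_wpM2l//.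
by have /andP[] := truncn_itv cM0.
Qed.

Definition row_shear i (e : 'rV[R]_d) : 'M[R]_d :=
  \matrix_(a, b) (if a == i then e 0 b else (a == b)%:R).

Lemma det_row_shear i e : \det (row_shear i e) = e 0 i.
Proof.
rewrite (expand_det_col _ i) (bigD1 i)//= big1 ?addr0 => [|a ai]; last first.
  by rewrite mxE (negbTE ai) mul0r.
rewrite mxE eqxx /cofactor addnn -signr_odd odd_double expr0 mul1r.
rewrite (_ : row' i _ = 1%:M) ?det1 ?mulr1//.
apply/matrixP => a b; rewrite !mxE eq_sym (negbTE (neq_lift _ _)).
by rewrite (inj_eq lift_inj).
Qed.

Lemma row_shear_line i e (L : 'cV[int]_d) (t : int) : row_shear i e *m emb (L + t *: basis i) =
  emb L + (e 0 i * t%:~R + (\sum_j e 0 j * (L j 0)%:~R) - (L i 0)%:~R) *: delta_mx i 0.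
Proof.
apply/matrixP => a q; rewrite ord1 !mxE eqxx andbT.
have [->|ai] := eqVneq a i.
  rewrite mulr1 (eq_bigr (fun j => e 0 j * (L j 0)%:~R + (e 0 j * t%:~R) *+ (j == i))).
    have -> : \sum_(j < d) (e 0 j * (L j 0)%:~R + e 0 j * t%:~R *+ (j == i)) =
        \sum_j e 0 j * (L j 0)%:~R + e 0 i * t%:~R.
      rewrite big_split; congr (_ + _); rewrite (bigD1 i)//= eqxx big1 ?addr0 => [//|j ji].
      by rewrite (negbTE ji) mulr0n.
    by ring.
  move=> j _; rewrite !mxE eqxx andbT rmorphD/= mulrDr; congr (_ + _).
  by case: eqP => _; rewrite ?mulr1 ?mulr0 ?mulr0z ?mulr0 ?mulr1n ?mulr0n.
rewrite mulr0 addr0 (bigD1 a)//= big1 ?addr0 => [|j ja].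
  by rewrite !mxE eqxx (negbTE ai) eqxx mul1r mulr0 addr0.
by rewrite !mxE (negbTE ai) eq_sym (negbTE ja) mul0r.
Qed.

(** The extra factor changes only coordinate i of the integer point, affinely along each line in
    direction i. Each line is treated by [interval_cnt], and the errors add up over the order of M^p
    lines. *)
Lemma density_shear A i (e : 'rV[R]_d) : A \in unitmx -> e 0 i != 0 -> uniform_density A ->
  uniform_density (A *m row_shear i e).
Proof.
move=> uA ei [c c0 Ac]; set E := row_shear i e.
have uE : E \in unitmx by rewrite unitmxE det_row_shear unitfE.
have uAE : A *m E \in unitmx by rewrite unitmx_mul uA.
pose r := d%:R * `|invmx A|; have r0 : 0 <= r by rewrite mulr_ge0.
exists (c + `|\det A| * ((`|e 0 i| + 1) * (2 * r + 1) ^+ p)).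
  by rewrite addr_ge0// !mulr_ge0// ?addr_ge0// exprn_ge0// addr_ge0// mulr_ge0.
move=> M K M1 Kc KM; have M0 : 0 <= M by apply: le_trans M1.
have [m [mP mM]] := nat_bound r0 M1.
have fS := pts_finite uA KM; have fS' := pts_finite uAE KM.
have Elat j k : j != i -> (E *m emb k) j 0 = (k j 0)%:~R.
  move=> ji; rewrite mxE (bigD1 j)//= big1 ?addr0 => [|b bj].
    by rewrite !mxE (negbTE ji) eqxx mul1r.
  by rewrite !mxE (negbTE ji) eq_sym (negbTE bj) mul0r.
have line : `| `|e 0 i| * cnt (pts (A *m E) K) - 1 * cnt (pts A K)| <=
    (`|e 0 i| + 1) * (2 * m).+1%:R ^+ p.
  apply: (@lines_le R p m i) => //.
    move=> k [Kk|Kk] j ji; apply: mP.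
      have := pts_bound uA KM (x := E *m emb k); rewrite mulmxA => /(_ Kk) h.
      by rewrite -(Elat j k ji); apply: le_trans h; exact: mx_entry_le.
    by apply: emb_bound; exact: pts_bound Kk.
  move=> L; have [L0|L0] := eqVneq (L i 0) 0; last first.
    rewrite !lateral_line0// /cnt /fsum fset_set0 big_seq_fset0 !mulr0 subrr normr0.
    by rewrite addr_ge0.
  pose I : set R := [set x | K (A *m (emb L + x *: delta_mx i 0))].
  have IM x : I x -> `|x| <= r * M.
    move=> /(pts_bound uA KM) h; rewrite (le_trans _ h)//.
    have := mx_entry_le (emb L + x *: delta_mx i 0) i 0.
    by rewrite !mxE L0 !eqxx mulr1 add0r.
  have Ic x y z : I x -> I y -> x <= z <= y -> I z.
    move=> Ix Iy /andP[xz zy]; have [xy|xy] := eqVneq x y.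
      by have -> : z = x by apply/eqP; rewrite eq_le xz xy zy.
    have lt : x < y by rewrite lt_neqAle xy (le_trans xz).
    have := Kc _ _ ((z - x) / (y - x)) Ix Iy.
    rewrite divr_ge0 ?subr_ge0 ?(ltW lt)// ler_pdivrMr ?subr_gt0// mul1r lerD2r zy => /(_ isT).
    rewrite -mulmxBr scalemxAr -mulmxDr opprD addrACA subrr add0r.
    have -> // : emb L + x *: delta_mx i 0 + ((z - x) / (y - x)) *: ((y *: delta_mx i 0) - (x *: delta_mx i 0)) = emb L + z *: delta_mx i 0 :> 'cV[R]_d.
    rewrite -scalerBl scalerA -mulrA mulVf ?mulr1; last by rewrite subr_eq0 eq_sym.
    by rewrite -addrA -scalerDl (addrC x) subrK.
  set b := \sum_j e 0 j * (L j 0)%:~R.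
  have cnt2 : cnt (pts (A *m E) K `&` [set k | lateral i k = L]) =
      cnt [set t : int | I (e 0 i * t%:~R + b)] :> R.
    rewrite -(@cnt_line R p i L)//.
      congr cnt; apply/seteqP; split=> k /= [h1 h2]; split=> //.
        move: h1; rewrite /pts/= -mulmxA.
        have {1}-> : k = L + (k i 0) *: basis i.
          apply/matrixP => j q; rewrite -h2 ord1 !mxE eqxx andbT.
          by have [->|] := eqVneq j i; rewrite ?mulr1 ?mulr0 ?add0r ?addr0.
        by rewrite row_shear_line L0 subr0.
      rewrite /pts/= -mulmxA.
      have {1}-> : k = L + (k i 0) *: basis i.
        apply/matrixP => j q; rewrite -h1 ord1 !mxE eqxx andbT.
        by have [->|] := eqVneq j i; rewrite ?mulr1 ?mulr0 ?add0r ?addr0.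
      by rewrite row_shear_line L0 subr0.
    apply: (@int_bounded_finite R _ ((r * M + `|b|) / `|e 0 i|)) => t /IM h.
    rewrite ler_pdivlMr ?normr_gt0// mulrC -normrM.
    by have := ler_normB (e 0 i * t%:~R + b) b; rewrite addrK; move: h; lra.
  have cnt1 : cnt (pts A K `&` [set k | lateral i k = L]) = cnt [set t : int | I t%:~R] :> R.
    rewrite -(@cnt_line R p i L)//.
      have embline k : lateral i k = L -> emb L + (k i 0)%:~R *: delta_mx i 0 = emb k :> 'cV[R]_d.
        move=> kL; apply/matrixP => j q; rewrite -kL ord1 !mxE eqxx andbT.
        by have [->|] := eqVneq j i; rewrite ?mulr1 ?mulr0 ?mulr0z ?add0r ?addr0.
      congr cnt; apply/seteqP; split=> k /= [h1 h2]; split=> //.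
        by rewrite /I/= embline.
      by move: h2; rewrite /I/= embline.
    by apply: (@int_bounded_finite R _ (r * M)) => t /IM.
  by rewrite cnt1 cnt2 mul1r; exact: (interval_cnt b ei Ic IM).
have := Ac M K M1 Kc KM; rewrite det_mulmx det_row_shear normrM.
move: line; rewrite mul1r.
have : (2 * m).+1%:R ^+ p <= (2 * r + 1) ^+ p * M ^+ p.
  by rewrite -exprMn lerXn2r// ?nnegrE// mulr_ge0// addr_ge0// mulr_ge0.
move: (cnt (pts (A *m E) K)) (cnt (pts A K)) (cnt (pts 1%:M K)) ((2 * m).+1%:R ^+ p) => x y z w wM h1 h2.
have -> : `|\det A| * `|e 0 i| * x - z = `|\det A| * (`|e 0 i| * x - y) + (`|\det A| * y - z) by ring.
rewrite (le_trans (ler_normD _ _))// normrM normr_id addrC mulrDl lerD//.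
rewrite -!mulrA ler_wpM2l// (le_trans h1)// ler_wpM2l// addr_ge0//.
Qed.

Definition row_mix (T : 'M[R]_d) (r : seq 'I_d) : 'M[R]_d :=
  \matrix_(a, b) (if a \in r then T a b else (a == b)%:R).

(** A triangular matrix is a product of row shears, one row at a time. The order of the rows is such
    that each row vanishes at the indices treated later; hence the later factors leave it
    unchanged. *)
Lemma density_row_mix (T : 'M[R]_d) (r : seq 'I_d) : uniq r -> (forall i, T i i != 0) ->
  pairwise (fun i j => T i j == 0) r ->
  forall A, A \in unitmx -> uniform_density A -> uniform_density (A *m row_mix T r).
Proof.
move=> + T0; elim: r => [_ _ A uA dA|i r IH /=/andP[ir ur] /andP[Ti Tr] A uA dA].
  have -> : row_mix T [::] = 1%:M by apply/matrixP => a b; rewrite !mxE.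
  by rewrite mulmx1.
have -> : row_mix T (i :: r) = row_shear i (row i T) *m row_mix T r.
  apply/matrixP => a b; rewrite !mxE !inE; have [->|ai] /= := eqVneq a i.
    rewrite (bigD1 b)//= big1 ?addr0 => [|j jb]; last first.
      rewrite !mxE eqxx; case: ifP => [jr|_]; last by rewrite (negbTE jb) mulr0.
      by rewrite (eqP (allP Ti _ jr)) mul0r.
    rewrite !mxE eqxx; case: ifP => [br|_]; last by rewrite eqxx mulr1.
    by rewrite (eqP (allP Ti _ br)) mul0r.
  rewrite (bigD1 a)//= big1 ?addr0 => [|j ja].
    by rewrite !mxE (negbTE ai) eqxx mul1r.
  by rewrite !mxE (negbTE ai) eq_sym (negbTE ja) mul0r.
rewrite mulmxA; apply: IH => //.
  by rewrite unitmx_mul uA unitmxE det_row_shear mxE unitfE T0.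
by apply: density_shear => //; rewrite mxE.
Qed.

Lemma density_perm (s : {perm 'I_d}) : uniform_density (perm_mx s).
Proof.
exists 0 => // M K _ Kc KM; rewrite mul0r det_perm normr_sign mul1r.
have inj : injective (@row_perm int d 1 s).
  move=> k k' /matrixP E; apply/matrixP => i j.
  by have := E ((s^-1)%g i) j; rewrite !mxE permKV.
have -> : pts 1%:M K = row_perm s @` pts (perm_mx s) K.
  apply/seteqP; split=> k; rewrite /pts/= mul1mx.
    move=> Kk; exists (row_perm (s^-1)%g k).
      by rewrite -row_permE /emb -map_row_perm -row_permM mulgV row_perm1.
    by rewrite -row_permM mulgV row_perm1.
  by case=> k' Kk' <-; rewrite /emb map_row_perm row_permE.
rewrite /cnt fsum_image//; first by rewrite subrr normr0.
by apply: (pts_finite _ KM); exact: unitmx_perm.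
Qed.

(** By the LUP decomposition: a permutation only relabels the integer points, the rows of the lower
    factor are treated in increasing order, those of the upper factor in decreasing order. *)
Theorem density A : A \in unitmx -> uniform_density A.
Proof.
move=> uA; have := cormen_lup_correct A; have := cormen_lup_perm A.
have := cormen_lup_lower A; have := cormen_lup_upper A.
case: (cormen_lup A) => [[P L] U] /= Uup Llow /is_perm_mxP[s ->] AE.
have {}AE : A = perm_mx (s^-1)%g *m L *m U.
  by rewrite -mulmxA -[L *m U]AE mulmxA -perm_mxM mulVg perm_mx1 mul1mx.
have L1 i : L i i = 1 by rewrite Llow// eqxx.
have detA : \det A != 0 by rewrite -unitfE -unitmxE.
have U0 i : U i i != 0.
  move: detA; rewrite AE det_mulmx mulf_eq0 negb_or => /andP[_].
  rewrite -det_tr det_trig; last by apply/is_trig_mxP => a b ab; rewrite mxE Uup.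
  by apply: contraNN => /eqP Ui; rewrite (bigD1 i)//= mxE Ui mul0r.
have mixL : row_mix L (enum 'I_d) = L by apply/matrixP => a b; rewrite mxE mem_enum.
have mixU : row_mix U (rev (enum 'I_d)) = U.
  by apply/matrixP => a b; rewrite mxE mem_rev mem_enum.
have pw : pairwise (fun i j : 'I_d => i < j)%N (enum 'I_d).
  rewrite -(pairwise_map val ltn) val_enum_ord -sorted_pairwise ?iota_ltn_sorted//.
  exact: ltn_trans.
have uPL : perm_mx (s^-1)%g *m L \in unitmx.
  move: (uA); rewrite {1}AE unitmx_mul => /andP[] //.
rewrite AE -mixU; apply: density_row_mix => //.
- by rewrite rev_uniq enum_uniq.
- rewrite pairwise_rev; apply: sub_pairwise pw => i j ij /=.
  by rewrite Uup.
- rewrite -mixL; apply: density_row_mix; rewrite ?enum_uniq ?unitmx_perm//.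
  + by move=> i; rewrite L1 oner_eq0.
  + apply: sub_pairwise pw => i j ij /=; have -> := Llow i j (ltnW ij).
    by rewrite -val_eqE /= ltn_eqF.
  + exact: density_perm.
Qed.

Lemma cnt_param (T : choiceType) (J : finType) (e : J -> T) (S : set T) : injective e ->
  finite_set S -> S `<=` range e -> cnt S = \sum_i (`[< S (e i) >])%:R :> R.
Proof.
move=> ei fS Se; rewrite /cnt /fsum.
rewrite (perm_big [seq e g | g <- enum J & `[< S (e g) >]]) /=; last first.
  apply: uniq_perm; first exact: fset_uniq.
    by rewrite map_inj_uniq// filter_uniq// enum_uniq.
  move=> k; rewrite in_fset_set//; apply/idP/mapP => [|[i]].
    rewrite inE => Sk; have [i _ ik] := Se k Sk; exists i => //.
    by rewrite mem_filter mem_enum andbT; apply/asboolP; rewrite ik.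
  by rewrite mem_filter => /andP[/asboolP Si _] ->; rewrite inE.
rewrite big_map big_filter big_mkcond big_enum /=.
by apply: eq_bigr => i _; case: ifP.
Qed.

Definition box (I : 'I_d -> set R) : set 'cV[R]_d := [set x | forall j, I j (x j 0)].

Lemma cnt_box (I : 'I_d -> set R) (M : R) : 1 <= M -> (forall j x, I j x -> `|x| <= M) ->
  cnt (pts 1%:M (box I)) = \prod_j cnt [set t : int | I j t%:~R] :> R.
Proof.
move=> M1 IM; have [m [mP _]] := nat_bound (@ler01 R) M1.
pose e (i : 'I_(2 * m).+1) : int := i%:Z - m%:Z.
have ei : injective e by move=> i j /addIr [] /val_inj.
have range_e (t : int) : (`|t| <= m)%N -> exists g, e g = t.
  move=> tm; have lt : (`|(t + m%:Z)%R|%N < (2 * m).+1)%N by lia.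
  by exists (Ordinal lt); rewrite /e /=; lia.
pose ev (f : {ffun 'I_d -> 'I_(2 * m).+1}) : 'cV[int]_d := \col_j e (f j).
have evi : injective ev.
  move=> f g /matrixP E; apply/ffunP => j; apply: ei.
  by have := E j 0; rewrite !mxE.
rewrite (cnt_param evi).
- transitivity (\sum_(f : {ffun 'I_d -> 'I_(2 * m).+1}) \prod_j (`[< I j (e (f j))%:~R >])%:R : R).
    apply: eq_bigr => f _; rewrite /pts /= mul1mx.
    have [h|h] := asboolP (box I (emb (ev f))).
      rewrite big1// => j _; rewrite asboolT//.
      by have := h j; rewrite embE mxE.
    have [j nj] : exists j, ~ I j (e (f j))%:~R.
      apply: contrapT => nn; apply: h => j; rewrite embE mxE.
      by apply: contrapT => nj; apply: nn; exists j.
    by rewrite (bigD1 j)//= asboolF// mul0r.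
  rewrite -(bigA_distr_bigA (fun j (g : 'I_(2 * m).+1) => (`[< I j (e g)%:~R >])%:R : R)); apply: eq_bigr => j _; rewrite (cnt_param ei)//.
    by apply: (@int_bounded_finite R _ M) => t /IM.
  move=> t /IM tM; have [|i <-] := range_e t; last by exists i.
  by apply: mP; rewrite mul1r.
- apply: (@bounded_points_finite R _ _ M) => k; rewrite /pts/= mul1mx => kI j.
  by have := IM _ _ (kI j); rewrite embE.
- move=> k; rewrite /pts/= mul1mx => kI.
  have h j : exists g, e g = k j 0.
    apply: range_e; apply: mP; rewrite mul1r.
    by have := IM _ _ (kI j); rewrite embE.
  have [f fP] := choice h.
  by exists [ffun j => f j] => //; apply/matrixP => j q; rewrite ord1 mxE ffunE.
Qed.

Lemma box_convex (I : 'I_d -> set R) :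
  (forall j x y z, I j x -> I j y -> x <= z <= y -> I j z) -> convex_set (box I).
Proof.
move=> Ic x y t Kx Ky /andP[t0 t1] j; rewrite !mxE.
have [xy|/ltW xy] := leP (x j 0) (y j 0).
  by apply: (Ic j _ _ _ (Kx j) (Ky j)); apply/andP; split; nra.
by apply: (Ic j _ _ _ (Ky j) (Kx j)); apply/andP; split; nra.
Qed.

(** Each [I j] may be any interval between the open and the closed one, which covers all conventions
    at the ends. The error is of the order of the surface; it combines [density] with the product
    formula for integer points of a box. *)
Theorem lattice_count A : A \in unitmx -> exists2 c : R, 0 <= c &
  forall (M : R) (a b : 'I_d -> R) (I : 'I_d -> set R), 1 <= M ->
  (forall j, [/\ a j <= b j, `|a j| <= M & `|b j| <= M]) ->
  (forall j x y z, I j x -> I j y -> x <= z <= y -> I j z) ->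
  (forall j x, a j < x < b j -> I j x) -> (forall j x, I j x -> a j <= x <= b j) ->
  `| `|\det A| * cnt (pts A (box I)) - \prod_j (b j - a j)| <= c * M ^+ p.
Proof.
move=> uA; have [c c0 dA] := density uA.
exists (c + d%:R * 2 * 4 ^+ p); first by rewrite addr_ge0// !mulr_ge0// exprn_ge0.
move=> M a b I M1 abM Ic abI Iab.
have IM j x : I j x -> `|x| <= M.
  move=> /Iab/andP[ax xb]; have [_] := abM j; rewrite !ler_norml => /andP[h1 _] /andP[_ h2].
  by apply/andP; split; lra.
have boxM x : box I x -> `|x| <= M.
  by move=> xI; apply: mx_norm_le => [|j q]; [lra|rewrite ord1 (IM j)].
have := dA M _ M1 (box_convex Ic) boxM; rewrite (cnt_box M1 IM).
move: (cnt _) => x; set y := \prod_j _; set z := \prod_j _ => h.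
suff : `|y - z| <= d%:R * 2 * (4 * M) ^+ p.
  rewrite exprMn mulrA => h2; have -> : `|\det A| * x - z = (`|\det A| * x - y) + (y - z) by ring.
  by rewrite (le_trans (ler_normD _ _))// mulrDl lerD.
have abd j : 0 <= b j - a j <= 2 * M.
  have [h1] := abM j; rewrite !ler_norml => /andP[h2 h3] /andP[h4 h5].
  by apply/andP; split; lra.
have cb j : `|cnt [set t : int | I j t%:~R] - (b j - a j)| <= 2.
  have fT : finite_set [set t : int | I j t%:~R] by apply: (@int_bounded_finite R _ M) => t /IM.
  have : (b j - 2^-1) - (a j + 2^-1) - 1 <= cnt [set t : int | I j t%:~R].
    apply: int_cnt_ge => // t /andP[h1 h2]; apply: abI; apply/andP; split; lra.
  have : cnt [set t : int | I j t%:~R] <= b j - a j + 1.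
    have [->|/set0P T0] := eqVneq [set t : int | I j t%:~R] set0.
      by rewrite /cnt /fsum fset_set0 big_seq_fset0; have /andP[] := abd j; lra.
    have [u [v [/Iab/andP[u1 u2] /Iab/andP[v1 v2] uv h3]]] := @int_cnt_le R _ fT T0.
    by rewrite rmorphB/= in h3; lra.
  by move=> h1 h2; rewrite ler_norml; apply/andP; split; lra.
apply: prod_diff => //; first by rewrite mulr_ge0//; lra.
- move=> j; have := cb j; rewrite !ler_norml => /andP[h1 h2]; have /andP[h3 h4] := abd j.
  by have := cnt_ge0 (R := R) [set t : int | I j t%:~R] => h5; apply/andP; split; lra.
- by move=> j; have /andP[h3 h4] := abd j; rewrite ger0_norm//; lra.
Qed.

(** A line in direction i meets a convex set in a segment, so a unit shift in this direction expels
    at most one of its lattice points from the set. *)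
Theorem boundary_count A : A \in unitmx -> exists2 c : R, 0 <= c &
  forall (M : R) K i, 1 <= M -> convex_set K -> (forall x, K x -> `|x| <= M) ->
  cnt (pts A K `\` [set k | pts A K (k - basis i)]) <= c * M ^+ p /\
  cnt (pts A K `\` [set k | pts A K (k + basis i)]) <= c * M ^+ p.
Proof.
move=> uA; pose r := d%:R * `|invmx A|; have r0 : 0 <= r by rewrite mulr_ge0.
exists ((2 * r + 1) ^+ p); first by rewrite exprn_ge0// addr_ge0// mulr_ge0.
move=> M K i M1 Kc KM; have [m [mP mM]] := nat_bound r0 M1.
have fS := pts_finite uA KM.
have one (T : set int) (P : set 'cV[int]_d) (L : 'cV[int]_d) : L i 0 = 0 -> finite_set P ->
    (forall t, T t <-> P (L + t *: basis i)) ->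
    (forall t t', T t -> T t' -> t < t' -> False) ->
    cnt (P `&` [set k | lateral i k = L]) <= 1 :> R.
  move=> L0 fP TP T1.
  have kE k : lateral i k = L -> k = L + k i 0 *: basis i.
    move=> kL; apply/matrixP => j q; rewrite -kL ord1 !mxE eqxx andbT.
    by have [->|] := eqVneq j i; rewrite ?mulr1 ?mulr0 ?add0r ?addr0.
  have fT : finite_set T.
    apply: (@sub_finite_set _ _ ((fun k : 'cV[int]_d => k i 0) @` P)); last exact: finite_image.
    move=> t /TP Pt; exists (L + t *: basis i) => //.
    by rewrite !mxE L0 !eqxx mulr1 add0r.
  have -> : P `&` [set k | lateral i k = L] = [set k | lateral i k = L /\ T (k i 0)].
    apply/seteqP; split=> k /= [h1 h2]; split=> //.
      by apply/TP; rewrite -kE.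
    by rewrite (kE k h1); apply/TP.
  rewrite cnt_line//; have [->|/set0P T0] := eqVneq T set0.
    by rewrite /cnt /fsum fset_set0 big_seq_fset0.
  have [a [b [Ta Tb ab h]]] := @int_cnt_le R _ fT T0.
  have [E|ne] := eqVneq a b; first by rewrite E subrr mulr0z add0r in h.
  by case: (T1 a b) => //; rewrite lt_neqAle ne.
have conv k (t : int) : 0 < t -> pts A K k -> pts A K (k + t *: basis i) ->
    forall u : int, 0 <= u <= t -> pts A K (k + u *: basis i).
  move=> t0 Kk Kt u /andP[u0 ut]; rewrite /pts/=.
  have := Kc _ _ (u%:~R / t%:~R) Kk Kt.
  rewrite divr_ge0 ?ler0z ?(ltW t0)// ler_pdivrMr ?ltr0z// mul1r ler_int ut => /(_ isT).
  rewrite !embD mulmxDr addrAC subrr add0r scalemxAr -mulmxDr.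
  congr (K (A *m (_ + _))); apply/matrixP => j q; rewrite !mxE !rmorphM/=.
  by rewrite mulrA divfK// intr_eq0 gt_eqF.
have bnd S : S `<=` pts A K -> (forall L : 'cV[int]_d, L i 0 = 0 -> cnt (S `&` [set k | lateral i k = L]) <= 1 :> R) ->
    cnt S <= (2 * r + 1) ^+ p * M ^+ p.
  move=> SK H; have fS' : finite_set S by exact: sub_finite_set fS.
  have : `|1 * cnt S - 0 * cnt (set0 : set 'cV[int]_d)| <= 1 * (2 * m).+1%:R ^+ p :> R.
    apply: (@lines_le R p m i) => //.
      by move=> k [/SK Sk|//] j _; apply: mP; apply: emb_bound; exact: pts_bound Sk.
    move=> L; rewrite mul1r mul0r subr0 ger0_norm ?cnt_ge0//.
    have [L0|L0] := eqVneq (L i 0) 0; first exact: H.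
    by rewrite lateral_line0// /cnt /fsum fset_set0 big_seq_fset0.
  rewrite mul0r subr0 !mul1r ger0_norm ?cnt_ge0// => h; rewrite (le_trans h)// -exprMn.
  by rewrite lerXn2r ?nnegrE ?mulr_ge0//; have := M1; nra.
split; apply: bnd; try exact: subDsetl.
- move=> L L0; apply: (one [set t | (pts A K `\` [set k | pts A K (k - basis i)]) (L + t *: basis i)]) => //.
    by apply: sub_finite_set fS; exact: subDsetl.
  move=> t t' [/= Kt _] [/= Kt' nt'] tt'; apply: nt'.
  have E : L + t' *: basis i = L + t *: basis i + (t' - t) *: basis i.
    by rewrite -addrA -scalerDl (addrC t) subrK.
  have := conv (L + t *: basis i) (t' - t) _ Kt; rewrite -E subr_gt0 => /(_ tt' Kt' (t' - t - 1)).
  have -> : L + t *: basis i + (t' - t - 1) *: basis i = L + t' *: basis i - basis i.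
    by rewrite scalerBl scale1r addrA -E.
  by apply; lia.
- move=> L L0; apply: (one [set t | (pts A K `\` [set k | pts A K (k + basis i)]) (L + t *: basis i)]) => //.
    by apply: sub_finite_set fS; exact: subDsetl.
  move=> t t' [/= Kt nt] [/= Kt' _] tt'; apply: nt.
  have E : L + t' *: basis i = L + t *: basis i + (t' - t) *: basis i.
    by rewrite -addrA -scalerDl (addrC t) subrK.
  have := conv (L + t *: basis i) (t' - t) _ Kt; rewrite -E subr_gt0 => /(_ tt' Kt' 1).
  by rewrite scale1r; apply; lia.
Qed.

End Density.

(** * Lattice paths in direction e_1 *)

Section Schedule.
Context {R : realType}.
Variables (P : nat) (mu : nat -> R).
Hypothesis P0 : (0 < P)%N.
Hypothesis mu01 : forall i, 0 <= mu i <= 1.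

(* Type i is scheduled at the times congruent to i modulo P and jumps when the
   integer part of mu i times the number of its past occurrences increases. *)
Definition turns i s : nat := (s %/ P + (i < s %% P))%N.
Definition jumps i s : int := Num.floor (mu i * (turns i s)%:R).
Definition jumping s : bool := jumps (s %% P) s.+1 != jumps (s %% P) s.

Lemma turnsS i s : (i < P)%N -> turns i s.+1 = (turns i s + (s %% P == i)%N)%N.
Proof.
move=> iP; rewrite /turns divnS// modnS; have := ltn_pmod s P0.
case: ifP => [/dvdnP[q E]|_] sP /=; last by lia.
have E2 := divn_eq s P.
have : (q * P = (s %/ P).+1 * P)%N.
  suff : (s %% P).+1 = P by move: E E2; rewrite mulSn; lia.
  move: E E2 sP; move: (s %/ P)%N (s %% P)%N => a r E E2 sP.
  have : (q * P = a * P + r.+1)%N by lia.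
  move=> E3; have : (P %| r.+1)%N by rewrite -(dvdn_addr r.+1 (dvdn_mull a (dvdnn P))) -E3 dvdn_mull.
  by move=> /dvdn_leq; lia.
by move=> E3; move: E E2; rewrite E3 mulSn; lia.
Qed.

Lemma turns0 i : turns i 0 = 0%N.
Proof. by rewrite /turns div0n mod0n. Qed.

Lemma turns_bound i s : (i < P)%N -> `|(turns i s)%:R - s%:R / P%:R| <= 1 :> R.
Proof.
move=> iP; have P0' : 0 < P%:R :> R by rewrite ltr0n.
have -> : s%:R / P%:R = (s %/ P)%:R + (s %% P)%:R / P%:R :> R.
  by rewrite {1}(divn_eq s P) natrD natrM mulrDl mulfK// gt_eqF.
have h : (0 : R) <= (s %% P)%:R / P%:R <= (1 : R).
 
  by rewrite divr_ge0// ler_pdivrMr// mul1r ler_nat ltnW// ltn_pmod.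
rewrite /turns natrD; move: h => /andP[h1 h2].
move: (_ / _) ((s %/ P)%:R : R) h1 h2 => x y h1 h2.
by case: (i < _)%N; rewrite /= ler_norml; apply/andP; split; lra.
Qed.

Lemma jumpsS i s : (i < P)%N ->
  jumps i s.+1 = jumps i s + (jumping s && (s %% P == i)%N)%:Z.
Proof.
move=> iP; rewrite /jumping; have [si|si] := eqVneq (s %% P)%N i; last first.
  by rewrite andbF addr0 /jumps turnsS// (negbTE si) addn0.
rewrite andbT si; have [->|ne] := eqVneq (jumps i s.+1) (jumps i s); first by rewrite addr0.
move: ne; rewrite /jumps turnsS// si eqxx natrD mulrDr mulr1.
have := mu01 i; move: (mu i) (_%:R) => m t /andP[m0 m1] ne.
set x := m * t in ne *.
have h1 := @floor_itv R x; have h2 := @floor_itv R (x + m).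
move: h1 h2 ne; clearbody x; move: (Num.floor x) (Num.floor (x + m)) => a b.
rewrite !rmorphD /= => /andP[h1 h2] /andP[h3 h4] ne.
have : a%:~R < b%:~R + 1 :> R by lra.
have : b%:~R < a%:~R + 1 + 1 :> R by lra.
rewrite -[1]/(1%:~R) -!rmorphD/= !ltr_int => h5 h6.
by apply/eqP; move: ne => /eqP; lia.
Qed.

Lemma jumps_count i s1 s2 : (i < P)%N -> (s1 <= s2)%N ->
  \sum_(s1 <= s < s2) (jumping s && (s %% P == i)%N)%:R =
    (jumps i s2 - jumps i s1)%:~R :> R.
Proof.
move=> iP s12; rewrite -(telescope_sumr (fun s => jumps i s) s12) rmorph_sum.
by apply: eq_bigr => s _; rewrite jumpsS// addrC addKr.
Qed.

Lemma jumps_count_le i s1 s2 : (i < P)%N -> (s1 <= s2)%N ->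
  \sum_(s1 <= s < s2) (jumping s && (s %% P == i)%N)%:R <=
    mu i * ((s2%:R - s1%:R) / P%:R) + 3 :> R.
Proof.
move=> iP s12; rewrite jumps_count// rmorphB/= /jumps.
have /andP[m0 m1] := mu01 i.
have := turns_bound s2 iP; have := turns_bound s1 iP; rewrite !ler_norml mulrBl.
move: (turns i s1)%:R (turns i s2)%:R (s1%:R / P%:R) (s2%:R / P%:R) => t1 t2 x1 x2 /andP[h3 h4] /andP[h5 h6].
have /andP[h1 _] := @floor_itv R (mu i * t2).
have /andP[_ h2] := @floor_itv R (mu i * t1).
rewrite rmorphD /= in h2.
have h7 : mu i * t2 <= mu i * (x2 + 1) by rewrite ler_wpM2l//; lra.
have h8 : mu i * (x1 - 1) <= mu i * t1 by rewrite ler_wpM2l//; lra.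
by nra.
Qed.

Lemma jumps_count0 i s : mu i = 0 -> (i < P)%N -> jumping s && (s %% P == i)%N = false.
Proof.
move=> m0 iP; have := jumpsS s iP; rewrite /jumps m0 !mul0r.
by case: (_ && _) => //; lia.
Qed.

Lemma jumps_bound i s : (i < P)%N -> `|(jumps i s)%:~R - mu i * (s%:R / P%:R)| <= 2.
Proof.
move=> iP; have /andP[m0 m1] := mu01 i.
have := turns_bound s iP; rewrite /jumps !ler_norml.
move: (turns i s)%:R (s%:R / P%:R) => t x /andP[h3 h4].
have /andP[h1 h2] := @floor_itv R (mu i * t); rewrite rmorphD /= in h2.
have h7 : mu i * t <= mu i * (x + 1) by rewrite ler_wpM2l//; lra.
have h8 : mu i * (x - 1) <= mu i * t by rewrite ler_wpM2l//; lra.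
by apply/andP; split; nra.
Qed.

End Schedule.

Section Zigzag.
Context {R : realType} {n : nat}.
Local Notation d := n.+2.
Local Notation N := (2 ^ n.+2)%N.

(* A lattice path that follows the e1-direction at speed tau along bonds of
   type typ s, used with a frequency at most proportional to their weight. *)
Record zigzag (A : 'M[R]_d) (sg : 'I_N -> 'cV[int]_d) (b : 'I_N -> 'I_N -> R) (B : R)
    (Zf : nat -> 'cV[int]_d) (typ : nat -> 'I_N * 'I_N) (fwd act : nat -> bool)
    (tau : R) (dl : nat -> 'cV[R]_d) (D : R) : Prop := {
  zz_tau : 0 < tau ;
  zz_0 : Zf 0%N = 0 ;
  zz_S : forall s, Zf s.+1 = Zf s + (if act s then
     (if fwd s then sg (typ s).1 - sg (typ s).2 else sg (typ s).2 - sg (typ s).1) else 0) ;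
  zz_dl : forall s, A *m emb (Zf s) = (s%:R * tau) *: e1 + dl s ;
  zz_D : forall s, `|dl s| <= D ;
  zz_count : forall i s1 s2, (s1 <= s2)%N ->
     \sum_(s1 <= s < s2) (act s && (typ s == i))%:R <=
       b i.1 i.2 * (tau / B) * (s2%:R - s1%:R) + 3 :> R ;
  zz_zero : forall s, act s -> b (typ s).1 (typ s).2 != 0 }.

(** A bond type takes its turn once per period and is used in a fraction of its turns proportional
    to its multiplier [Lam], backwards if that is negative. The bound of [Lam] by [b] becomes the
    bound on the frequencies, and the calibration identity becomes the direction e_1. *)
Lemma zigzag_exists (A : 'M[R]_d) (Z : 'M[R]_(d, N)) (sg : 'I_N -> 'cV[int]_d)
    (b Lam : 'I_N -> 'I_N -> R) (B : R) :
  corner_labels A Z sg -> 0 < B -> (forall s t, `|Lam s t| <= b s t) ->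
  \sum_s \sum_t Lam s t *: (col s Z - col t Z) = B *: e1 ->
  exists Zf typ fwd act tau dl D, zigzag A sg b B Zf typ fwd act tau dl D.
Proof.
move=> [ZE _ _ _] B0 Lb LamE.
pose T := ('I_N * 'I_N)%type; pose P := #|{: T}|.
have i0 : 'I_N by exists 0%N; rewrite expn_gt0.
have P0 : (0 < P)%N by apply/card_gt0P; exists (i0, i0).
pose ty (i : nat) : T := nth (i0, i0) (enum {: T}) i.
pose L (t : T) := Lam t.1 t.2.
pose L0 := \sum_(t : T) `|L t|.
have L00 : 0 < L0.
  rewrite lt_def sumr_ge0// andbT; apply/eqP => L00.
  have Lz t : L t = 0.
    by apply/eqP; rewrite -normr_eq0; apply/eqP; apply: (psumr_eq0P _ L00).
  have /matrixP/(_ ord0 0) := LamE; rewrite !mxE !eqxx mulr1 big1 ?mxE => [|s _].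
    by move=> /eqP; rewrite eq_sym gt_eqF.
  by rewrite big1// => t _; have := Lz (s, t); rewrite /L/= => ->; rewrite scale0r.
pose mu i := `|L (ty i)| / L0.
have mu01 i : 0 <= mu i <= 1.
  rewrite /mu divr_ge0 ?(ltW L00)//= ler_pdivrMr// mul1r /L0 (bigD1 (ty i))//= lerDl.
  exact: sumr_ge0.
pose fw (t : T) := 0 <= L t.
pose w (t : T) : 'cV[int]_d := if fw t then sg t.1 - sg t.2 else sg t.2 - sg t.1.
have Aw t : `|L t| *: (A *m emb (w t)) = L t *: (col t.1 Z - col t.2 Z).
  have AZ s s' : A *m emb (sg s - sg s') = col s Z - col s' Z.
    rewrite !ZE embB -mulmxBr; congr (_ *m _); by rewrite opprB addrA subrK.
  rewrite /w /fw; case: ifP => [L1|/negbT]; first by rewrite AZ ger0_norm.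
  by rewrite -ltNge => L1; rewrite AZ ltr0_norm// scaleNr -scalerN opprB.
pose Zf s := \sum_(i < P) (jumps P mu i s) *: w (ty i).
(* In a period of P steps the path advances on average by the sum of [Lam s t] (z_s - z_t) divided
   by [L0], which is (B / L0) e_1. *)
pose tau := B / (L0 * P%:R).
have P0' : 0 < P%:R :> R by rewrite ltr0n.
pose dl s := A *m emb (Zf s) - (s%:R * tau) *: e1.
have tyP (i : 'I_P) : ty i = enum_val i by rewrite /ty (enum_val_nth (i0, i0)).
have sumP (V : nmodType) (f : T -> V) : \sum_(i < P) f (ty i) = \sum_t f t.
  rewrite (eq_bigr (fun i : 'I_P => f (enum_val i))) => [|i _]; last by rewrite tyP.
  rewrite (reindex (@enum_rank T)) /=; last exact/onW_bij/enum_rank_bij.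
  by apply: eq_bigr => t _; rewrite enum_rankK.
pose D := \sum_(i < P) 2 * `|A *m emb (w (ty i))|.
exists Zf, (fun s => ty (s %% P)%N), (fun s => fw (ty (s %% P)%N)), (jumping P mu), tau, dl, D.
split.
- by rewrite divr_gt0// mulr_gt0.
- rewrite /Zf big1// => i _; rewrite /jumps turns0 mulr0.
  by rewrite (_ : Num.floor 0 = 0) ?scale0r//; exact: floor0.
- move=> s; rewrite /Zf; have sP : (s %% P < P)%N by rewrite ltn_pmod.
  rewrite (eq_bigr (fun i : 'I_P => jumps P mu i s *: w (ty i) +
     (jumping P mu s && (s %% P == i)%N)%:Z *: w (ty i))); last first.
    by move=> i _; rewrite (jumpsS P0 mu01)// scalerDl.
  rewrite big_split; congr (_ + _); rewrite (bigD1 (Ordinal sP))//= eqxx andbT.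
  rewrite big1 ?addr0 => [|i ne]; last first.
    rewrite (_ : (s %% P == i)%N = false) ?andbF ?scale0r//.
    by apply: contraNF ne => /eqP E; apply/eqP/val_inj.
  by rewrite /w; case: (jumping _ _ _); rewrite ?scale1r ?scale0r.
- by move=> s; rewrite /dl addrC subrK.
- move=> s; rewrite /dl.
  have -> : A *m emb (Zf s) = \sum_(i < P) (jumps P mu i s)%:~R *: (A *m emb (w (ty i))).
    rewrite /Zf (big_morph (fun k : 'cV[int]_d => A *m emb k) (id1 := 0) (op1 := +%R)); last 2 first.
    - by move=> x y; rewrite embD mulmxDr.
    - by rewrite /emb map_mx0 mulmx0.
    by apply: eq_bigr => i _; rewrite /emb map_mxZ -scalemxAr.
  have -> : (s%:R * tau) *: e1 = \sum_(i < P) (mu i * (s%:R / P%:R)) *: (A *m emb (w (ty i))).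
    have -> : (s%:R * tau) *: e1 = (s%:R / (L0 * P%:R)) *: (B *: e1) :> 'cV[R]_d.
      by rewrite scalerA /tau; congr (_ *: _); ring.
    rewrite -LamE pair_big/= scaler_sumr -(sumP _ (fun t => _ *: (Lam t.1 t.2 *: (col t.1 Z - col t.2 Z)))).
    apply: eq_bigr => i _; rewrite -[Lam _ _]/(L (ty i)) -Aw scalerA; congr (_ *: _).
    by rewrite /mu invfM; ring.
  rewrite -sumrB (le_trans (ler_norm_sum _ _ _))// ler_sum// => i _.
  rewrite -scalerBl normrZ ler_wpM2r//; exact: (jumps_bound P0 mu01).
- move=> t s1 s2 s12; have tP : (enum_rank t < P)%N by exact: ltn_ord.
  have tyt : ty (enum_rank t) = t by rewrite tyP enum_rankK.
  have E s : (jumping P mu s && (ty (s %% P)%N == t)) = (jumping P mu s && (s %% P == enum_rank t)%N).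
    congr (_ && _); have sP : (s %% P < P)%N by rewrite ltn_pmod.
    rewrite (tyP (Ordinal sP)) -[t in LHS]enum_rankK (inj_eq enum_val_inj).
    by rewrite -val_eqE.
  rewrite (eq_bigr (fun s => (jumping P mu s && (s %% P == enum_rank t)%N)%:R)); last by move=> s _; rewrite E.
  apply: le_trans (jumps_count_le P0 mu01 tP s12) _; rewrite lerD2r /mu tyt /tau.
  have -> : `|L t| / L0 * ((s2%:R - s1%:R) / P%:R) = `|L t| * ((L0 * P%:R)^-1 * (s2%:R - s1%:R)).
    by rewrite invfM; ring.
  have -> : b t.1 t.2 * (B / (L0 * P%:R) / B) * (s2%:R - s1%:R) = b t.1 t.2 * ((L0 * P%:R)^-1 * (s2%:R - s1%:R)).
    by field; rewrite !gt_eqF.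
  rewrite ler_wpM2r ?Lb// mulr_ge0 ?invr_ge0 ?mulr_ge0 ?(ltW L00)//.
  by rewrite subr_ge0 ler_nat.
- move=> s js; have sP : (s %% P < P)%N by rewrite ltn_pmod.
  apply: contraTneq js => b0.
  have m0 : mu (s %% P)%N = 0.
    have := Lb (ty (s %% P)%N).1 (ty (s %% P)%N).2; rewrite b0 normr_le0 => /eqP.
    by rewrite /mu /L => ->; rewrite normr0 mul0r.
  by have := jumps_count0 P0 mu01 s m0 sP; rewrite eqxx andbT => ->.
Qed.

End Zigzag.

(** * Elastic blocks *)

Section SecondDifferences.
Context {R : realType} {n : nat}.
Local Notation d := n.+2.
Local Notation N := (2 ^ n.+2)%N.
Implicit Types (u phi : 'cV[int]_d -> 'cV[R]_d) (q g h : 'cV[int]_d) (F : seq 'cV[int]_d).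

Definition small_shift g := forall j, `|g j 0| <= 1.

Definition prefix_shift h (m : nat) : 'cV[int]_d := \col_j (if (j < m)%N then h j 0 else 0).

Lemma prefix_shift0 h : prefix_shift h 0 = 0.
Proof. by apply/matrixP => i j; rewrite !mxE. Qed.

Lemma prefix_shift_full h : prefix_shift h d = h.
Proof. by apply/matrixP => i j; rewrite mxE ltn_ord (ord1 j). Qed.

Lemma prefix_shiftS h (m : 'I_d) :
  prefix_shift h m.+1 = prefix_shift h m + h m 0 *: basis m.
Proof.
apply/matrixP => i j; rewrite (ord1 j) !mxE eqxx andbT ltnS leq_eqVlt -val_eqE /=.
have [/val_inj ->|ne] := eqVneq (i : nat) m; first by rewrite ltnn /= mulr1 add0r.
by rewrite mulr0 addr0.
Qed.

Lemma small_prefix h m : small_shift h -> small_shift (prefix_shift h m).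
Proof. by move=> hs j; rewrite mxE; case: ifP. Qed.

Lemma small_prefix_back h (m : 'I_d) : small_shift h -> small_shift (prefix_shift h m - basis m).
Proof.
move=> hs j; rewrite !mxE eqxx andbT; have [->|jm] := eqVneq j m.
  by rewrite ltnn sub0r normrN.
by rewrite subr0; case: ifP.
Qed.

Lemma small_entry (x : int) : `|x| <= 1 -> [\/ x = 0, x = 1 | x = -1].
Proof.
move=> h; have : x = 0 \/ x = 1 \/ x = -1 by lia.
by case=> [->|[->|->]]; [constructor 1|constructor 2|constructor 3].
Qed.

(** The shift is performed one coordinate at a time; a step -1 is a step +1 read backwards from a
    shifted base point. The norm is taken after summation over F, because the sums are small through
    cancellation and the single terms need not be. *)
Lemma walk_bound (V : normedModType R) F (phi : 'cV[int]_d -> V) (E : R) h : small_shift h ->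
  (forall g j, small_shift g -> `|\sum_(q <- F) (phi (q + g + basis j) - phi (q + g))| <= E) ->
  `|\sum_(q <- F) (phi (q + h) - phi q)| <= d%:R * E.
Proof.
move=> hs H; have E0 : 0 <= E.
  by apply: le_trans (H 0 ord0 _) => // j; rewrite mxE normr0.
have -> : \sum_(q <- F) (phi (q + h) - phi q) = \sum_(m < d) \sum_(q <- F)
    (phi (q + prefix_shift h m.+1) - phi (q + prefix_shift h m)).
  rewrite exchange_big; apply: eq_bigr => q _ /=.
  have := telescope_sumr (fun m => phi (q + prefix_shift h m)) (leq0n d).
  by rewrite big_mkord prefix_shift0 addr0 prefix_shift_full => ->.
rewrite (le_trans (ler_norm_sum _ _ _))//.
apply: (@le_trans _ _ (\sum_(m < d) E)); last by rewrite sumr_const card_ord mulr_natl.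
apply: ler_sum => m _; have := small_entry (hs m); rewrite prefix_shiftS.
case=> ->.
- by rewrite scale0r addr0 big1 ?normr0// => q _; rewrite subrr.
- under eq_bigr do rewrite scale1r addrA.
  by apply: H; exact: small_prefix.
- have := H (prefix_shift h m - basis m) m (small_prefix_back m hs).
  rewrite -normrN -sumrN; congr (`| _ | <= _); apply: eq_bigr => q _.
  by rewrite scaleN1r opprB !addrA subrK.
Qed.

(* Second differences measure how far [u] is from its affine extrapolation. *)
Definition diff i u q : 'cV[R]_d := u (q + basis i) - u q.

Lemma extrapolation_bound F u (E : R) h : small_shift h ->
  (forall g i j, small_shift g ->
     `|\sum_(q <- F) (diff i u (q + g + basis j) - diff i u (q + g))| <= E) ->
  `|\sum_(q <- F) (u (q + h) - u q - \sum_i (h i 0)%:~R *: diff i u q)| <= d%:R * (d%:R * E).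
Proof.
move=> hs H; have E0 : 0 <= E.
  by apply: le_trans (H 0 ord0 ord0 _) => // j; rewrite mxE normr0.
have -> : \sum_(q <- F) (u (q + h) - u q - \sum_i (h i 0)%:~R *: diff i u q) =
   \sum_(m < d) \sum_(q <- F)
    (u (q + prefix_shift h m.+1) - u (q + prefix_shift h m) - (h m 0)%:~R *: diff m u q).
  rewrite exchange_big; apply: eq_bigr => q _ /=; rewrite sumrB; congr (_ - _).
  have := telescope_sumr (fun m => u (q + prefix_shift h m)) (leq0n d).
  by rewrite big_mkord prefix_shift0 addr0 prefix_shift_full => ->.
rewrite (le_trans (ler_norm_sum _ _ _))//.
apply: (@le_trans _ _ (\sum_(m < d) (d%:R * E))); last by rewrite sumr_const card_ord -[leLHS]mulr_natl.
apply: ler_sum => m _; have := small_entry (hs m); rewrite prefix_shiftS.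
case=> ->.
- rewrite scale0r addr0 big1 ?normr0 ?mulr_ge0// => q _.
  by rewrite subrr sub0r mulr0z scale0r oppr0.
- have := walk_bound (phi := diff m u) (small_prefix m hs) (fun g j => H g m j).
  congr (`| _ | <= _); apply: eq_bigr => q _.
  by rewrite scale1r mulr1z scale1r /diff addrA.
- have := walk_bound (phi := diff m u) (small_prefix_back m hs) (fun g j => H g m j).
  rewrite -normrN -sumrN; congr (`| _ | <= _); apply: eq_bigr => q _.
  rewrite scaleN1r mulrN1z scaleN1r opprK /diff !addrA subrK opprD !opprB.
  by rewrite addrA.
Qed.

End SecondDifferences.

(** * Discrete compatibility and telescoping of the stress *)

Section Compatibility.
Context {R : realType} {n : nat}.
Local Notation d := n.+2.
Local Notation N := (2 ^ n.+2)%N.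
Variables (A : 'M[R]_d) (Z : 'M[R]_(d, N)) (sg : 'I_N -> 'cV[int]_d).
Variables (T : 'M[R]_(d, N) -> R) (al : R).
Hypothesis unitA : A \in unitmx.
Hypothesis labels : corner_labels A Z sg.
Hypothesis TD : forall G H, T (G + H) = T G + T H.
Hypothesis TZ : forall a H, T (a *: H) = a * T H.
Hypothesis T_translation : forall c, T (translation c) = 0.
Hypothesis T_affine : forall F : 'M[R]_d, T (F *m Z) = al * F ord0 ord0.
Implicit Types (u : 'cV[int]_d -> 'cV[R]_d) (q g h : 'cV[int]_d) (F : seq 'cV[int]_d).

Definition Dmx u q : 'M[R]_d := \matrix_(a, i) diff i u q a 0.
Definition strain u q : 'M[R]_d := 2^-1 *: (A^T *m Dmx u q + (Dmx u q)^T *m A).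
Definition cellmx u q : 'M[R]_(d, N) := \matrix_(a, s) u (q + sg s) a 0.
Definition grad u q : 'M[R]_d := Dmx u q *m invmx A.

Lemma T_bound : exists2 C : R, 0 <= C & forall X, `|T X| <= C * `|X|.
Proof.
have T0 : T 0 = 0 by rewrite -(scale0r 0) TZ mul0r.
exists (\sum_i \sum_j `|T (delta_mx i j)|); first by do 2!apply: sumr_ge0 => ? _.
move=> X; rewrite {1}[X]matrix_sum_delta (big_morph _ TD T0).
rewrite (le_trans (ler_norm_sum _ _ _))// mulr_suml ler_sum// => i _.
rewrite (big_morph _ TD T0) (le_trans (ler_norm_sum _ _ _))// mulr_suml ler_sum// => j _.
by rewrite TZ normrM mulrC ler_wpM2l// mx_entry_le.
Qed.

Lemma T_sum (I : Type) (r : seq I) (X : I -> 'M[R]_(d, N)) :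
  T (\sum_(i <- r) X i) = \sum_(i <- r) T (X i).
Proof. by rewrite (big_morph _ TD (_ : T 0 = 0))// -(scale0r 0) TZ mul0r. Qed.

Lemma dot_colE (X Y : 'M[R]_d) i j : (X^T *m Y) i j = dot (col i X) (col j Y).
Proof. by rewrite mxE; apply: eq_bigr => k _; rewrite !mxE. Qed.

Lemma strainE u q i j : strain u q i j =
  2^-1 * (dot (col i A) (diff j u q) + dot (col j A) (diff i u q)).
Proof.
have colD k : col k (Dmx u q) = diff k u q.
  by apply/matrixP => a b; rewrite (ord1 b) !mxE.
by rewrite mxE [in LHS]mxE !dot_colE !colD [X in _ + X]dotC.
Qed.

(** Discrete form of the classical identity that expresses second derivatives of a displacement by
    first derivatives of its linearised strain. It rests on the symmetry of second differences. *)
Lemma second_difference u q i j l :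
  dot (col l A) (diff i u (q + basis j) - diff i u q) =
  (strain u (q + basis i) - strain u q) j l + (strain u (q + basis j) - strain u q) i l
  - (strain u (q + basis l) - strain u q) i j.
Proof.
have sym a b : diff a u (q + basis b) - diff a u q = diff b u (q + basis a) - diff b u q.
  rewrite /diff (addrAC q (basis b)).
  by apply/matrixP => x y; rewrite !mxE; ring.
have E (M M' : 'M[R]_d) a b : (M - M') a b = M a b - M' a b by rewrite !mxE.
rewrite !E !strainE.
have Es (a b : 'I_d) (v w : 'cV[R]_d) x y : 2^-1 * (dot v x + dot w y) = 2^-1 * dot v x + 2^-1 * dot w y by rewrite mulrDr.
have -> : dot (col l A) (diff i u (q + basis j) - diff i u q) =
   2^-1 * dot (col l A) (diff i u (q + basis j) - diff i u q) +
   2^-1 * dot (col l A) (diff j u (q + basis i) - diff j u q).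
  by rewrite sym -mulrDl -[2^-1]div1r -splitr mul1r.
have dBr (v x y : 'cV[R]_d) : dot v (x - y) = dot v x - dot v y by rewrite (dotC v) dotBl !(dotC _ v).
have s1 : dot (col j A) (diff l u (q + basis i)) - dot (col j A) (diff l u q) =
   dot (col j A) (diff i u (q + basis l)) - dot (col j A) (diff i u q) by rewrite -!dBr sym.
have s2 : dot (col i A) (diff l u (q + basis j)) - dot (col i A) (diff l u q) =
   dot (col i A) (diff j u (q + basis l)) - dot (col i A) (diff j u q) by rewrite -!dBr sym.
by rewrite (dBr _ (diff i u (q + basis j))) (dBr _ (diff j u (q + basis i))); lra.
Qed.

Lemma Hessian_sum_bound : exists2 K : R, 0 < K & forall F u (E : R), 
  (forall g i j l, small_shift g ->
    `|\sum_(q <- F) (strain u (q + g + basis i) - strain u (q + g)) j l| <= E) ->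
  forall g i j, small_shift g ->
    `|\sum_(q <- F) (diff i u (q + g + basis j) - diff i u (q + g))| <= K * E.
Proof.
pose K := d%:R * `|(invmx A)^T| * 3 + 1.
exists K; first by rewrite ltr_wpDl// !mulr_ge0.
move=> F u E H g i j gs; set X := \sum_(q <- F) _.
have E0 : 0 <= E by apply: le_trans (H g i i i gs).
have AX : `|A^T *m X| <= 3 * E.
  apply: mx_norm_le => [|l k]; first by rewrite mulr_ge0.
  have -> : (A^T *m X) l k = dot (col l A) X.
    by rewrite (ord1 k) mxE; apply: eq_bigr => a _; rewrite !mxE.
  rewrite /X (big_morph (fun x => dot (col l A) x) (id1 := 0) (op1 := +%R)); last 2 first.
  - by move=> x y; rewrite dotC dotDl !(dotC _ (col l A)).
  - by rewrite -(scale0r 0) dotZr mul0r.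
  under eq_bigr do rewrite second_difference.
  rewrite sumrB big_split /=.
  rewrite (le_trans (ler_normB _ _))// (_ : 3 = 1 + 1 + 1 :> R); last by ring.
  rewrite !mulrDl !mul1r lerD ?H// (le_trans (ler_normD _ _))// lerD// H//.
have -> : X = (invmx A)^T *m (A^T *m X) by rewrite mulmxA -trmx_mul mulmxV// trmx1 mul1mx.
apply: le_trans (mx_norm_mul _ _) _.
apply: (@le_trans _ _ (d%:R * `|(invmx A)^T| * (3 * E))); first by rewrite ler_wpM2l.
by rewrite /K [leRHS]mulrDl mul1r mulrA lerDl.
Qed.

Lemma gradM u q (x : 'cV[R]_d) : grad u q *m (A *m x) = \sum_i x i 0 *: diff i u q.
Proof.
rewrite mulmxA mulmxKV//; apply/matrixP => a k; rewrite (ord1 k) !mxE summxE.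
by apply: eq_bigr => i _; rewrite !mxE mulrC.
Qed.

Lemma sg_small s : small_shift (sg s).
Proof. by have [_ sg01 _ _] := labels; move=> j; have [->|->] := sg01 s j. Qed.

(* On affine [u] the summands vanish, because T (F Z) = al F_11 and the
   displacement along the path is A g = tau e1 + delta' - delta. *)
Theorem stress_telescoping : exists2 K : R, 0 < K &
  forall F u (E tau : R) g (dl dl' : 'cV[R]_d), 0 <= tau -> small_shift g ->
  A *m emb g = tau *: e1 + dl' - dl ->
  (forall g i j l, small_shift g ->
    `|\sum_(q <- F) (strain u (q + g + basis i) - strain u (q + g)) j l| <= E) ->
  `|\sum_(q <- F) (tau * T (cellmx u q) - al * dot e1
      ((u (q + g) - grad u (q + g) *m dl') - (u q - grad u q *m dl)))| <=
   K * (1 + tau + `|dl'|) * E.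
Proof.
have [K K0 KP] := Hessian_sum_bound; have [CT CT0 TB] := T_bound.
pose K1 := d%:R * (d%:R * K) : R.
have K10 : 0 <= K1 by rewrite !mulr_ge0// ltW.
have K1E E : d%:R * (d%:R * (K * E)) = K1 * E by rewrite /K1 !mulrA.
have K1le E : 0 <= E -> d%:R * (K * E) <= K1 * E.
  move=> E0; rewrite -K1E ler_peMl ?ler1n//.
  by apply: mulr_ge0 => //; apply: mulr_ge0 => //; exact: ltW.
clearbody K1.
pose K2 := `|al| * (d%:R * K1 * `|invmx A|) * d%:R.
exists (CT * K1 + `|al| * K1 + K2 + 1).
  by rewrite ltr_wpDl// /K2 !addr_ge0// !mulr_ge0.
move=> F u E tau g dl dl' tau0 gs Ag H.
have E0 : 0 <= E by apply: le_trans (H g ord0 ord0 ord0 gs).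
have HD := KP F u E H.
have ext h : small_shift h -> `|\sum_(q <- F) (u (q + h) - u q - \sum_i (h i 0)%:~R *: diff i u q)| <= K1 * E.
  by move=> hs; have := extrapolation_bound hs HD; rewrite K1E.
pose rho q : 'M[R]_(d, N) := \matrix_(a, s) (u (q + sg s) - u q - \sum_i ((sg s) i 0)%:~R *: diff i u q) a 0.
have rhoB : `|\sum_(q <- F) rho q| <= K1 * E.
  apply: mx_norm_le => [|a s]; first by rewrite mulr_ge0.
  apply: le_trans (ext (sg s) (sg_small s)); apply: le_trans (mx_entry_le _ a 0).
  by rewrite !summxE le_eqVlt; apply/orP; left; apply/eqP; congr (`| _ |); apply: eq_bigr => q _; rewrite mxE.
have cellE q : cellmx u q = translation (u q + grad u q *m (A *m const_mx 2^-1)) + grad u q *m Z + rho q.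
  have [ZE _ _ _] := labels.
  apply/matrixP => a s; rewrite [LHS]mxE.
  have GZ : (grad u q *m Z) a s = (grad u q *m col s Z) a 0.
    by rewrite !mxE; apply: eq_bigr => k _; rewrite [X in _ = _ * X]mxE.
  have Eq : u (q + sg s) = u q + grad u q *m (A *m const_mx 2^-1) + grad u q *m col s Z +
     (u (q + sg s) - u q - \sum_i ((sg s) i 0)%:~R *: diff i u q).
    rewrite ZE -[X in _ = X + _]addrA -mulmxDr -mulmxDr (addrC (const_mx _)) subrK gradM.
    rewrite (eq_bigr (fun i => ((sg s) i 0)%:~R *: diff i u q)); last by move=> i _; rewrite embE.
    by set x := \sum_i _; clearbody x; apply/matrixP => y k; rewrite !mxE; ring.
  rewrite Eq [RHS]mxE [X in _ = X + _]mxE GZ [X in _ = X + _ + _]mxE [X in _ = _ + X]mxE.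
  by rewrite [LHS]mxE [X in X + _ = _]mxE.
have TE q : T (cellmx u q) = al * (grad u q) ord0 ord0 + T (rho q).
  by rewrite cellE !TD T_translation T_affine add0r.
pose r1 q := u (q + g) - u q - \sum_i (g i 0)%:~R *: diff i u q.
pose r2 q := (grad u (q + g) - grad u q) *m dl'.
(* The affine part of the displacement contributes the same on both sides and cancels. There remain
   the deviation [rho] of the cell from affine, the deviation [r1] of the step, and the change [r2]
   of the gradient, all governed by second differences. *)
have step q : tau * T (cellmx u q) - al * dot e1
      ((u (q + g) - grad u (q + g) *m dl') - (u q - grad u q *m dl)) =
   tau * T (rho q) - al * dot e1 (r1 q) + al * dot e1 (r2 q).
  have -> : (u (q + g) - grad u (q + g) *m dl') - (u q - grad u q *m dl) =
     r1 q - r2 q + tau *: (grad u q *m e1).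
    have -> : tau *: (grad u q *m e1) = \sum_i (g i 0)%:~R *: diff i u q - grad u q *m dl' + grad u q *m dl.
      rewrite (eq_bigr (fun i => (emb g : 'cV[R]_d) i 0 *: diff i u q)); last by move=> i _; rewrite embE.
      rewrite -gradM Ag scalemxAr -mulmxBr -mulmxDr; congr (_ *m _).
      by apply/matrixP => y k; rewrite !mxE; ring.
    rewrite /r1 /r2 mulmxBl; set s := \sum_i _.
    by apply/matrixP => a k; rewrite !mxE; ring.
  rewrite TE mulrDr dotC dotDl dotBl dotZl !(dotC _ e1).
  have -> : dot e1 (grad u q *m e1) = (grad u q) ord0 ord0.
    by rewrite dot_e1 -colE mxE.
  by ring.
rewrite (eq_bigr _ (fun q _ => step q)) big_split sumrB /= -!mulr_sumr -T_sum.
have dsum (X : 'cV[int]_d -> 'cV[R]_d) : \sum_(q <- F) dot e1 (X q) = dot e1 (\sum_(q <- F) X q).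
  rewrite (big_morph (fun x => dot e1 x) (id1 := 0) (op1 := +%R))//.
  - by move=> x y; rewrite dotC dotDl !(dotC _ e1).
  - by rewrite -(scale0r 0) dotZr mul0r.
have de1 (x : 'cV[R]_d) : `|dot e1 x| <= `|x| by rewrite dot_e1 mx_entry_le.
have b1 : `|tau * T (\sum_(q <- F) rho q)| <= tau * (CT * K1 * E).
  rewrite normrM ger0_norm// ler_wpM2l// (le_trans (TB _))// -mulrA ler_wpM2l//.
have b2 : `|al * \sum_(q <- F) dot e1 (r1 q)| <= `|al| * K1 * E.
  by rewrite normrM dsum -mulrA ler_wpM2l// (le_trans (de1 _))// ext.
have b3 : `|al * \sum_(q <- F) dot e1 (r2 q)| <= K2 * `|dl'| * E.
  rewrite normrM dsum /K2 -!mulrA ler_wpM2l// (le_trans (de1 _))//.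
  rewrite /r2 -mulmx_suml.
  have -> : \sum_(q <- F) (grad u (q + g) - grad u q) = (\sum_(q <- F) (Dmx u (q + g) - Dmx u q)) *m invmx A.
    by rewrite mulmx_suml; apply: eq_bigr => q _; rewrite mulmxBl.
  have DB : `|\sum_(q <- F) (Dmx u (q + g) - Dmx u q)| <= K1 * E.
    apply: mx_norm_le => [|a i]; first by rewrite mulr_ge0.
    have := walk_bound (phi := diff i u) gs (fun h j => HD h i j).
    have -> : (\sum_(q <- F) (Dmx u (q + g) - Dmx u q)) a i = (\sum_(q <- F) (diff i u (q + g) - diff i u q)) a 0.
      by rewrite !summxE; apply: eq_bigr => q _; rewrite !mxE.
    by move=> h; rewrite (le_trans (mx_entry_le _ _ _))// (le_trans h)// K1le.
  rewrite (le_trans (mx_norm_mul _ _))//.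
  have : `|(\sum_(q <- F) (Dmx u (q + g) - Dmx u q)) *m invmx A| <= d%:R * (K1 * E) * `|invmx A|.
    by rewrite (le_trans (mx_norm_mul _ _))// ler_wpM2r// ler_wpM2l.
  set y := `|_ *m _| => hy.
  have : d%:R * y * `|dl'| <= d%:R * (d%:R * (K1 * E) * `|invmx A|) * `|dl'|.
    by rewrite ler_wpM2r// ler_wpM2l.
  by move=> h; apply: le_trans h _; rewrite le_eqVlt; apply/orP; left; apply/eqP; ring.
rewrite (le_trans (ler_normD _ _))//.
have := ler_normB (tau * T (\sum_(q <- F) rho q)) (al * \sum_(q <- F) dot e1 (r1 q)).
have p1 : 0 <= CT * K1 * E by rewrite !mulr_ge0.
have p2 : 0 <= `|al| * K1 * E by rewrite !mulr_ge0.
have p3 : 0 <= K2 * E by rewrite /K2 !mulr_ge0.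
have d0 : 0 <= `|dl'| by [].
move: b1 b2 b3 p1 p2 p3 d0; move: (`|tau * _|) (`|al * \sum_(q <- F) dot e1 (r1 q)|) (`|al * \sum_(q <- F) dot e1 (r2 q)|) (`|tau * _ - _|) => x y z w.
move: (CT * K1) (`|al| * K1) K2 `|dl'| => a b c D b1 b2 b3 p1 p2 p3 d0 h.
have q1 : 0 <= b * E * tau by rewrite mulr_ge0.
have q2 : 0 <= a * E * D by rewrite mulr_ge0.
have q3 : 0 <= b * E * D by rewrite mulr_ge0.
have q4 : 0 <= c * E * tau by rewrite mulr_ge0.
have q5 : 0 <= E * tau by rewrite mulr_ge0.
have q6 : 0 <= E * D by rewrite mulr_ge0.
by lra.
Qed.

End Compatibility.

(** * Comparison of rotations and chains of cells *)

Section RotationComparison.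
Context {R : realType} {n : nat}.
Local Notation d := n.+2.
Local Notation N := (2 ^ n.+2)%N.

Lemma det_lipschitz (p : nat) (X Y : 'M[R]_p.+1) (X0 e : R) : 0 <= X0 -> 0 <= e ->
  (forall i j, `|X i j| <= X0) -> (forall i j, `|Y i j| <= X0) ->
  (forall i j, `|X i j - Y i j| <= e) ->
  `|\det X - \det Y| <= #|{: {perm 'I_p.+1}}|%:R * (p.+1%:R * e * X0 ^+ p).
Proof.
move=> X00 e0 XX YX XY; rewrite /determinant -sumrB (le_trans (ler_norm_sum _ _ _))//.
rewrite mulr_natl -sumr_const; apply: ler_sum => s _.
by rewrite -mulrBr normrM normr_sign mul1r; apply: prod_diff.
Qed.

(* Row i of the adjugate of S A = adj(A) S^T does not involve column i. *)
Lemma SO_columns (A : 'M[R]_d) : A \in unitmx -> exists2 C : R, 0 < C &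
  forall i (S : 'M[R]_d) (e : R), SO S ->
  (forall j, j != i -> `|S *m col j A - col j A| <= e) -> `|S - 1%:M| <= C * e.
Proof.
move=> uA; have detA : \det A != 0 by rewrite -unitfE -unitmxE.
pose X0 := d%:R * `|A|; have X00 : 0 <= X0 by rewrite mulr_ge0.
pose K := #|{: {perm 'I_n.+1}}|%:R * (n.+1%:R * X0 ^+ n) : R.
have K0 : 0 <= K by rewrite !mulr_ge0// exprn_ge0.
(* Row i of the adjugate is normal to the other columns of A. Putting it in place of column i gives
   the invertible matrix [M' i], and S moves every column of it by a controlled amount. *)
pose nv i : 'cV[R]_d := \col_a (\adj A) i a.
pose c i : 'rV[R]_d := (invmx A *m nv i)^T.
pose M' i := A *m (row_shear i (c i))^T.
have M'col i j : j != i -> col j (M' i) = col j A.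
  move=> ji; rewrite /M'; apply/matrixP => a b; rewrite !mxE (bigD1 j)//= big1 ?addr0 => [|l lj].
    by rewrite !mxE (negbTE ji) eqxx mulr1.
  by rewrite !mxE (negbTE ji) eq_sym (negbTE lj) mulr0.
have M'coli i : col i (M' i) = nv i.
  have -> : col i (M' i) = A *m (invmx A *m nv i).
    by apply/matrixP => a b; rewrite !mxE; apply: eq_bigr => l _; rewrite !mxE eqxx (ord1 b).
  by rewrite mulKVmx.
have uM' i : M' i \in unitmx.
  rewrite /M' unitmx_mul uA unitmx_tr unitmxE det_row_shear unitfE mxE.
  have -> : (invmx A *m nv i) i 0 = (\det A)^-1 * dot (nv i) (nv i).
    rewrite /invmx uA -scalemxAl mxE; congr (_ * _); rewrite mxE.
    by apply: eq_bigr => a _; congr (_ * _); rewrite [RHS]mxE.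
  rewrite mulf_neq0 ?invr_eq0//; apply/eqP => /dot_eq0 n0.
  have /matrixP/(_ i i) := mul_adj_mx A; rewrite !mxE eqxx mulr1n => E.
  move: detA; rewrite -E big1 ?eqxx// => a _.
  by have /matrixP/(_ a 0) := n0; rewrite !mxE => ->; rewrite mul0r.
pose C := \sum_i (d%:R * `|invmx (M' i)| * (1 + K)) + 1.
have C0 : 0 <= \sum_i (d%:R * `|invmx (M' i)| * (1 + K)).
  by apply: sumr_ge0 => i _; rewrite !mulr_ge0// addr_ge0.
exists C; first by rewrite /C ltr_wpDl.
move=> i S e SOS H.
have e0 : 0 <= e.
  have [j ji] : exists j : 'I_d, j != i.
    have [->|i0] := eqVneq i ord0; first by exists ord_max.
    by exists ord0; rewrite eq_sym.
  exact: le_trans (H j ji).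
have [SS detS] := SOS.
have adjSA : \adj (S *m A) = \adj A *m S^T.
  have uSA : S *m A \in unitmx by rewrite unitmxE det_mulmx detS mul1r unitfE.
  apply: (can_inj (mulKmx uSA)); rewrite mul_mx_adj det_mulmx detS mul1r.
  rewrite -mulmxA (mulmxA A) mul_mx_adj mul_scalar_mx -scalemxAr SOP//.
  by rewrite scalemx1.
have SAX a b : `|(S *m A) a b| <= X0.
  by rewrite (le_trans (mx_entry_le _ _ _))// SO_mul_norm.
have AX a b : `|A a b| <= X0.
  by rewrite (le_trans (mx_entry_le _ _ _))// ler_peMl// ler1n.
have cof k : `|(\adj A *m S^T - \adj A) i k| <= K * e.
  rewrite -adjSA !mxE /cofactor -mulrBr normrM normrX normrN1 expr1n mul1r.
  have := @det_lipschitz n (row' k (col' i (S *m A))) (row' k (col' i A)) X0 e X00 e0.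
  rewrite /K -!mulrA (mulrC _ e) !mulrA => h; rewrite (le_trans (h _ _ _))//.
  - by move=> a b; rewrite 2!mxE; exact: SAX.
  - by move=> a b; rewrite !mxE.
  - move=> a b; have := H (lift i b); rewrite eq_sym neq_lift => /(_ isT) hb.
    apply: le_trans hb; have := mx_entry_le (S *m col (lift i b) A - col (lift i b) A) (lift k a) 0.
    apply: le_trans; rewrite le_eqVlt; apply/orP; left; apply/eqP; congr (`| _ |).
    by rewrite !mxE; congr (_ - _); apply: eq_bigr => l _; rewrite !mxE.
have Sn : `|S *m nv i - nv i| <= K * e.
  apply: mx_norm_le => [|a b]; first by rewrite mulr_ge0.
  apply: le_trans (cof a); rewrite le_eqVlt; apply/orP; left; apply/eqP; congr (`| _ |).
  by rewrite !mxE (ord1 b); congr (_ - _); apply: eq_bigr => l _; rewrite !mxE mulrC.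
have SM : `|(S - 1%:M) *m M' i| <= (1 + K) * e.
  apply: mx_norm_le => [|a b]; first by rewrite mulr_ge0// addr_ge0.
  have -> : ((S - 1%:M) *m M' i) a b = (S *m col b (M' i) - col b (M' i)) a 0.
    by rewrite mulmxBl mul1mx !mxE; congr (_ - _); apply: eq_bigr => l _; rewrite [X in _ = _ * X]mxE.
  rewrite (le_trans (mx_entry_le _ _ _))// mulrDl mul1r; have [->|bi] := eqVneq b i.
    by rewrite M'coli (le_trans Sn)// lerDr.
  by rewrite M'col// (le_trans (H b bi))// lerDl mulr_ge0.
have -> : S - 1%:M = (S - 1%:M) *m M' i *m invmx (M' i) by rewrite mulmxK.
rewrite (le_trans (mx_norm_mul _ _))//.
apply: (@le_trans _ _ (d%:R * ((1 + K) * e) * `|invmx (M' i)|)).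
  by rewrite ler_wpM2r// ler_wpM2l.
have -> : d%:R * ((1 + K) * e) * `|invmx (M' i)| = d%:R * `|invmx (M' i)| * (1 + K) * e by ring.
rewrite ler_wpM2r// /C (bigD1 i)//= -addrA lerDl addr_ge0//.
by apply: sumr_ge0 => l _; rewrite !mulr_ge0// addr_ge0.
Qed.

Lemma floor_step (x y : R) : `|y| <= 1 -> `|Num.floor (x + y) - Num.floor x| <= 1.
Proof.
rewrite ler_norml => /andP[y0 y1].
have /andP[h1 h2] := @floor_itv R x; have /andP[h3 h4] := @floor_itv R (x + y).
rewrite rmorphD /= in h2; rewrite rmorphD /= in h4.
move: h1 h2 h3 h4; move: (Num.floor x) (Num.floor (x + y)) => a b h1 h2 h3 h4.
have : a%:~R < b%:~R + 1 + 1 :> R by lra.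
have : b%:~R < a%:~R + 1 + 1 :> R by lra.
by rewrite -[1]/(1%:~R) -!rmorphD/= !ltr_int => h5 h6; lia.
Qed.

(* Integer points rounded from the segment [k, k'] form a chain. *)
Lemma chain_bound (V : normedModType R) (phi : 'cV[int]_d -> V) (gam : R) (k k' : 'cV[int]_d) (J : nat) :
  (0 < J)%N -> (forall j, `|(k' j 0 - k j 0)%:~R| <= J%:R :> R) ->
  (forall (q : 'cV[int]_d) (t : R) i, 0 <= t <= 1 ->
    (forall j, `|(q j 0)%:~R - ((k j 0)%:~R + t * (k' j 0 - k j 0)%:~R)| <= 2) ->
    `|phi (q + basis i) - phi q| <= gam) ->
  `|phi k' - phi k| <= J%:R * (d%:R * gam).
Proof.
move=> J0 kJ H; have J0' : 0 < J%:R :> R by rewrite ltr0n.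
pose x (j : nat) : 'cV[int]_d := k + \col_i Num.floor ((j%:R / J%:R) * (k' i 0 - k i 0)%:~R : R).
have x0 : x 0%N = k.
  by apply/matrixP => a b; rewrite (ord1 b) !mxE mul0r mul0r floor0 addr0.
have xJ : x J = k'.
  apply/matrixP => a b; rewrite (ord1 b) !mxE divff ?gt_eqF// mul1r intrKfloor.
  by rewrite addrC subrK.
rewrite -x0 -xJ.
have -> : phi (x J) - phi (x 0%N) = \sum_(0 <= j < J) (phi (x j.+1) - phi (x j)).
  by rewrite (telescope_sumr (phi \o x)).
rewrite (le_trans (ler_norm_sum _ _ _))// big_mkord.
apply: (@le_trans _ _ (\sum_(j < J) (d%:R * gam))); last by rewrite sumr_const card_ord -[leLHS]mulr_natl.
apply: ler_sum => j _.
have hs : small_shift (x j.+1 - x j).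
  move=> i; rewrite !mxE opprD addrACA subrr add0r -natr1 mulrDl mulrDl.
  apply: floor_step; rewrite mul1r normrM normfV normr_nat mulrC ler_pdivrMr// mul1r.
  exact: kJ.
have := @walk_bound R n V [:: x j] phi gam (x j.+1 - x j) hs.
rewrite !big_seq1 (addrC (x j)) subrK; apply => g i gs; rewrite big_seq1.
apply: (H _ (j%:R / J%:R)).
  by rewrite divr_ge0//= ler_pdivrMr// mul1r ler_nat ltnW.
move=> l; have := gs l; rewrite -(ler_int R) intr_norm rmorph1 ler_norml => /andP[g1 g2].
set y : R := j%:R / J%:R * (k' l 0 - k l 0)%:~R.
have -> : ((x j + g) l 0)%:~R = (k l 0)%:~R + (Num.floor y)%:~R + (g l 0)%:~R :> R.
  have -> : (x j + g) l 0 = k l 0 + Num.floor y + g l 0 by rewrite !mxE.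
  by rewrite !intrD.
have /andP[h1 h2] := @floor_itv R y; rewrite rmorphD /= in h2.
by rewrite ler_norml; apply/andP; split; lra.
Qed.

End RotationComparison.

(** * Windows and rigidity at a fixed scale *)

Section Windows.
Context {R : realType} {n : nat}.
Local Notation d := n.+2.
Local Notation N := (2 ^ n.+2)%N.
Variables (A : 'M[R]_d).
Hypothesis unitA : A \in unitmx.
Implicit Types (k g q : 'cV[int]_d) (a m : R).

Definition cwin m := pts A (box (fun=> [set x : R | 0 <= x < m])).
Definition vwin a m := pts A (box (fun=> [set x : R | - a <= x <= m + a])).
Definition mu : R := d%:R * `|A|.

Lemma mu_ge0 : 0 <= mu. Proof. by rewrite mulr_ge0. Qed.

Lemma small_shift_norm g : small_shift g -> `|emb g : 'cV[R]_d| <= 1.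
Proof.
move=> gs; apply: mx_norm_le => // i j; rewrite (ord1 j) embE -intr_norm.
by have := gs i; rewrite -(ler_int R) rmorph1.
Qed.

Lemma mul_small (x : 'cV[R]_d) c : `|x| <= c -> `|A *m x| <= mu * c.
Proof. by move=> xc; rewrite (le_trans (mx_norm_mul _ _))// /mu ler_wpM2l// mulr_ge0. Qed.

Lemma vwin_finite a m : finite_set (vwin a m).
Proof.
apply: (@pts_finite R n.+1 A _ (`|a| + `|m|)) => // x xB; apply: mx_norm_le => [|i j].
  by rewrite addr_ge0.
rewrite (ord1 j); have /andP[h1 h2] := xB i.
have := ler_norm a; have := ler_norm m; have := normr_ge0 m.
by rewrite ler_norml => *; apply/andP; split; lra.
Qed.

Lemma cwin_finite m : finite_set (cwin m).
Proof.
apply: sub_finite_set (vwin_finite 0 m) => k kC i.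
by have /andP[h1 h2] := kC i; apply/andP; rewrite oppr0 addr0; split=> //; exact: ltW.
Qed.

Lemma vwin_shift a a' m q (x : 'cV[R]_d) :
  (forall i, - a <= x i 0 <= m + a) -> `|A *m emb q - x| <= a' -> vwin (a + a') m q.
Proof.
move=> xB qx i; have := mx_entry_le (A *m emb q - x) i 0; rewrite !mxE => h.
have := le_trans h qx; rewrite ler_norml; have /andP[h1 h2] := xB i.
by move=> /andP[h3 h4]; apply/andP; split; lra.
Qed.

Lemma vwin_small a m q g : vwin a m q -> small_shift g -> vwin (a + mu) m (q + g).
Proof.
move=> qW gs; apply: (@vwin_shift a mu m _ (A *m emb q)) => //.
by rewrite embD mulmxDr addrC addKr -[mu]mulr1; apply: mul_small; exact: small_shift_norm.
Qed.

Lemma vwin_sub a a' m : a <= a' -> vwin a m `<=` vwin a' m.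
Proof. by move=> aa k kW i; have /andP[h1 h2] := kW i; apply/andP; split; lra. Qed.

Lemma cwin_vwin a m : 0 <= a -> cwin m `<=` vwin a m.
Proof. by move=> a0 k kW i; have /andP[h1 h2] := kW i; apply/andP; split; lra. Qed.

Definition a0 : R := 4 * mu.
(** Beyond [a0], a chain of rounded points deviates from the segment by up to 2 in each lattice
    coordinate, which costs 2 [mu]; one more step along a basis vector costs another [mu]. *)
Definition rho : R := a0 + 3 * mu.

Lemma small_basis (i : 'I_d) : small_shift (basis i).
Proof. by move=> j; rewrite mxE eqxx andbT; case: (_ == _). Qed.

Lemma a0_le_rho : a0 <= rho.
Proof. by have := mu_ge0; rewrite /rho; lra. Qed.

Lemma a0_ge0 : 0 <= a0. Proof. by rewrite mulr_ge0// mu_ge0. Qed.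

Lemma rho_ge0 : 0 <= rho. Proof. exact: le_trans a0_ge0 a0_le_rho. Qed.

(** The segment between two points of the smaller window stays in its convex box, and the rounded
    chain stays in the larger window. Its length depends on m alone, not on the function or the
    points. *)
Lemma chain_win m : 1 <= m -> exists J : nat, forall (V : normedModType R)
    (phi : 'cV[int]_d -> V) (gam : R),
  (forall q i, vwin rho m q -> vwin rho m (q + basis i) -> `|phi (q + basis i) - phi q| <= gam) ->
  forall k k', vwin a0 m k -> vwin a0 m k' -> `|phi k' - phi k| <= J%:R * (d%:R * gam).
Proof.
move=> m1; have mu0 := mu_ge0.
have a00 : 0 <= a0 by rewrite mulr_ge0.
pose c := d%:R * `|invmx A| * (m + 2 * a0).
have c0 : 0 <= c by rewrite !mulr_ge0//; lra.
exists (Num.truncn c).+1 => V phi gam H k k' kW k'W; apply: chain_bound => //.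
  move=> j; have h : `|A *m (emb k' - emb k)| <= m + 2 * a0.
    apply: mx_norm_le => [|i l]; first lra.
    have := kW i; have := k'W i; rewrite mulmxBr (ord1 l) ler_norml => /andP[h1 h2] /andP[h3 h4].
    by rewrite !mxE in h1 h2 h3 h4 *; apply/andP; split; lra.
  have : `|(emb k' - emb k : 'cV[R]_d)| <= c.
    rewrite -(mulKmx unitA (emb k' - emb k)) (le_trans (mx_norm_mul _ _))// /c ler_wpM2l//.
  move=> h2; have /andP[_ h3] := truncn_itv c0.
  apply: ltW; apply: le_lt_trans h3; apply: le_trans h2.
  by have := mx_entry_le (emb k' - emb k : 'cV[R]_d) j 0; rewrite !mxE rmorphB.
move=> q t i /andP[t0 t1] qt.
pose x : 'cV[R]_d := A *m (emb k + t *: (emb k' - emb k)).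
have xB l : - a0 <= x l 0 <= m + a0.
  have -> : x l 0 = (1 - t) * (A *m emb k) l 0 + t * (A *m emb k') l 0.
    by rewrite /x mulmxDr -scalemxAr mulmxBr !mxE; ring.
  have /andP[h1 h2] := kW l; have /andP[h3 h4] := k'W l.
  move: ((A *m emb k) l 0) ((A *m emb k') l 0) h1 h2 h3 h4 => y z h1 h2 h3 h4.
  by apply/andP; split; nra.
have qx : `|A *m emb q - x| <= mu * 2.
  rewrite /x -mulmxBr; apply: mul_small; apply: mx_norm_le => // l b.
  by have := qt l; rewrite (ord1 b) !mxE rmorphB.
have W1 := vwin_shift xB qx.
apply: H; first by apply: vwin_sub W1; rewrite /rho; lra.
apply: vwin_sub (vwin_small W1 (small_basis i)); rewrite /rho; lra.
Qed.

End Windows.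

Section Frames.
Context {R : realType} {n : nat}.
Local Notation d := n.+2.
Local Notation N := (2 ^ n.+2)%N.
Variables (A : 'M[R]_d) (Z : 'M[R]_(d, N)) (sg : 'I_N -> 'cV[int]_d).
Variables (j0 : 'I_N) (ji : 'I_d -> 'I_N) (al : R) (b : 'I_N -> 'I_N -> R).
Variables (om Q T : 'M[R]_(d, N) -> R).
Hypothesis unitA : A \in unitmx.
Hypothesis labels : corner_labels A Z sg.
Hypothesis sg0 : sg j0 = 0.
Hypothesis sgi : forall i, sg (ji i) = basis i.
Hypothesis rc : reduced_cell A Z j0 ji al b om Q T.
Implicit Types (Y : 'cV[int]_d -> 'cV[R]_d) (k g q : 'cV[int]_d).

Local Notation cellY := (cellmx sg).
Definition cell_om Y k : R := om (cellY Y k).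
Local Notation omY := cell_om.

Lemma col_cell Y k s : col s (cellY Y k) = Y (k + sg s).
Proof. by apply/matrixP => i j; rewrite (ord1 j) !mxE. Qed.

Lemma col_frame (P : 'M[R]_d) (H : 'M[R]_(d, N)) c s :
  col s (P *m (Z + H) + translation c) = P *m (col s Z + col s H) + c.
Proof.
apply/matrixP => i j; rewrite (ord1 j) !mxE; congr (_ + _).
by apply: eq_bigr => l _; rewrite !mxE.
Qed.

Lemma col_norm (H : 'M[R]_(d, N)) s : `|col s H| <= `|H|.
Proof. by apply: mx_norm_le => // i j; rewrite mxE mx_entry_le. Qed.

Lemma frame_difference Y k (P : 'M[R]_d) H c s t : cellY Y k = P *m (Z + H) + translation c ->
  Y (k + sg s) - Y (k + sg t) = P *m (col s Z - col t Z + (col s H - col t H)).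
Proof.
move=> E; rewrite -!col_cell E !col_frame opprD addrACA subrr addr0 -mulmxBr.
by rewrite opprD addrACA.
Qed.

(** Adjacent cells share a face, on which the two frames describe the same corners. Hence both
    rotations map the d-1 edge vectors of that face to nearly the same vectors, and [SO_columns]
    applies. *)
Lemma neighbor_rotation : exists2 C : R, 0 < C & forall Y k i P P' H H' c c',
  SO P -> SO P' -> cellY Y k = P *m (Z + H) + translation c ->
  cellY Y (k + basis i) = P' *m (Z + H') + translation c' -> `|P - P'| <= C * (`|H| + `|H'|).
Proof.
have [C C0 CP] := SO_columns unitA.
exists (d%:R * (C * (2 * d%:R ^+ 2))); first by rewrite !mulr_gt0// exprn_gt0.
move=> Y k i P P' H H' c c' SOP_ SOP' E E'.
have key : `|P'^T *m P - 1%:M| <= C * (2 * d%:R ^+ 2 * (`|H| + `|H'|)).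
  apply: (CP i); first by apply: SO_mul => //; exact: SO_tr.
  move=> j ji_; have [ZE sg01 sgS sgI] := labels.
  have [s sP] := sgS (pred1 i); have [s' s'P] := sgS (fun l => (l == i) || (l == j)).
  have sE : sg s = basis i.
    by apply/matrixP => l u; rewrite (ord1 u) sP /= !mxE eqxx andbT; case: (l == i).
  have s'E : sg s' = basis i + basis j.
    apply/matrixP => l u; rewrite (ord1 u) s'P !mxE eqxx !andbT.
    by have [->|] := eqVneq l i; rewrite /= ?(negbTE ji_) ?[i == j]eq_sym ?(negbTE ji_) ?addr0 ?add0r//; case: (l == j).
  have D1 := frame_difference s' s E; have D2 := frame_difference (ji j) j0 E'.
  rewrite sE s'E in D1; rewrite sgi sg0 addr0 in D2.
  have colj : col s' Z - col s Z = col j A.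
    rewrite !ZE -mulmxBr sE s'E embD colE; congr (_ *m _).
    by apply/matrixP => l u; rewrite !mxE; case: (l == j); case: (l == i); rewrite /= ?(ord1 u) ?eqxx /= ?mulr1z ?mulr0z; ring.
  have colj' : col (ji j) Z - col j0 Z = col j A.
    rewrite !ZE -mulmxBr sgi sg0 colE; congr (_ *m _).
    by apply/matrixP => l u; rewrite !mxE; case: (l == j); rewrite /= ?(ord1 u) ?eqxx /= ?mulr1z ?mulr0z; ring.
  rewrite colj in D1; rewrite colj' in D2.
  have PP : P *m (col j A + (col s' H - col s H)) = P' *m (col j A + (col (ji j) H' - col j0 H')).
    by rewrite -D1 -D2 addrA.
  have SvE : P'^T *m P *m col j A - col j A = P'^T *m (P' *m (col (ji j) H' - col j0 H') - P *m (col s' H - col s H)).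
    have -> : P' *m (col (ji j) H' - col j0 H') - P *m (col s' H - col s H) = P *m col j A - P' *m col j A.
      move: PP; rewrite (mulmxDr P) (mulmxDr P').
      move: (P *m (col s' H - col s H)) (P' *m (col (ji j) H' - col j0 H')) (P *m col j A) (P' *m col j A) => z w x y E0.
      have -> : x = y + w - z by rewrite -E0 addrK.
      by apply/matrixP => p q; rewrite !mxE; ring.
    by rewrite mulmxBr !mulmxA; have [-> _] := SOP'; rewrite mul1mx.
  have colB (X : 'M[R]_(d, N)) u v : `|col u X - col v X| <= 2 * `|X|.
    by rewrite (le_trans (ler_normB _ _))// mulrDl mul1r lerD// col_norm.
  rewrite SvE (le_trans (SO_mul_norm _ (SO_tr SOP')))//.
  have h1 : `|P' *m (col (ji j) H' - col j0 H')| <= d%:R * (2 * `|H'|).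
    by rewrite (le_trans (SO_mul_norm _ SOP'))// ler_wpM2l.
  have h2 : `|P *m (col s' H - col s H)| <= d%:R * (2 * `|H|).
    by rewrite (le_trans (SO_mul_norm _ SOP_))// ler_wpM2l.
  have -> : 2 * d%:R ^+ 2 * (`|H| + `|H'|) = d%:R * (d%:R * (2 * `|H'|) + d%:R * (2 * `|H|)) by ring.
  by rewrite ler_wpM2l// (le_trans (ler_normB _ _))// lerD.
have -> : P - P' = P' *m (P'^T *m P - 1%:M).
  by rewrite mulmxBr mulmxA (SOP SOP') mul1mx mulmx1.
rewrite (le_trans (SO_mul_norm _ SOP'))// -!mulrA ler_wpM2l// (le_trans key)//.
by rewrite -!mulrA.
Qed.

Local Notation vwin := (vwin A).
Local Notation cwin := (cwin A).
Local Notation a0 := (a0 A).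
Local Notation rho := (rho A).

Lemma omY_ge0 Y k : 0 <= omY Y k. Proof. exact: rc_ge0 rc _. Qed.

(** Discrete rigidity on a window: the rotations of neighbouring cells are compared along chains,
    and the total energy of the window controls the deviation from one rotation. K grows with m;
    this is harmless because m is fixed before the energy becomes small. *)
Lemma frame (m : R) : 1 <= m -> exists K th : R, [/\ 0 < K, 0 < th &
  forall Y, (forall k, vwin rho m k -> omY Y k <= th) ->
  [/\ exists2 P, SO P & forall k, vwin a0 m k -> exists H c,
      cellY Y k = P *m (Z + H) + translation c /\ `|H| ^+ 2 <= K * fsum (vwin rho m) (omY Y),
      forall k k', vwin a0 m k -> vwin a0 m k' -> `|Y k' - Y k| <= K &
      forall k, vwin a0 m k -> `|grad A Y k| <= K]].
Proof.
move=> m1; have [c0 [th [c00 th0 wells]]] := rc_wells rc.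
have [C C0 CP] := neighbor_rotation; have [J JP] := chain_win unitA m1.
have mu0 := mu_ge0 A.
have a00 : 0 <= a0 by rewrite mulr_ge0.
pose h0 := Num.sqrt (th / c0).
have h00 : 0 <= h0 by rewrite sqrtr_ge0.
pose L := J%:R * (d%:R * (C * 2)).
have L0 : 0 <= L by rewrite !mulr_ge0// ltW.
pose K1 := (d%:R * (d%:R * L) * `|Z| * d%:R + d%:R).
have K10 : 0 <= K1 by rewrite addr_ge0// !mulr_ge0// ltW.
pose gY := d%:R * (mu A + 2 * h0).
have gY0 : 0 <= gY by rewrite mulr_ge0// addr_ge0// mulr_ge0.
pose K := K1 ^+ 2 / c0 + J%:R * (d%:R * gY) + d%:R * gY * `|invmx A| + 1.
have t1 : 0 <= K1 ^+ 2 / c0 by rewrite divr_ge0 ?sqr_ge0// ltW.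
have t2 : 0 <= J%:R * (d%:R * gY) by apply: mulr_ge0 => //; exact: mulr_ge0.
have t3 : 0 <= d%:R * gY * `|invmx A| by apply: mulr_ge0 => //; exact: mulr_ge0.
exists K, th; split=> //; first by rewrite /K; lra.
move=> Y good; set Om := fsum _ _.
have fV : finite_set (vwin rho m) by exact: vwin_finite.
have Om0 : 0 <= Om by apply: fsum_ge0 => // k _; exact: omY_ge0.
have omOm k : vwin rho m k -> omY Y k <= Om.
  move=> kV; rewrite -[leLHS](fsum1 k (omY Y)); apply: fsum_le_set => //.
    by move=> _ ->.
  by move=> q _; exact: omY_ge0.
have ex k : exists x : 'M[R]_d * 'cV[R]_d * 'M[R]_(d, N), vwin rho m k ->
    [/\ SO x.1.1, cellY Y k = x.1.1 *m (Z + x.2) + translation x.1.2 & c0 * `|x.2| ^+ 2 <= omY Y k].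
  have [kV|nkV] := pselect (vwin rho m k); last by exists (0, 0, 0).
  have [P [c [H [SOP_ E cH]]]] := wells _ (good k kV).
  by exists (P, c, H).
have [x xP] := choice ex.
pose h := Num.sqrt (Om / c0).
have h_ge0 : 0 <= h by rewrite sqrtr_ge0.
have h2 : h ^+ 2 = Om / c0 by rewrite sqr_sqrtr// divr_ge0// ltW.
have Hh k : vwin rho m k -> `|(x k).2| <= h.
  move=> kV; have [_ _ cH] := xP k kV.
  by rewrite -(@ler_pXn2r _ 2)// ?nnegrE// h2 ler_pdivlMr// mulrC (le_trans cH)// omOm.
have Hh0 k : vwin rho m k -> `|(x k).2| <= h0.
  move=> kV; have [_ _ cH] := xP k kV.
  rewrite -(@ler_pXn2r _ 2)// ?nnegrE// sqr_sqrtr ?divr_ge0 ?(ltW c00) ?(ltW th0)//.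
  by rewrite ler_pdivlMr// mulrC (le_trans cH)// good.
have subV k : vwin a0 m k -> vwin rho m k by apply: vwin_sub; exact: a0_le_rho.
have rot k : vwin a0 m k -> `|(x k).1.1 - (x 0).1.1| <= L * h.
  have V0 : vwin a0 m 0.
    move=> i; rewrite (_ : emb 0 = 0); last by apply/matrixP => u v; rewrite !mxE.
    by rewrite mulmx0 mxE; apply/andP; split; lra.
  move=> kV; have := JP _ (fun k => (x k).1.1) (C * 2 * h) _ 0 k V0 kV.
  rewrite /L -!mulrA; apply => q i qV qV'.
  have [S1 E1 _] := xP q qV; have [S2 E2 _] := xP _ qV'.
  rewrite distrC (le_trans (CP _ _ _ _ _ _ _ _ _ S1 S2 E1 E2))//.
  by rewrite ler_wpM2l ?(ltW C0)// mulrDl !mul1r lerD// Hh.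
have diffY q i : vwin rho m q -> `|diff i Y q| <= gY.
  move=> qV; have [S1 E1 _] := xP q qV.
  have := frame_difference (ji i) j0 E1; rewrite sgi sg0 addr0 /diff => ->.
  rewrite (le_trans (SO_mul_norm _ S1))// /gY ler_wpM2l// (le_trans (ler_normD _ _))// lerD//.
    have [ZE _ _ _] := labels; rewrite !ZE -mulmxBr sgi sg0.
    have -> : emb (basis i) - const_mx 2^-1 - (emb 0 - const_mx 2^-1) = emb (basis i) :> 'cV[R]_d.
      by apply/matrixP => l u; rewrite !mxE mulr0z; ring.
    by rewrite -[mu A]mulr1; apply: mul_small; apply: small_shift_norm; exact: small_basis.
  rewrite (le_trans (ler_normB _ _))// mulrDl mul1r lerD//;
    by rewrite (le_trans (col_norm _ _))// Hh0.
split.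
- have [S0 _ _] : [/\ SO (x 0).1.1, True & True].
    have V0 : vwin rho m 0.
      move=> i; rewrite (_ : emb 0 = 0); last by apply/matrixP => u v; rewrite !mxE.
      by have := rho_ge0 A; rewrite mulmx0 mxE => ?; apply/andP; split; lra.
    by have [] := xP 0 V0.
  exists (x 0).1.1 => // k kV; have [S1 E1 _] := xP k (subV k kV).
  set P0 := (x 0).1.1 in S0 *; set P := (x k).1.1 in S1 E1 *; set H := (x k).2 in E1 *.
  (* The discrepancy between the rotation of this cell and the common one is moved into the
     displacement. *)
  pose S := P0^T *m P; exists (S *m (Z + H) - Z), (x k).1.2; split.
    have -> : Z + (S *m (Z + H) - Z) = S *m (Z + H) by rewrite addrC subrK.
    by rewrite E1 /S -(mulmxA P0^T) (mulmxA P0) (SOP S0) mul1mx.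
  have S1n : `|S - 1%:M| <= d%:R * (L * h).
    have -> : S - 1%:M = P0^T *m (P - P0) by rewrite mulmxBr; have [-> _] := S0.
    by rewrite (le_trans (SO_mul_norm _ (SO_tr S0)))// ler_wpM2l// rot.
  have Hn : `|S *m (Z + H) - Z| <= K1 * h.
    have -> : S *m (Z + H) - Z = (S - 1%:M) *m Z + S *m H.
      by rewrite mulmxDr mulmxBl mul1mx addrAC.
    rewrite (le_trans (ler_normD _ _))// /K1 mulrDl lerD//.
      rewrite (le_trans (mx_norm_mul _ _))//.
      have -> : d%:R * (d%:R * L) * `|Z| * d%:R * h = d%:R * (d%:R * (L * h)) * `|Z| * d%:R by ring.
      rewrite (@le_trans _ _ (d%:R * (d%:R * (L * h)) * `|Z|))//.
        by rewrite ler_wpM2r// ler_wpM2l.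
      rewrite ler_peMr ?ler1n//; apply: mulr_ge0 => //; apply: mulr_ge0 => //; apply: mulr_ge0 => //.
      exact: mulr_ge0.
    rewrite (le_trans (SO_mul_norm _ (SO_mul (SO_tr S0) S1)))// ler_wpM2l// Hh//.
    exact: subV.
  have : `|S *m (Z + H) - Z| ^+ 2 <= (K1 * h) ^+ 2 by rewrite lerXn2r// nnegrE ?mulr_ge0.
  move=> hh; rewrite (le_trans hh)// exprMn h2.
  have -> : K1 ^+ 2 * (Om / c0) = K1 ^+ 2 / c0 * Om by ring.
  by rewrite ler_wpM2r// /K; lra.
- move=> k k' kV k'V; have := JP _ Y gY (fun q i qV _ => diffY q i qV) k k' kV k'V.
  by move=> hh; rewrite (le_trans hh)// /K; lra.
- move=> k kV; rewrite /grad (le_trans (mx_norm_mul _ _))//.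
  rewrite (@le_trans _ _ (d%:R * gY * `|invmx A|))//; last by rewrite /K; lra.
  rewrite ler_wpM2r// ler_wpM2l//; apply: mx_norm_le => // u i.
  by rewrite mxE (le_trans (mx_entry_le _ _ _))//; apply: diffY; exact: subV.
Qed.

End Frames.

Section ShiftSums.
Context {R : realType} {V : zmodType}.
Implicit Types (S C : set V) (f : V -> R) (e : V).

Lemma fsum_split S (P : set V) f : finite_set S ->
  fsum S f = fsum (S `&` P) f + fsum (S `\` P) f.
Proof.
move=> fS; rewrite -fsum_setU.
- by rewrite setUIDK.
- exact: finite_setIl.
- exact: finite_setD.
- by apply/seteqP; split=> // k [[_ Pk] [_]].
Qed.

Lemma fsum_shift S f e : finite_set S ->
  fsum S (fun q => f (q + e)) = fsum [set q | S (q - e)] f.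
Proof.
move=> fS; have -> : [set q | S (q - e)] = (fun q => q + e) @` S.
  apply/seteqP; split=> q /=; first by move=> Sq; exists (q - e); rewrite ?subrK.
  by case=> x Sx <-; rewrite addrK.
by rewrite (fsum_image f (addIr e) fS).
Qed.

Lemma shift_finite S e : finite_set S -> finite_set [set q | S (q - e)].
Proof.
move=> fS; have -> : [set q | S (q - e)] = (fun q => q + e) @` S.
  apply/seteqP; split=> q /=; first by move=> Sq; exists (q - e); rewrite ?subrK.
  by case=> x Sx <-; rewrite addrK.
exact: finite_image.
Qed.

Lemma fsum_shift_le S C f e : finite_set S -> finite_set C -> (forall q, 0 <= f q) ->
  (forall q, S q -> C (q + e)) -> fsum S (fun q => f (q + e)) <= fsum C f.
Proof.
move=> fS fC f0 SC; rewrite fsum_shift//; apply: fsum_le_set => // q /= /SC.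
by rewrite subrK.
Qed.

(* The interior terms cancel. *)
Lemma fsum_increment C f e : finite_set C ->
  `|fsum C (fun q => f (q + e) - f q)| <=
    fsum (C `\` [set q | C (q + e)]) (fun q => `|f (q + e)|) +
    fsum (C `\` [set q | C (q - e)]) (fun q => `|f q|).
Proof.
move=> fC; rewrite fsumB (fsum_split [set q | C (q + e)])// [X in _ - X](fsum_split [set q | C (q - e)])//.
have -> : fsum (C `&` [set q | C (q + e)]) (fun q => f (q + e)) = fsum (C `&` [set q | C (q - e)]) f.
  rewrite fsum_shift; last exact: finite_setIl.
  by congr fsum; apply/seteqP; split=> q /=; rewrite subrK => -[].
rewrite opprD addrACA subrr add0r (le_trans (ler_normB _ _))// lerD//;
  exact: fsum_norm.
Qed.

End ShiftSums.

(** * The elastic inequality on a window *)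

Section Block.
Context {R : realType} {n : nat}.
Local Notation d := n.+2.
Local Notation N := (2 ^ n.+2)%N.
Variables (A : 'M[R]_d) (Z : 'M[R]_(d, N)) (sg : 'I_N -> 'cV[int]_d).
Variables (j0 : 'I_N) (ji : 'I_d -> 'I_N) (al : R) (b : 'I_N -> 'I_N -> R).
Variables (om Q T : 'M[R]_(d, N) -> R).
Hypothesis unitA : A \in unitmx.
Hypothesis labels : corner_labels A Z sg.
Hypothesis sg0 : sg j0 = 0.
Hypothesis sgi : forall i, sg (ji i) = basis i.
Hypothesis rc : reduced_cell A Z j0 ji al b om Q T.
Implicit Types (Y u : 'cV[int]_d -> 'cV[R]_d) (k g q : 'cV[int]_d).

Local Notation omY := (cell_om sg om).
Local Notation Om m Y := (fsum (vwin A (rho A) m) (omY Y)).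

Lemma strain_arith (y z w v Cs N2 : R) : 0 < Cs -> 2^-1 * z - v <= w ->
  N2 <= Cs * z -> y ^+ 2 <= N2 -> y ^+ 2 <= 2 * Cs * (w + v).
Proof.
move=> Cs0 h1 h2 h3; apply: le_trans h3 (le_trans h2 _).
have -> : 2 * Cs * (w + v) = Cs * (2 * (w + v)) by ring.
by rewrite ler_pM2l//; lra.
Qed.

Lemma stress_arith (y z w v r : R) : 2^-1 * y - v <= w -> 2 * r * z - al * r ^+ 2 <= y ->
  r * z - (2^-1 * al * r ^+ 2 + v) <= w.
Proof. by move=> *; lra. Qed.

Lemma weighted_young (y lam : R) : 0 < lam -> `|y| <= 2^-1 * (lam + y ^+ 2 / lam).
Proof.
move=> lam0; rewrite -(ler_pM2l (_ : 0 < 2 * lam)) ?mulr_gt0//.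
have -> : 2 * lam * (2^-1 * (lam + y ^+ 2 / lam)) = lam ^+ 2 + `|y| ^+ 2.
  by rewrite real_normK ?num_real//; field; rewrite gt_eqF.
by have := sqr_ge0 (lam - `|y|); rewrite sqrrB; lra.
Qed.

Lemma halfopen_convex (m : R) : convex_set (box (fun=> [set x : R | 0 <= x < m]) : set 'cV[R]_d).
Proof.
apply: box_convex => _ a c z /= /andP[a1 a2] /andP[c1 c2] /andP[z1 z2].
by apply/andP; split; [exact: le_trans z1|exact: le_lt_trans c2].
Qed.

Lemma halfopen_bound (m : R) : 0 <= m ->
  forall z : 'cV[R]_d, box (fun=> [set x : R | 0 <= x < m]) z -> `|z| <= m.
Proof.
move=> m0 z zB; apply: mx_norm_le => // i j; rewrite (ord1 j).
by have /andP[h1 h2] := zB i; rewrite ger0_norm// ltW.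
Qed.

Lemma mu_le_a0 : mu A <= a0 A.
Proof. by have := mu_ge0 A; rewrite /a0; lra. Qed.

Lemma mu2_le_a0 : mu A + mu A <= a0 A.
Proof. by have := mu_ge0 A; rewrite /a0; lra. Qed.

Definition displacement (P : 'M[R]_d) Y q : 'cV[R]_d := P^T *m Y q - A *m emb q.

Lemma cell_displacement P Y k H c : SO P -> cellmx sg Y k = P *m (Z + H) + translation c ->
  exists c', cellmx sg (displacement P Y) k = H + translation c'.
Proof.
move=> [PP _] E; exists (P^T *m c - A *m emb k - A *m const_mx 2^-1).
have [ZE _ _ _] := labels; apply/matrixP => i s.
have Es : displacement P Y (k + sg s) = col s H + (P^T *m c - A *m emb k - A *m const_mx 2^-1).
  rewrite /displacement -(col_cell sg) E col_frame mulmxDr mulmxA PP mul1mx ZE embD !mulmxDr mulmxN.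
  by set x := A *m _; set y := A *m emb k; set z := A *m _; apply/matrixP => l w; rewrite !mxE; ring.
by move/matrixP/(_ i 0): Es; rewrite [in X in X -> _]mxE [in X in _ = X -> _]mxE => Es; rewrite mxE [RHS]mxE -/(displacement P Y (k + sg s)) [X in _ = _ + X]mxE; move: Es; rewrite !mxE.
Qed.

Lemma strain_cell u k : strain A u k = cell_strain A j0 ji (cellmx sg u k).
Proof.
rewrite /strain /cell_strain; have -> // : edge_differences j0 ji (cellmx sg u k) = Dmx u k.
by apply/matrixP => a i; rewrite !mxE sg0 sgi addr0.
Qed.

Lemma cell_strain_translation H c : cell_strain A j0 ji (H + translation c) = cell_strain A j0 ji H.
Proof.
rewrite /cell_strain; have -> // : edge_differences j0 ji (H + translation c) = edge_differences j0 ji H.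
by apply/matrixP => a i; rewrite !mxE; ring.
Qed.

(** First-order extrapolation of the deformation back to the straight line: if the path is at
    distance [dl] from its ideal position, the gradient applied to [dl] is subtracted. *)
Definition yhat Y q (dl : 'cV[R]_d) : 'cV[R]_d := Y q - grad A Y q *m dl.

(** With the unit vector f = P^T e_1, expanding the square of y - tau f bounds f . y by (tau^2 + y .
    y) / (2 tau). The rotation may be far from the identity. *)
Lemma rotation_stretch (P : 'M[R]_d) (x : 'cV[R]_d) (tau : R) : SO P -> 0 < tau ->
  (P *m (tau *: e1 + x)) ord0 0 - tau <= dot e1 x + dot x x / (2 * tau).
Proof.
move=> SOP_ tau0; set f := P^T *m e1; set y := tau *: e1 + x.
have ff : dot f f = 1.
  have -> : dot f f = (f^T *m f) 0 0.
    by rewrite [RHS]mxE; apply: eq_bigr => l _; rewrite [X in _ = X * _]mxE.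
  rewrite /f trmx_mul trmxK -mulmxA (mulmxA P) (SOP SOP_) mul1mx mxE.
  by rewrite (bigD1 ord0)//= big1 ?addr0 => [|l l0]; rewrite !mxE ?eqxx ?mulr1// (negbTE l0) mulr0.
have -> : (P *m y) ord0 0 = dot f y.
  have -> : dot f y = (f^T *m y) 0 0.
    by rewrite [RHS]mxE; apply: eq_bigr => l _; rewrite [X in _ = X * _]mxE.
  rewrite /f trmx_mul trmxK -mulmxA [RHS]mxE (bigD1 ord0)//= big1 ?addr0 => [|l l0].
    by rewrite 2![X in _ = X * _]mxE !eqxx mul1r.
  by rewrite 2![X in X * _]mxE (negbTE l0) mul0r.
have yy : dot y y = tau ^+ 2 + 2 * tau * dot e1 x + dot x x.
  rewrite /y dotDl !dotDr !(dotZl tau) !dotZr (dotC x e1).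
  have -> : dot (e1 : 'cV[R]_d) e1 = 1 by rewrite dot_e1 mxE !eqxx.
  by ring.
have : 0 <= dot (y - tau *: f) (y - tau *: f) by exact: dot_ge0.
rewrite dot_sqrB ff yy => h.
rewrite -(ler_pM2r (_ : 0 < 2 * tau)) ?mulr_gt0//.
have -> : (dot e1 x + dot x x / (2 * tau)) * (2 * tau) = 2 * tau * dot e1 x + dot x x.
  by rewrite mulrDl divfK ?mulf_neq0 ?gt_eqF//; ring.
by rewrite expr2 in h; nra.
Qed.

Lemma yhat_displacement P Y q dl : SO P ->
  yhat Y q dl = P *m (A *m emb q - dl + yhat (displacement P Y) q dl).
Proof.
move=> SOP_; have YE k : Y k = P *m (A *m emb k + displacement P Y k).
  by rewrite /displacement addrC subrK mulmxA (SOP SOP_) mul1mx.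
have DE : Dmx Y q = P *m (A + Dmx (displacement P Y) q).
  apply/matrixP => a i.
  have E : diff i Y q = P *m (col i A + diff i (displacement P Y) q).
    rewrite /diff (YE (q + basis i)) (YE q) -mulmxBr embD (mulmxDr A); congr (P *m _).
    have -> : emb (basis i) = delta_mx i 0 :> 'cV[R]_d.
      by apply/matrixP => l w; rewrite !mxE; case: (_ && _).
    rewrite -colE; move: (col i A) (A *m emb q) => x y.
    by apply/matrixP => l w; rewrite !mxE; ring.
  rewrite [LHS]mxE E.
  by rewrite !mxE; apply: eq_bigr => l _; rewrite !mxE.
rewrite /yhat {1}YE /grad DE -!mulmxA -mulmxBr; congr (P *m _).
rewrite mulmxDl mulmxA mulmxV// mul1mx [X in _ - (_ + X)]mulmxA opprD.
by rewrite addrACA mulmxA.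
Qed.

(** In each cell the stress inequality bounds r T(H) - al r^2 / 2 by the energy up to Taylor errors.
    Summed over the cube, the stress is the elongation of [yhat] up to sums of strain differences,
    which reduce to boundary layers of order m^(d-1). The constant c is independent of m and eta, so
    its term is negligible for large m at fixed eta. *)
Theorem block_inequality (tau D : R) : 0 < tau -> 0 <= D -> exists2 c : R, 0 <= c &
  forall m eta : R, 1 <= m -> 0 < eta -> exists th r0 Kp : R, [/\ 0 < th, 0 < r0, 0 < Kp &
  forall Y, (forall k, vwin A (rho A) m k -> omY Y k <= th) ->
  [/\ forall k k', vwin A (a0 A) m k -> vwin A (a0 A) m k' -> `|Y k' - Y k| <= Kp,
      forall k, vwin A (a0 A) m k -> `|grad A Y k| <= Kp &
      forall r g s t dl dl', 0 < r <= r0 -> g = sg s - sg t ->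
      A *m emb g = tau *: e1 + dl' - dl -> `|dl| <= D -> `|dl'| <= D ->
      r * al / tau * fsum (cwin A m) (fun q => (yhat Y (q + g) dl' - yhat Y q dl) ord0 0 - tau)
        - r ^+ 2 * (2^-1 * al * cnt (cwin A m) + c * m ^+ n.+1 / eta)
      <= fsum (cwin A m) (omY Y) + eta * Om m Y]].
Proof.
move=> tau0 D0.
have al0 := rc_al rc.
have [KT KT0 KTP] := stress_telescoping unitA labels (rc_TD rc) (rc_TZ rc) (rc_T_translation rc) (rc_T_affine rc).
have [cb cb0 cbP] := boundary_count unitA.
have [Cs Cs0 CsP] := rc_strain rc.
pose K2 := KT * (1 + tau + D).
have K20 : 0 < K2 by rewrite mulr_gt0//; lra.
have K2P x : x <= D -> KT * (1 + tau + x) <= K2.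
  by move=> xD; rewrite /K2 ler_wpM2l ?(ltW KT0)//; lra.
clearbody K2.
exists (16 * Cs * K2 ^+ 2 * cb / tau ^+ 2).
  by rewrite !mulr_ge0 ?invr_ge0 ?exprn_ge0 ?(ltW Cs0) ?(ltW K20) ?(ltW tau0).
move=> m eta m1 eta0.
have [K [th1 [K0 th10 frameP]]] := frame unitA labels sg0 sgi rc m1.
have fV : finite_set (vwin A (rho A) m) by exact: vwin_finite.
have fC : finite_set (cwin A m) by exact: cwin_finite.
have [Nm NmE] : exists Nm : R, Nm = cnt (cwin A m) by exists (cnt (cwin A m)).
have [NV NVE] : exists NV : R, NV = cnt (vwin A (rho A) m) by exists (cnt (vwin A (rho A) m)).
have Nm0 : 0 <= Nm by rewrite NmE cnt_ge0.
have NV0 : 0 <= NV by rewrite NVE cnt_ge0.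
(* The Taylor accuracy is chosen after K and the number of cells, both depending on m: the errors of
   all cells together are at most eta / 4 times the energy of the window. *)
pose e := Num.min (eta / 4) 1 / (K * (Nm + 1)).
have e0 : 0 < e by rewrite divr_gt0 ?lt_min ?divr_gt0 ?mulr_gt0//; lra.
have eK1 : e * K * Nm <= Num.min (eta / 4) 1.
  have -> : e * K * Nm = Num.min (eta / 4) 1 * (Nm / (Nm + 1)).
    by rewrite /e; field; rewrite !gt_eqF//; lra.
  rewrite ler_piMr ?le_min ?ler01 ?divr_ge0 ?(ltW eta0)//.
  by rewrite ler_pdivrMr; lra.
have eK : e * K * Nm <= eta / 4 /\ e * K * Nm <= 1.
  by move: eK1; rewrite le_min => /andP[].
clearbody e.
have [t t0 tP] := rc_taylor rc e0.
(* Below this threshold the window energy W satisfies K W < t^2, so every displacement lies in the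
   range of the Taylor expansion. *)
pose th := Num.min th1 (t ^+ 2 / (2 * (K * (NV + 1)))).
have KN0 : 0 < K * (NV + 1) by rewrite mulr_gt0//; lra.
have th0 : 0 < th by rewrite lt_min th10 divr_gt0 ?exprn_gt0// mulr_gt0.
have thth1 : th <= th1 by rewrite ge_min lexx.
have thP : th * (2 * (K * (NV + 1))) <= t ^+ 2.
  have : th <= t ^+ 2 / (2 * (K * (NV + 1))) by rewrite ge_min lexx orbT.
  by rewrite ler_pdivlMr// mulr_gt0.
clearbody th.
have [K3 K3E] : exists K3 : R, K3 = 2 + 4 * d%:R ^+ 2 * `|invmx A| * D by eexists.
have K30 : 0 <= K3 by rewrite K3E addr_ge0// !mulr_ge0// exprn_ge0.
have [S0 S0E] : exists S0 : R, S0 = al / tau * Nm * (d%:R * (K3 ^+ 2 * K)) / (2 * tau) by eexists.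
have S00 : 0 <= S0.
  by rewrite S0E !mulr_ge0 ?invr_ge0 ?mulr_ge0 ?exprn_ge0 ?(ltW al0) ?(ltW tau0) ?(ltW K0).
(* For r up to [r0] the quadratic term of [rotation_stretch], weighted by r, is at most eta / 4
   times the window energy. *)
pose r0 := eta / 4 / (S0 + 1).
have S01 : 0 < S0 + 1 by lra.
have r00 : 0 < r0 by rewrite divr_gt0// divr_gt0.
have r0S : r0 * S0 <= eta / 4.
  rewrite /r0 mulrAC ler_pdivrMr// ler_wpM2l//; [by rewrite divr_ge0// ltW|lra].
clearbody r0.
exists th, r0, K; split=> // Y good.
have [|[P SOP_ PF] Ylip Yg] := frameP Y.
  by move=> k kV; rewrite (le_trans (good k kV)).
split=> // r g s s' dl dl' /andP[rpos rr0] gE Ag dlD dl'D.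
have [W WE] : exists W : R, W = Om m Y by eexists.
rewrite -WE.
have om0 k : 0 <= omY Y k by exact: omY_ge0 rc _ _.
have W0 : 0 <= W by rewrite WE; apply: fsum_ge0.
have WN : K * W < t ^+ 2.
  have h : W <= th * NV by rewrite WE NVE -fsum_const; apply: ler_fsum.
  have t20 : 0 < t ^+ 2 by rewrite exprn_gt0.
  have h3 : K * W <= K * (th * NV) by rewrite ler_pM2l.
  have h4 : 0 < th * K by rewrite mulr_gt0.
  have h5 : 0 <= th * K * NV by rewrite mulr_ge0// ltW.
  by nra.
have exH k : exists x : 'M[R]_(d, N) * 'cV[R]_d, vwin A (a0 A) m k ->
    cellmx sg Y k = P *m (Z + x.1) + translation x.2 /\ `|x.1| ^+ 2 <= K * W.
  have [kV|nkV] := pselect (vwin A (a0 A) m k); last by exists (0, 0).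
  by have [H [c Hc]] := PF k kV; exists (H, c); rewrite WE.
have [x xP] := choice exH.
pose u := displacement P Y.
pose H k := (x k).1.
have HK k : vwin A (a0 A) m k -> `|H k| ^+ 2 <= K * W by move=> /xP[].
have uH k : vwin A (a0 A) m k -> exists c', cellmx sg u k = H k + translation c'.
  by move=> /xP[E _]; exact: cell_displacement E.
have omH k : vwin A (a0 A) m k -> omY Y k = om (Z + H k).
  by move=> /xP[E _]; rewrite /cell_om E (rc_translation rc) (rc_rotation rc).
have TH k : vwin A (a0 A) m k -> T (cellmx sg u k) = T (H k).
  by move=> /uH[c' ->]; rewrite (rc_TD rc) (rc_T_translation rc) addr0.
have SH k : vwin A (a0 A) m k -> strain A u k = cell_strain A j0 ji (H k).
  by move=> /uH[c' E]; rewrite strain_cell E cell_strain_translation.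
have omQ k : vwin A (a0 A) m k -> 2^-1 * Q (H k) - e * (K * W) <= omY Y k.
  move=> kV; rewrite (omH k kV); apply: le_trans (tP (H k) _).
    by rewrite lerB// ler_wpM2l ?(ltW e0)// HK.
  rewrite -(@ltr_pXn2r _ 2) ?nnegrE ?(ltW t0)//; exact: le_lt_trans (HK k kV) WN.
pose hh := Num.sqrt (K * W).
have hh0 : 0 <= hh by rewrite sqrtr_ge0.
have hh2 : hh ^+ 2 = K * W by rewrite sqr_sqrtr// mulr_ge0// ltW.
have Hh k : vwin A (a0 A) m k -> `|H k| <= hh.
  by move=> kV; rewrite -(@ler_pXn2r _ 2)// ?nnegrE// hh2 HK.
have mu0 := mu_ge0 A.
have C1 q g' : cwin A m q -> small_shift g' -> vwin A (mu A) m (q + g').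
  move=> qC gs; have := vwin_small (cwin_vwin (lexx 0) qC) gs; by rewrite add0r.
have V1 q : vwin A (mu A) m q -> vwin A (a0 A) m q by apply: vwin_sub; exact: mu_le_a0.
have V2 q g' : vwin A (mu A) m q -> small_shift g' -> vwin A (a0 A) m (q + g').
  by move=> qV gs; apply: vwin_sub (vwin_small qV gs); exact: mu2_le_a0.
have VR q : vwin A (a0 A) m q -> vwin A (rho A) m q by apply: vwin_sub; exact: a0_le_rho.
have gs : small_shift g.
  have [_ sg01 _ _] := labels; rewrite gE => j; rewrite !mxE.
  by have [->|->] := sg01 s j; have [->|->] := sg01 s' j.
have strain2 k j l : vwin A (a0 A) m k -> (strain A u k j l) ^+ 2 <= 2 * Cs * (omY Y k + e * (K * W)).
  move=> kV; have h1 := omQ k kV; have h2 := CsP (H k).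
  have h3 : (strain A u k j l) ^+ 2 <= `|cell_strain A j0 ji (H k)| ^+ 2.
    by rewrite -[leLHS]real_normK ?num_real// lerXn2r ?nnegrE// SH// mx_entry_le.
  move: h1 h2 h3; move: (strain A u k j l) (Q (H k)) (omY Y k) => y z w h1 h2 h3.
  exact: (strain_arith Cs0 h1 h2 h3).
(* With the weight lam = r / [mub] in Young's inequality, the part of the boundary terms that is
   linear in the energy is exactly eta / 4 times the window energy; the other part is the term with
   r^2 m^(d-1) / eta. *)
have [mub mubE] : exists mub : R, mub = eta * tau / (16 * Cs * K2) by eexists.
have mub0 : 0 < mub by rewrite mubE divr_gt0 ?mulr_gt0.
have [lam lamE] : exists lam : R, lam = r / mub by eexists.
have lam0 : 0 < lam by rewrite lamE divr_gt0.
have m0 : 0 <= m := le_trans ler01 m1.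
have boxc := @halfopen_convex m.
have boxm := halfopen_bound m0.
have bnd (S : set 'cV[int]_d) (f : 'cV[int]_d -> R) : S `<=` cwin A m -> cnt S <= cb * m ^+ n.+1 ->
    fsum S (fun q => f q ^+ 2) <= 4 * Cs * W ->
    fsum S (fun q => `|f q|) <= 2^-1 * (lam * (cb * m ^+ n.+1) + 4 * Cs * W / lam).
  move=> SC Sc fW; have fS : finite_set S by exact: sub_finite_set fC.
  apply: (@le_trans _ _ (fsum S (fun q => 2^-1 * (lam + f q ^+ 2 / lam)))).
    by apply: ler_fsum => // q _; exact: weighted_young.
  rewrite fsumZ ler_pM2l// fsumD fsum_const lerD//; first by rewrite ler_pM2l.
  have -> : fsum S (fun q => f q ^+ 2 / lam) = fsum S (fun q => f q ^+ 2) / lam.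
    by rewrite mulrC -fsumZ; apply: eq_bigr => q _; rewrite mulrC.
  by rewrite ler_pM2r ?invr_gt0.
have sumW (S : set 'cV[int]_d) g' : S `<=` cwin A m -> (forall q, S q -> vwin A (a0 A) m (q + g')) ->
    forall j l, fsum S (fun q => (strain A u (q + g') j l) ^+ 2) <= 4 * Cs * W.
  move=> SC SV j l; have fS : finite_set S by exact: sub_finite_set fC.
  apply: (@le_trans _ _ (fsum S (fun q => 2 * Cs * (omY Y (q + g') + e * (K * W))))).
    by apply: ler_fsum => // q /SV; exact: strain2.
  rewrite fsumZ fsumD fsum_const.
  have h1 : fsum S (fun q => omY Y (q + g')) <= W by rewrite WE; apply: fsum_shift_le => // q /SV /VR.
  have h2 : e * (K * W) * cnt S <= W.
    have h3 : cnt S <= Nm by rewrite NmE; exact: cnt_le.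
    have h4 : e * K * Nm <= 1 by case: eK.
    have h5 : 0 <= e * (K * W) by rewrite !mulr_ge0// ltW.
    apply: (@le_trans _ _ (e * (K * W) * Nm)); first by rewrite ler_wpM2l.
    by have -> : e * (K * W) * Nm = e * K * Nm * W; [ring|rewrite ler_piMl].
  have -> : 4 * Cs * W = 2 * Cs * (W + W) by ring.
  by rewrite ler_wpM2l ?lerD// mulr_ge0// ltW.
have [E EE] : exists E : R, E = lam * (cb * m ^+ n.+1) + 4 * Cs * W / lam by eexists.
have EP g' i j l : small_shift g' -> `|\sum_(q <- fset_set (cwin A m))
    (strain A u (q + g' + basis i) - strain A u (q + g')) j l| <= E.
  move=> gs'; have [b1 b2] := cbP m _ i m1 boxc boxm.
  have := fsum_increment (fun q => strain A u (q + g') j l) (basis i) fC.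
  rewrite (_ : fsum _ _ = \sum_(q <- fset_set (cwin A m))
    (strain A u (q + g' + basis i) - strain A u (q + g')) j l); last first.
    by apply: eq_bigr => q _; rewrite [RHS]mxE [X in _ = _ + X]mxE (addrAC q).
  move=> h; rewrite (le_trans h)//.
  have -> : E = 2^-1 * E + 2^-1 * E by rewrite -mulrDl -[2^-1]div1r -splitr mul1r.
  rewrite EE; rewrite lerD//; apply: bnd => //; try exact: subDsetl.
    (* The interior strain differences cancel; only the cells whose forward or backward neighbour
       leaves the cube remain, and these are counted by [boundary_count]. *)
    have := @sumW (cwin A m `\` [set q | cwin A m (q + basis i)]) (basis i + g').
    rewrite (_ : fsum _ (fun q => _ ^+ 2) = fsum (cwin A m `\` [set q | cwin A m (q + basis i)]) (fun q => (strain A u (q + (basis i + g')) j l) ^+ 2)); last by apply: eq_bigr => q _; rewrite addrA.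
    apply; first exact: subDsetl.
    move=> q [qC _]; rewrite addrA; apply: V2 => //; apply: C1 => //; exact: small_basis.
  apply: sumW; first exact: subDsetl.
  by move=> q [qC _]; apply: V1; exact: C1.
have tel := KTP (fset_set (cwin A m)) u E tau g dl dl' (ltW tau0) gs Ag EP.
pose du q : 'cV[R]_d := yhat u (q + g) dl' - yhat u q dl.
have E0 : 0 <= E.
  by rewrite EE addr_ge0// !mulr_ge0 ?invr_ge0 ?exprn_ge0 ?(ltW lam0) ?(ltW Cs0).
have tel2 : al * fsum (cwin A m) (fun q => dot e1 (du q)) - K2 * E <=
    tau * fsum (cwin A m) (fun q => T (H q)).
  have -> : tau * fsum (cwin A m) (fun q => T (H q)) = fsum (cwin A m) (fun q => tau * T (cellmx sg u q)).
    rewrite -fsumZ; apply: fsum_eq => // q qC; rewrite TH//.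
    exact: cwin_vwin (a0_ge0 A) _ qC.
  rewrite -fsumZ lerBlDr addrC -lerBlDr -fsumB.
  have h : KT * (1 + tau + `|dl'|) * E <= K2 * E.
    by rewrite ler_wpM2r// K2P.
  have := le_trans tel h; rewrite -normrN => h2; apply: le_trans (le_trans (ler_norm _) h2).
  rewrite -sumrN le_eqVlt; apply/orP; left; apply/eqP; apply: eq_bigr => q _.
  by rewrite opprB.
have duN q : cwin A m q -> dot (du q) (du q) <= d%:R * (K3 ^+ 2 * K) * W.
  move=> qC.
  have colB k v w : vwin A (a0 A) m k -> `|u (k + sg v) - u (k + sg w)| <= 2 * hh.
    move=> kV; have [c' E'] := uH k kV.
    have -> : u (k + sg v) - u (k + sg w) = col v (H k) - col w (H k).
      by rewrite -!(col_cell sg) E'; apply/matrixP => a c; rewrite !mxE; ring.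
    rewrite (le_trans (ler_normB _ _))// mulrDl mul1r.
    by rewrite lerD// (le_trans (col_norm _ _))// Hh.
  have gB k (dl0 : 'cV[R]_d) : vwin A (a0 A) m k -> `|dl0| <= D ->
      `|grad A u k *m dl0| <= 2 * d%:R ^+ 2 * `|invmx A| * D * hh.
    move=> kV dl0D; have DB : `|Dmx u k| <= 2 * hh.
      apply: mx_norm_le => [|a i]; first by rewrite mulr_ge0.
      rewrite mxE (le_trans (mx_entry_le _ _ _))//.
      by have := colB k (ji i) j0 kV; rewrite sgi sg0 addr0.
    rewrite (le_trans (mx_norm_mul _ _))//.
    have GB : `|grad A u k| <= d%:R * (2 * hh) * `|invmx A|.
      by rewrite (le_trans (mx_norm_mul _ _))// ler_wpM2r// ler_wpM2l.
    have -> : 2 * d%:R ^+ 2 * `|invmx A| * D * hh = d%:R * (d%:R * (2 * hh) * `|invmx A|) * D by ring.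
    by rewrite ler_pM ?mulr_ge0// ler_wpM2l.
  have duB : `|du q| <= K3 * hh.
    have -> : du q = (u (q + g) - u q) - grad A u (q + g) *m dl' + grad A u q *m dl.
      rewrite /du /yhat; move: (u (q + g)) (u q) (grad A u (q + g) *m dl') (grad A u q *m dl) => a1 a2 a3 a4.
      by apply/matrixP => i j; rewrite !mxE; ring.
    have qV : vwin A (a0 A) m q by exact: cwin_vwin (a0_ge0 A) _ qC.
    have qgV : vwin A (a0 A) m (q + g) by apply: V1; exact: C1.
    have h1 := gB _ _ qV dlD; have h2 := gB _ _ qgV dl'D.
    have h3 : `|u (q + g) - u q| <= 2 * hh.
      have kV : vwin A (a0 A) m (q - sg s').
        apply: V1; apply: C1 => // j; have [_ sg01 _ _] := labels.
        by rewrite mxE; have [->|->] := sg01 s' j.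
      have -> : q + g = q - sg s' + sg s by rewrite gE addrA addrAC.
      by have := colB _ s s' kV; rewrite subrK.
    have := ler_normD (u (q + g) - u q - grad A u (q + g) *m dl') (grad A u q *m dl).
    have := ler_normB (u (q + g) - u q) (grad A u (q + g) *m dl').
    move: h1 h2 h3; rewrite K3E => h1 h2 h3 h4 h5; apply: le_trans h5 _.
    have -> : (2 + 4 * d%:R ^+ 2 * `|invmx A| * D) * hh = 2 * hh + 2 * d%:R ^+ 2 * `|invmx A| * D * hh + 2 * d%:R ^+ 2 * `|invmx A| * D * hh by ring.
    by rewrite lerD// (le_trans h4)// lerD.
  have duB2 : `|du q| ^+ 2 <= K3 ^+ 2 * (K * W).
    by rewrite -hh2 -exprMn lerXn2r// nnegrE ?mulr_ge0.
  rewrite /dot; apply: (@le_trans _ _ (\sum_(i < d) (K3 ^+ 2 * (K * W)))); last first.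
    by rewrite sumr_const card_ord -[leLHS]mulr_natl !mulrA.
  apply: ler_sum => i _; apply: le_trans duB2; rewrite -expr2 -[leLHS]real_normK ?num_real//.
  by rewrite lerXn2r ?nnegrE// mx_entry_le.
have stretch q : cwin A m q -> (yhat Y (q + g) dl' - yhat Y q dl) ord0 0 - tau <=
    dot e1 (du q) + d%:R * (K3 ^+ 2 * K) / (2 * tau) * W.
  move=> qC; have -> : yhat Y (q + g) dl' - yhat Y q dl = P *m (tau *: e1 + du q).
    rewrite (yhat_displacement Y (q + g) dl' SOP_) (yhat_displacement Y q dl SOP_) -mulmxBr; congr (P *m _).
    rewrite embD mulmxDr Ag /du -/u; move: (A *m emb q) (yhat u _ _) (yhat u _ _) => a1 a2 a3.
    by apply/matrixP => i j; rewrite !mxE; ring.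
  rewrite (le_trans (rotation_stretch _ SOP_ tau0))// lerD2l.
  by rewrite [leRHS]mulrAC ler_pM2r ?invr_gt0 ?mulr_gt0// duN.
have S1 : fsum (cwin A m) (fun q => (yhat Y (q + g) dl' - yhat Y q dl) ord0 0 - tau) <=
    fsum (cwin A m) (fun q => dot e1 (du q)) + d%:R * (K3 ^+ 2 * K) / (2 * tau) * W * Nm.
  by rewrite NmE -fsum_const -fsumD; apply: ler_fsum => // q; exact: stretch.
have S2 : fsum (cwin A m) (fun q => r * T (H q) - (2^-1 * al * r ^+ 2 + e * (K * W))) <=
    fsum (cwin A m) (omY Y).
  apply: ler_fsum => // q qC; have qV : vwin A (a0 A) m q by exact: cwin_vwin (a0_ge0 A) _ qC.
  have h1 := omQ q qV; have h2 := rc_QT rc (H q) r.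
  exact: (stress_arith h1 h2).
rewrite fsumB fsumZ fsum_const -NmE in S2.
set X := fsum _ (fun q => _ - tau) in S1 *.
set Du := fsum _ (fun q => dot e1 (du q)) in S1 tel2.
set TT := fsum _ (fun q => T (H q)) in tel2 S2.
set OC := fsum _ (omY Y) in S2 *.
have rt0 : 0 < r / tau by rewrite divr_gt0.
have ra0 : 0 < r * al / tau by rewrite divr_gt0 ?mulr_gt0.
have e1_ : r * al / tau * X <= r * al / tau * Du + r * S0 * W.
  have h : r * al / tau * X <= r * al / tau * (Du + d%:R * (K3 ^+ 2 * K) / (2 * tau) * W * Nm) by rewrite ler_pM2l.
  apply: le_trans h _; rewrite mulrDr lerD2l le_eqVlt; apply/orP; left; apply/eqP.
  by rewrite S0E; ring.
have e2 : r * S0 * W <= eta / 4 * W.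
  rewrite ler_wpM2r//; apply: (@le_trans _ _ (r0 * S0)); first by rewrite ler_wpM2r.
  exact: r0S.
have e3 : r * al / tau * Du - r / tau * (K2 * E) <= r * TT.
  have h : r / tau * (al * Du - K2 * E) <= r / tau * (tau * TT) by rewrite ler_pM2l.
  move: h; rewrite mulrBr => h.
  have -> : r * TT = r / tau * (tau * TT) by rewrite [RHS]mulrA divfK// gt_eqF.
  by apply: le_trans h; rewrite lerB// le_eqVlt; apply/orP; left; apply/eqP; ring.
have e4 : r / tau * (K2 * E) = r ^+ 2 * (16 * Cs * K2 ^+ 2 * cb / tau ^+ 2 * m ^+ n.+1 / eta) + eta / 4 * W.
  by rewrite EE lamE mubE; field; rewrite !gt_eqF.
have e5 : e * (K * W) * Nm <= eta / 4 * W.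
  have [h _] := eK; have -> : e * (K * W) * Nm = e * K * Nm * W by ring.
  by rewrite ler_wpM2r.
rewrite (mulrDr (r ^+ 2)); set X1 := r ^+ 2 * (16 * _ * _ * _ / _ * _ / _) in e4 *.
have -> : r ^+ 2 * (2^-1 * al * cnt (cwin A m)) = 2^-1 * al * r ^+ 2 * Nm by rewrite NmE; ring.
rewrite [(2^-1 * al * r ^+ 2 + _) * Nm]mulrDl in S2.
move: e1_ e2 e3 e4 e5 S2; set x1 := r * al / tau * X; set x2 := r * al / tau * Du.
set x3 := r * S0 * W; set x4 := r / tau * (K2 * E); set x5 := e * (K * W) * Nm.
set x6 := 2^-1 * al * r ^+ 2 * Nm; set x7 := r * TT; set x8 := eta / 4 * W.
have -> : eta * W = 4 * x8 by rewrite /x8; field.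
have x80 : 0 <= x8 by rewrite mulr_ge0// divr_ge0// ltW.
by clearbody x1 x2 x3 x4 x5 x6 x7 x8 X1 OC; move=> *; lra.
Qed.

End Block.

(** The times form a block of consecutive integers; the summand 2 is the rounding at its two
    ends. *)
Lemma time_window {R : realType} (P : nat -> bool) (S : nat) (a b tau c K : R) :
  0 < tau -> 0 <= c -> a <= b ->
  (forall s1 s2, (s1 <= s2)%N -> \sum_(s1 <= s < s2) (P s)%:R <= c * (s2%:R - s1%:R) + K) ->
  \sum_(s < S) (P s && `[< a <= s%:R * tau <= b >])%:R <= c * ((b - a) / tau + 2) + K.
Proof.
move=> tau0 c0 ab H.
pose x := Num.max 0 (a / tau); pose y := Num.max 0 (b / tau).
have x0 : 0 <= x by rewrite le_max lexx.
have y0 : 0 <= y by rewrite le_max lexx.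
have xy : y - x <= (b - a) / tau.
  have h : a / tau <= b / tau by rewrite ler_pM2r ?invr_gt0.
  rewrite mulrBl /x /y; have [h1|h1] := leP 0 (a / tau); have [h2|h2] := leP 0 (b / tau); lra.
have /andP[hx1 hx2] := truncn_itv x0; have /andP[hy1 hy2] := truncn_itv y0.
set s1 := Num.truncn x in hx1 hx2; pose s2 := maxn s1 (Num.truncn y).+1.
have s12 : (s1 <= s2)%N by exact: leq_maxl.
have s2y : s2%:R <= s1%:R + ((b - a) / tau + 2).
  rewrite /s2; have [_|_] := leqP (Num.truncn y).+1 s1.
    by have := divr_ge0 (_ : 0 <= b - a) (ltW tau0); rewrite subr_ge0 => /(_ ab); lra.
  by rewrite -natr1; rewrite -natr1 in hx2; lra.
have step : \sum_(s < S) (P s && `[< a <= s%:R * tau <= b >])%:R <= \sum_(s1 <= s < s2) (P s)%:R :> R.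
  rewrite -(big_mkord xpredT (fun s => (P s && `[< a <= s%:R * tau <= b >])%:R : R)).
  have sub s : P s && `[< a <= s%:R * tau <= b >] -> (s1 <= s < s2)%N.
    move=> /andP[_ /asboolP/andP[h1 h2]].
    have h3 : x <= s%:R by rewrite /x ge_max ler0n ler_pdivrMr.
    have h4 : s%:R <= y by rewrite /y le_max ler_pdivlMr// h2 orbT.
    apply/andP; split; first by rewrite -(ler_nat R); lra.
    rewrite /s2 leq_max; apply/orP; right; rewrite -(ltr_nat R); exact: le_lt_trans h4 hy2.
  rewrite (big_nat_widenl s1 0%N s2)//= (big_nat_widen _ s2 (maxn S s2)) ?leq_maxr//.
  rewrite (big_nat_widen _ S (maxn S s2)) ?leq_maxl//.
  rewrite [leLHS]big_mkcond [leRHS]big_mkcond; apply: ler_sum => s _ /=.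
  case: ifP => _; last by case: ifP.
  case E: (P s && _); last by case: ifP.
  by have /andP[h1 h2] := sub s E; rewrite h1 h2; move: E => /andP[-> _].
apply: le_trans step (le_trans (H _ _ s12) _).
by rewrite lerD2r ler_wpM2l// lerBlDl.
Qed.

(** * Tubes *)

Section Tube.
Context {R : realType} {n : nat}.
Local Notation d := n.+2.
Local Notation N := (2 ^ n.+2)%N.
Variables (A : 'M[R]_d) (Z : 'M[R]_(d, N)) (sg : 'I_N -> 'cV[int]_d).
Variables (j0 : 'I_N) (ji : 'I_d -> 'I_N) (al : R) (b : 'I_N -> 'I_N -> R).
Variables (om Q T : 'M[R]_(d, N) -> R).
Variables (B : R) (Zf : nat -> 'cV[int]_d) (typ : nat -> 'I_N * 'I_N) (fwd act : nat -> bool)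
    (tau : R) (dl : nat -> 'cV[R]_d) (D : R).
Hypothesis unitA : A \in unitmx.
Hypothesis labels : corner_labels A Z sg.
Hypothesis sg0 : sg j0 = 0.
Hypothesis sgi : forall i, sg (ji i) = basis i.
Hypothesis rc : reduced_cell A Z j0 ji al b om Q T.
Hypothesis zz : zigzag A sg b B Zf typ fwd act tau dl D.
Hypothesis B0 : 0 < B.
Implicit Types (Y : 'cV[int]_d -> 'cV[R]_d) (k g q ell : 'cV[int]_d) (I : set 'cV[int]_d).

Local Notation omY := (cell_om sg om).
Definition src s := if fwd s then (typ s).2 else (typ s).1.
Definition dst s := if fwd s then (typ s).1 else (typ s).2.
Definition rt : R := rho A + D.
Definition lateral_tube m : set 'cV[int]_d :=
  [set k | forall j, j != ord0 -> - rt <= (A *m emb k : 'cV[R]_d) j 0 <= m + rt].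
Definition tube m I := I `&` lateral_tube m.
Definition rowsum : R := \sum_j `|A ord0 j|.

Lemma D_ge0 : 0 <= D. Proof. exact: le_trans (zz_D zz 0). Qed.

Lemma step_corner s : act s -> Zf s.+1 = Zf s - sg (src s) + sg (dst s).
Proof.
move=> a; rewrite (zz_S zz) a /src /dst; case: (fwd s);
  by rewrite addrA addrAC.
Qed.

Lemma step_gap s : exists u v, Zf s.+1 - Zf s = sg u - sg v.
Proof.
case a : (act s); last by exists j0, j0; rewrite (zz_S zz) a addr0 !subrr.
exists (dst s), (src s); rewrite step_corner//.
by apply/matrixP => x y; rewrite !mxE; ring.
Qed.

Lemma sg_norm s : `|emb (sg s) : 'cV[R]_d| <= 1.
Proof. exact: small_shift_norm (sg_small labels s). Qed.

Lemma AZf0 s : `|(A *m emb (Zf s)) ord0 0 - s%:R * tau| <= D.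
Proof.
have -> : (A *m emb (Zf s)) ord0 0 - s%:R * tau = dl s ord0 0.
  by rewrite (zz_dl zz) !mxE !eqxx /=; ring.
by rewrite (le_trans (mx_entry_le _ _ _))// (zz_D zz).
Qed.

Lemma AZfj s j : j != ord0 -> `|(A *m emb (Zf s)) j 0| <= D.
Proof.
move=> jn; have -> : (A *m emb (Zf s)) j 0 = dl s j 0.
  by rewrite (zz_dl zz) !mxE (negbTE jn) /=; ring.
by rewrite (le_trans (mx_entry_le _ _ _))// (zz_D zz).
Qed.

Lemma window_tube m k s : vwin A (rho A) m k -> lateral_tube m (k + Zf s).
Proof.
move=> kV j jn; have /andP[h1 h2] := kV j; have := AZfj s jn; rewrite ler_norml => /andP[h3 h4].
rewrite embD mulmxDr mxE /rt; move: ((A *m emb k) j 0) ((A *m emb (Zf s)) j 0) h1 h2 h3 h4.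
by move=> x y h1 h2 h3 h4; apply/andP; split; lra.
Qed.

Lemma cell_tube m ell s t : cwin A m ell -> lateral_tube m (ell + Zf s - sg t).
Proof.
move=> eC; rewrite addrAC; apply: window_tube.
have gs : small_shift (- sg t).
  by move=> j; have [_ sg01 _ _] := labels; rewrite mxE; have [->|->] := sg01 t j.
have := vwin_small (cwin_vwin (lexx 0) eC) gs; apply: vwin_sub; rewrite add0r.
by have := mu_ge0 A; rewrite /rho /a0; lra.
Qed.

Lemma omY_shift Y k v : omY (fun q => Y (q + v)) k = omY Y (k + v).
Proof. by rewrite /cell_om; congr om; apply/matrixP => i j; rewrite !mxE addrAC. Qed.

(** The index [ell + Zf s - sg (src s)] is the cell that carries the bond of step s, because the
    current point is its corner [src s]. Only bonds carried by cells of I are tested. *)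
Definition unbroken Y I (M : R) (S : nat) ell := forall s, (s < S)%N -> act s ->
  I (ell + Zf s - sg (src s)) -> `|Y (ell + Zf s.+1) - Y (ell + Zf s)| <= M.

(* Each broken line crosses a broken bond, and a bond of type i in a given cell
   is used by at most about b i * m / B lines. *)
Lemma tube_fracture (eta : R) : 0 < eta < 1 -> exists m0 M : R, 0 <= M /\
  forall (m : R) Y I (S : nat), 1 <= m -> m0 <= m -> finite_set I ->
  (forall ell, cwin A m ell -> ~ unbroken Y I M S ell) ->
  (1 - eta) * B * cnt (cwin A m) <= (1 + eta) * m * fsum (tube m I) (omY Y).
Proof.
move=> /andP[eta0 eta1]; have [M M0 MP] := rc_fracture rc eta0.
have tau0 := zz_tau zz; have D0 := D_ge0; have mu0 := mu_ge0 A.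
pose bb (i : 'I_N * 'I_N) := b i.1 i.2.
have bb0 i : 0 <= bb i by exact: rc_b rc _ _.
pose m0 := \sum_i (2 * (D + mu A) + 2 * tau + 3 * B / bb i) / eta.
exists m0, M; split; first exact: ltW.
move=> m Y I S m1 mm0 fI H; set Tb := tube m I.
have fT : finite_set Tb by exact: finite_setIl.
have fC : finite_set (cwin A m) by exact: cwin_finite.
pose brk i k : bool := M < `|col i.1 (cellmx sg Y k) - col i.2 (cellmx sg Y k)|.
pose v s := Zf s - sg (src s).
pose use i k s : bool := act s && (typ s == i) && `[< cwin A m (k - v s) >].
have count i k : \sum_(s < S) (use i k s)%:R <= bb i * (m * (1 + eta) / B).
  pose x := (A *m emb k : 'cV[R]_d) ord0 0.
  have win s : cwin A m (k - v s) -> x - m - (D + mu A) <= s%:R * tau <= x + (D + mu A).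
    move=> /(_ ord0) /=; rewrite /v opprB addrA embB mulmxBr embD mulmxDr mxE => /andP[h1 h2].
    have := AZf0 s; have h : `|(A *m emb (sg (src s)) : 'cV[R]_d) ord0 0| <= mu A.
      rewrite (le_trans (mx_entry_le _ _ _))// -[leRHS]mulr1; apply: mul_small; exact: sg_norm.
    move: h h1 h2; rewrite !ler_norml ![(_ + _ : 'cV[R]_d) _ _]mxE ![(- _ : 'cV[R]_d) _ _]mxE -/x.
    move: ((A *m emb (Zf s)) ord0 0) ((A *m emb (sg (src s))) ord0 0) => y z.
    move=> /andP[g1 g2] h1 h2 /andP[g3 g4].
    by apply/andP; split; lra.
  apply: (@le_trans _ _ (\sum_(s < S) ((act s && (typ s == i)) &&
      `[< x - m - (D + mu A) <= s%:R * tau <= x + (D + mu A) >])%:R)).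
    apply: ler_sum => s _; rewrite /use ler_nat; case: (act s && _) => //=.
    by have [h|h] := asboolP (cwin A m (k - v s)) => //; rewrite asboolT//; exact: win.
  have [bi0|bi0] := eqVneq (bb i) 0.
    rewrite bi0 mul0r big1// => s _; case a : (act s) => //=; case t : (typ s == i) => //=.
    by have := zz_zero zz a; rewrite (eqP t) -/(bb i) bi0 eqxx.
  have bi : 0 < bb i by rewrite lt_def bi0 bb0.
  have := @time_window R (fun s => act s && (typ s == i)) S (x - m - (D + mu A)) (x + (D + mu A)) tau
     (bb i * (tau / B)) 3 tau0 _ _ (zz_count zz i).
  rewrite mulr_ge0 ?divr_ge0 ?(ltW tau0) ?(ltW B0)// => /(_ isT); rewrite (_ : x - m - (D + mu A) <= x + (D + mu A)); last lra.
  move=> /(_ isT) h; apply: le_trans h _.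
  have mi : (2 * (D + mu A) + 2 * tau + 3 * B / bb i) / eta <= m.
    apply: le_trans mm0; rewrite /m0 (bigD1 i)//= lerDl; apply: sumr_ge0 => l _.
    rewrite divr_ge0 ?(ltW eta0)// !addr_ge0// ?mulr_ge0 ?invr_ge0 ?(ltW tau0) ?(ltW B0)//.
    by rewrite addr_ge0.
  rewrite ler_pdivrMr// in mi.
  have -> : bb i * (tau / B) * ((x + (D + mu A) - (x - m - (D + mu A))) / tau + 2) + 3 =
      bb i / B * (m + (2 * (D + mu A) + 2 * tau + 3 * B / bb i)).
    by field; rewrite !gt_eqF.
  have -> : bb i * (m * (1 + eta) / B) = bb i / B * (m + m * eta) by ring.
  by rewrite ler_pM2l ?divr_gt0// lerD2l.
(* Double counting of triples (cell, bond type, time): every line supplies at least one broken bond,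
   and [count] bounds how many lines use a given one. *)
have cC : cnt (cwin A m) <= fsum Tb (fun k => \sum_i (brk i k)%:R * (bb i * (m * (1 + eta) / B))).
  apply: (@le_trans _ _ (fsum Tb (fun k => \sum_i \sum_(s < S) (brk i k)%:R * (use i k s)%:R))); last first.
    apply: ler_fsum => // k _; apply: ler_sum => i _; rewrite -mulr_sumr.
    by rewrite ler_wpM2l// ler0n.
  under eq_fun do rewrite exchange_big.
  rewrite -exchange_fsum.
  apply: (@le_trans _ _ (\sum_(s < S) fsum (cwin A m) (fun ell =>
     (act s && brk (typ s) (ell + v s) && `[< Tb (ell + v s) >])%:R))).
    rewrite exchange_fsum; apply: ler_fsum => // ell eC.
    have [s sS [a [Is brs]]] : exists2 s, (s < S)%N & act s /\ (I (ell + Zf s - sg (src s)) /\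
        M < `|Y (ell + Zf s.+1) - Y (ell + Zf s)|).
      apply: contrapT => nex; apply: (H ell eC) => s sS a Is; rewrite leNgt; apply/negP => br.
      by apply: nex; exists s.
    rewrite (bigD1 (Ordinal sS))//= a /=.
    have -> : brk (typ s) (ell + v s).
      rewrite /brk /v !col_cell; move: brs; rewrite step_corner// !addrA.
      have E : ell + Zf s - sg (src s) + sg (src s) = ell + Zf s by rewrite subrK.
      by rewrite -{2}E /src /dst; case: (fwd s) => //; rewrite distrC.
    rewrite asboolT; last by rewrite /v addrA; split=> //; exact: cell_tube.
    by rewrite lerDl sumr_ge0// => *; rewrite ler0n.
  apply: ler_sum => s _.
  rewrite -[leLHS]/(fsum _ (fun ell => (fun k => (act s && brk (typ s) k && `[< Tb k >])%:R) (ell + v s))).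
  rewrite fsum_shift//.
  have fS' : finite_set [set q | cwin A m (q - v s)] by exact: shift_finite.
  have -> : fsum [set q | cwin A m (q - v s)] (fun k => (act s && brk (typ s) k && `[< Tb k >])%:R) =
     fsum (Tb `&` [set q | cwin A m (q - v s)]) (fun k => (act s && brk (typ s) k)%:R) :> R.
    rewrite setIC fsum_cond//; apply: fsum_eq => // k _; case: (_ && brk _ _) => /=; last by case: ifP.
    by case: `[< _ >].
  rewrite fsum_cond//; apply: ler_fsum => // k _.
  case: ifPn => [/asboolP kC|_]; last first.
    by apply: sumr_ge0 => i _; rewrite mulr_ge0 ?ler0n.
  case a : (act s); last by rewrite sumr_ge0// => i _; rewrite mulr_ge0 ?ler0n.
  rewrite /= (bigD1 (typ s))//= /use a eqxx asboolT// mulr1 lerDl.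
  by apply: sumr_ge0 => i _; rewrite mulr_ge0 ?ler0n.
have omB : fsum Tb (fun k => \sum_i (brk i k)%:R * (bb i * (m * (1 + eta) / B))) * ((1 - eta) * B) <=
    (1 + eta) * m * fsum Tb (omY Y).
  rewrite mulrC -!fsumZ; apply: ler_fsum => // k _.
  have := MP (cellmx sg Y k); rewrite -/(omY Y k) => h.
  have -> : (1 - eta) * B * \sum_i (brk i k)%:R * (bb i * (m * (1 + eta) / B)) =
      (1 + eta) * m * ((1 - eta) * \sum_i (brk i k)%:R * bb i).
    by rewrite !mulr_sumr; apply: eq_bigr => i _; field; rewrite gt_eqF.
  rewrite ler_wpM2l ?mulr_ge0//; [lra|lra|].
  apply: le_trans h; rewrite le_eqVlt; apply/orP; left; apply/eqP; congr (_ * _).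
  rewrite pair_big_dep/= [RHS]big_mkcond; apply: eq_bigr => i _.
  by rewrite /brk /bb /=; case: ifP => _; rewrite ?mul1r ?mul0r.
rewrite mulrC; apply: le_trans omB; rewrite ler_wpM2r// mulr_ge0 ?(ltW B0)//; lra.
Qed.

(** The window moves with average speed tau in direction e_1, hence a fixed cell is inside it for at
    most (m + 2 [rt]) / tau + 2 times. *)
Lemma tube_visits (m : R) I S (F : 'cV[int]_d -> R) : 0 <= m -> finite_set I -> (forall k, 0 <= F k) ->
  \sum_(s < S) fsum (tube m I `&` [set k | vwin A (rho A) m (k - Zf s)]) F <=
    ((m + 2 * rt) / tau + 2) * fsum (tube m I) F.
Proof.
move=> m0 fI F0; have tau0 := zz_tau zz; have D0 := D_ge0; have rho0 := rho_ge0 A.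
have fT : finite_set (tube m I) by exact: finite_setIl.
under eq_bigr do rewrite fsum_cond//.
rewrite exchange_fsum -fsumZ; apply: ler_fsum => // k _.
rewrite (eq_bigr (fun s : 'I_S => (`[< vwin A (rho A) m (k - Zf s) >])%:R * F k)); last first.
  by move=> s _; case: ifP; rewrite ?mul1r ?mul0r.
rewrite -mulr_suml ler_wpM2r//; pose x := (A *m emb k : 'cV[R]_d) ord0 0.
apply: (@le_trans _ _ (\sum_(s < S) (true && `[< x - m - rt <= s%:R * tau <= x + rt >])%:R)).
  apply: ler_sum => s _; rewrite ler_nat /=; have [kV|//] := asboolP (vwin A (rho A) m (k - Zf s)).
  rewrite asboolT//; have /andP[h1 h2] := kV ord0; have := AZf0 s; rewrite ler_norml => /andP[h3 h4].
  rewrite embB mulmxBr mxE [X in _ + X]mxE -/x in h1 h2; rewrite /rt.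
  by move: ((A *m emb (Zf s)) ord0 0) h1 h2 h3 h4 => y h1 h2 h3 h4; apply/andP; split; lra.
have := @time_window R (fun=> true) S (x - m - rt) (x + rt) tau 1 0 tau0 ler01.
rewrite mul1r addr0; have -> : x + rt - (x - m - rt) = m + 2 * rt by ring.
apply; first by rewrite /rt; lra.
by move=> s1 s2 s12; rewrite big_const_nat iter_addr_0 mul1r addr0 natrB.
Qed.

Definition step_value x0 ell s : R := (A *m emb (ell + Zf s) : 'cV[R]_d) ord0 0 + x0.

Lemma rowsum_bound (x : 'cV[R]_d) c : `|x| <= c -> `|(A *m x) ord0 0| <= rowsum * c.
Proof.
move=> xc; rewrite mxE (le_trans (ler_norm_sum _ _ _))// /rowsum mulr_suml ler_sum// => j _.
by rewrite normrM ler_wpM2l// (le_trans (mx_entry_le _ _ _)).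
Qed.

Lemma step_value_diff x0 ell s : `|step_value x0 ell s.+1 - step_value x0 ell s| <= rowsum.
Proof.
have [u [v E]] := step_gap s; rewrite /step_value.
have -> : (A *m emb (ell + Zf s.+1)) ord0 0 + x0 - ((A *m emb (ell + Zf s)) ord0 0 + x0) =
    (A *m emb (Zf s.+1 - Zf s)) ord0 0 :> R.
  by rewrite opprD addrACA subrr addr0 embB !(embD ell) mulmxBr !mulmxDr !mxE; ring.
rewrite E -[rowsum]mulr1; apply: rowsum_bound; apply: small_shift_norm => j.
by have [_ sg01 _ _] := labels; rewrite !mxE; have [->|->] := sg01 u j; have [->|->] := sg01 v j.
Qed.

Lemma rowsum_ge0 : 0 <= rowsum. Proof. exact: sumr_ge0. Qed.

(* The part of a line between the two boundary layers. *)
Lemma crossing x0 ell L1 S : 4 * rowsum < L1 -> step_value x0 ell 0%N <= rowsum ->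
  L1 - 2 * rowsum <= step_value x0 ell S -> exists s1 s2, [/\ (s1 <= s2 <= S)%N,
    rowsum < step_value x0 ell s1 <= 2 * rowsum,
    L1 - 2 * rowsum <= step_value x0 ell s2 <= L1 - rowsum &
    forall s, (s1 <= s < s2)%N -> rowsum < step_value x0 ell s < L1 - 2 * rowsum].
Proof.
move=> L14 f0 fS; set f := step_value x0 ell in f0 fS *; have r0 := rowsum_ge0.
have fd s : `|f s.+1 - f s| <= rowsum by exact: step_value_diff.
have exS : exists s, L1 - 2 * rowsum <= f s by exists S.
have [s2 hs2 s2min] := ex_minnP exS.
have s2S : (s2 <= S)%N by exact: s2min.
have s20 : (0 < s2)%N by rewrite lt0n; apply/eqP => E; move: hs2; rewrite E; lra.
have lt2 s : (s < s2)%N -> f s < L1 - 2 * rowsum.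
  by move=> ss; rewrite ltNge; apply/negP => /s2min; rewrite leqNgt ss.
have ex1 : exists s, (s < s2)%N && (f s <= rowsum) by exists 0%N; rewrite s20.
have bd s : (s < s2)%N && (f s <= rowsum) -> (s <= s2)%N by case/andP => /ltnW.
have [s1 /andP[s1s2 fs1] s1max] := ex_maxnP ex1 bd.
have gt1 s : (s1 < s < s2)%N -> rowsum < f s.
  move=> /andP[h1 h2]; rewrite ltNge; apply/negP => h3.
  by have := s1max s; rewrite h2 h3 => /(_ isT); rewrite leqNgt h1.
have hs2' : f s2 <= L1 - rowsum.
  have := fd s2.-1; rewrite prednK// => /ler_normlP[_ h].
  by have := lt2 s2.-1; rewrite prednK// => /(_ (leqnn _)); lra.
exists s1.+1, s2; split=> //.
- by rewrite s1s2.
- have := fd s1 => /ler_normlP[_ h]; apply/andP; split; last lra.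
  have [E|ne] := eqVneq s1.+1 s2; first by rewrite E; lra.
  by apply: gt1; rewrite ltnSn ltn_neqAle ne.
- by rewrite hs2.
- by move=> s /andP[h1 h2]; rewrite gt1 ?h1//= lt2.
Qed.

Lemma yhat_shift Y v q x : yhat A (fun k => Y (k + v)) q x = yhat A Y (q + v) x.
Proof.
have E : Dmx (fun k => Y (k + v)) q = Dmx Y (q + v).
  by apply/matrixP => i j; rewrite !mxE (addrAC q).
by rewrite /yhat /grad E.
Qed.

Lemma window_sum Y I m s : finite_set I ->
  (forall k, vwin A (rho A) m k -> I (k + Zf s)) ->
  fsum (vwin A (rho A) m) (omY (fun q => Y (q + Zf s))) =
  fsum (tube m I `&` [set k | vwin A (rho A) m (k - Zf s)]) (omY Y).
Proof.
move=> fI H; have fV : finite_set (vwin A (rho A) m) by exact: vwin_finite.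
transitivity (fsum (vwin A (rho A) m) (fun k => omY Y (k + Zf s))).
  by apply: fsum_eq => // k _; exact: omY_shift.
rewrite fsum_shift//; congr fsum; apply/seteqP; split=> k /=; last by case.
move=> kV; split=> //; split.
  by rewrite -[k](subrK (Zf s)); exact: H.
by rewrite -[k](subrK (Zf s)); exact: window_tube.
Qed.

(** A time is bad for two reasons. The window may leave I, which happens only near the two ends of
    the tube, or it may contain a cell of energy above th; times of the latter kind are counted by
    the energy, since each cell is visited a bounded number of times. *)
Lemma bad_times (m x0 L1 th : R) Y I S : 0 <= m -> 0 < th -> finite_set I ->
  - (m + 3 * mu A) <= x0 <= - m ->
  S%:R * tau <= L1 + m + 3 * mu A + D + tau ->
  (forall k, lateral_tube m k ->
     2^-1 * rowsum < (A *m (emb k + const_mx 2^-1) : 'cV[R]_d) ord0 0 + x0 < L1 - 2^-1 * rowsum -> I k) ->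
  \sum_(s < S) (~~ `[< forall k, vwin A (rho A) m k -> I (k + Zf s) /\ omY Y (k + Zf s) <= th >])%:R <=
  2 * (2 * (rowsum + rho A + D + m + 3 * mu A + tau) / tau + 2) +
  ((m + 2 * rt) / tau + 2) * fsum (tube m I) (omY Y) / th.
Proof.
move=> m0 th0 fI /andP[x01 x02] SL Hin; have tau0 := zz_tau zz; have D0 := D_ge0.
have rho0 := rho_ge0 A; have mu0 := mu_ge0 A; have rs0 := rowsum_ge0.
pose c1 := rowsum + rho A + D + m + 3 * mu A + tau.
have c10 : 0 <= c1 by rewrite /c1 !addr_ge0// ?mulr_ge0// ltW.
pose WS s := fsum (tube m I `&` [set k | vwin A (rho A) m (k - Zf s)]) (omY Y).
have om0 k : 0 <= omY Y k by exact: omY_ge0 rc _ _.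
have fT : finite_set (tube m I) by exact: finite_setIl.
have WS0 s : 0 <= WS s by apply: fsum_ge0 => //; exact: finite_setIl.
have point s : (s < S)%N -> (~~ `[< forall k, vwin A (rho A) m k -> I (k + Zf s) /\ omY Y (k + Zf s) <= th >])%:R <=
    (true && `[< - c1 <= s%:R * tau <= c1 >])%:R + (true && `[< L1 - c1 <= s%:R * tau <= L1 + c1 >])%:R + WS s / th.
  move=> sS; have w0 : 0 <= WS s / th by rewrite divr_ge0// ltW.
  case: asboolP => [_|h] /=.
    by rewrite addr_ge0// addr_ge0// ler0n.
  have st0 : 0 <= s%:R * tau by rewrite mulr_ge0// ltW.
  have stS : s%:R * tau <= S%:R * tau by rewrite ler_pM2r// ler_nat ltnW.
  have [[k [kV nI]]|nI] := pselect (exists k, vwin A (rho A) m k /\ ~ I (k + Zf s)).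
    have nv := contra_not (Hin _ (window_tube s kV)) nI.
    set v : R := _ + x0 in nv.
    have vb : `|v - (s%:R * tau + (A *m emb k : 'cV[R]_d) ord0 0 + x0)| <= D + 2^-1 * rowsum.
      have -> : v - (s%:R * tau + (A *m emb k) ord0 0 + x0) = ((A *m emb (Zf s)) ord0 0 - s%:R * tau) +
          (A *m (const_mx 2^-1 : 'cV[R]_d)) ord0 0.
        rewrite /v embD !mulmxDr; move: (A *m emb k) (A *m emb (Zf s)) (A *m const_mx _) => a1 a2 a3.
        by rewrite !mxE; ring.
      rewrite (le_trans (ler_normD _ _))// lerD ?AZf0// [leRHS]mulrC; apply: rowsum_bound.
      by apply: mx_norm_le => // i j; rewrite mxE ger0_norm.
    have /andP[k1 k2] := kV ord0; move: vb; rewrite ler_norml => /andP[v1 v2].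
    have [hv|hv] := leP v (2^-1 * rowsum).
      rewrite (asboolT (_ : - c1 <= s%:R * tau <= c1)) ?mulr1n.
        by rewrite -addrA lerDl addr_ge0// ler0n.
      by apply/andP; split; rewrite /c1; lra.
    have hv2 : L1 - 2^-1 * rowsum <= v by rewrite leNgt; apply/negP => h2; apply: nv; rewrite hv h2.
    rewrite (asboolT (_ : L1 - c1 <= s%:R * tau <= L1 + c1)) ?mulr1n.
      by rewrite addrAC lerDr addr_ge0// ler0n.
    by apply/andP; split; rewrite /c1; lra.
  have allI k : vwin A (rho A) m k -> I (k + Zf s).
    by move=> kV; apply: contrapT => nk; apply: nI; exists k.
  have [k kV omk] : exists2 k, vwin A (rho A) m k & th < omY Y (k + Zf s).
    apply: contrapT => nk; apply: h => k kV; split; first exact: allI.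
    by rewrite leNgt; apply/negP => hk; apply: nk; exists k.
  have : th <= WS s.
    apply: le_trans (ltW omk) _; rewrite -(fsum1 (k + Zf s) (omY Y)); apply: fsum_le_set => //.
      exact: finite_setIl.
    move=> _ ->; split; last by rewrite /= addrK.
    by split; [exact: allI|exact: window_tube].
  move=> hW; have : 1 <= WS s / th by rewrite ler_pdivlMr// mul1r.
  by move=> h1; rewrite ler_wpDl// addr_ge0// ler0n.
apply: (@le_trans _ _ (\sum_(s < S) ((true && `[< - c1 <= s%:R * tau <= c1 >])%:R +
    (true && `[< L1 - c1 <= s%:R * tau <= L1 + c1 >])%:R + WS s / th))).
  by apply: ler_sum => s _; exact: point.
rewrite !big_split /= -mulr_suml.
have tw a c : a <= c -> \sum_(s < S) (true && `[< a <= s%:R * tau <= c >])%:R <= (c - a) / tau + 2 :> R.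
  move=> ac; have := @time_window R (fun=> true) S a c tau 1 0 tau0 ler01 ac.
  rewrite mul1r addr0; apply.
  by move=> s1 s2 s12; rewrite big_const_nat iter_addr_0 mul1r addr0 natrB.
have c1n : - c1 <= c1 by apply: (le_trans _ c10); rewrite oppr_le0.
have c1n2 : L1 - c1 <= L1 + c1 by rewrite lerD2l.
have t1 := tw _ _ c1n.
have t2 := tw _ _ c1n2.
have E1 : c1 - - c1 = 2 * c1 by ring.
have E2 : L1 + c1 - (L1 - c1) = 2 * c1 by ring.
rewrite E1 in t1; rewrite E2 in t2.
have t3 := tube_visits S m0 fI om0.
rewrite -/c1 (_ : 2 * (2 * c1 / tau + 2) = (2 * c1 / tau + 2) + (2 * c1 / tau + 2)); last by ring.
apply: lerD; last by rewrite ler_pM2r ?invr_gt0.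
exact: lerD t1 t2.
Qed.

Lemma half_sub1_norm : `|2^-1 - 1 : R| <= 2^-1.
Proof. by rewrite ler_norml; apply/andP; split; lra. Qed.

Lemma shifted_interval (c z w x0 L1 : R) : c < z + x0 < L1 - 2 * c -> `|w| <= c * 2^-1 ->
  2^-1 * c < z + w + x0 < L1 - 2^-1 * c.
Proof. by move=> /andP[h1 h2]; rewrite ler_norml => /andP[h3 h4]; apply/andP; split; lra. Qed.

(** At good times [block_inequality] is applied to the moving window. At bad times only the single
    unbroken line is followed, whose bonds have length at most M. The boundary layers prescribe the
    total elongation, and bad times can account for only a small part of it. *)
Theorem tube_elastic : exists2 c : R, 0 <= c & forall m eta M : R, 1 <= m -> 0 < eta -> 0 <= M ->
  exists r0 K : R, [/\ 0 < r0, 0 <= K & forall Y I (x0 L1 aeps r : R) S ell0,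
  0 < r <= r0 -> 0 <= aeps -> - (m + 3 * mu A) <= x0 <= - m -> finite_set I -> 4 * rowsum < L1 ->
  L1 + m + 3 * mu A + D <= S%:R * tau <= L1 + m + 3 * mu A + D + tau ->
  (forall k, lateral_tube m k ->
     2^-1 * rowsum < (A *m (emb k + const_mx 2^-1) : 'cV[R]_d) ord0 0 + x0 < L1 - 2^-1 * rowsum -> I k) ->
  (forall q1 q2, lateral_tube m q1 -> lateral_tube m q2 ->
     0 < (A *m emb q1 : 'cV[R]_d) ord0 0 + x0 <= 2 * rowsum ->
     L1 - 2 * rowsum <= (A *m emb q2 : 'cV[R]_d) ord0 0 + x0 < L1 ->
     (A *m emb q2 : 'cV[R]_d) ord0 0 - (A *m emb q1 : 'cV[R]_d) ord0 0 + aeps * (L1 - 4 * rowsum)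
       <= Y q2 ord0 0 - Y q1 ord0 0) ->
  cwin A m ell0 -> unbroken Y I M S ell0 ->
  r * al * cnt (cwin A m) * aeps * (L1 - 4 * rowsum) - r * K -
    (L1 + K) * r ^+ 2 * (2^-1 * al * cnt (cwin A m) + c * m ^+ n.+1 / eta) <=
  (1 + 2 * eta) * (m + 2 * rt + 2 * tau) * fsum (tube m I) (omY Y)].
Proof.
have tau0 := zz_tau zz; have D0 := D_ge0; have al0 := rc_al rc.
have rho0 := rho_ge0 A; have mu0 := mu_ge0 A; have rs0 := rowsum_ge0.
have [c c0 block] := block_inequality unitA labels sg0 sgi rc tau0 D0.
exists c => // m eta M m1 eta0 M0; have m0 : 0 <= m := le_trans ler01 m1.
have [th [r1 [Kp [th0 r10 Kp0 blockP]]]] := block m eta m1 eta0.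
have fC : finite_set (cwin A m) by exact: cwin_finite.
have [Nm NmE] : exists Nm : R, Nm = cnt (cwin A m) by eexists.
have Nm0 : 0 <= Nm by rewrite NmE cnt_ge0.
have [K1 K1E] : exists K1 : R, K1 = (Kp + d%:R * Kp * D) * Nm by eexists.
have K10 : 0 <= K1 by rewrite K1E !mulr_ge0// addr_ge0// ?mulr_ge0// ltW.
have [K4 K4E] : exists K4 : R, K4 = Nm * M + 2 * K1 by eexists.
have K40 : 0 <= K4 by rewrite K4E addr_ge0// mulr_ge0.
have [c1 c1E] : exists c1 : R, c1 = rowsum + rho A + D + m + 3 * mu A + tau by eexists.
have c10 : 0 <= c1 by rewrite c1E !addr_ge0// ?mulr_ge0// ltW.
have [Kn KnE] : exists Kn : R, Kn = 2 * (2 * c1 / tau + 2) by eexists.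
have Kn0 : 0 <= Kn by rewrite KnE mulr_ge0// addr_ge0// divr_ge0 ?mulr_ge0// ltW.
(* A bad time loses at most r al [K4]. For r up to [r2] this is at most eta th tau, so the loss at
   times of high energy is absorbed by eta times that energy. *)
have [r2 [r20 r2P]] : exists r2 : R, 0 < r2 /\ r2 * (al * K4) <= eta * th * tau.
  have h : 0 < al * K4 + 1 by rewrite ltr_wpDl// mulr_ge0// ltW.
  exists (eta * th * tau / (al * K4 + 1)); split; first by rewrite divr_gt0// !mulr_gt0.
  by rewrite mulrAC ler_pdivrMr// ler_wpM2l ?lerDl// !mulr_ge0// ltW.
exists (Num.min r1 r2), (al * (2 * D * Nm + 2 * K1 + Kn * K4) + c1); split.
- by rewrite lt_min r10.
- by rewrite addr_ge0// mulr_ge0 ?(ltW al0)// !addr_ge0// !mulr_ge0.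
move=> Y I x0 L1 aeps r S ell0 /andP[rp]; rewrite le_min => /andP[rr1 rr2] a0_ge x0b fI L14 /andP[SL1 SL2] Hin Hbd eC unb.
set ET := fsum _ (omY Y).
have om0 k : 0 <= omY Y k by exact: omY_ge0 rc _ _.
have fT : finite_set (tube m I) by exact: finite_setIl.
have ET0 : 0 <= ET by exact: fsum_ge0.
pose pr s : bool := `[< forall k, vwin A (rho A) m k -> I (k + Zf s) /\ omY Y (k + Zf s) <= th >].
pose Ys s q := Y (q + Zf s).
pose x s := fsum (cwin A m) (fun q => yhat A (Ys s) q (dl s) ord0 0).
pose y s := Nm * Y (ell0 + Zf s) ord0 0.
pose WS s := fsum (tube m I `&` [set k | vwin A (rho A) m (k - Zf s)]) (omY Y).
have WS0 s : 0 <= WS s by apply: fsum_ge0 => //; exact: finite_setIl.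
have [G GE] : exists G : R, G = 2^-1 * al * Nm + c * m ^+ n.+1 / eta by eexists.
have G0 : 0 <= G.
  rewrite GE addr_ge0// ?mulr_ge0 ?invr_ge0// ?(ltW al0) ?(ltW eta0) ?exprn_ge0//.
have prP s : pr s -> forall k, vwin A (rho A) m k -> I (k + Zf s) /\ omY (Ys s) k <= th.
  by move=> /asboolP H k kV; have [Ik omk] := H k kV; rewrite omY_shift.
have gshift s q v : yhat A (Ys s) (q + (Zf s.+1 - Zf s)) v = yhat A (Ys s.+1) q v.
  by rewrite !yhat_shift -addrA subrK.
have gsmall s : small_shift (Zf s.+1 - Zf s).
  have [u [v ->]] := step_gap s => j; have [_ sg01 _ _] := labels.
  by rewrite !mxE; have [->|->] := sg01 u j; have [->|->] := sg01 v j.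
have C_a0 q : cwin A m q -> vwin A (a0 A) m q by exact: cwin_vwin (a0_ge0 A) _.
have C_a0g s q : cwin A m q -> vwin A (a0 A) m (q + (Zf s.+1 - Zf s)).
  move=> qC; have := vwin_small (cwin_vwin (lexx 0) qC) (gsmall s); rewrite add0r.
  by apply: vwin_sub; exact: mu_le_a0.
have near_line s (v w : 'cV[R]_d) q q' : pr s -> vwin A (a0 A) m q -> vwin A (a0 A) m q' -> `|v| <= D ->
    `|yhat A (Ys s) q v ord0 0 - Ys s q' ord0 0| <= Kp + d%:R * Kp * D.
  move=> prs qV q'V vD; have [Ylip Yg _] := blockP (Ys s) (fun k kV => (prP s prs k kV).2).
  have -> : yhat A (Ys s) q v ord0 0 - Ys s q' ord0 0 = (Ys s q - Ys s q') ord0 0 - (grad A (Ys s) q *m v) ord0 0.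
    rewrite /yhat; move: (Ys s q) (Ys s q') (grad A (Ys s) q *m v) => b1 b2 b3.
    by rewrite !mxE; ring.
  rewrite (le_trans (ler_normB _ _))// lerD//.
    by rewrite (le_trans (mx_entry_le _ _ _))// Ylip.
  rewrite (le_trans (mx_entry_le _ _ _))// (le_trans (mx_norm_mul _ _))//.
  by rewrite ler_pM ?mulr_ge0// ler_wpM2l// Yg.
have xy s : pr s -> `|x s - y s| <= K1.
  move=> prs; have -> : x s - y s = fsum (cwin A m) (fun q => yhat A (Ys s) q (dl s) ord0 0 - Ys s ell0 ord0 0).
    by rewrite fsumB fsum_const -NmE /y mulrC.
  rewrite (le_trans (fsum_norm _ _))// K1E NmE -fsum_const; apply: ler_fsum => // q qC.
  exact: (near_line s (dl s) 0 q ell0 prs (C_a0 _ qC) (C_a0 _ eC) (zz_D zz s)).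
have xy1 s : pr s -> `|x s.+1 - y s.+1| <= K1.
  move=> prs; have -> : x s.+1 - y s.+1 = fsum (cwin A m) (fun q =>
      yhat A (Ys s) (q + (Zf s.+1 - Zf s)) (dl s.+1) ord0 0 - Ys s (ell0 + (Zf s.+1 - Zf s)) ord0 0).
    rewrite fsumB fsum_const -NmE /y [_ * Nm]mulrC; congr (_ - _ * _).
      by apply: eq_bigr => q _; rewrite gshift.
    by rewrite /Ys -addrA subrK.
  rewrite (le_trans (fsum_norm _ _))// K1E NmE -fsum_const; apply: ler_fsum => // q qC.
  exact: (near_line s (dl s.+1) 0 _ _ prs (C_a0g s _ qC) (C_a0g s _ eC) (zz_D zz s.+1)).
have blk s : pr s -> r * al / tau * (x s.+1 - x s - Nm * tau) - r ^+ 2 * G <= (1 + eta) * WS s.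
  move=> prs; have [_ _ bl] := blockP (Ys s) (fun k kV => (prP s prs k kV).2).
  have [u [v guv]] := step_gap s.
  have Ag : A *m emb (Zf s.+1 - Zf s) = tau *: e1 + dl s.+1 - dl s.
    rewrite embB mulmxBr !(zz_dl zz) -natr1; apply/matrixP => i j; rewrite !mxE; ring.
  have rb : 0 < r <= r1 by rewrite rp rr1.
  have := bl r _ u v (dl s) (dl s.+1) rb guv Ag (zz_D zz s) (zz_D zz s.+1).
  have -> : fsum (cwin A m) (fun q => (yhat A (Ys s) (q + (Zf s.+1 - Zf s)) (dl s.+1) - yhat A (Ys s) q (dl s)) ord0 0 - tau)
     = x s.+1 - x s - Nm * tau.
    rewrite fsumB fsum_const -NmE (mulrC Nm); congr (_ - _).
    rewrite /x -fsumB; apply: eq_bigr => q _; rewrite gshift.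
    by rewrite mxE [X in _ + X]mxE.
  rewrite -NmE -GE => h; apply: le_trans h _; rewrite mulrDl mul1r.
  have -> : WS s = fsum (vwin A (rho A) m) (omY (Ys s)).
    by rewrite /Ys (window_sum Y fI)// => k kV; have [] := prP s prs k kV.
  rewrite lerD//; apply: fsum_le_set; first exact: vwin_finite.
    exact: cwin_vwin (rho_ge0 A).
  by move=> k _; exact: omY_ge0 rc _ _.
have f0 : step_value x0 ell0 0%N <= rowsum.
  have /andP[_ h] := eC ord0; rewrite /step_value (zz_0 zz) addr0.
  have /andP[_ h2] := x0b; move: h; rewrite /=; move: ((A *m emb ell0) ord0 0) => z h.
  by apply: le_trans rs0; move: (ltW h); lra.
have fSv : L1 - 2 * rowsum <= step_value x0 ell0 S.
  have /andP[h _] := eC ord0; rewrite /step_value embD mulmxDr mxE.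
  have := AZf0 S; rewrite ler_norml => /andP[h3 h4]; have /andP[h5 h6] := x0b; move: h; rewrite /=.
  by move: ((A *m emb ell0) ord0 0) ((A *m emb (Zf S)) ord0 0) h3 h4 => z w h3 h4 h; lra.
have [s1 [s2 [/andP[s12 s2S] /andP[v1 v1'] /andP[v2 v2'] vm]]] := crossing L14 f0 fSv.
have lat s : lateral_tube m (ell0 + Zf s).
  apply: window_tube; apply: vwin_sub (C_a0 _ eC); exact: a0_le_rho.
have bonds s : (s1 <= s < s2)%N -> `|Y (ell0 + Zf s.+1) - Y (ell0 + Zf s)| <= M.
  move=> ss; case a : (act s); last by rewrite (zz_S zz) a addr0 subrr normr0.
  apply: unb => //; first by have /andP[_ h] := ss; exact: leq_trans h s2S.
  apply: Hin; first exact: cell_tube.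
  have := vm s ss; rewrite /step_value => /andP[g1 g2].
  have h : `|(A *m (const_mx 2^-1 - emb (sg (src s)) : 'cV[R]_d)) ord0 0| <= rowsum * 2^-1.
    apply: rowsum_bound; apply: mx_norm_le => // i j; rewrite (ord1 j) !mxE.
    have [_ sg01 _ _] := labels; have [->|->] := sg01 (src s) i; rewrite ?mulr0z ?mulr1z.
      by rewrite subr0 ger0_norm.
    exact: half_sub1_norm.
  have -> : (A *m (emb (ell0 + Zf s - sg (src s)) + const_mx 2^-1)) ord0 0 =
     (A *m emb (ell0 + Zf s)) ord0 0 + (A *m (const_mx 2^-1 - emb (sg (src s)) : 'cV[R]_d)) ord0 0.
    rewrite embB mulmxDr !mulmxBr; move: (A *m _) (A *m _) (A *m _) => a1 a2 a3; rewrite !mxE; ring.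
  by apply: shifted_interval h; rewrite g1 g2.
have yM s : (s1 <= s < s2)%N -> y s.+1 - y s <= Nm * M.
  move=> ss; rewrite /y -mulrBr ler_wpM2l//.
  have := mx_entry_le (Y (ell0 + Zf s.+1) - Y (ell0 + Zf s)) ord0 0.
  rewrite mxE [X in _ + X]mxE => h; exact: le_trans (ler_norm _) (le_trans h (bonds s ss)).
(* The averaged position [x] is used at both ends of a good step, so good steps contribute exact
   increments of [x]. Passing between [x] and the single line [y] costs at most [K1] at either end
   and happens in bad steps only. *)
pose Dd s := if pr s || ((0 < s)%N && pr s.-1) then x s else y s.
have Ddy s : `|Dd s - y s| <= K1.
  rewrite /Dd; case: ifP => [|_]; last by rewrite subrr normr0.
  by case/orP => [/xy//|/andP[s0 /xy1]]; rewrite prednK.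
have Dstep s : (s1 <= s < s2)%N ->
    Dd s.+1 - Dd s <= (pr s)%:R * (x s.+1 - x s) + (~~ pr s)%:R * K4.
  move=> ss; case p : (pr s) => /=.
    by rewrite mul1r mul0r addr0 /Dd p /= orbT.
  rewrite mul0r mul1r add0r K4E; have := Ddy s; have := Ddy s.+1; have := yM s ss.
  by rewrite !ler_norml => h1 /andP[h2 h3] /andP[h4 h5]; lra.
pose nb : R := \sum_(s1 <= s < s2) (~~ pr s)%:R.
pose X : R := \sum_(s1 <= s < s2) (pr s)%:R * (x s.+1 - x s - Nm * tau).
have nb0 : 0 <= nb by apply: sumr_ge0 => *; rewrite ler0n.
have tele : Dd s2 - Dd s1 <= X + Nm * tau * ((s2%:R - s1%:R) - nb) + nb * K4.
  rewrite -(telescope_sumr Dd s12) big_seq_cond.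
  have -> : X + Nm * tau * ((s2%:R - s1%:R) - nb) + nb * K4 =
     \sum_(s1 <= s < s2) ((pr s)%:R * (x s.+1 - x s) + (~~ pr s)%:R * K4).
    rewrite big_split /= -mulr_suml; congr (_ + _).
    have -> : s2%:R - s1%:R = \sum_(s1 <= s < s2) (1 : R).
      by rewrite big_const_nat iter_addr_0 natrB.
    rewrite /X /nb -sumrB mulr_sumr -big_split; apply: eq_bigr => s _ /=.
    by case: (pr s) => /=; ring.
  rewrite [leRHS]big_seq_cond; apply: ler_sum => s; rewrite mem_index_iota andbT.
  exact: Dstep.
have Xlow : Nm * aeps * (L1 - 4 * rowsum) - 2 * D * Nm - 2 * K1 - nb * K4 <= X.
  have hb : step_value x0 ell0 s2 - step_value x0 ell0 s1 + aeps * (L1 - 4 * rowsum) <=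
      Y (ell0 + Zf s2) ord0 0 - Y (ell0 + Zf s1) ord0 0.
    have := Hbd (ell0 + Zf s1) (ell0 + Zf s2) (lat s1) (lat s2).
    have -> : (A *m emb (ell0 + Zf s2)) ord0 0 - (A *m emb (ell0 + Zf s1)) ord0 0 =
      step_value x0 ell0 s2 - step_value x0 ell0 s1.
      by rewrite /step_value; move: ((A *m _) _ _) ((A *m _) _ _) => a1 a2; ring.
    apply.
      by rewrite v1' andbT; exact: le_lt_trans rs0 v1.
    by rewrite v2; apply: le_lt_trans v2' _; move: v1 v1' L14; lra.
  have hy : Nm * (step_value x0 ell0 s2 - step_value x0 ell0 s1 + aeps * (L1 - 4 * rowsum)) <= y s2 - y s1.
    by rewrite /y -mulrBr ler_wpM2l.
  have hf : (s2%:R - s1%:R) * tau - 2 * D <= step_value x0 ell0 s2 - step_value x0 ell0 s1.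
    have := AZf0 s1; have := AZf0 s2; rewrite /step_value !embD !mulmxDr ![(_ + _ : 'cV[R]_d) _ _]mxE.
    by rewrite !ler_norml => /andP[h1 h2] /andP[h3 h4]; lra.
  have hf2 := ler_wpM2l Nm0 hf.
  have := Ddy s1; have := Ddy s2; rewrite !ler_norml => /andP[g1 g2] /andP[g3 g4].
  have g5 : 0 <= Nm * tau * nb by rewrite !mulr_ge0// ltW.
  move: tele hy hf2 g1 g2 g3 g4 g5; move: (Dd s1) (Dd s2) (y s1) (y s2) (step_value x0 ell0 s1) (step_value x0 ell0 s2).
  move=> d1 d2 y1 y2 f1 f2 h1 h2 h3 h4 h5 h6 h7 h8; lra.
have subS (F : nat -> R) : (forall s, 0 <= F s) -> \sum_(s1 <= s < s2) F s <= \sum_(s < S) F s.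
  move=> F0; rewrite -(big_mkord xpredT F) (big_nat_widenl s1 0%N s2)// (big_nat_widen _ s2 S)//=.
  by rewrite [leLHS]big_mkcond; apply: ler_sum => s _; case: ifP.
have nbB : nb <= Kn + ((m + 2 * rt) / tau + 2) * ET / th.
  have := bad_times Y m0 th0 fI x0b SL2 Hin; rewrite -c1E -KnE; apply: le_trans.
  by apply: (subS (fun s => (~~ pr s)%:R)) => s; rewrite ler0n.
have eta1 : 0 <= 1 + eta by rewrite addr_ge0// ltW.
have XB : r * al / tau * X <= S%:R * (r ^+ 2 * G) + (1 + eta) * (((m + 2 * rt) / tau + 2) * ET).
  apply: (@le_trans _ _ (\sum_(s1 <= s < s2) (r ^+ 2 * G + (1 + eta) * WS s))).
    rewrite /X mulr_sumr; apply: ler_sum => s _.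
    have h0 : 0 <= r ^+ 2 * G + (1 + eta) * WS s by rewrite addr_ge0// mulr_ge0// exprn_ge0// ltW.
    case p : (pr s); last by rewrite mul0r mulr0.
    by rewrite mul1r -lerBlDl; exact: blk.
  have h : forall s, 0 <= r ^+ 2 * G + (1 + eta) * WS s.
    by move=> s; rewrite addr_ge0// mulr_ge0// exprn_ge0// ltW.
  apply: le_trans (subS _ h) _; rewrite big_split /= sumr_const card_ord -[_ *+ S]mulr_natl lerD2l.
  by rewrite -mulr_sumr ler_wpM2l//; exact: tube_visits.
rewrite -NmE -GE.
have muV : ((m + 2 * rt) / tau + 2) * tau = m + 2 * rt + 2 * tau by rewrite mulrDl divfK// gt_eqF.
have [V VE] : exists V : R, V = (m + 2 * rt) / tau + 2 by eexists.
have V0 : 0 <= V by rewrite VE addr_ge0// divr_ge0 ?(ltW tau0)// addr_ge0// mulr_ge0// /rt addr_ge0.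
rewrite -VE in muV nbB XB.
rewrite -muV.
have F1 : r * al * (Nm * aeps * (L1 - 4 * rowsum) - 2 * D * Nm - 2 * K1 - nb * K4) <=
    S%:R * tau * (r ^+ 2 * G) + (1 + eta) * (V * tau * ET).
  have ral : 0 <= r * al by rewrite mulr_ge0// ltW.
  apply: (@le_trans _ _ (r * al * X)); first by rewrite ler_wpM2l.
  have -> : r * al * X = r * al / tau * X * tau by field; rewrite gt_eqF.
  apply: (@le_trans _ _ ((S%:R * (r ^+ 2 * G) + (1 + eta) * (V * ET)) * tau)); first by rewrite ler_pM2r.
  by rewrite le_eqVlt; apply/orP; left; apply/eqP; ring.
have F2 : S%:R * tau * (r ^+ 2 * G) <= (L1 + c1) * (r ^+ 2 * G).
  rewrite ler_wpM2r ?mulr_ge0 ?exprn_ge0 ?(ltW rp)//; apply: (le_trans SL2); rewrite c1E.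
  have -> : L1 + (rowsum + rho A + D + m + 3 * mu A + tau) = L1 + m + 3 * mu A + D + tau + (rowsum + rho A) by ring.
  by rewrite lerDl addr_ge0.
have F3 : r * al * (nb * K4) <= r * al * (Kn * K4) + eta * (V * tau * ET).
  have ralK : 0 <= r * (al * K4) by rewrite !mulr_ge0// ltW.
  have h1 : r * (al * K4) * nb <= r * (al * K4) * (Kn + V * ET / th) by rewrite ler_wpM2l.
  have h2 : r * (al * K4) <= eta * th * tau by apply: le_trans r2P; rewrite ler_wpM2r// mulr_ge0// ltW.
  have h3 : r * (al * K4) * (V * ET / th) <= eta * th * tau * (V * ET / th).
    by rewrite ler_wpM2r// divr_ge0 ?mulr_ge0// ltW.
  have h4 : eta * th * tau * (V * ET / th) = eta * (V * tau * ET) by field; rewrite gt_eqF.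
  have -> : r * al * (nb * K4) = r * (al * K4) * nb by ring.
  have -> : r * al * (Kn * K4) = r * (al * K4) * Kn by ring.
  by apply: le_trans h1 _; rewrite mulrDr lerD2l -h4.
have F4 : 0 <= (al * (2 * D * Nm + 2 * K1 + Kn * K4)) * r ^+ 2 * G.
  by rewrite !mulr_ge0 ?exprn_ge0 ?(ltW rp) ?(ltW al0) ?addr_ge0 ?mulr_ge0.
have F5 : 0 <= r * c1 by rewrite mulr_ge0// ltW.
have -> : (1 + 2 * eta) * (V * tau) * ET = (1 + 2 * eta) * (V * tau * ET) by ring.
move: F1 F2 F3 F4 F5; move: (S%:R * tau * (r ^+ 2 * G)) (V * tau * ET) => z w F1 F2 F3 F4 F5.
by lra.
Qed.

End Tube.

(** * Packing of disjoint tubes *)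

Section Packing.
Context {R : realType} {n : nat}.
Local Notation d := n.+2.
Local Notation N := (2 ^ n.+2)%N.
Variables (A : 'M[R]_d) (Z : 'M[R]_(d, N)) (sg : 'I_N -> 'cV[int]_d).
Variables (j0 : 'I_N) (ji : 'I_d -> 'I_N) (al : R) (b : 'I_N -> 'I_N -> R).
Variables (om Q T : 'M[R]_(d, N) -> R).
Variables (B : R) (Zf : nat -> 'cV[int]_d) (typ : nat -> 'I_N * 'I_N) (fwd act : nat -> bool)
    (tau : R) (dl : nat -> 'cV[R]_d) (D : R).
Hypothesis unitA : A \in unitmx.
Hypothesis labels : corner_labels A Z sg.
Hypothesis sg0 : sg j0 = 0.
Hypothesis sgi : forall i, sg (ji i) = basis i.
Hypothesis rc : reduced_cell A Z j0 ji al b om Q T.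
Hypothesis zz : zigzag A sg b B Zf typ fwd act tau dl D.
Hypothesis B0 : 0 < B.
Implicit Types (Y : 'cV[int]_d -> 'cV[R]_d) (k g q ell : 'cV[int]_d) (I : set 'cV[int]_d).

Local Notation omY := (cell_om sg om).
Definition rowsums (i : 'I_d) : R := \sum_j `|A i j|.

Lemma rowsums_le_mu i : rowsums i <= mu A.
Proof.
apply: (@le_trans _ _ (\sum_(j < d) `|A|)); first by apply: ler_sum => j _; exact: mx_entry_le.
by rewrite sumr_const card_ord /mu mulr_natl.
Qed.

Lemma half_bound i : `|(A *m const_mx 2^-1 : 'cV[R]_d) i 0| <= 2^-1 * rowsums i.
Proof.
rewrite mxE (le_trans (ler_norm_sum _ _ _))// mulr_sumr; apply: ler_sum => j _.
by rewrite mxE normrM mulrC ler_pM// ger0_norm.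
Qed.

Lemma round_exists (P : 'cV[R]_d) : exists p : 'cV[int]_d, `|A *m emb p - P| <= mu A.
Proof.
exists (\col_j Num.floor ((invmx A *m P) j 0)).
rewrite -[X in _ - X](mulKVmx unitA) -mulmxBr (le_trans (mx_norm_mul _ _))//.
rewrite -[leRHS]mulr1 ler_wpM2l// mx_norm_le// => i j; rewrite !mxE (ord1 j).
have := @floor_itv R ((invmx A *m P) i 0); rewrite mxE; move: (\sum_j0 _) => x.
by rewrite rmorphD /= => /andP[h1 h2]; rewrite ler_norml; apply/andP; split; lra.
Qed.

Definition interior (L : 'I_d -> R) (x : 'cV[R]_d) : Prop :=
  forall j, 2^-1 * rowsums j < x j 0 < L j - 2^-1 * rowsums j.

(** All that the lower bound retains of the boundary condition; both alternatives imply it. The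
    length is reduced by the two layers, of width 2 [rowsum A] each in lattice units. *)
Definition stretched Y (L : 'I_d -> R) (aeps : R) : Prop := forall q1 q2,
  (forall j, 0 < (A *m emb q1 : 'cV[R]_d) j 0 < L j) -> (forall j, 0 < (A *m emb q2 : 'cV[R]_d) j 0 < L j) ->
  (A *m emb q1 : 'cV[R]_d) ord0 0 <= 2 * rowsum A -> L ord0 - 2 * rowsum A <= (A *m emb q2 : 'cV[R]_d) ord0 0 ->
  (A *m emb q2 : 'cV[R]_d) ord0 0 - (A *m emb q1 : 'cV[R]_d) ord0 0 + aeps * (L ord0 - 4 * rowsum A)
    <= Y q2 ord0 0 - Y q1 ord0 0.

Definition spacing (m : R) : R := m + 2 * rt A D + 4 * mu A + 2.

(* The tubes lie over disjoint lateral boxes of side [spacing m]. *)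
Lemma tube_packing (m : R) I (L : 'I_d -> R) (E : R) Y : 1 <= m -> finite_set I -> 0 <= E ->
  (forall j, 2 * spacing m <= L j) ->
  (forall p, (forall j, j != ord0 -> rt A D + mu A + 1 <= (A *m emb p : 'cV[R]_d) j 0 /\
       (A *m emb p : 'cV[R]_d) j 0 + m + rt A D + mu A < L j) ->
     - (m + 3 * mu A) <= (A *m emb p : 'cV[R]_d) ord0 0 <= - m ->
     E <= fsum (tube A D m [set k | I (k + p)]) (omY (fun k => Y (k + p)))) ->
  E * \prod_(j | j != ord0) (L j / spacing m - 2) <= fsum I (omY Y).
Proof.
move=> m1 fI E0 Lm H; set m' := spacing m in Lm *.
have mu0 := mu_ge0 A; have D0 := D_ge0 zz; have rho0 := rho_ge0 A.
have rt0 : 0 <= rt A D by rewrite addr_ge0.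
have m'E : m' = m + 2 * rt A D + 4 * mu A + 2 by [].
have m'0 : 0 < m' by rewrite m'E; lra.
clearbody m'.
(* Index set of the tubes. The first coordinate admits only the integer 0, since one tube spans the
   whole length; in the other directions the index box must fit into the domain. *)
pose Ib (j : 'I_d) : set R := if j == ord0 then [set x | 0 <= x < 1] else [set x | 0 <= x /\ x + 1 <= L j / m'].
pose Bx : set 'cV[int]_d := pts 1%:M (box Ib).
pose tgt (kp : 'cV[int]_d) : 'cV[R]_d := \col_j (if j == ord0 then - m - 2 * mu A else
   rt A D + 2 * mu A + 1 + (kp j 0)%:~R * m').
have [p pP] : exists p : 'cV[int]_d -> 'cV[int]_d, forall kp, `|A *m emb (p kp) - tgt kp| <= mu A.
  by have [p] := choice (fun kp => round_exists (tgt kp)); exists p.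
(* The index of the lateral box that contains a cell; its fibres are disjoint, so no cell is counted
   for two tubes. *)
pose idx k : 'cV[int]_d := \col_j (if j == ord0 then 0 else Num.floor ((A *m emb k : 'cV[R]_d) j 0 / m')).
have om0 k : 0 <= omY Y k by exact: omY_ge0 rc _ _.
have BxP kp : Bx kp -> forall j, Ib j (kp j 0)%:~R.
  by move=> h j; have := h j; rewrite mul1mx embE.
have entry kp j : `|(A *m emb (p kp)) j 0 - tgt kp j 0| <= mu A.
  have := le_trans (mx_entry_le _ j 0) (pP kp); by rewrite mxE [X in _ + X]mxE.
pose M : R := 1 + \sum_j `|L j / m'|.
have M1 : 1 <= M by rewrite lerDl sumr_ge0.
have IbM j x : Ib j x -> `|x| <= M.
  have LM : L j / m' <= M.
    rewrite (le_trans (ler_norm _))// /M (bigD1 j)//= addrCA lerDl addr_ge0// sumr_ge0//.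
  rewrite /Ib; case: ifP => _ /=.
    by move=> /andP[x0 x1]; rewrite ger0_norm// (le_trans (ltW x1)).
  by case=> x0 x1; rewrite ger0_norm//; move: LM x1; lra.
have fB : finite_set Bx.
  apply: (@bounded_points_finite R _ _ M) => kp kB j; apply: IbM; exact: BxP kB j.
have key kp : Bx kp -> E <= fsum (I `&` [set k | idx k = kp]) (omY Y).
  move=> kB; have Hp := H (p kp).
  have lat j : j != ord0 -> rt A D + mu A + 1 + (kp j 0)%:~R * m' <= (A *m emb (p kp) : 'cV[R]_d) j 0
      <= rt A D + 3 * mu A + 1 + (kp j 0)%:~R * m'.
    move=> jn; have := entry kp j; rewrite [X in _ - X]mxE (negbTE jn) ler_norml; move: ((A *m _) j 0) (_ * m') => x y.
    by move=> /andP[h1 h2]; apply/andP; split; lra.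
  have kpj j : j != ord0 -> 0 <= (kp j 0)%:~R * m' /\ (kp j 0)%:~R * m' + m' <= L j.
    move=> jn; have := BxP _ kB j; rewrite /Ib (negbTE jn) /= => -[h1 h2].
    split; first by rewrite mulr_ge0// ltW.
    by move: h2; rewrite ler_pdivlMr// mulrDl mul1r.
  have {}Hp : E <= fsum (tube A D m [set k | I (k + p kp)]) (omY (fun k => Y (k + p kp))).
    apply: Hp.
      move=> j jn; have /andP[h1 h2] := lat j jn; have [h3 h4] := kpj j jn; split.
        by apply: le_trans h1; rewrite lerDl.
      move: h2 h3 h4 m'E; move: ((A *m _) j 0) (_ * m') => x y; lra.
    have := entry kp ord0; rewrite [X in _ - X]mxE eqxx ler_norml; move: ((A *m _) ord0 0) m1 mu0 => x.
    by move=> m1 mu0 /andP[h1 h2]; apply/andP; split; lra.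
  apply: le_trans Hp _.
  have fT : finite_set (tube A D m [set k | I (k + p kp)]).
    apply: finite_setIl; have -> : [set k | I (k + p kp)] = [set k | I (k - (- p kp))].
      by apply/seteqP; split=> k /=; rewrite opprK.
    exact: shift_finite.
  have -> : fsum (tube A D m [set k | I (k + p kp)]) (omY (fun k => Y (k + p kp))) =
     fsum (tube A D m [set k | I (k + p kp)]) (fun k => omY Y (k + p kp)).
    by apply: fsum_eq => // k _; exact: omY_shift.
  apply: fsum_shift_le => //; first exact: finite_setIl.
  move=> k [Ik latk]; split=> //=.
  apply/matrixP => j i; rewrite (ord1 i) mxE; case: eqP => [->|/eqP jn].
    have := BxP _ kB ord0; rewrite /Ib eqxx /= => /andP[g1 g2].
    move: g1 g2; rewrite ler0z -[1]/(1%:~R) ltr_int => g1 g2.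
    by apply/eqP; rewrite eq_le g1 /= -ltzD1 add0r.
  rewrite embD mulmxDr mxE; apply: floor_def.
  have /andP[h1 h2] := lat j jn; have /andP[h3 h4] := latk j jn.
  rewrite ler_pdivlMr// ltr_pdivrMr// rmorphD /= mulrDl mul1r; move: h1 h2 h3 h4.
  move: ((A *m emb k) j 0) ((A *m emb (p kp)) j 0) (_ * m') => x y z.
  by rewrite m'E; move: m1 mu0 rt0; move=> *; apply/andP; split; lra.
have cntB : \prod_(j | j != ord0) (L j / m' - 2) <= cnt Bx :> R.
  rewrite /Bx (cnt_box M1 IbM) [leRHS](bigD1 ord0)//=.
  have fIb j : finite_set [set t : int | Ib j t%:~R].
    by apply: (@int_bounded_finite R _ M) => t; exact: IbM.
  have c0 : 1 <= cnt [set t : int | Ib ord0 t%:~R] :> R.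
    have e : cnt [set (0 : int)] = 1 :> R by rewrite /cnt fsum1.
    by rewrite -[leLHS]e; apply: cnt_le => // _ ->; rewrite /Ib eqxx /= lexx ltr01.
  have pr0 : 0 <= \prod_(j | j != ord0) cnt [set t : int | Ib j t%:~R] :> R.
    by apply: prodr_ge0 => j _; exact: cnt_ge0.
  apply: (@le_trans _ _ (\prod_(j | j != ord0) cnt [set t : int | Ib j t%:~R])); last by rewrite ler_peMl.
  apply: ler_prod => j jn; apply/andP; split.
    by rewrite subr_ge0 ler_pdivlMr.
  have -> : L j / m' - 2 = (L j / m' - 1) - 0 - 1 by ring.
  apply: int_cnt_ge => // t /andP[t0 t1]; rewrite /= /Ib (negbTE jn); split=> //.
  by rewrite -lerBrDr.
apply: (@le_trans _ _ (E * cnt Bx)); first by rewrite ler_wpM2l.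
rewrite -fsum_const; apply: (@le_trans _ _ (fsum Bx (fun kp => fsum (I `&` [set k | idx k = kp]) (omY Y)))).
  by apply: ler_fsum.
have -> : fsum Bx (fun kp => fsum (I `&` [set k | idx k = kp]) (omY Y)) =
   fsum Bx (fun kp => fsum I (fun k => if `[< idx k = kp >] then omY Y k else 0)).
  by apply: fsum_eq => // kp _; rewrite fsum_cond.
rewrite exchange_fsum2; apply: ler_fsum => // k _.
rewrite -(fsum_cond (fun kp => idx k = kp) (fun=> omY Y k) fB).
apply: (@le_trans _ _ (fsum [set idx k] (fun=> omY Y k))); last by rewrite fsum1.
by apply: fsum_le_set => // kp [_ /= ->].
Qed.

(** For each tube either every line is broken, or some unbroken line exists; E is assumed to lie
    below the energy per tube in both cases, and the tubes are then added up. Different tubes may be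
    in different cases. *)
Theorem packed_lower_bound : exists2 c : R, 0 <= c & forall eta : R, 0 < eta < 1 ->
  exists m0 : R, forall m, 1 <= m -> m0 <= m -> exists r0 K : R, [/\ 0 < r0, 0 <= K &
  forall Y I (L : 'I_d -> R) (aeps r E : R), 0 < r <= r0 -> 0 <= aeps -> finite_set I -> 0 <= E ->
  4 * rowsum A < L ord0 -> (forall j, 2 * spacing m <= L j) ->
  (forall k, interior L (A *m (emb k + const_mx 2^-1)) -> I k) ->
  stretched Y L aeps ->
  E * ((1 + eta) * m) <= (1 - eta) * B * cnt (cwin A m) ->
  E * ((1 + 2 * eta) * (m + 2 * rt A D + 2 * tau)) <=
    r * al * cnt (cwin A m) * aeps * (L ord0 - 4 * rowsum A) - r * K -
    (L ord0 + K) * r ^+ 2 * (2^-1 * al * cnt (cwin A m) + c * m ^+ n.+1 / eta) ->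
  E * \prod_(j | j != ord0) (L j / spacing m - 2) <= fsum I (omY Y)].
Proof.
have tau0 := zz_tau zz; have mu0 := mu_ge0 A; have D0 := D_ge0 zz.
have rt0 : 0 <= rt A D by rewrite addr_ge0// rho_ge0.
have [c c0 elastic] := tube_elastic unitA labels sg0 sgi rc zz.
exists c => // eta eta01; have /andP[eta0 eta1] := eta01.
have [m0 [M [M0 fracture]]] := tube_fracture unitA labels rc zz B0 eta01.
exists m0 => m m1 m0m; have [r0 [K [r00 K0 {}elastic]]] := elastic m eta M m1 eta0 M0.
exists r0, K; split=> // Y I L aeps r E rr aeps0 fI E0 L14 Lm HI HY E1 E2.
apply: tube_packing => // p plat p0; set x0 : R := (A *m emb p) ord0 0 in p0.
set Yp := fun k => Y (k + p); set Ip := [set k | I (k + p)].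
have fIp : finite_set Ip.
  have -> : Ip = [set k | I (k - (- p))] by apply/seteqP; split=> k /=; rewrite /Ip /= opprK.
  exact: shift_finite.
have latin k j : lateral_tube A D m k -> j != ord0 ->
    mu A + 1 <= (A *m emb (k + p) : 'cV[R]_d) j 0 < L j - mu A.
  move=> lk jn; have /andP[h1 h2] := lk j jn; have [h3 h4] := plat j jn; rewrite embD mulmxDr mxE.
  move: ((A *m emb k) j 0) ((A *m emb p) j 0) h1 h2 h3 h4 => x y.
  by move=> *; apply/andP; split; lra.
pose X := L ord0 + m + 3 * mu A + D.
have X0 : 0 <= X / tau.
  have := rowsum_ge0 A; rewrite /X => rs0; rewrite divr_ge0//; last exact: ltW.
  by move: m1 mu0 D0 L14 rs0; lra.
(* Enough steps for every line that starts in the window to reach the far boundary layer. *)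
pose S := (Num.truncn (X / tau)).+1.
have SX : X <= S%:R * tau <= X + tau.
  have /andP[h1 h2] := truncn_itv X0; apply/andP; split.
    by rewrite -ler_pdivrMr//; exact: ltW.
  by rewrite /S -natr1 mulrDl mul1r lerD2r -ler_pdivlMr.
have [unb|brk] := pselect (exists ell, cwin A m ell /\ unbroken sg Zf typ fwd act Yp Ip M S ell).
  have [ell [eC eu]] := unb.
  have den : 0 < (1 + 2 * eta) * (m + 2 * rt A D + 2 * tau).
    by rewrite mulr_gt0//; move: eta0 m1 rt0 tau0; lra.
  rewrite -(ler_pM2r den) [leRHS]mulrC; apply: (le_trans E2).
  apply: (elastic Yp Ip x0 (L ord0) aeps r S ell) => //.
    move=> k lk /andP[k1 k2]; apply: HI => j; rewrite embD -addrA [emb p + _]addrC addrA mulmxDr mxE.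
    have [->|jn] := eqVneq j ord0; first by rewrite k1 k2.
    have := latin k j lk jn; rewrite embD !mulmxDr; have := half_bound j; have := rowsums_le_mu j.
    move: (A *m emb k) (A *m emb p) (A *m const_mx 2^-1) => x y z; rewrite !mxE ler_norml.
    move: (rowsums j) (x j 0) (y j 0) (z j 0) => rj xj yj zj.
    by move=> h1 /andP[h2 h3] /andP[h4 h5]; apply/andP; split; lra.
  move=> q1 q2 lq1 lq2 /andP[a1 a2] /andP[b1 b2].
  have full q : lateral_tube A D m q -> 0 < (A *m emb q : 'cV[R]_d) ord0 0 + x0 < L ord0 ->
      forall j, 0 < (A *m emb (q + p) : 'cV[R]_d) j 0 < L j.
    move=> lq q0 j; have [->|jn] := eqVneq j ord0; first by rewrite embD mulmxDr mxE.
    have /andP[h1 h2] := latin q j lq jn; move: ((A *m _) j 0) h1 h2 mu0 => x.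
    by move=> *; apply/andP; split; lra.
  have rs0 := rowsum_ge0 A.
  have v q : (A *m emb (q + p) : 'cV[R]_d) ord0 0 = (A *m emb q : 'cV[R]_d) ord0 0 + x0.
    by rewrite embD mulmxDr mxE.
  have := HY (q1 + p) (q2 + p); rewrite !v.
  have -> : (A *m emb q2) ord0 0 + x0 - ((A *m emb q1) ord0 0 + x0) =
    (A *m emb q2 : 'cV[R]_d) ord0 0 - (A *m emb q1 : 'cV[R]_d) ord0 0 by ring.
  apply=> //; apply: full => //.
    rewrite a1; apply: le_lt_trans a2 _; move: L14 rs0; lra.
  rewrite b2 andbT; apply: lt_le_trans b1; move: L14 rs0; lra.
have den : 0 < (1 + eta) * m.
  by rewrite mulr_gt0//; move: eta0 m1; lra.
rewrite -(ler_pM2r den) [leRHS]mulrC; apply: (le_trans E1).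
apply: (fracture m Yp Ip S) => // ell eC eu; apply: brk; by exists ell.
Qed.

End Packing.

Definition lim0 {R : realType} (f : R -> R) (y : R) := f x @[x --> (0 : R)] --> y.

Lemma near0_gt {R : realType} (f : R -> R) (y z : R) : lim0 f y -> z < y ->
  exists2 dl : R, 0 < dl & forall x, 0 < x < dl -> z < f x.
Proof.
move=> fy zy; have /nbhs_ballP[e /= e0 He] : \forall x \near (0 : R), z < f x.
  exact: cvgr_gt fy _ zy.
exists e => // x /andP[x0 xe]; apply: He; rewrite /ball /= sub0r normrN gtr0_norm//.
Qed.

Lemma two_scale_gt {R : realType} (f : R -> R -> R) (g : R -> R) (y z : R) :
  (forall eta, 0 < eta < 1 -> lim0 (f eta) (g eta)) -> lim0 g y -> z < y ->
  exists2 dl : R, 0 < dl & forall eta, 0 < eta < 1 -> eta < dl ->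
    exists2 dl' : R, 0 < dl' & forall t, 0 < t < dl' -> z < f eta t.
Proof.
move=> fg gy zy; have [e e0 He] := near0_gt gy zy.
exists e => // eta eta01 etae; apply: near0_gt (fg eta eta01) _; apply: He.
by have /andP[-> _] := eta01.
Qed.

Section Limits.
Context {R : realType}.
Implicit Types (f g : R -> R) (a b : R).

Lemma lim0_cst a : lim0 (fun=> a) a. Proof. exact: cvg_cst. Qed.
Lemma lim0_id : lim0 (fun x : R => x) 0. Proof. exact: cvg_id. Qed.
Lemma lim0D f g a b : lim0 f a -> lim0 g b -> lim0 (fun x => f x + g x) (a + b).
Proof. exact: cvgD. Qed.
Lemma lim0N f a : lim0 f a -> lim0 (fun x => - f x) (- a).
Proof. exact: cvgN. Qed.
Lemma lim0M f g a b : lim0 f a -> lim0 g b -> lim0 (fun x => f x * g x) (a * b).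
Proof. exact: cvgM. Qed.
Lemma lim0V f a : a != 0 -> lim0 f a -> lim0 (fun x => (f x)^-1) a^-1.
Proof. exact: cvgV. Qed.

Lemma lim0_eq f a b : a = b -> lim0 f a -> lim0 f b. Proof. by move=> ->. Qed.

Lemma lim0X f a m : lim0 f a -> lim0 (fun x => f x ^+ m) (a ^+ m).
Proof.
move=> fa; elim: m => [|m IH]; first by rewrite expr0; exact: lim0_cst.
by rewrite exprS; under eq_fun do rewrite exprS; exact: lim0M.
Qed.

End Limits.

Ltac lim0_rat := lazymatch goal with
  | |- lim0 (fun _ => ?c) _ => exact: lim0_cst
  | |- lim0 (fun x => x) _ => exact: lim0_id
  | |- lim0 (fun x => @GRing.add _ (@?f x) (@?g x)) _ => refine (@lim0D _ f g _ _ _ _); lim0_rat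
  | |- lim0 (fun x => @GRing.mul _ (@?f x) (@?g x)) _ => refine (@lim0M _ f g _ _ _ _); lim0_rat
  | |- lim0 (fun x => @GRing.opp _ (@?f x)) _ => refine (@lim0N _ f _ _); lim0_rat
  | |- lim0 (fun x => @GRing.exp _ (@?f x) ?m) _ => refine (@lim0X _ f _ m _); lim0_rat
  | |- lim0 (fun x => @GRing.inv _ (@?f x)) _ => refine (@lim0V _ f _ _ _); [|lim0_rat]
  | _ => idtac
  end.

Lemma lim0_prod {R : realType} (I : finType) (P : pred I) (f : I -> R -> R) (a : I -> R) :
  (forall i, P i -> lim0 (f i) (a i)) -> lim0 (fun x => \prod_(i | P i) f i x) (\prod_(i | P i) a i).
Proof.
move=> fa; rewrite (_ : (fun x => \prod_(i | P i) f i x) = (\prod_(i | P i) f i)%R); last first.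
  by apply/funext => x; rewrite fct_prodE.
elim/big_ind2: _ => //; first exact: cvg_cst.
by move=> u u' v v' h1 h2; exact: cvgM.
Qed.

(** * The lower bound *)

Section Asymptotics.
Context {R : realType} {n : nat}.
Local Notation d := n.+2.
Local Notation N := (2 ^ n.+2)%N.
Variables (A : 'M[R]_d) (Z : 'M[R]_(d, N)) (sg : 'I_N -> 'cV[int]_d).
Variables (j0 : 'I_N) (ji : 'I_d -> 'I_N) (al : R) (b Lam : 'I_N -> 'I_N -> R).
Variables (om Q T : 'M[R]_(d, N) -> R) (B : R) (l : 'I_d -> R).
Hypothesis unitA : A \in unitmx.
Hypothesis labels : corner_labels A Z sg.
Hypothesis sg0 : sg j0 = 0.
Hypothesis sgi : forall i, sg (ji i) = basis i.
Hypothesis rc : reduced_cell A Z j0 ji al b om Q T.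
Hypothesis B0 : 0 < B.
Hypothesis Lamb : forall s t, `|Lam s t| <= b s t.
Hypothesis LamB : \sum_s \sum_t Lam s t *: (col s Z - col t Z) = B *: e1.
Hypothesis l0 : forall j, 0 < l j.
Implicit Types (Y : 'cV[int]_d -> 'cV[R]_d) (k g q ell : 'cV[int]_d) (I : set 'cV[int]_d).

Local Notation omY := (cell_om sg om).
Local Notation P := (\prod_(j | j != ord0) l j).
Local Notation dt := `|\det A|.

Lemma P_gt0 : 0 < P. Proof. exact: prodr_gt0. Qed.

Lemma dt_gt0 : 0 < dt. Proof. by rewrite normr_gt0 -unitfE -unitmxE. Qed.

Lemma card_lateral : #|[pred j : 'I_d | j != ord0]| = n.+1.
Proof. by rewrite cardC1 card_ord. Qed.

Lemma cwin_count : exists2 c : R, 0 <= c & forall m : R, 1 <= m ->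
  (m ^+ d - c * m ^+ n.+1) / dt <= cnt (cwin A m).
Proof.
have [c c0 H] := lattice_count unitA; exists c => // m m1.
have m0 : 0 <= m := le_trans ler01 m1.
rewrite ler_pdivrMr ?dt_gt0// mulrC.
have := H m (fun=> 0) (fun=> m) (fun=> [set x : R | 0 <= x < m]) m1.
rewrite -/(cwin A m) (eq_bigr (fun=> m)); last by move=> i _; rewrite subr0.
rewrite prodr_const card_ord => h.
have : `|dt * cnt (cwin A m) - m ^+ d| <= c * m ^+ n.+1.
  apply: h.
  - by move=> j; rewrite normr0 ger0_norm.
  - by move=> j x y z /= /andP[x0 xm] /andP[y0 ym] /andP[xz zy]; rewrite (le_trans x0 xz) (le_lt_trans zy ym).
  - by move=> j x /andP[x0 xm]; rewrite /= ltW.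
  - by move=> j x /= /andP[x0 xm]; rewrite x0 ltW.
by rewrite ler_norml => /andP[h1 _]; move: h1; lra.
Qed.

(* Here [t] stands for the inverse width [1 / m] of a tube; first [t -> 0], then [eta -> 0]. *)
Lemma tube_scales (a0 theta c c1 K0 K2 : R) : 0 <= c -> 0 <= c1 -> 0 <= K0 -> 0 <= K2 ->
  theta < P * (B / dt) -> theta < P * (a0 ^+ 2 * l ord0 * (2^-1 * al / dt)) ->
  exists2 eta : R, 0 < eta < 1 & exists2 dl : R, 0 < dl & forall t, 0 < t < dl ->
   theta < P * ((1 - eta) * B * ((1 - c1 * t) / dt) / (1 + eta) / (1 + K0 * t) ^+ n.+1) /\
   theta < P * (a0 ^+ 2 * l ord0 * (2^-1 * al * ((1 - c1 * t) / dt) - c * t / eta) /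
       ((1 + 2 * eta) * (1 + K2 * t)) / (1 + K0 * t) ^+ n.+1).
Proof.
move=> c0 c10 K00 K20 th1 th2.
pose f1 (eta t : R) := P * ((1 - eta) * B * ((1 - c1 * t) / dt) / (1 + eta) / (1 + K0 * t) ^+ n.+1).
pose f2 (eta t : R) := P * (a0 ^+ 2 * l ord0 * (2^-1 * al * ((1 - c1 * t) / dt) - c * t / eta) /
       ((1 + 2 * eta) * (1 + K2 * t)) / (1 + K0 * t) ^+ n.+1).
have g1 eta : 0 < eta < 1 -> lim0 (f1 eta) (P * ((1 - eta) * B * (1 / dt) / (1 + eta))).
  move=> /andP[h0 h1]; rewrite /f1; eapply lim0_eq; last lim0_rat.
  - by rewrite !mulr0 subr0 addr0 expr1n divr1.
  - by rewrite mulr0 addr0 expr1n oner_neq0.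
have g1l : lim0 (fun eta => P * ((1 - eta) * B * (1 / dt) / (1 + eta))) (P * (B / dt)).
  eapply lim0_eq; last lim0_rat; last by rewrite addr0 oner_neq0.
  by rewrite subr0 addr0 !mul1r divr1.
have g2 eta : 0 < eta < 1 -> lim0 (f2 eta) (P * (a0 ^+ 2 * l ord0 * (2^-1 * al * (1 / dt)) / (1 + 2 * eta))).
  move=> /andP[h0 h1]; rewrite /f2; eapply lim0_eq; last lim0_rat.
  - by rewrite !mulr0 mul0r !subr0 addr0 expr1n mulr1 divr1.
  - by rewrite mulr0 addr0 mulr1 gt_eqF//; lra.
  - by rewrite mulr0 addr0 expr1n oner_neq0.
have g2l : lim0 (fun eta => P * (a0 ^+ 2 * l ord0 * (2^-1 * al * (1 / dt)) / (1 + 2 * eta)))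
    (P * (a0 ^+ 2 * l ord0 * (2^-1 * al / dt))).
  eapply lim0_eq; last lim0_rat; last by rewrite mulr0 addr0 oner_neq0.
  by rewrite mulr0 addr0 mul1r divr1.
have [e1 e10 H1] := two_scale_gt g1 g1l th1.
have [e2 e20 H2] := two_scale_gt g2 g2l th2.
pose eta := Num.min (2^-1) (Num.min (e1 / 2) (e2 / 2)).
have eta0 : 0 < eta by rewrite !lt_min !divr_gt0// invr_gt0 ltr0n.
have eta_e1 : eta < e1 by rewrite !gt_min; apply/orP; right; apply/orP; left; lra.
have eta_e2 : eta < e2 by rewrite !gt_min; apply/orP; right; apply/orP; right; lra.
have eta1 : 0 < eta < 1 by rewrite eta0 gt_min; apply/orP; left; lra.
have [d1 d10 {}H1] := H1 eta eta1 eta_e1; have [d2 d20 {}H2] := H2 eta eta1 eta_e2.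
exists eta => //; exists (Num.min d1 d2); first by rewrite lt_min d10.
by move=> t; rewrite lt_min => /and3P[t0 t1 t2]; split; [apply: H1|apply: H2]; rewrite t0.
Qed.

(** Lattice units with s^2 = eps: the tubes have length l / s^2. With r = a0 s, both r [aeps] and
    r^2 are at least or equal to a multiple of s^2, and multiplying by the length gives a finite
    elastic energy per tube. *)
Theorem discrete_lower_bound (a0 theta : R) : 0 < a0 -> 0 <= theta ->
  theta < P * (B / dt) -> theta < P * (a0 ^+ 2 * l ord0 * (2^-1 * al / dt)) ->
  exists2 e0 : R, 0 < e0 & forall (s aeps : R) Y I, 0 < s < e0 -> a0 * s <= aeps -> finite_set I ->
  (forall k, interior A (fun j => l j / s ^+ 2) (A *m (emb k + const_mx 2^-1)) -> I k) ->
  stretched A Y (fun j => l j / s ^+ 2) aeps ->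
  theta <= (s ^+ 2) ^+ n.+1 * fsum I (omY Y).
Proof.
move=> a00 th0 th1 th2.
have [Zf [typ [fwd [act [tau [dl [D zz]]]]]]] := zigzag_exists labels B0 Lamb LamB.
have tau0 := zz_tau zz; have mu0 := mu_ge0 A; have D0 := D_ge0 zz; have al0 := rc_al rc.
have rt0 : 0 <= rt A D by rewrite addr_ge0// rho_ge0.
have [c c0 packed] := packed_lower_bound unitA labels sg0 sgi rc zz B0.
have [c1 c10 count] := cwin_count.
have [K0 K0E] : exists K0 : R, K0 = 2 * rt A D + 4 * mu A + 2 by eexists.
have K00 : 0 <= K0 by rewrite K0E !addr_ge0// mulr_ge0.
have [K2 K2E] : exists K2 : R, K2 = 2 * rt A D + 2 * tau by eexists.
have K20 : 0 <= K2 by rewrite K2E addr_ge0// mulr_ge0// ltW.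
have [eta eta01 [d1 d10 scales]] := tube_scales c0 c10 K00 K20 th1 th2.
have /andP[eta0 eta1] := eta01.
have [m0 {}packed] := packed eta eta01.
have [m [m1 m0m dm]] : exists m, [/\ 1 <= m, m0 <= m & m^-1 < d1].
  exists (1 + `|m0| + d1^-1).
  have g0 : 0 < d1^-1 by rewrite invr_gt0.
  split; first by rewrite -addrA lerDl addr_ge0// ltW.
    by rewrite (le_trans (ler_norm _))// addrAC lerDr addr_ge0// ltW.
  have h : d1^-1 < 1 + `|m0| + d1^-1 by rewrite ltrDr ltr_wpDr.
  by rewrite -[ltRHS]invrK ltf_pV2 ?posrE ?invr_gt0// (lt_trans g0).
have m_gt0 : 0 < m := lt_le_trans ltr01 m1.
have [r0 [K [r00 Kge0 {}packed]]] := packed m m1 m0m.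
have [|sc1 sc2] := scales m^-1; first by rewrite invr_gt0 m_gt0.
have {}count := count m m1.
have [C CE] : exists C : R, C = cnt (cwin A m) by eexists.
rewrite -CE in count packed.
have [m' m'E] : exists m' : R, m' = spacing A D m by eexists.
have m'K : m' = m * (1 + K0 / m) by rewrite m'E /spacing K0E; field; rewrite gt_eqF.
have m'0 : 0 < m' by rewrite m'K mulr_gt0// ltr_wpDr// divr_ge0// ltW.
have Cm : m ^+ n.+2 * ((1 - c1 / m) / dt) <= C.
  apply: le_trans count; rewrite mulrA ler_pM2r ?invr_gt0 ?dt_gt0//.
  rewrite exprS; move: (m ^+ n.+1) => X; rewrite le_eqVlt; apply/orP; left; apply/eqP.
  by field; rewrite gt_eqF.
(* [F] and [El s] are the lower bounds for the energy of one tube in the broken and in the unbroken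
   case. The number of tubes is [Pr s] divided by (s^2)^(d-1), and this power is the scaling of the
   energy. *)
pose F := (1 - eta) * B * C / ((1 + eta) * m).
pose G := 2^-1 * al * C + c * m ^+ n.+1 / eta.
pose den := (1 + 2 * eta) * (m + 2 * rt A D + 2 * tau).
have den0 : 0 < den by rewrite mulr_gt0// addr_gt0 ?mulr_gt0// ltr_wpDr// mulr_ge0.
pose El (s : R) := (al * C * a0 ^+ 2 * (l ord0 - 4 * rowsum A * (s * s)) - a0 * K * s -
    (l ord0 + K * (s * s)) * a0 ^+ 2 * G) / den.
pose Pr (s : R) := \prod_(j | j != ord0) (l j / m' - 2 * (s * s)).
have PrE : \prod_(j | j != ord0) (l j / m') = P / m' ^+ n.+1.
  by rewrite big_split /= prodr_const card_lateral exprVn.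
have Prc : lim0 Pr (P / m' ^+ n.+1).
  rewrite -PrE; apply: lim0_prod => j _; eapply lim0_eq; last lim0_rat.
  by rewrite !mulr0 subr0.
have Elc : lim0 El ((al * C * a0 ^+ 2 * l ord0 - l ord0 * a0 ^+ 2 * G) / den).
  rewrite /El; eapply lim0_eq; last lim0_rat.
  by rewrite !mulr0 !subr0 addr0.
have mm' : P / m' ^+ n.+1 = P * (m^-1 ^+ n.+1 / (1 + K0 / m) ^+ n.+1).
  by rewrite m'K exprMn invfM exprVn.
have PM0 : 0 < P / m' ^+ n.+1 by rewrite divr_gt0 ?P_gt0// exprn_gt0.
have [X XE] : exists X : R, X = m ^+ n.+1 by eexists.
have X0 : 0 < X by rewrite XE exprn_gt0.
have Cm' : (1 - c1 / m) / dt <= C / (m * X).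
  by rewrite ler_pdivlMr ?mulr_gt0// mulrC XE -exprS.
have k2 : 0 < 1 + K2 / m by rewrite ltr_wpDr// divr_ge0// ltW.
have k0 : 0 < (1 + K0 / m) ^+ n.+1 by rewrite exprn_gt0// ltr_wpDr// divr_ge0// ltW.
have eta2 : 0 < 1 + 2 * eta by rewrite addr_gt0// mulr_gt0.
have eta3 : 0 < 1 + eta by rewrite addr_gt0.
have eta4 : 0 < 1 - eta by rewrite subr_gt0.
have denE : den = (1 + 2 * eta) * (m * (1 + K2 / m)).
  by rewrite /den K2E; field; rewrite gt_eqF.
move: ((1 + K0 / m) ^+ n.+1) k0 mm' sc1 sc2 => Y0 k0 mm' sc1 sc2.
rewrite exprVn -XE in mm'.
have F_lim : theta < F * (P / m' ^+ n.+1).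
  apply: lt_le_trans sc1 _; rewrite mm'.
  have -> : F * (P * (X^-1 / Y0)) = P * ((1 - eta) * B * (C / (m * X)) / (1 + eta) / Y0).
    by rewrite /F; field; rewrite !gt_eqF.
  rewrite ler_pM2l ?P_gt0// !ler_pM2r ?invr_gt0//.
  by rewrite ler_pM2l ?mulr_gt0.
have E_lim : theta < ((al * C * a0 ^+ 2 * l ord0 - l ord0 * a0 ^+ 2 * G) / den) * (P / m' ^+ n.+1).
  apply: lt_le_trans sc2 _; rewrite mm' denE /G -XE.
  move: (1 + K2 / m) k2 => z k2.
  have -> : (al * C * a0 ^+ 2 * l ord0 - l ord0 * a0 ^+ 2 * (2^-1 * al * C + c * X / eta)) / ((1 + 2 * eta) * (m * z)) *
      (P * (X^-1 / Y0)) = P * (a0 ^+ 2 * l ord0 * (2^-1 * al * (C / (m * X)) - c / m / eta) / ((1 + 2 * eta) * z) / Y0).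
    by field; rewrite !gt_eqF.
  rewrite ler_pM2l ?P_gt0// !ler_pM2r ?invr_gt0 ?mulr_gt0//.
  by rewrite ler_pM2l ?mulr_gt0 ?exprn_gt0// lerD2r ler_pM2l ?mulr_gt0 ?invr_gt0.
have [e1 e10 H1] := near0_gt (lim0M (@lim0_cst R F) Prc) F_lim.
have [e2 e20 H2] := near0_gt (lim0M Elc Prc) E_lim.
have [e3 e30 H3] : exists2 e3 : R, 0 < e3 & forall s, 0 < s < e3 -> 4 * rowsum A < l ord0 / s ^+ 2 /\
    forall j, 2 * m' < l j / s ^+ 2.
  have [lm [lm0 lmP]] : exists lm : R, 0 < lm /\ forall j, lm <= l j.
    exists (\big[Num.min/1]_j l j); split; last by move=> j; exact: bigmin_le.
    by rewrite lt_bigmin//.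
  pose q := 4 * rowsum A + 2 * m' + 1.
  have q1 : 1 <= q by rewrite /q lerDr addr_ge0// mulr_ge0// ?rowsum_ge0// ltW.
  have q0 : 0 < q := lt_le_trans ltr01 q1.
  exists (Num.min 1 (lm / q)); first by rewrite lt_min ltr01 divr_gt0.
  move=> s; rewrite lt_min => /and3P[s0 s1 s2].
  have h j : q <= l j / s ^+ 2.
    rewrite ler_pdivlMr ?exprn_gt0// (le_trans _ (lmP j))//.
    apply: (@le_trans _ _ (q * s)); first by rewrite ler_pM2l// expr2 ger_pMl// ltW.
    by rewrite mulrC -ler_pdivlMr// ltW.
  have r0' := rowsum_ge0 A.
  split=> [|j]; [apply: lt_le_trans (h ord0)|apply: lt_le_trans (h j)].
    by rewrite /q -addrA ltrDl addr_gt0// mulr_gt0.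
  by rewrite /q addrAC ltrDr ltr_wpDl// mulr_ge0.
exists (Num.min (Num.min e1 e2) (Num.min e3 (r0 / a0))).
  by rewrite !lt_min e10 e20 e30 divr_gt0.
move=> s aeps Y I /andP[s0]; rewrite !lt_min => /andP[/andP[s1 s2] /andP[s3 s4]] ae fI HI HY.
have [L4 Lm] := H3 s (introT andP (conj s0 s3)).
have {}H1 := H1 s (introT andP (conj s0 s1)); have {}H2 := H2 s (introT andP (conj s0 s2)).
have ss0 : 0 < s * s by rewrite mulr_gt0.
have Pr0 : 0 < Pr s.
  apply: prodr_gt0 => j _; have := Lm j; rewrite expr2 ltr_pdivlMr// => h.
  by rewrite subr_gt0 ltr_pdivlMr// mulrAC.
have F0 : 0 <= F by rewrite -(pmulr_lge0 _ Pr0) ltW// (le_lt_trans th0).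
have El0 : 0 <= El s by rewrite -(pmulr_lge0 _ Pr0) ltW// (le_lt_trans th0).
have prE : (s ^+ 2) ^+ n.+1 * \prod_(j | j != ord0) (l j / s ^+ 2 / m' - 2) = Pr s.
  have -> : (s ^+ 2) ^+ n.+1 = \prod_(j < d | j != ord0) s ^+ 2 by rewrite prodr_const card_lateral.
  rewrite -big_split; apply: eq_bigr => j _ /=.
  by field; rewrite !gt_eqF.
have concl E : 0 <= E -> E <= F -> E <= El s -> theta <= E * Pr s -> theta <= (s ^+ 2) ^+ n.+1 * fsum I (omY Y).
  move=> E0 EF EE tE; apply: (le_trans tE); rewrite -prE mulrCA ler_pM2l ?exprn_gt0//.
  rewrite m'E; apply: (packed Y I (fun j => l j / s ^+ 2) aeps (a0 * s) E) => //.
  - by rewrite mulr_gt0//= mulrC -ler_pdivlMr// ltW.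
  - by apply: le_trans ae; rewrite mulr_ge0// ltW.
  - by move=> j; rewrite -m'E ltW.
  - by rewrite -ler_pdivlMr// mulr_gt0//; move: eta0; lra.
  rewrite -/den -ler_pdivlMr//; apply: (le_trans EE).
  rewrite ler_pM2r ?invr_gt0// -/G.
  have ca : 0 <= a0 * s * al * C by rewrite CE !mulr_ge0// ?cnt_ge0// ltW.
  have h : al * C * a0 ^+ 2 * (l ord0 - 4 * rowsum A * (s * s)) <=
      a0 * s * al * C * aeps * (l ord0 / s ^+ 2 - 4 * rowsum A).
    have -> : al * C * a0 ^+ 2 * (l ord0 - 4 * rowsum A * (s * s)) =
      a0 * s * al * C * (a0 * s) * (l ord0 / s ^+ 2 - 4 * rowsum A) by field; rewrite gt_eqF.
    by rewrite ler_wpM2r ?subr_ge0 ?(ltW L4)// ler_wpM2l.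
  have h2 : (l ord0 / s ^+ 2 + K) * (a0 * s) ^+ 2 * G = (l ord0 + K * (s * s)) * a0 ^+ 2 * G.
    by field; rewrite gt_eqF.
  by rewrite h2 (_ : a0 * s * K = a0 * K * s) ?lerD2r//; ring.
have [FE|EF] := leP F (El s).
  by apply: (concl F) => //; exact: ltW H1.
by apply: (concl (El s)) => //; [exact: ltW|exact: ltW H2].
Qed.

End Asymptotics.

(** * From the energy to sums over lattice cells *)

Section CellSums.
Context {R : realType} {n : nat}.
Local Notation d := n.+2.
Local Notation N := (2 ^ n.+2)%N.
Variables (A : 'M[R]_d) (Z : 'M[R]_(d, N)) (sg : 'I_N -> 'cV[int]_d) (l : 'I_d -> R).
Hypothesis unitA : A \in unitmx.
Hypothesis labels : corner_labels A Z sg.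
Hypothesis l0 : forall j, 0 < l j.
Implicit Types (eps : R) (k : 'cV[int]_d) (y : 'cV[R]_d -> 'cV[R]_d).

Definition midpoint eps k : 'cV[R]_d := eps *: (A *m (const_mx 2^-1 + emb k)).
Definition cell_index eps : set 'cV[int]_d := [set k | inner_midpoints A l eps (midpoint eps k)].
Definition lattice_units eps y k : 'cV[R]_d := eps^-1 *: y (eps *: (A *m emb k)).

Lemma midpoint_inj eps : 0 < eps -> injective (midpoint eps).
Proof.
move=> e0 k k' /(scalerI (lt0r_neq0 e0)) /(congr1 (mulmx (invmx A))).
by rewrite !mulKmx// => /addrI /emb_inj.
Qed.

Lemma cell_center eps x : cell A eps x x.
Proof.
exists 0; last by rewrite mulmx0 scaler0 addr0.
by move=> i; rewrite mxE; apply/andP; split; lra.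
Qed.

Lemma cell_index_Omega eps k : cell_index eps k -> Omega l (midpoint eps k).
Proof. by case=> _; apply; apply: subset_closure; exact: cell_center. Qed.

Lemma cell_index_finite eps : 0 < eps -> finite_set (cell_index eps).
Proof.
move=> e0; pose M := \sum_j l j.
have M0 : 0 <= M by apply: sumr_ge0 => j _; exact: ltW.
have bd k : cell_index eps k -> `|A *m (const_mx 2^-1 + emb k)| <= eps^-1 * M.
  move=> /cell_index_Omega H; rewrite -[X in `|X|](scalerK (lt0r_neq0 e0)) mx_normZ//.
  rewrite gtr0_norm ?invr_gt0// ler_pM2l ?invr_gt0//; apply: mx_norm_le => // i j.
  have := H i; rewrite (ord1 j) -/(midpoint eps k) => /andP[h1 h2]; rewrite gtr0_norm//.
  by rewrite (le_trans (ltW h2))// /M (bigD1 i)//= lerDl sumr_ge0// => i' _; exact: ltW.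
have e1 : 0 <= eps^-1 * M by rewrite mulr_ge0// invr_ge0 ltW.
apply: (@bounded_points_finite R _ _ (d%:R * `|invmx A| * (eps^-1 * M) + 1)) => k /bd h j.
apply: emb_bound; rewrite -[emb k](addKr (const_mx 2^-1)) addrC (le_trans (ler_normB _ _))// lerD//.
  rewrite -[X in `|X|](mulKmx unitA) (le_trans (mx_norm_mul _ _))//.
  by rewrite ler_wpM2l// mulr_ge0.
by apply: mx_norm_le => // i i'; rewrite mxE ger0_norm//; lra.
Qed.

Lemma interior_cell_index eps k : 0 < eps ->
  interior A (fun j => l j / eps) (A *m (emb k + const_mx 2^-1)) -> cell_index eps k.
Proof.
move=> e0 H; split; first by exists k.
move=> y cy j; rewrite addrC in H.
have near_cell (e : R) : 0 < e -> exists2 v : R, `|v| <= 2^-1 * rowsums A j &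
    `|y j 0 - (eps * ((A *m (const_mx 2^-1 + emb k) : 'cV[R]_d) j 0) + eps * v)| < e.
  move=> ep; have [z [[u uP <-] /= hz]] := cy _ (nbhsx_ballx y e ep).
  exists ((A *m u) j 0).
    rewrite mxE (le_trans (ler_norm_sum _ _ _))// mulr_sumr; apply: ler_sum => i _.
    rewrite normrM mulrC ler_wpM2r// ler_norml.
    by have /andP[h1 h2] := uP i; apply/andP; split; [|exact: ltW].
  move: hz; rewrite -ball_normE /= => hz; apply: le_lt_trans hz; apply: le_trans (mx_entry_le _ j 0) => /=.
  by rewrite /midpoint; move: (A *m u) (A *m (_ + _)) => a1 a2; rewrite !mxE.
have /andP[h1 h2] := H j; move: h1 h2 near_cell; move: ((A *m _) j 0) => x h1 h2 near_cell.
rewrite ltrBrDr ltr_pdivlMr// mulrDl in h2.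
have h1' : eps * (2^-1 * rowsums A j) < eps * x by rewrite ltr_pM2l.
have vb (v : R) : `|v| <= 2^-1 * rowsums A j -> - (eps * (2^-1 * rowsums A j)) <= eps * v <= eps * (2^-1 * rowsums A j).
  by rewrite ler_norml => /andP[g1 g2]; rewrite -mulrN !ler_pM2l// g1.
apply/andP; split.
- have [|v /vb/andP[v1 v2]] := near_cell (eps * x - eps * (2^-1 * rowsums A j)); first by rewrite subr_gt0.
  by rewrite ltr_norml => /andP[g1 g2]; lra.
- have [|v /vb/andP[v1 v2]] := near_cell (l j - eps * x - eps * (2^-1 * rowsums A j)); first by lra.
  by rewrite ltr_norml => /andP[g1 g2]; lra.
Qed.

Lemma corner_midpoint eps k s : midpoint eps k + eps *: col s Z = eps *: (A *m emb (k + sg s)).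
Proof.
have [-> _ _ _] := labels; rewrite -scalerDr -mulmxDr embD; congr (_ *: (_ *m _)).
by apply/matrixP => i j; rewrite !mxE; ring.
Qed.

Lemma dgrad_cell eps y k : exists c, dgrad Z eps y (midpoint eps k) =
  cellmx sg (lattice_units eps y) k + translation c.
Proof.
exists (- (eps^-1 *: ((2 ^+ d)^-1 *: \sum_j y (midpoint eps k + eps *: col j Z)))).
apply/matrixP => i s; rewrite /dgrad mxE corner_midpoint scalerBr [LHS]mxE [RHS]mxE; congr (_ + _).
  by rewrite [RHS]mxE.
by rewrite [RHS]mxE.
Qed.

Lemma energyE W eps y : 0 < eps -> energy A l W Z eps y =
  ((eps ^+ n.+1)%:E * \sum_(k <- fset_set (cell_index eps)) W (dgrad Z eps y (midpoint eps k)))%E.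
Proof.
move=> e0; rewrite /energy; congr (_ * _)%E.
rewrite -fsbig_finite; last exact: cell_index_finite.
have -> : inner_midpoints A l eps = [set midpoint eps k | k in cell_index eps].
  apply/seteqP; split=> [x [[k _ <-] h]|_ [k kI <-] //]; exists k => //.
  by split=> //; exists k.
by rewrite fsbig_image// => k k' _ _; exact: midpoint_inj.
Qed.

Lemma lA_rowsum : lA A = rowsum A.
Proof. by apply: eq_bigr => j _; rewrite dotC dot_e1 mxE. Qed.

(** With homogeneous stretching the elongation is a (x_2 - x_1), and the points are at least the
    length minus two layers apart; with rigidly moved ends it is a times the full length, which is
    even larger. *)
Lemma admissible_stretched eps a y : 0 < eps -> 0 <= a -> admissible A l eps a y ->
  4 * rowsum A < l ord0 / eps ->
  stretched A (lattice_units eps y) (fun j => l j / eps) a.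
Proof.
move=> e0 a0 adm L4 q1 q2 i1 i2 b1 b2.
have inO q : (forall j, 0 < (A *m emb q : 'cV[R]_d) j 0 < l j / eps) ->
    Omega l (eps *: (A *m emb q)).
  move=> h j; have /andP[h1 h2] := h j; rewrite mxE mulr_gt0//= mulrC.
  by rewrite -ltr_pdivlMr.
have lat q : lattice A eps (eps *: (A *m emb q)) by exists q.
have B1q : B1 A l eps (eps *: (A *m emb q1)).
  split; first by apply: subset_closure; exact: inO.
  by rewrite mxE lA_rowsum mulrC ler_pM2r.
have B2q : B2 A l eps (eps *: (A *m emb q2)).
  split; first by apply: subset_closure; exact: inO.
  rewrite mxE lA_rowsum; move: b2; rewrite lerBlDr ler_pdivrMr// mulrDl.
  by move: ((A *m _) _ _) => x; lra.
have v q : (eps *: (A *m emb q)) ord0 0 = eps * (A *m emb q) ord0 0 by rewrite mxE.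
have u q : lattice_units eps y q ord0 0 = eps^-1 * y (eps *: (A *m emb q)) ord0 0 by rewrite mxE.
rewrite !u; move: b1 b2; rewrite -mulrBr ler_pdivlMl//.
case: adm => [h|[h1 h2]].
  rewrite h; [|by split=> //; exact: inO|by right].
  rewrite h; [|by split=> //; exact: inO|by left].
  rewrite !v; move: ((A *m _) _ _) ((A *m _) _ _) L4 => x1 x2 L4 b1 b2.
  have -> : (1 + a) * (eps * x2) - (1 + a) * (eps * x1) = eps * (x2 - x1 + a * (x2 - x1)) by ring.
  rewrite ler_pM2l// lerD2l ler_wpM2l//.
  by move: (l ord0 / eps) L4 b2 => z L4 b2; lra.
rewrite h2//; last by split=> //; exact: inO.
rewrite h1//; last by split=> //; exact: inO.
rewrite !v; move: ((A *m _) _ _) ((A *m _) _ _) => x1 x2 b1 b2.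
have -> : eps * (x2 - x1 + a * (l ord0 / eps - 4 * rowsum A)) =
  eps * x2 + a * l ord0 - eps * x1 - a * (4 * rowsum A * eps) by field; rewrite gt_eqF.
by rewrite gerBl !mulr_ge0 ?rowsum_ge0// ltW.
Qed.

End CellSums.

Section EnergyLower.
Context {R : realType} {n : nat}.
Local Notation d := n.+2.
Local Notation N := (2 ^ n.+2)%N.
Variables (A : 'M[R]_d) (Z : 'M[R]_(d, N)) (W : 'M[R]_(d, N) -> \bar R) (beta : 'cV[R]_d -> R).
Variables (sg : 'I_N -> 'cV[int]_d) (l : 'I_d -> R) (B : R) (bp : 'I_N -> 'I_N -> R)
  (WI : forall I : {set 'I_N}, 'M[R]_(d, #|I|) -> R).
Hypothesis unitA : A \in unitmx.
Hypothesis labels : corner_labels A Z sg.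
Hypothesis l0 : forall j, 0 < l j.
Hypothesis assumptions : cell_energy_assumptions A Z W beta.
Hypothesis WI0 : forall I G, 0 <= @WI I G.
Hypothesis bp_sym : forall s t, s != t -> 0 <= bp s t /\ bp s t = bp t s.
Hypothesis Wfr : fracture_asymptotics W WI bp.
Hypothesis B0 : 0 < B.
Hypothesis Bpair : forall xi : 'cV[R]_d, B * `|xi ord0 0| <= pair_density Z bp xi.

Theorem energy_lower_bound (a0 theta : R) : 0 < a0 -> 0 <= theta ->
  theta < \prod_(j | j != ord0) l j * (B / `|\det A|) ->
  theta < \prod_(j | j != ord0) l j * (a0 ^+ 2 * l ord0 * (2^-1 * alphaA Z W / `|\det A|)) ->
  exists2 e0 : R, 0 < e0 & forall eps a y, 0 < eps < e0 -> a0 * Num.sqrt eps <= a ->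
    admissible A l eps a y -> (theta%:E <= energy A l W Z eps y)%E.
Proof.
move=> a00 th0 th1 th2; have [j0 [ji [edge sg0 sgi]]] := edge_labels labels.
have [om [Q [T [rc omW]]]] := reduced_cell_exists unitA edge assumptions WI0 bp_sym Wfr.
have [Lam [Lamb LamB]] := calibration bp_sym (ltW B0) Bpair.
have [e0 e00 H] := discrete_lower_bound unitA labels sg0 sgi rc B0 Lamb LamB l0 a00 th0 th1 th2.
have [e1 [e10 H1]] : exists e1 : R, 0 < e1 /\ forall eps, 0 < eps < e1 -> 4 * rowsum A < l ord0 / eps.
  have q0 : 0 < 4 * rowsum A + 1 by rewrite ltr_wpDl// mulr_ge0// rowsum_ge0.
  exists (l ord0 / (4 * rowsum A + 1)); split; first by rewrite divr_gt0.
  move=> eps /andP[ep]; rewrite ltr_pdivlMr// mulrC -ltr_pdivlMr// => h.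
  by apply: le_lt_trans h; rewrite lerDl.
exists (Num.min e1 (e0 ^+ 2)); first by rewrite lt_min e10 exprn_gt0.
move=> eps a y /andP[ep]; rewrite lt_min => /andP[ee1 ee0] aeps adm.
have se : Num.sqrt eps ^+ 2 = eps by rewrite sqr_sqrtr// ltW.
have s0 : 0 < Num.sqrt eps by rewrite sqrtr_gt0.
have se0 : Num.sqrt eps < e0.
  by rewrite -(@ltr_pXn2r _ 2%N)// ?nnegrE ?ltW// se.
have fI := cell_index_finite unitA l0 ep.
have a_ge0 : 0 <= a by apply: le_trans aeps; rewrite mulr_ge0// ltW.
have Hin k : interior A (fun j => l j / Num.sqrt eps ^+ 2) (A *m (emb k + const_mx 2^-1)) -> cell_index A l eps k.
  by rewrite se; exact: interior_cell_index.
have HY : stretched A (lattice_units A eps y) (fun j => l j / Num.sqrt eps ^+ 2) a.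
  rewrite se; apply: (admissible_stretched ep a_ge0 adm); apply: H1; by rewrite ep.
have := H (Num.sqrt eps) a _ _ (introT andP (conj s0 se0)) aeps fI Hin HY.
rewrite se => h; rewrite energyE//.
apply: (@le_trans _ _ (eps ^+ n.+1 * fsum (cell_index A l eps) (cell_om sg om (lattice_units A eps y)))%:E).
  by rewrite lee_fin.
rewrite EFinM lee_pmul2l ?lte_fin ?exprn_gt0// /fsum -sumEFin; apply: lee_sum => k _.
have [c ->] := dgrad_cell labels eps y k.
by apply: le_trans (omW _); rewrite (rc_translation rc).
Qed.

End EnergyLower.

(** * The upper bounds *)

Section ElasticUpper.
Context {R : realType} {n : nat}.
Local Notation d := n.+2.
Local Notation N := (2 ^ n.+2)%N.
Variables (A : 'M[R]_d) (Z : 'M[R]_(d, N)) (W : 'M[R]_(d, N) -> \bar R) (beta : 'cV[R]_d -> R).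
Variables (sg : 'I_N -> 'cV[int]_d) (l : 'I_d -> R).
Hypothesis unitA : A \in unitmx.
Hypothesis labels : corner_labels A Z sg.
Hypothesis l0 : forall j, 0 < l j.
Implicit Types (eps : R) (k : 'cV[int]_d).

Local Notation dt := `|\det A|.
Local Notation midshift := (A *m const_mx 2^-1 : 'cV[R]_d).

Lemma midshift_bound j : `|midshift j 0| <= mu A.
Proof.
have r0 : 0 <= rowsums A j by exact: sumr_ge0.
by have h1 := half_bound A j; have h2 := rowsums_le_mu A j; lra.
Qed.

Definition size_bound : R := 1 + \sum_j l j + mu A.

Lemma size_bound_ge1 : 1 <= size_bound.
Proof. by rewrite /size_bound -addrA lerDl addr_ge0// ?mu_ge0// sumr_ge0// => j _; exact: ltW. Qed.

Lemma size_boundP eps j : 0 < eps <= 1 ->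
  `|- midshift j 0| <= size_bound / eps /\ `|l j / eps - midshift j 0| <= size_bound / eps.
Proof.
move=> /andP[e0 e1]; have m := midshift_bound j; have m0 := mu_ge0 A.
have ei : 1 <= eps^-1 by rewrite invr_ge1// unitfE gt_eqF.
have lS : l j <= \sum_i l i.
  by rewrite (bigD1 j)//= lerDl sumr_ge0// => i _; exact: ltW.
have mue : mu A <= mu A / eps by rewrite ler_peMr.
have h : (l j + mu A) / eps <= size_bound / eps.
  by rewrite ler_pM2r ?invr_gt0// lerD2r (le_trans lS)// lerDr.
have le0 : 0 <= l j / eps by rewrite divr_ge0// ltW.
rewrite mulrDl in h; split.
  by rewrite normrN; apply: le_trans h; apply: (le_trans m); rewrite ler_wpDl.
apply: le_trans h; apply: le_trans (ler_normB _ _) _.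
by rewrite ger0_norm// lerD// (le_trans m).
Qed.

Lemma cell_index_coord eps k j : 0 < eps -> cell_index A l eps k ->
  - midshift j 0 < (A *m emb k : 'cV[R]_d) j 0 < l j / eps - midshift j 0.
Proof.
move=> e0 /cell_index_Omega/(_ j); rewrite /midpoint mulmxDr; move: (A *m emb k) midshift => x z.
rewrite mxE [X in _ * X]mxE => /andP[h1 h2]; rewrite pmulr_rgt0// in h1.
rewrite mulrC -ltr_pdivlMr// in h2.
by rewrite ltrBrDr ltrNl; apply/andP; split; lra.
Qed.

Lemma cell_index_count : exists2 c : R, 0 <= c & forall eps, 0 < eps <= 1 ->
  eps ^+ d * cnt (cell_index A l eps) <= (\prod_j l j + c * eps) / dt.
Proof.
have [c c0 H] := lattice_count unitA; have S1 := size_bound_ge1.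
exists (c * size_bound ^+ n.+1); first by rewrite mulr_ge0// exprn_ge0// (le_trans ler01).
move=> eps e01; have /andP[e0 e1] := e01.
pose I (j : 'I_d) : set R := [set x : R | - midshift j 0 < x < l j / eps - midshift j 0].
have M1 : 1 <= size_bound / eps.
  by rewrite ler_pdivlMr// mul1r (le_trans e1).
have := H (size_bound / eps) (fun j => - midshift j 0) (fun j => l j / eps - midshift j 0) I M1.
have -> : \prod_j (l j / eps - midshift j 0 - - midshift j 0) = (\prod_j l j) / eps ^+ d.
  rewrite (eq_bigr (fun j => l j / eps)); last by move=> j _; ring.
  by rewrite big_split /= prodr_const card_ord exprVn.
move=> h; have : `|dt * cnt (pts A (box I)) - (\prod_j l j) / eps ^+ d| <= c * (size_bound / eps) ^+ n.+1.
  apply: h.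
  - move=> j; have [b1 b2] := size_boundP j e01; split=> //.
    by rewrite lerDr divr_ge0// ltW.
  - by move=> j x y z /andP[x0 xm] /andP[y0 ym] /andP[xz zy]; rewrite /I /= (lt_le_trans x0 xz) (le_lt_trans zy ym).
  - by move=> j x /andP[x0 xm]; rewrite /I /= x0.
  - by move=> j x /andP[x0 xm]; rewrite !ltW.
rewrite ler_norml => /andP[_]; rewrite lerBlDr => hc.
have fB : finite_set (pts A (box I)).
  apply: (@pts_finite R n.+1 A _ (size_bound / eps)) => // x xI.
  apply: mx_norm_le; first by rewrite (le_trans ler01).
  move=> i j; rewrite (ord1 j); have /andP[h1 h2] := xI i; have [b1 b2] := size_boundP i e01.
  by rewrite ler_norml; move: b1 b2; rewrite !ler_norml => /andP[b1 b2] /andP[b3 b4]; rewrite (le_trans b1 (ltW h1)) (le_trans (ltW h2) b4).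
have cle : cnt (cell_index A l eps) <= cnt (pts A (box I)) :> R.
  by apply: cnt_le => // k kI j; exact: cell_index_coord.
rewrite ler_pdivlMr ?dt_gt0// -[leLHS]mulrA [_ * dt]mulrC.
apply: (@le_trans _ _ (eps ^+ d * (c * (size_bound / eps) ^+ n.+1 + (\prod_j l j) / eps ^+ d))).
  by rewrite ler_pM2l ?exprn_gt0// (le_trans _ hc)// ler_pM2l ?dt_gt0.
rewrite le_eqVlt; apply/orP; left; apply/eqP; rewrite exprMn exprVn [eps ^+ d]exprS.
move: (eps ^+ n.+1) (exprn_gt0 n.+1 e0) => X X0; field; rewrite !gt_eqF//.
Qed.

Hypothesis assumptions : cell_energy_assumptions A Z W beta.

(** The competitor is x + a G x with G the optimal strain plus a skew part. The margin x below
    serves at once as Taylor accuracy, as tolerance for a / sqrt eps and as bound for eps in the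
    cell count. *)
Theorem elastic_upper_bound (a0 theta : R) : 0 <= a0 ->
  \prod_(j | j != ord0) l j / dt * (2^-1 * l ord0 * alphaA Z W * a0 ^+ 2) < theta ->
  exists2 rho : R, 0 < rho & exists2 e0 : R, 0 < e0 & forall eps a, 0 < eps < e0 -> 0 <= a ->
    a <= (a0 + rho) * Num.sqrt eps ->
    exists2 y, admissible A l eps a y & (energy A l W Z eps y <= theta%:E)%E.
Proof.
move=> a0_ge0 th; have [j0 [ji [edge sg0 sgi]]] := edge_labels labels.
have [W0 Wf Wz Wc Wr WH _] := assumptions.
have [E [al0 ET E1 QE _]] := alphaA_spec W0 Wf Wz Wr WH unitA edge.
have [c c0 count] := cell_index_count.
(* The skew part makes the first row of G equal to that of the identity. The first component of the
   deformation is then (1 + a) x_1 everywhere, as the boundary condition demands, and [Qcell] does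
   not see the change. *)
pose S : 'M[R]_d := \matrix_(i, j) (if i == ord0 then if j == ord0 then 0 else - E ord0 j
   else if j == ord0 then E ord0 i else 0).
have skew : S + S^T = 0.
  by apply/matrixP => i j; rewrite !mxE; case: eqP => _; case: eqP => _; ring.
pose G := E + S.
have G0 j : G ord0 j = (j == ord0)%:R.
  by rewrite !mxE eqxx; case: eqP => [->|_]; rewrite ?E1 ?addr0 ?subrr.
have Grow (x : 'cV[R]_d) : (G *m x) ord0 0 = x ord0 0.
  rewrite mxE (bigD1 ord0)//= big1 => [|i i0]; first by rewrite G0 mul1r addr0.
  by rewrite G0 (negbTE i0) mul0r.
have QG : Qcell Z W (G *m Z) = alphaA Z W.
  have := Qcell_rigidD W0 Wf Wz Wr (E *m Z) 0 skew.
  by rewrite translation0 add0r -mulmxDl QE.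
set al := alphaA Z W in th QG al0.
have [q qE] : exists q : R, q = `|G *m Z| by eexists.
have q0 : 0 <= q by rewrite qE.
have lim : lim0 (fun x => - ((\prod_j l j + c * x) / dt * ((a0 + x) ^+ 2 * (2^-1 * al + x * q ^+ 2))))
    (- (\prod_(j | j != ord0) l j / dt * (2^-1 * l ord0 * al * a0 ^+ 2))).
  eapply lim0_eq; last lim0_rat.
  by rewrite mulr0 mul0r !addr0 [\prod_j _](bigD1 ord0)//=; ring.
have thN : - theta < - (\prod_(j | j != ord0) l j / dt * (2^-1 * l ord0 * al * a0 ^+ 2)) by rewrite ltrN2.
have [dl dl0 Hdl] := near0_gt lim thN.
pose x := dl / 2.
have x0 : 0 < x by rewrite divr_gt0.
have {}Hdl : (\prod_j l j + c * x) / dt * ((a0 + x) ^+ 2 * (2^-1 * al + x * q ^+ 2)) < theta.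
  by rewrite -ltrN2; apply: Hdl; rewrite x0 /x ltr_pdivrMr// ltr_pMr// ltr1n.
clearbody x.
have [t t0 taylor] := W_taylor W0 Wz Wr x0.
have ax0 : 0 < (a0 + x) * (q + 1) by rewrite mulr_gt0// ltr_wpDl.
exists x => //; exists (Num.min 1 (Num.min x ((t / ((a0 + x) * (q + 1))) ^+ 2))).
  by rewrite !lt_min ltr01 x0 exprn_gt0// divr_gt0.
move=> eps a /andP[e0]; rewrite !lt_min => /and3P[e1 ex et] a_ge0 ale.
pose y (z : 'cV[R]_d) : 'cV[R]_d := z + a *: (G *m z).
exists y.
  by left=> z _ _; rewrite /y mxE [X in _ + X]mxE Grow; ring.
have s0 : 0 < Num.sqrt eps by rewrite sqrtr_gt0.
have se : Num.sqrt eps ^+ 2 = eps by rewrite sqr_sqrtr// ltW.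
have aH : `|a *: (G *m Z)| < t.
  rewrite mx_normZ ger0_norm// -qE.
  have : Num.sqrt eps < t / ((a0 + x) * (q + 1)).
    by rewrite -(@ltr_pXn2r _ 2%N)// ?nnegrE ?(ltW s0)// ?divr_ge0 ?(ltW t0) ?(ltW ax0)// se.
  rewrite ltr_pdivlMr// => h; apply: le_lt_trans h.
  apply: (@le_trans _ _ ((a0 + x) * Num.sqrt eps * (q + 1))); last by rewrite mulrA [Num.sqrt eps * _]mulrC.
  by rewrite ler_pM// lerDl.
have [Wfin Wtay] := taylor _ aH.
have dg k : W (dgrad Z eps y (midpoint A eps k)) = W (Z + a *: (G *m Z)).
  have [c' ->] := dgrad_cell labels eps y k.
  rewrite (W_translation Wf).
  have -> : cellmx sg (lattice_units A eps y) k = Z + a *: (G *m Z) +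
     translation (A *m (emb k + const_mx 2^-1) + a *: (G *m (A *m (emb k + const_mx 2^-1)))).
    apply/matrixP => i s; rewrite [LHS]mxE /lattice_units /y.
    have zs : A *m emb (k + sg s) = col s Z + A *m (emb k + const_mx 2^-1).
      have [-> _ _ _] := labels; rewrite -mulmxDr embD; congr (_ *m _).
      by apply/matrixP => i' j'; rewrite !mxE; ring.
    rewrite -scalemxAr scalerA [a * eps]mulrC -scalerA -scalerDr scalerK ?gt_eqF// zs.
    move: (A *m (emb k + _)) => v; rewrite mulmxDr.
    have colM (X : 'M[R]_d) : X *m col s Z = col s (X *m Z).
      by apply/matrixP => i' j'; rewrite !mxE; apply: eq_bigr => k' _; rewrite mxE.
    rewrite colM; move: (G *m Z) (G *m v) => GZ w; rewrite !mxE; ring.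
  by rewrite (W_translation Wf).
rewrite energyE//.
have -> : (\sum_(k <- fset_set (cell_index A l eps)) W (dgrad Z eps y (midpoint A eps k)) =
   (fsum (cell_index A l eps) (fun=> fine (W (Z + a *: (G *m Z)))))%:E)%E.
  by rewrite /fsum -sumEFin; apply: eq_bigr => k _; rewrite dg fineK.
rewrite fsum_const -EFinM lee_fin.
have Wb : fine (W (Z + a *: (G *m Z))) <= a ^+ 2 * (2^-1 * al + x * q ^+ 2).
  move: Wtay; rewrite (QcellZ Wr) QG mx_normZ ger0_norm// -qE ler_norml => /andP[_].
  by rewrite lerBlDr exprMn => h; apply: le_trans h _; rewrite le_eqVlt; apply/orP; left; apply/eqP; ring.
have qq : 0 <= 2^-1 * al + x * q ^+ 2 by rewrite addr_ge0 ?mulr_ge0 ?exprn_ge0// ltW.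
have a2 : a ^+ 2 <= (a0 + x) ^+ 2 * eps.
  by rewrite -se -exprMn ler_pXn2r// nnegrE// (le_trans a_ge0).
have fI := cell_index_finite unitA l0 e0.
have {}count : eps ^+ d * cnt (cell_index A l eps) <= (\prod_j l j + c * x) / dt.
  apply: le_trans (count eps _) _; first by rewrite e0 ltW.
  by rewrite ler_pM2r ?invr_gt0 ?dt_gt0// lerD2l ler_wpM2l// ltW.
apply: le_trans (ltW Hdl); rewrite [leLHS]mulrA.
have cn0 : 0 <= cnt (cell_index A l eps) :> R by exact: cnt_ge0.
have Wb' : fine (W (Z + a *: (G *m Z))) <= (a0 + x) ^+ 2 * eps * (2^-1 * al + x * q ^+ 2).
  by apply: le_trans Wb _; rewrite ler_wpM2r.
apply: (@le_trans _ _ (eps ^+ n.+1 * ((a0 + x) ^+ 2 * eps * (2^-1 * al + x * q ^+ 2)) * cnt (cell_index A l eps))).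
  by rewrite ler_wpM2r// ler_wpM2l// exprn_ge0// ltW.
have -> : eps ^+ n.+1 * ((a0 + x) ^+ 2 * eps * (2^-1 * al + x * q ^+ 2)) * cnt (cell_index A l eps) =
  eps ^+ d * cnt (cell_index A l eps) * ((a0 + x) ^+ 2 * (2^-1 * al + x * q ^+ 2)).
  by rewrite [eps ^+ d]exprS; ring.
by rewrite ler_wpM2r// mulr_ge0// exprn_ge0// addr_ge0// ltW.
Qed.

End ElasticUpper.

(** * The crack construction *)

Section CrackUpper.
Context {R : realType} {n : nat}.
Local Notation d := n.+2.
Local Notation N := (2 ^ n.+2)%N.
Variables (A : 'M[R]_d) (Z : 'M[R]_(d, N)) (W : 'M[R]_(d, N) -> \bar R) (beta : 'cV[R]_d -> R).
Variables (sg : 'I_N -> 'cV[int]_d) (l : 'I_d -> R) (B : R) (bp : 'I_N -> 'I_N -> R)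
  (WI : forall I : {set 'I_N}, 'M[R]_(d, #|I|) -> R) (xi : 'cV[R]_d).
Hypothesis unitA : A \in unitmx.
Hypothesis labels : corner_labels A Z sg.
Hypothesis l0 : forall j, 0 < l j.
Hypothesis assumptions : cell_energy_assumptions A Z W beta.
Hypothesis WI0 : forall I G, 0 <= @WI I G.
Hypothesis bp_sym : forall s t, s != t -> 0 <= bp s t /\ bp s t = bp t s.
Hypothesis Wfr : fracture_asymptotics W WI bp.
Hypothesis Wblock : block_energy_bound Z W WI.
Hypothesis xi1 : xi ord0 0 = 1.
Hypothesis Bpair : pair_density Z bp xi = B.
Hypothesis tilt : \sum_(j | j != ord0) l j * `|xi j 0| < l ord0 / 2.
Implicit Types (eps : R) (k : 'cV[int]_d).

Local Notation dt := `|\det A|.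
Local Notation P := (\prod_(j | j != ord0) l j).

Definition height k : R := dot xi (A *m emb k).
(** Replaces the first coordinate by the height along xi. It has determinant 1 and turns a slab
    between two crack planes into a box, so that [lattice_count] applies to [shear *m A]. *)
Definition shear : 'M[R]_d := \matrix_(i, j) (if i == ord0 then xi j 0 else (i == j)%:R).

Lemma det_shear : \det shear = 1.
Proof.
rewrite -det_tr det_trig; last first.
  apply/is_trig_mxP => i j ij; rewrite !mxE; case: eqP => [j0|_].
    by move: ij; rewrite j0.
  by case: eqP ij => // ->; rewrite ltnn.
rewrite big1// => i _; rewrite !mxE; case: eqP => [->|_]; first by [].
by rewrite eqxx.
Qed.

Lemma shear_first (x : 'cV[R]_d) : (shear *m x) ord0 0 = dot xi x.
Proof. by rewrite mxE /dot; apply: eq_bigr => j _; rewrite mxE eqxx. Qed.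

Lemma shear_other (x : 'cV[R]_d) j : j != ord0 -> (shear *m x) j 0 = x j 0.
Proof.
move=> jn; rewrite mxE (bigD1 j)//= big1 => [|i ij]; first by rewrite mxE (negbTE jn) eqxx mul1r addr0.
by rewrite mxE (negbTE jn) eq_sym (negbTE ij) mul0r.
Qed.

Lemma slab_count : exists2 c : R, 0 <= c & forall S eps p q, size_bound A l <= S -> 0 < eps <= 1 -> p <= q ->
  `|p| <= S / eps -> `|q| <= S / eps ->
  dt * cnt (cell_index A l eps `&` [set k | p <= height k <= q]) <=
    (q - p) * (P / eps ^+ n.+1) + c * (S / eps) ^+ n.+1.
Proof.
have unitS : shear *m A \in unitmx.
  by rewrite unitmx_mul unitA andbT unitmxE det_shear unitr1.
have dS : \det (shear *m A) = \det A by rewrite det_mulmx det_shear mul1r.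
have [c c0 H] := lattice_count unitS; exists c => // S eps p q Sb e01 pq pS qS.
have /andP[e0 e1] := e01; have S1 := size_bound_ge1 A l0.
have M1 : 1 <= S / eps by rewrite ler_pdivlMr// mul1r (le_trans e1)// (le_trans S1).
pose ms : 'cV[R]_d := A *m const_mx 2^-1.
pose lo j := if j == ord0 then p else - ms j 0.
pose hi j := if j == ord0 then q else l j / eps - ms j 0.
pose I (j : 'I_d) : set R := if j == ord0 then [set x : R | p <= x <= q] else [set x : R | - ms j 0 < x < l j / eps - ms j 0].
have bds j : [/\ lo j <= hi j, `|lo j| <= S / eps & `|hi j| <= S / eps].
  rewrite /lo /hi; case: eqP => [//|_]; have [b1 b2] := size_boundP A l0 j e01.
  have Se : size_bound A l / eps <= S / eps by rewrite ler_pM2r ?invr_gt0.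
  split; [by rewrite lerDr divr_ge0// ltW|exact: le_trans Se|exact: le_trans Se].
have IB j x : I j x -> lo j <= x <= hi j.
  by rewrite /I /lo /hi; case: eqP => _ // /andP[h1 h2]; rewrite !ltW.
have := H (S / eps) lo hi I M1 bds; rewrite dS.
have -> : \prod_j (hi j - lo j) = (q - p) * (P / eps ^+ n.+1).
  rewrite (bigD1 ord0)//= /lo /hi eqxx; congr (_ * _).
  rewrite (eq_bigr (fun j => l j / eps)); last by move=> j /negbTE ->; ring.
  by rewrite big_split /= prodr_const card_lateral exprVn.
move=> h; have : `|dt * cnt (pts (shear *m A) (box I)) - (q - p) * (P / eps ^+ n.+1)| <= c * (S / eps) ^+ n.+1.
  apply: h => //.
  - move=> j x y z; rewrite /I; case: eqP => _ /= /andP[x0 xm] /andP[y0 ym] /andP[xz zy].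
      by rewrite (le_trans x0 xz) (le_trans zy ym).
    by rewrite (lt_le_trans x0 xz) (le_lt_trans zy ym).
  - move=> j x; rewrite /I /lo /hi; case: eqP => _ // /andP[h1 h2].
    by rewrite /= !ltW.
rewrite ler_norml => /andP[_]; rewrite lerBlDl; apply: le_trans.
rewrite ler_pM2l ?dt_gt0//; apply: cnt_le.
  apply: (@pts_finite R n.+1 (shear *m A) _ (S / eps)) => // x xI.
  apply: mx_norm_le; first by rewrite (le_trans ler01).
  move=> i j; rewrite (ord1 j); have /andP[h1 h2] := IB _ _ (xI i); have [_ b1 b2] := bds i.
  by rewrite ler_norml; move: b1 b2; rewrite !ler_norml => /andP[b1 b2] /andP[b3 b4]; rewrite (le_trans b1 h1) (le_trans h2 b4).
move=> k [kI kh] j; rewrite -mulmxA /I; case: eqP => [->|/eqP jn]; first by rewrite /= shear_first.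
by rewrite /= shear_other//; exact: cell_index_coord.
Qed.

Definition cut_energy (c : R) k : R :=
  \sum_s \sum_t half_bond bp s t * ((c <= height (k + sg s)) != (c <= height (k + sg t)))%:R.

Definition crack (eps a c : R) (x : 'cV[R]_d) : 'cV[R]_d :=
  x + (if eps * c <= dot xi x then a * l ord0 else 0) *: e1.

Lemma crack_cell eps a c k : 0 < eps ->
  W (dgrad Z eps (crack eps a c) (midpoint A eps k)) =
  W (crack_shift Z [set s | c <= height (k + sg s)] (a * l ord0 / eps)).
Proof.
move=> e0; have [_ Wf _ _ _ _ _] := assumptions.
have [c' ->] := dgrad_cell labels eps (crack eps a c) k; rewrite (W_translation Wf).
have -> : cellmx sg (lattice_units A eps (crack eps a c)) k =
    crack_shift Z [set s | c <= height (k + sg s)] (a * l ord0 / eps) + translation (A *m (emb k + const_mx 2^-1)).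
  apply/matrixP => i s; rewrite [LHS]mxE /lattice_units /crack dotZr ler_pM2l// -/(height _).
  have zs : A *m emb (k + sg s) = col s Z + A *m (emb k + const_mx 2^-1).
    have [-> _ _ _] := labels; rewrite -mulmxDr embD; congr (_ *m _).
    by apply/matrixP => i' j'; rewrite !mxE; ring.
  rewrite scalerDr scalerK ?gt_eqF// scalerA.
  rewrite [RHS]mxE [crack_shift _ _ _ _ _]mxE inE [translation _ _ _]mxE.
  case: (c <= height _) => /=; rewrite zs; move: (A *m (emb k + _)) => v.
    by rewrite !mxE andbT; case: (i == ord0) => /=; rewrite ?mulr1n ?mulr0n; ring.
  by rewrite !mxE mulr0 mul0r mulr0n; ring.
by rewrite (W_translation Wf).
Qed.

Lemma crack_cell_energy (eta : R) : 0 < eta -> exists2 M : R, 0 < M & forall eps a c k, 0 < eps ->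
  M <= a * l ord0 / eps ->
  (W (dgrad Z eps (crack eps a c) (midpoint A eps k)) <= ((1 + eta) * cut_energy c k)%:E)%E.
Proof.
move=> eta0; have [W0 Wf Wz Wc Wr WH _] := assumptions.
have [M M0 H] := fracture_upper_bound W0 Wf Wz WI0 Wfr Wblock eta0.
exists M => // eps a c k e0 Mt; rewrite crack_cell//.
set J := [set s | _]%SET; set t := a * l ord0 / eps in Mt *.
have cut0 : 0 <= (1 + eta) * cut_energy c k.
  have cut1 : 0 <= cut_energy c k.
    by apply: sumr_ge0 => s _; apply: sumr_ge0 => s' _; rewrite mulr_ge0// half_bond_ge0.
  by rewrite mulr_ge0// addr_ge0// ltW.
(* A cell on one side of the plane is unchanged or rigidly translated, with energy 0; only cells
   that are cut need the fracture estimate. *)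
have [J0|J0] := eqVneq J finset.set0.
  have -> : crack_shift Z J t = Z by apply/matrixP => i j; rewrite J0 mxE inE addr0.
  by rewrite (W_Z Wz) lee_fin.
have [JT|JT] := eqVneq (~: J) finset.set0.
  have -> : crack_shift Z J t = Z + translation (t *: e1).
    apply/matrixP => i j; have -> : J = [set: 'I_N]%SET by rewrite -[J]finset.setCK JT finset.setC0.
    by rewrite !mxE inE andbT; case: (i == ord0); rewrite ?mulr1n ?mulr0n ?mulr1 ?mulr0.
  by rewrite (W_translation Wf) (W_Z Wz) lee_fin.
apply: le_trans (H J t J0 JT Mt) _; rewrite lee_fin ler_pM2l ?addr_gt0// /cut_energy.
apply: ler_sum => s _; rewrite big_mkcond /=; apply: ler_sum => s' _; rewrite !inE.
by case: (_ != _); rewrite ?mulr1 ?mulr0.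
Qed.

Definition spread : R := \sum_s `|dot xi (A *m emb (sg s))|.

Lemma height_corner k s : `|height (k + sg s) - height k| <= spread.
Proof.
rewrite /height embD mulmxDr dotDr addrC addKr /spread (bigD1 s)//= lerDl.
exact: sumr_ge0.
Qed.

(** A bond whose ends differ in height by delta is cut by at most |delta| / h + 2 of the planes at
    spacing h. Weighted by the bonds, the first term sums to the pair density of xi, which is B. *)
Lemma crack_average (c0 h : R) (J : nat) k : 0 < h ->
  \sum_(i < J) cut_energy (c0 + i%:R * h) k <=
  (B / h + 2 * \sum_s \sum_t half_bond bp s t) *
    (`[< c0 - spread <= height k <= c0 + J%:R * h + spread >])%:R.
Proof.
move=> h0; case: asboolP => [_|nk] /=; last first.
  rewrite mulr0 big1// => i _; rewrite /cut_energy big1// => s _; rewrite big1// => t _.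
  case: eqP => [_|ne]; first by rewrite mulr0.
  exfalso; apply: nk; have := height_corner k s; have := height_corner k t.
  have i0 : 0 <= i%:R * h by rewrite mulr_ge0// ltW.
  have iJ : i%:R * h <= J%:R * h by rewrite ler_pM2r// ler_nat ltnW.
  rewrite !ler_norml => /andP[h1 h2] /andP[h3 h4].
  move: ne h1 h2 h3 h4 i0 iJ; move: (height k) (height (k + sg s)) (height (k + sg t)) (i%:R * h) (J%:R * h) spread => x xs xt ih Jh C.
  by case: (leP (c0 + ih) xs) => h5; case: (leP (c0 + ih) xt) => h6 // _ *; apply/andP; split; lra.
rewrite mulr1 exchange_big /= -Bpair /pair_density mulr_suml mulr_sumr -big_split /=.
apply: ler_sum => s _; rewrite exchange_big /= mulr_suml mulr_sumr -big_split /=.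
apply: ler_sum => t _; rewrite -mulr_sumr -mulrA [2 * _]mulrC -mulrDr ler_wpM2l ?half_bond_ge0//.
have dE : dot (col s Z - col t Z) xi = height (k + sg s) - height (k + sg t).
  have [zE _ _ _] := labels.
  have -> : col s Z - col t Z = A *m emb (k + sg s) - A *m emb (k + sg t).
    rewrite !zE -!mulmxBr !embD; congr (_ *m _); apply/matrixP => i j; rewrite !mxE; ring.
  by rewrite dotBl !(dotC _ xi).
rewrite dE; move: (height (k + sg s)) (height (k + sg t)) => x y.
have mM : Num.min x y <= Num.max x y by rewrite ge_min le_max lexx.
have hw : Num.min x y - c0 <= Num.max x y - c0 by rewrite lerD2r.
have := @time_window R (fun=> true) J _ _ h 1 0 h0 ler01 hw.
rewrite mul1r addr0 => tw; apply: le_trans (_ : _ <= (Num.max x y - c0 - (Num.min x y - c0)) / h + 2) _.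
  apply: le_trans (tw _); last by move=> s1 s2 s12; rewrite big_const_nat iter_addr_0 mul1r addr0 natrB.
  apply: ler_sum => i _; case: asboolP => [_|nw] /=; first by case: (_ != _).
  case: eqP => // ne; exfalso; apply: nw; move: ne.
  rewrite lerBlDl lerBrDl ge_min le_max.
  by case: (leP (c0 + i%:R * h) x) => h1; case: (leP (c0 + i%:R * h) y) => h2 // _; rewrite ?(ltW h1) ?(ltW h2) ?h1 ?h2 ?orbT.
rewrite lerD2r ler_pM2r ?invr_gt0//.
have -> : Num.max x y - c0 - (Num.min x y - c0) = Num.max x y - Num.min x y by ring.
case: (leP x y) => xy; last by rewrite ler_norm.
by rewrite distrC ler_norm.
Qed.

(** The height differs from x_1 by at most the lateral sum, because the first entry of xi is 1. The
    plane therefore avoids both layers, and the second boundary condition holds with the right part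
    moved by a l_1. *)
Lemma crack_admissible eps a c : 0 < eps -> l ord0 / 2 <= eps * c ->
  eps * c + 2 * lA A * eps + \sum_(j | j != ord0) l j * `|xi j 0| <= l ord0 ->
  2 * lA A * eps + \sum_(j | j != ord0) l j * `|xi j 0| < l ord0 / 2 ->
  admissible A l eps a (crack eps a c).
Proof.
move=> e0 c1 c2 c3.
have near x : Omega l x -> `|dot xi x - x ord0 0| <= \sum_(j | j != ord0) l j * `|xi j 0|.
  move=> xO; rewrite /dot (bigD1 ord0)//= xi1 mul1r addrAC subrr add0r (le_trans (ler_norm_sum _ _ _))//.
  apply: ler_sum => j _; rewrite normrM mulrC ler_wpM2r//; have /andP[x0 x1] := xO j.
  by rewrite gtr0_norm// ltW.
right; split=> x [_ xO] [_ xB]; have := near x xO; rewrite ler_norml => /andP[h1 h2];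
  rewrite /crack [LHS]mxE [X in _ + X]mxE mxE eqxx /= mulr1.
  rewrite ifF ?addr0//; apply/negbTE; rewrite -ltNge; lra.
rewrite ifT//; lra.
Qed.

Lemma window_bound (c M e x y : R) : c + e <= M -> x + y <= e -> 0 <= c -> 0 <= x -> 0 <= y ->
  `|c - y| <= M /\ `|c + x + y| <= M.
Proof. by move=> h1 h2 h3 h4 h5; rewrite !ler_norml; split; apply/andP; split; lra. Qed.

Theorem crack_upper_bound (theta : R) : P * B / dt < theta ->
  exists2 K : R, 0 < K & exists2 e0 : R, 0 < e0 & forall eps a, 0 < eps < e0 -> K * eps <= a ->
    exists2 y, admissible A l eps a y & (energy A l W Z eps y <= theta%:E)%E.
Proof.
move=> th; have [c c_ge0 slab] := slab_count.
have sp0 : 0 <= spread by exact: sumr_ge0.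
have [S SE] : exists S : R, S = size_bound A l + l ord0 + 1 by eexists.
have Sb : size_bound A l <= S by rewrite SE -addrA lerDl addr_ge0// ltW.
have S0 : 0 <= S by apply: le_trans Sb; rewrite (le_trans ler01)// size_bound_ge1.
have [D1 D1E] : exists D1 : R, D1 = 2 * spread * P + c * S ^+ n.+1 by eexists.
have P0 : 0 < P by exact: prodr_gt0.
have dt0 : 0 < dt := dt_gt0 unitA.
have D10 : 0 <= D1 by rewrite D1E addr_ge0// !mulr_ge0 ?exprn_ge0// ltW.
pose sb := \sum_s \sum_t half_bond bp s t.
have sb0 : 0 <= sb by apply: sumr_ge0 => s _; apply: sumr_ge0 => t _; exact: half_bond_ge0.
have B0 : 0 <= B.
  by rewrite -Bpair; apply: sumr_ge0 => s _; apply: sumr_ge0 => t _; rewrite mulr_ge0// half_bond_ge0.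
have lim : lim0 (fun x => - ((1 + x) * ((P + x) / dt * (B + 2 * x * sb)))) (- (P * B / dt)).
  by eapply lim0_eq; last lim0_rat; rewrite mulr0 mul0r !addr0 mul1r; ring.
have thN : - theta < - (P * B / dt) by rewrite ltrN2.
have [dl dl0 Hdl] := near0_gt lim thN.
have [x [x0 xth]] : exists x : R, 0 < x /\ (1 + x) * ((P + x) / dt * (B + 2 * x * sb)) < theta.
  exists (dl / 2); rewrite divr_gt0//; split=> //.
  by rewrite -ltrN2; apply: Hdl; rewrite divr_gt0//= ltr_pdivrMr// ltr_pMr// ltr1n.
(* So many planes that the excess thickness of the slab and the boundary error of the count,
   collected in [D1], are negligible against its width J x. *)
have [J J0 DJ] : exists2 J : nat, (0 < J)%N & D1 <= x * (J%:R * x).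
  have h : 0 <= D1 / (x * x) by rewrite divr_ge0// mulr_ge0// ltW.
  exists (Num.truncn (D1 / (x * x))).+1 => //; have /andP[_ h2] := truncn_itv h.
  by rewrite mulrCA -ler_pdivrMr ?mulr_gt0// ltW.
have [M M0 cellE] := crack_cell_energy x0.
have [e2 e20 e2P] : exists2 e2 : R, 0 < e2 & forall eps, 0 < eps < e2 ->
    eps * (J%:R * x + 2 * lA A) < l ord0 / 2 - \sum_(j | j != ord0) l j * `|xi j 0| /\
    eps * (J%:R * x + spread) <= 1.
  have lA0 : 0 <= lA A by rewrite lA_rowsum rowsum_ge0.
  have g0 : 0 < l ord0 / 2 - \sum_(j | j != ord0) l j * `|xi j 0| by rewrite subr_gt0.
  have Jx : 0 <= J%:R * x by rewrite mulr_ge0// ltW.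
  have q1 : 0 < J%:R * x + 2 * lA A + 1 by rewrite ltr_wpDl// addr_ge0// mulr_ge0.
  have q2 : 0 < J%:R * x + spread + 1 by rewrite ltr_wpDl// addr_ge0.
  exists (Num.min ((l ord0 / 2 - \sum_(j | j != ord0) l j * `|xi j 0|) / (J%:R * x + 2 * lA A + 1))
      (1 / (J%:R * x + spread + 1))); first by rewrite lt_min !divr_gt0.
  move=> eps /andP[e0]; rewrite lt_min !ltr_pdivlMr// => /andP[h1 h2]; split.
    by apply: le_lt_trans h1; rewrite ler_pM2l// lerDl.
  by apply: le_trans (ltW h2); rewrite ler_pM2l// lerDl.
exists (M / l ord0); first by rewrite divr_gt0.
exists (Num.min 1 e2); first by rewrite lt_min ltr01.
move=> eps a /andP[e0]; rewrite lt_min => /andP[e1 ee2] Ma.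
have [small1 small2] := e2P eps (introT andP (conj e0 ee2)).
have fI := cell_index_finite unitA l0 e0.
(* The planes start at mid-length, in lattice units. *)
pose c0 := l ord0 / (2 * eps).
have c0E : eps * c0 = l ord0 / 2 by rewrite /c0; field; rewrite gt_eqF.
pose F (i : nat) := fsum (cell_index A l eps) (cut_energy (c0 + i%:R * x)).
pose Sl := cell_index A l eps `&` [set k | c0 - spread <= height k <= c0 + J%:R * x + spread].
have total : \sum_(i < J) F i <= (B / x + 2 * sb) * cnt Sl.
  rewrite /F exchange_fsum.
  apply: (@le_trans _ _ (fsum (cell_index A l eps) (fun k => (B / x + 2 * sb) *
      (`[< c0 - spread <= height k <= c0 + J%:R * x + spread >])%:R))).
    by apply: ler_fsum => // k _; exact: crack_average.
  rewrite fsumZ ler_wpM2l//; first by rewrite addr_ge0 ?divr_ge0 ?mulr_ge0// ltW.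
  rewrite /cnt (fsum_cond [set k | c0 - spread <= height k <= c0 + J%:R * x + spread] (fun=> 1) fI).
  by apply: ler_fsum => // k _; rewrite /=; case: asboolP.
(* Some plane costs no more than the average. *)
have [i iF] : exists i : 'I_J, J%:R * F i <= (B / x + 2 * sb) * cnt Sl.
  apply: contrapT => nF; have : \sum_(i < J) ((B / x + 2 * sb) * cnt Sl / J%:R) < \sum_(i < J) F i.
    apply: ltr_sum; first by apply/hasP; exists (Ordinal J0); rewrite ?mem_index_enum.
    move=> i _; rewrite ltr_pdivrMr ?ltr0n// [F i * _]mulrC ltNge; apply/negP => h; apply: nF; by exists i.
  by rewrite sumr_const card_ord -[_ *+ J]mulr_natr divfK ?pnatr_eq0 -?lt0n// ltNge total.
have ix : 0 <= i%:R * x by rewrite mulr_ge0// ltW.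
have iJx : i%:R * x <= J%:R * x by rewrite ler_pM2r// ler_nat ltnW.
exists (crack eps a (c0 + i%:R * x)).
  have ei : eps * (i%:R * x) <= eps * (J%:R * x) by rewrite ler_pM2l.
  have ei0 : 0 <= eps * (i%:R * x) by rewrite mulr_ge0// ltW.
  rewrite mulrDr in small1.
  by apply: crack_admissible => //; rewrite ?mulrDr ?c0E; [lra|lra|lra].
rewrite energyE//.
have Mt : M <= a * l ord0 / eps.
  by move: Ma; rewrite ler_pdivlMr// mulrAC ler_pdivrMr.
apply: (@le_trans _ _ ((eps ^+ n.+1)%:E * ((1 + x) * F i)%:E)%E).
  rewrite lee_pmul2l ?lte_fin ?exprn_gt0// /F -fsumZ /fsum -sumEFin; apply: lee_sum => k _.
  exact: cellE.
rewrite -EFinM lee_fin; apply: le_trans (ltW xth).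
rewrite mulrCA ler_pM2l ?addr_gt0//.
have J0r : 0 < J%:R :> R by rewrite ltr0n.
have Fi : F i <= (B / x + 2 * sb) * cnt Sl / J%:R by rewrite ler_pdivlMr// mulrC.
have slabE : dt * cnt Sl <= (J%:R * x * P + D1) / eps ^+ n.+1.
  have := slab S eps (c0 - spread) (c0 + J%:R * x + spread) Sb.
  have -> : c0 + J%:R * x + spread - (c0 - spread) = J%:R * x + 2 * spread by ring.
  have -> : (J%:R * x + 2 * spread) * (P / eps ^+ n.+1) + c * (S / eps) ^+ n.+1 = (J%:R * x * P + D1) / eps ^+ n.+1.
    by rewrite D1E expr_div_n; ring.
  have Jx0 : 0 <= J%:R * x by rewrite mulr_ge0// ltW.
  have c00 : 0 <= c0 by rewrite divr_ge0 ?mulr_ge0// ltW.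
  have small3 : J%:R * x + spread <= 1 / eps by rewrite ler_pdivlMr// mulrC.
  have SS : c0 + 1 / eps <= S / eps.
    have -> : c0 = l ord0 / eps / 2 by rewrite /c0; field; rewrite gt_eqF.
    have h1 : 0 <= size_bound A l / eps by rewrite divr_ge0 ?(le_trans ler01 (size_bound_ge1 A l0))// ltW.
    have h2 : 0 <= l ord0 / eps by rewrite divr_ge0// ltW.
    have -> : S / eps = size_bound A l / eps + l ord0 / eps + 1 / eps by rewrite SE !mulrDl.
    rewrite lerD2r; move: h1 h2; move: (size_bound A l / eps) (l ord0 / eps) => z w h1 h2; lra.
  apply.
  - by rewrite e0 ltW.
  - by move: Jx0 sp0; move: (J%:R * x) spread => z w; lra.
  - by have [] := window_bound SS small3 c00 Jx0 sp0.
  - by have [] := window_bound SS small3 c00 Jx0 sp0.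
have cntS : cnt Sl <= (J%:R * x * P + D1) / eps ^+ n.+1 / dt by rewrite ler_pdivlMr// mulrC.
have Bs0 : 0 <= B / x + 2 * sb by rewrite addr_ge0 ?divr_ge0 ?mulr_ge0// ltW.
apply: (@le_trans _ _ (eps ^+ n.+1 * ((B / x + 2 * sb) * ((J%:R * x * P + D1) / eps ^+ n.+1 / dt) / J%:R))).
  rewrite ler_pM2l ?exprn_gt0//; apply: le_trans Fi _.
  by rewrite ler_pM2r ?invr_gt0// ler_wpM2l.
have -> : eps ^+ n.+1 * ((B / x + 2 * sb) * ((J%:R * x * P + D1) / eps ^+ n.+1 / dt) / J%:R) =
   ((J%:R * x * P + D1) / (J%:R * x)) / dt * (B + 2 * x * sb).
  have en : eps ^+ n.+1 != 0 by rewrite expf_neq0// gt_eqF.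
  by move: (eps ^+ n.+1) en => X X0; field; rewrite X0 !gt_eqF.
rewrite ler_wpM2r//; first by rewrite addr_ge0 ?mulr_ge0// ltW.
by rewrite ler_pM2r ?invr_gt0// ler_pdivrMr ?mulr_gt0// mulrDl lerD// mulrC.
Qed.

End CrackUpper.

Lemma near_right {R : realType} (Q : R -> Prop) (e0 : R) : 0 < e0 ->
  (forall eps, 0 < eps < e0 -> Q eps) -> \forall eps \near (0 : R)^'+, Q eps.
Proof.
move=> e00 H; near=> eps; apply: H; apply/andP; split; near: eps.
  exact: nbhs_right_gt.
exact: nbhs_right_lt.
Unshelve. all: by end_near. Qed.

Lemma ereal_sandwich {R : realType} (T : Type) (F : set_system T) {FF : Filter F} (f : T -> \bar R) (t : R) :
  (forall theta : R, theta < t -> \forall x \near F, (theta%:E <= f x)%E) ->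
  (forall theta : R, t < theta -> \forall x \near F, (f x <= theta%:E)%E) -> f x @[x --> F] --> t%:E.
Proof.
move=> L U; apply/fine_cvgP; split.
  have tl : t - 1 < t by rewrite gtrBl.
  have tu : t < t + 1 by rewrite ltrDl.
  apply: filterS2 (L _ tl) (U _ tu) => x h1 h2.
  by rewrite fin_real// (lt_le_trans (ltNyr _) h1) (le_lt_trans h2 (ltry _)).
apply/cvgrPdist_le => e e0.
have tl : t - e < t by rewrite gtrBl.
have tu : t < t + e by rewrite ltrDl.
apply: filterS2 (L _ tl) (U _ tu) => x /= h1 h2.
have xf : f x \is a fin_num.
  by rewrite fin_real// (lt_le_trans (ltNyr _) h1) (le_lt_trans h2 (ltry _)).
rewrite -(fineK xf) !lee_fin in h1 h2; rewrite distrC ler_norml.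
by apply/andP; split; lra.
Qed.

(** * The limit *)

Section MinimalEnergy.
Context {R : realType} {n : nat}.
Local Notation d := n.+2.
Local Notation N := (2 ^ n.+2)%N.
Variables (A : 'M[R]_d) (Z : 'M[R]_(d, N)) (W : 'M[R]_(d, N) -> \bar R) (beta : 'cV[R]_d -> R).
Variables (sg : 'I_N -> 'cV[int]_d) (l : 'I_d -> R) (B : R) (bp : 'I_N -> 'I_N -> R)
  (WI : forall I : {set 'I_N}, 'M[R]_(d, #|I|) -> R) (xi : 'cV[R]_d) (aeps : R -> R).
Hypothesis detA : 0 < \det A.
Hypothesis labels : corner_labels A Z sg.
Hypothesis l0 : forall j, 0 < l j.
Hypothesis assumptions : cell_energy_assumptions A Z W beta.
Hypothesis WI0 : forall I G, 0 <= @WI I G.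
Hypothesis bp_sym : forall s t, s != t -> 0 <= bp s t /\ bp s t = bp t s.
Hypothesis Wfr : fracture_asymptotics W WI bp.
Hypothesis Wblock : block_energy_bound Z W WI.
Hypothesis xi1 : xi ord0 0 = 1.
Hypothesis B0 : 0 < B.
Hypothesis Bxi : pair_density Z bp xi = B.
Hypothesis Bpair : forall x : 'cV[R]_d, B * `|x ord0 0| <= pair_density Z bp x.
Hypothesis tilt : \sum_(j | j != ord0) l j * `|xi j 0| < l ord0 / 2.
Hypothesis aeps0 : forall eps, 0 < eps -> 0 < aeps eps.

Local Notation P := (\prod_(j | j != ord0) l j).
Local Notation al := (alphaA Z W).
Definition minimal_energy (eps : R) : \bar R :=
  ereal_inf [set energy A l W Z eps y | y in admissible A l eps (aeps eps)].
Local Notation mE := minimal_energy.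

Lemma unitA : A \in unitmx. Proof. by rewrite unitmxE unitfE gt_eqF. Qed.

Lemma detE : `|\det A| = \det A. Proof. by rewrite gtr0_norm. Qed.

Lemma stiffness_gt0 : 0 < al.
Proof.
have [j0 [ji [edge _ _]]] := edge_labels labels; have [W0 Wf Wz Wc Wr WH _] := assumptions.
by have [E []] := alphaA_spec W0 Wf Wz Wr WH unitA edge.
Qed.

Lemma minimal_energy_ge0 eps : 0 < eps -> (0 <= mE eps)%E.
Proof.
move=> e0; have uA := unitA; apply: le_ereal_inf_tmp => _ [y _ <-]; rewrite energyE//.
apply: mule_ge0; first by rewrite lee_fin exprn_ge0// ltW.
apply: sume_ge0 => k _.
exact: (cell_energy_ge0 assumptions).
Qed.

Lemma minimal_energy_lower (a0 theta : R) : 0 < a0 -> 0 <= theta ->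
  theta < P / \det A * B -> theta < P / \det A * (2^-1 * l ord0 * al * a0 ^+ 2) ->
  (\forall eps \near (0 : R)^'+, a0 * Num.sqrt eps <= aeps eps) ->
  \forall eps \near (0 : R)^'+, (theta%:E <= mE eps)%E.
Proof.
move=> a00 th0 th1 th2 Ha.
have th1' : theta < P * (B / `|\det A|) by rewrite detE mulrA mulrAC.
have th2' : theta < P * (a0 ^+ 2 * l ord0 * (2^-1 * al / `|\det A|)).
  by apply: lt_le_trans th2 _; rewrite detE le_eqVlt; apply/orP; left; apply/eqP; ring.
have [e0 e00 H] := energy_lower_bound unitA labels l0 assumptions WI0 bp_sym Wfr B0 Bpair a00 th0 th1' th2'.
apply: filterS2 Ha (near_right e00 (fun eps h => h)) => eps ae he.
by apply: le_ereal_inf_tmp => _ [y adm <-]; exact: H he ae adm.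
Qed.

Lemma minimal_energy_elastic (a0 theta : R) : 0 <= a0 ->
  P / \det A * (2^-1 * l ord0 * al * a0 ^+ 2) < theta ->
  (forall rho : R, 0 < rho -> \forall eps \near (0 : R)^'+, aeps eps <= (a0 + rho) * Num.sqrt eps) ->
  \forall eps \near (0 : R)^'+, (mE eps <= theta%:E)%E.
Proof.
rewrite -detE => a00 th Ha.
have [rho rho0 [e0 e00 H]] := elastic_upper_bound unitA labels l0 assumptions a00 th.
apply: filterS2 (Ha rho rho0) (near_right e00 (fun eps h => h)) => eps ae he.
have /andP[ep _] := he; have [y adm yth] := H eps _ he (ltW (aeps0 ep)) ae.
by apply: le_trans yth; apply: ereal_inf_lbound; exists y.
Qed.

(** The crack construction needs an opening of order eps only; a strain of order sqrt eps exceeds it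
    for small eps. *)
Lemma minimal_energy_crack (a0 theta : R) : 0 < a0 -> P / \det A * B < theta ->
  (\forall eps \near (0 : R)^'+, a0 * Num.sqrt eps <= aeps eps) ->
  \forall eps \near (0 : R)^'+, (mE eps <= theta%:E)%E.
Proof.
rewrite -detE mulrAC => a00 th Ha.
have [K K0 [e0 e00 H]] := crack_upper_bound unitA labels l0 assumptions WI0 bp_sym Wfr Wblock xi1 Bxi tilt th.
have e1 : 0 < Num.min e0 ((a0 / K) ^+ 2) by rewrite lt_min e00 exprn_gt0// divr_gt0.
apply: filterS2 Ha (near_right e1 (fun eps h => h)) => eps ae /andP[ep].
rewrite lt_min => /andP[ee ek].
have s0 : 0 < Num.sqrt eps by rewrite sqrtr_gt0.
have se : Num.sqrt eps ^+ 2 = eps by rewrite sqr_sqrtr// ltW.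
have Ka : K * eps <= aeps eps.
  apply: le_trans ae; rewrite -{1}se expr2 mulrA ler_pM2r// mulrC -ler_pdivlMr//.
  by rewrite -(@ler_pXn2r _ 2%N)// ?nnegrE ?(ltW s0) ?divr_ge0 ?(ltW a00) ?(ltW K0)// se ltW.
have [y adm yth] := H eps _ (introT andP (conj ep ee)) Ka.
by apply: le_trans yth; apply: ereal_inf_lbound; exists y.
Qed.

Theorem minimal_energy_limit (a : \bar R) : (0 <= a)%E ->
  (aeps eps / Num.sqrt eps)%:E @[eps --> (0 : R)^'+] --> a ->
  mE eps @[eps --> (0 : R)^'+] -->
    ((P / \det A)%:E * Order.min ((2^-1 * l ord0 * al)%:E * a ^+ 2) B%:E)%E.
Proof.
have PA0 : 0 < P / \det A by rewrite divr_gt0// prodr_gt0.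
have c0 : 0 < 2^-1 * l ord0 * al by rewrite !mulr_gt0 ?stiffness_gt0.
set C := 2^-1 * l ord0 * al in c0 *.
have posE : \forall eps \near (0 : R)^'+, 0 < eps < 1 by exact: (near_right ltr01).
have neg theta : theta < 0 -> \forall eps \near (0 : R)^'+, (theta%:E <= mE eps)%E.
  move=> th; apply: filterS posE => eps /andP[ep _].
  by apply: le_trans (minimal_energy_ge0 ep); rewrite lee_fin ltW.
case: a => [r||]//; last first.
  move=> _ Ha.
  have Hn (x : R) : \forall eps \near (0 : R)^'+, x * Num.sqrt eps <= aeps eps.
    have /cvgeyPge/(_ x) h := Ha; apply: filterS2 h posE => eps; rewrite lee_fin => h /andP[ep _].
    by rewrite -ler_pdivlMr// sqrtr_gt0.
  have -> : ((P / \det A)%:E * Order.min (C%:E * +oo ^+ 2) B%:E = (P / \det A * B)%:E)%E.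
    by rewrite expe2 mulyy gt0_muley ?lte_fin// minye EFinM.
  apply: ereal_sandwich => theta th; last exact: minimal_energy_crack ltr01 th (Hn 1).
  have [/neg//|th0] := ltP theta 0.
  (* For an infinite limit any [a0] is allowed. This one is at least 1, so its square dominates it,
     and the elastic bound exceeds theta. *)
  pose a0 := 1 + theta / (P / \det A * C).
  have a01 : 1 <= a0 by rewrite lerDl divr_ge0// mulr_ge0// ltW.
  have a00 : 0 < a0 := lt_le_trans ltr01 a01.
  apply: (@minimal_energy_lower a0) => //.
  have : theta < P / \det A * C * a0.
    have q0 : 0 < P / \det A * C by rewrite mulr_gt0.
    rewrite /a0; move: (P / \det A * C) q0 => q q0.
    by rewrite mulrDr mulr1 mulrCA divff ?gt_eqF// mulr1 ltrDr.
  move=> h; apply: (lt_le_trans h); rewrite -mulrA ler_pM2l// ler_pM2l//.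
  by rewrite expr2 ler_pMl.
rewrite lee_fin => r0 /fine_cvgP[_ Ha]; rewrite /= in Ha.
have Hle (rho : R) : 0 < rho -> \forall eps \near (0 : R)^'+, aeps eps <= (r + rho) * Num.sqrt eps.
  move=> rho0; have rr : r < r + rho by rewrite ltrDl.
  have h : \forall eps \near (0 : R)^'+, aeps eps / Num.sqrt eps <= r + rho by exact: (cvgr_le r Ha _ rr).
  apply: filterS2 h posE => eps /= h /andP[ep _].
  by rewrite -ler_pdivrMr// sqrtr_gt0.
have Hge (x : R) : x < r -> \forall eps \near (0 : R)^'+, x * Num.sqrt eps <= aeps eps.
  move=> xr; have h : \forall eps \near (0 : R)^'+, x <= aeps eps / Num.sqrt eps by exact: (cvgr_ge r Ha _ xr).
  apply: filterS2 h posE => eps /= h /andP[ep _].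
  by rewrite -ler_pdivlMr// sqrtr_gt0.
rewrite -EFin_expe -EFinM -EFin_min -EFinM.
apply: ereal_sandwich => theta; last first.
  have [CB|BC] := leP (C * r ^+ 2) B; first by move=> th; exact: minimal_energy_elastic r0 th Hle.
  (* If the crack value is the smaller one, r cannot vanish, and r / 2 is a positive lower bound for
     the rescaled strain. *)
  move=> th; have rp : 0 < r.
    by rewrite lt_neqAle r0 andbT; apply/eqP => E; move: BC; rewrite -E expr0n mulr0 ltNge ltW.
  have r2 : r / 2 < r by rewrite ltr_pdivrMr// ltr_pMr// ltr1n.
  by apply: (@minimal_energy_crack (r / 2)) => //; [rewrite divr_gt0|exact: Hge].
rewrite minr_pMr ?ltW// lt_min => /andP[th1 th2].
have [/neg//|th0] := ltP theta 0.
have rp : 0 < r.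
  by rewrite lt_neqAle r0 andbT; apply/eqP => E; move: th1; rewrite -E expr0n !mulr0 ltNge th0.
have lim : lim0 (fun x => P / \det A * (C * (r - x) ^+ 2)) (P / \det A * (C * r ^+ 2)).
  by eapply lim0_eq; last lim0_rat; rewrite subr0.
have [dl dl0 Hdl] := near0_gt lim th1.
(* Slightly below r the elastic value still exceeds theta, and r - x remains positive. *)
pose x := Num.min dl r / 2.
have mr : 0 < Num.min dl r by rewrite lt_min dl0.
have x0 : 0 < x by rewrite divr_gt0.
have xm : x < Num.min dl r by rewrite ltr_pdivrMr// ltr_pMr// ltr1n.
move: xm; rewrite lt_min => /andP[xd xr].
apply: (@minimal_energy_lower (r - x)) => //; first by rewrite subr_gt0.
  by apply: Hdl; rewrite x0.
by apply: Hge; rewrite gtrBl.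
Qed.

End MinimalEnergy.

Theorem theorem2p2 (R : realType) (n : nat) :
  exists Cs : R, 0 < Cs /\
  forall (A : 'M[R]_n.+2) (l : 'I_n.+2 -> R) (Z : 'M[R]_(n.+2, 2 ^ n.+2))
    (W : 'M[R]_(n.+2, 2 ^ n.+2) -> \bar R) (beta : 'cV[R]_n.+2 -> R)
    (aeps : R -> R) (a : \bar R),
    0 < \det A ->
    (forall j, 0 < l j) ->
    corner_enumeration A Z ->
    cell_energy_assumptions A Z W beta ->
    Lmin A l beta Cs <= l ord0 ->
    (forall eps, 0 < eps -> 0 < aeps eps) ->
    (0 <= a)%E ->
    (aeps eps / Num.sqrt eps)%:E @[eps --> 0^'+] --> a ->
    ereal_inf [set energy A l W Z eps y | y in admissible A l eps (aeps eps)]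
      @[eps --> 0^'+] -->
      ((\prod_(j | j != ord0) l j / \det A)%:E *
       Order.min ((2^-1 * l ord0 * alphaA Z W)%:E * a ^+ 2) (betaA A beta))%E.
Proof.
(* The lateral sum has d-1 terms, each at most the largest lateral length times M2 / M1. The factor
   2d makes it strictly less than half of l_1, which is what the crack at mid-length requires. *)
exists (2 * n.+2%:R); split; first by rewrite mulr_gt0// ltr0n.
move=> A l Z W beta aeps a detA l0 enum assumptions Ll aeps0 a0 Ha.
have uA : A \in unitmx by rewrite unitmxE unitfE gt_eqF.
have [sg labels] := corner_labels_exist uA enum.
have [WI [bp [WI0 bp_sym Wfr Wblock bp_norm]]] := cell_energy_fracture assumptions.
have broken P : is_corner_partition P -> (1 < #|P|)%N -> 0 < broken_energy bp P.
  by move=> h1 h2; have [] := Wfr P h1 h2.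
have [B [xi [[B0 BE xi1 Bxi xiM] Bpair]]] := surface_energy_direction uA labels bp_sym bp_norm broken.
rewrite BE; apply: (minimal_energy_limit detA labels l0 assumptions WI0 bp_sym Wfr Wblock xi1 B0 Bxi Bpair) => //.
have xi_le j : `|xi j 0| <= M2 A beta / M1 A beta.
  by apply: le_trans xiM; apply: le_trans (enorm_ge _); exact: mx_entry_le.
set X := M2 A beta / M1 A beta in xi_le Ll.
have X0 : 0 < X by apply: lt_le_trans (xi_le ord0); rewrite xi1 normr1.
set mx := \big[Num.max/0]_(j | j != ord0) l j in Ll.
have lm j : j != ord0 -> l j <= mx by move=> jn; exact: le_bigmax_cond.
have mx0 : 0 < mx by apply: lt_le_trans (lm ord_max _).
have h : \sum_(j < n.+2 | j != ord0) l j * `|xi j 0| <= n.+1%:R * (mx * X).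
  apply: (@le_trans _ _ (\sum_(j < n.+2 | j != ord0) mx * X)).
    by apply: ler_sum => j jn; apply: ler_pM => //; [exact: ltW|exact: lm].
  by rewrite sumr_const cardC1 card_ord mulr_natl.
apply: (le_lt_trans h); rewrite ltr_pdivlMr//; apply: lt_le_trans Ll.
have -> : Lmin A l beta (2 * n.+2%:R) = n.+2%:R * (mx * X) * 2.
  by rewrite /Lmin -/mx -/X; ring.
have mX : 0 < mx * X by rewrite mulr_gt0.
have nn : n.+1%:R < n.+2%:R :> R by rewrite ltr_nat.
by move: (mx * X) mX => z z0; rewrite ltr_pM2r// ltr_pM2r.
Qed.
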